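(* Let $b\in\mathcal{PB}_3$ be a pure $3$-braid and let $w$ be the reduced word in the free generators $a_1,a_2$ representing the image of $b$ in $\mathcal{PB}_3/\langle\Delta_3^2\rangle$. Then $$\frac{1}{2\pi}\mathcal{L}(w)\le \Lambda_{tr}(b)=\frac{1}{\mathcal{M}_{tr}(b)}\le 300\cdot\mathcal{L}(w),$$ except in the cases $w=a_1^n$ or $w=a_2^n$ for an integer $n$, in which $\Lambda_{tr}(b)=0$, i.e. $\mathcal{M}_{tr}(b)=\infty$. Moreover $$\frac{1}{2\pi}\mathcal{L}(w)\le \Lambda_{pb}(b)=\frac{1}{\mathcal{M}_{pb}(b)}\le 300\cdot\mathcal{L}(w),$$ except in the case that every term of the reduced word $w$ has the same exponent, this exponent being either $+1$ or $-1$; in that case $\Lambda_{pb}(b)=0$, i.e. $\mathcal{M}_{pb}(b)=\infty$.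
   Context: Configuration space: $C_3(\mathbb{C})=\{(z_1,z_2,z_3)\in\mathbb{C}^3: z_i\ne z_j \text{ for } i\ne j\}$, with the symmetric group $\mathcal{S}_3$ acting by permuting coordinates; $C_3(\mathbb{C})/\mathcal{S}_3$ is the symmetrized configuration space and $\mathcal{B}_3$ is identified with its fundamental group. The totally real set $\mathcal{E}^{tr}=C_3(\mathbb{R})/\mathcal{S}_3$ (unordered triples of distinct real numbers) and the set $\mathcal{E}_{pb}$ of unordered triples consisting of one real point and a pair of complex conjugate non-real points are connected and simply connected, so $\mathcal{B}_3$ is canonically isomorphic to the relative fundamental groups $\pi_1(C_3(\mathbb{C})/\mathcal{S}_3,\mathcal{E}^{tr})$ and $\pi_1(C_3(\mathbb{C})/\mathcal{S}_3,\mathcal{E}_{pb})$ (homotopy classes of arcs with endpoints in the respective set); $b_{tr}$, $b_{pb}$ denote the images of $b$. Rectangles have sides parallel to the axes; if the horizontal sides have length $\mathsf b$ and vertical sides length $\mathsf a$, the extremal length is $\lambda(R)=\mathsf a/\mathsf b$ and the conformal module $m(R)=\mathsf b/\mathsf a$. A map $f$ from an open rectangle $R$ to a space $X$, continuous on $\bar R$, represents a homotopy class $\mathsf h$ of arcs with endpoints in a set $E$ if it maps the open horizontal sides into $E$ and its restriction to the closure of every maximal vertical segment in $R$ represents $\mathsf h$. $\Lambda_{tr}(b)$ is the infimum of $\lambda(R)$ over rectangles $R$ admitting a holomorphic map to $C_3(\mathbb{C})/\mathcal{S}_3$ representing $b_{tr}$, and $\mathcal{M}_{tr}(b)$ the supremum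 of $m(R)$ over the same rectangles; $\Lambda_{pb}(b)$, $\mathcal{M}_{pb}(b)$ are defined in the same way with $b_{pb}$. $\Delta_3=\sigma_1\sigma_2\sigma_1$ is the Garside element; $\langle\Delta_3^2\rangle$ is the center. $\mathcal{PB}_3/\langle\Delta_3^2\rangle$ is free on $a_1,a_2$, the classes of $\sigma_1^2,\sigma_2^2$. Syllables of a nontrivial reduced word $w=w_1^{n_1}w_2^{n_2}\cdots$ ($n_j\ne0$, $w_j$ alternately $a_1,a_2$; the $w_j^{n_j}$ are the terms): (1) every term with $|n_j|\ge2$ is a syllable; (2) every maximal sequence of at least two consecutive terms all having the same exponent, equal to $+1$ or to $-1$, is a syllable; (3) every remaining term (exponent $\pm1$, neighbouring terms having different exponent) is a syllable, called a singleton. The degree $d_j$ of a syllable is the sum of the absolute values of the exponents of its terms. $\mathcal{L}(w)=\sum_j\log(4d_j-1)$, summed over all syllables; $\mathcal{L}(\text{identity})=0$. *)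

(* Defs.v *)
From Stdlib Require Import Reals ZArith List.
From Coquelicot Require Import Coquelicot.
Import ListNotations.
Open Scope R_scope.

(* A word is a list of terms (g, n) standing for a_g^n,
   with g = true for a_1 and g = false for a_2. *)
Definition fword := list (bool * Z).

Fixpoint alternating (w : fword) : Prop :=
  match w with
  | [] => True
  | (g, _) :: w' =>
      match w' with
      | [] => True
      | (g', _) :: _ => g <> g' /\ alternating w'
      end
  end.

Definition reduced (w : fword) : Prop :=
  (forall t, In t w -> snd t <> 0%Z) /\ alternating w.

(* Degrees of the syllables of a reduced word, read from its list of exponents.
   A term with |n| >= 2 is a syllable of degree |n|; a maximal run of
   consecutive terms with the same exponent e in {+1,-1} is one syllable
   (of degree = its length; a run of length 1 is a singleton). *)
Definition flush (cur : option (Z * nat)) : list nat :=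
  match cur with None => [] | Some (_, c) => [c] end.

Fixpoint sd_aux (cur : option (Z * nat)) (l : list Z) : list nat :=
  match l with
  | [] => flush cur
  | n :: l' =>
      if (2 <=? Z.abs n)%Z then flush cur ++ (Z.abs_nat n :: sd_aux None l')
      else match cur with
           | Some (e, c) =>
               if Z.eqb e n then sd_aux (Some (e, S c)) l'
               else c :: sd_aux (Some (n, 1%nat)) l'
           | None => sd_aux (Some (n, 1%nat)) l'
           end
  end.

Definition syllable_degrees (w : fword) : list nat := sd_aux None (map snd w).

Definition Lw (w : fword) : R :=
  fold_right (fun d acc => ln (4 * INR d - 1) + acc) 0 (syllable_degrees w).

(* a letter (g, pos) is sigma_1^{+-1} (g = true) or sigma_2^{+-1} (g = false) *)
Definition letter := (bool * bool)%type.

(* the braid word of a_g^n = sigma_g^(2n) *)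
Definition expand_term (t : bool * Z) : list letter :=
  repeat (fst t, Z.ltb 0 (snd t)) (2 * Z.abs_nat (snd t)).

(* Delta_3^2 = (sigma_1 sigma_2)^3 and its inverse *)
Definition Delta2 : list letter :=
  [(true,true);(false,true);(true,true);(false,true);(true,true);(false,true)].
Definition Delta2inv : list letter :=
  [(false,false);(true,false);(false,false);(true,false);(false,false);(true,false)].

Definition Delta2pow (k : Z) : list letter :=
  if (0 <=? k)%Z then concat (repeat Delta2 (Z.to_nat k))
  else concat (repeat Delta2inv (Z.abs_nat k)).

Definition braid_word (w : fword) (k : Z) : list letter :=
  concat (map expand_term w) ++ Delta2pow k.

Definition rot (theta : R) : C := (cos theta, sin theta).

(* The base configuration is {-1, 0, 1}.  sigma_1 exchanges the points -1, 0
   by a half turn about -1/2, sigma_2 exchanges 0, 1 by a half turn about 1/2;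
   positive letters turn counterclockwise.  Motion of a point z at time s: *)
Definition gmove (l : letter) (s : R) (z : C) : C :=
  let sgn := if snd l then 1 else -1 in
  if fst l then
    (if Rlt_dec (Re z) (1/2) then Cplus (RtoC (-1/2)) (Cmult (Cminus z (RtoC (-1/2))) (rot (sgn * PI * s)))
     else z)
  else
    (if Rlt_dec (-1/2) (Re z) then Cplus (RtoC (1/2)) (Cmult (Cminus z (RtoC (1/2))) (rot (sgn * PI * s)))
     else z).

(* trajectory on [0,1] of the point starting at z for the concatenation of the
   letters (each letter uses a subinterval of equal length) *)
Fixpoint ptraj (ls : list letter) (z : C) (t : R) : C :=
  match ls with
  | [] => z
  | l :: rest =>
      let n := INR (length ls) in
      if Rle_dec (n * t) 1 then gmove l (n * t) z
      else ptraj rest (gmove l 1 z) ((n * t - 1) / (n - 1))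
  end.

Definition conf := (C * C * C)%type.

Definition distinct3 (z : conf) : Prop :=
  let '(a, b, c) := z in a <> b /\ a <> c /\ b <> c.

Inductive perm3 := P123 | P132 | P213 | P231 | P312 | P321.

Definition permute (p : perm3) (z : conf) : conf :=
  let '(a, b, c) := z in
  match p with
  | P123 => (a, b, c) | P132 => (a, c, b) | P213 => (b, a, c)
  | P231 => (b, c, a) | P312 => (c, a, b) | P321 => (c, b, a)
  end.

Definition c1 (z : conf) : C := fst (fst z).
Definition c2 (z : conf) : C := snd (fst z).
Definition c3 (z : conf) : C := snd z.

(* E_tr: totally real unordered triples (a permutation-invariant condition) *)
Definition E_tr (z : conf) : Prop :=
  Im (c1 z) = 0 /\ Im (c2 z) = 0 /\ Im (c3 z) = 0.

Definition E_pb (z : conf) : Prop :=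
  let '(a, b, c) := z in
     (Im a = 0 /\ b = Cconj c /\ Im b <> 0)
  \/ (Im b = 0 /\ a = Cconj c /\ Im a <> 0)
  \/ (Im c = 0 /\ a = Cconj b /\ Im a <> 0).

Definition tr_arc (ls : list letter) (t : R) : conf :=
  (ptraj ls (RtoC (-1)) t, ptraj ls (RtoC 0) t, ptraj ls (RtoC 1) t).

(* Arc representing b_pb: the isomorphism pi_1(X,E_tr) ~ pi_1(X,E_pb) is
   conjugation by the rotation z |-> e^{-i pi t/2} z, t in [0,1], which moves
   {-i,0,i} in E_pb to {-1,0,1} in E_tr. *)
Definition pb_traj (ls : list letter) (x : C) (t : R) : C :=
  if Rle_dec (3 * t) 1 then Cmult x (rot (PI * (1 - 3 * t) / 2))
  else if Rle_dec (3 * t) 2 then ptraj ls x (3 * t - 1)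
  else Cmult (ptraj ls x 1) (rot (PI * (3 * t - 2) / 2)).

Definition pb_arc (ls : list letter) (t : R) : conf :=
  (pb_traj ls (RtoC (-1)) t, pb_traj ls (RtoC 0) t, pb_traj ls (RtoC 1) t).

Definition cont_on (D : C -> Prop) (f : C -> C) : Prop :=
  forall z, D z -> forall eps, 0 < eps -> exists delta, 0 < delta /\
    forall u, D u -> Cmod (Cminus u z) < delta -> Cmod (Cminus (f u) (f z)) < eps.

Definition conf_cont_on (D : C -> Prop) (F : C -> conf) : Prop :=
  cont_on D (fun z => c1 (F z)) /\ cont_on D (fun z => c2 (F z)) /\
  cont_on D (fun z => c3 (F z)).

Definition holo_on (D : C -> Prop) (f : C -> C) : Prop :=
  forall z, D z -> exists f' : C, forall eps, 0 < eps -> exists delta, 0 < delta /\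
    forall h : C, h <> RtoC 0 -> Cmod h < delta ->
      Cmod (Cminus (Cdiv (Cminus (f (Cplus z h)) (f z)) h) f') < eps.

Definition conf_holo_on (D : C -> Prop) (F : C -> conf) : Prop :=
  holo_on D (fun z => c1 (F z)) /\ holo_on D (fun z => c2 (F z)) /\
  holo_on D (fun z => c3 (F z)).

Definition unit_square (z : C) : Prop :=
  0 <= Re z <= 1 /\ 0 <= Im z <= 1.

(* Two arcs g0, g1 : [0,1] -> C_3(C) (lifts of arcs in C_3(C)/S_3) with
   endpoints in E are homotopic in C_3(C)/S_3 through arcs with endpoints in E.
   The homotopy is lifted to C_3(C); its end is a lift of g1, i.e. g1 up to a
   permutation of the points. *)
Definition arc_homotopic (E : conf -> Prop) (g0 g1 : R -> conf) : Prop :=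
  exists (p : perm3) (H : C -> conf),
    (forall z, unit_square z -> distinct3 (H z)) /\
    conf_cont_on unit_square H /\
    (forall t, 0 <= t <= 1 -> H (0, t) = g0 t /\ H (1, t) = permute p (g1 t)) /\
    (forall s, 0 <= s <= 1 -> E (H (s, 0)) /\ E (H (s, 1))).

Definition open_rect (x0 y0 bw ah : R) (z : C) : Prop :=
  x0 < Re z < x0 + bw /\ y0 < Im z < y0 + ah.
Definition closed_rect (x0 y0 bw ah : R) (z : C) : Prop :=
  x0 <= Re z <= x0 + bw /\ y0 <= Im z <= y0 + ah.

(* F (a lift to C_3(C) of a map to C_3(C)/S_3; such lifts exist since the
   closed rectangle is simply connected and C_3(C) -> C_3(C)/S_3 is a covering)
   is continuous on the closed rectangle, holomorphic in the open rectangle,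
   maps the open horizontal sides into E, and its restriction to the closure of
   every maximal vertical segment represents the class of the arc g. *)
Definition represents (E : conf -> Prop) (g : R -> conf)
    (x0 y0 bw ah : R) (F : C -> conf) : Prop :=
  (forall z, closed_rect x0 y0 bw ah z -> distinct3 (F z)) /\
  conf_cont_on (closed_rect x0 y0 bw ah) F /\
  conf_holo_on (open_rect x0 y0 bw ah) F /\
  (forall x, x0 < x < x0 + bw -> E (F (x, y0)) /\ E (F (x, y0 + ah))) /\
  (forall x, x0 < x < x0 + bw ->
     arc_homotopic E (fun t => F (x, y0 + t * ah)) g).

Definition lambda_set (E : conf -> Prop) (g : R -> conf) (l : R) : Prop :=
  exists x0 y0 bw ah (F : C -> conf),
    0 < bw /\ 0 < ah /\ represents E g x0 y0 bw ah F /\ l = ah / bw.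

Definition module_set (E : conf -> Prop) (g : R -> conf) (m : R) : Prop :=
  exists x0 y0 bw ah (F : C -> conf),
    0 < bw /\ 0 < ah /\ represents E g x0 y0 bw ah F /\ m = bw / ah.

Definition Lambda (E : conf -> Prop) (g : R -> conf) : Rbar := Glb_Rbar (lambda_set E g).
Definition Module (E : conf -> Prop) (g : R -> conf) : Rbar := Lub_Rbar (module_set E g).

Definition Lambda_tr (ls : list letter) : Rbar := Lambda E_tr (tr_arc ls).
Definition M_tr (ls : list letter) : Rbar := Module E_tr (tr_arc ls).
Definition Lambda_pb (ls : list letter) : Rbar := Lambda E_pb (pb_arc ls).
Definition M_pb (ls : list letter) : Rbar := Module E_pb (pb_arc ls).

(* Main.v *)
(* The cross ratio u = (z2 - z1)/(z3 - z1) maps configurations to the twice punctured plane, whose universal covering is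
   the upper half plane, with deck group Gamma(2); here it is written through the period ratio tau = i K(1 - u)/K(u) of
   complete elliptic integrals. Totally real configurations lie under the orbit of L = {Re tau = 0}, and those of E_pb
   with z2 real under the orbit of L = {|tau| = 1}. An arc for the word w lifts to an arc from L to M L, where M is the
   product of the matrices (1, 2n; 0, 1) for a_1^n and (1, 0; -2n, 1) for a_2^n. With M = (a, b; c, d), put
   t = ad + bc in the first and t = (a^2 + d^2 - b^2 - c^2)/2 in the second case.
   If |t| > 1, a holomorphic map of the half plane into the strip 0 < Im < pi takes L and M L into vertical lines at a
   distance l with ln |t| <= l <= ln (2|t|). Cauchy's theorem on a rectangle with sides b, a then gives l b <= pi a;
   conversely an affine map of a rectangle into the strip, composed with the modular function, has extremal length l.
   Reading w syllable by syllable bounds the rows of the partial products by prod (4 d_j - 1) from above and by its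
   square root from below. If |t| = 1, then L and M L meet at infinity or coincide, and the rectangles may be
   arbitrarily wide. *)

Require Import Defs.
From Stdlib Require Import Reals ZArith List Lra Lia Psatz Classical ClassicalEpsilon Bool.
From Coquelicot Require Import Coquelicot.
Open Scope R_scope.

(** The modular function never appears as a function: the relation [Cov u t] stands for it, and
    everything rests on two lifting statements, from the twice punctured plane to the half plane
    (for given rectangles) and back (for constructed ones). The first uses that [G2] acts
    discretely, which comes from traces being 2 mod 4. The second uses inverse branches on discs of
    uniform hyperbolic size; they exist by compactness, because period ratios over points near the
    punctures are high in some cusp. Boundary conditions are transported by uniqueness of lifts: the
    cross ratios of admissible ends are fixed by an antiholomorphic involution, which is covered by
    a reflection of the half plane. The cross ratio does not see the centre, so the powers of
    [Delta2] are recorded separately by a logarithm of z3 - z1. The constant 1/(2 pi) is the 1/pi of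
    Cauchy's theorem times the 1/2 from the square root bound; the upper estimate comes out as 4
    L(w), far below 300 L(w). *)

(** * Complex arithmetic through real and imaginary parts *)

Lemma C_ext (z w : C) : Re z = Re w -> Im z = Im w -> z = w.
Proof. destruct z, w; simpl; intros; subst; reflexivity. Qed.

Lemma Re_plus z w : Re (z + w)%C = Re z + Re w. Proof. reflexivity. Qed.
Lemma Im_plus z w : Im (z + w)%C = Im z + Im w. Proof. reflexivity. Qed.
Lemma Re_opp z : Re (- z)%C = - Re z. Proof. reflexivity. Qed.
Lemma Im_opp z : Im (- z)%C = - Im z. Proof. reflexivity. Qed.
Lemma Re_minus z w : Re (z - w)%C = Re z - Re w. Proof. reflexivity. Qed.
Lemma Im_minus z w : Im (z - w)%C = Im z - Im w. Proof. reflexivity. Qed.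
Lemma Re_mult z w : Re (z * w)%C = Re z * Re w - Im z * Im w. Proof. reflexivity. Qed.
Lemma Im_mult z w : Im (z * w)%C = Re z * Im w + Im z * Re w. Proof. reflexivity. Qed.
Lemma Re_RtoC x : Re (RtoC x) = x. Proof. reflexivity. Qed.
Lemma Im_RtoC x : Im (RtoC x) = 0. Proof. reflexivity. Qed.
Lemma Re_conj z : Re (Cconj z) = Re z. Proof. reflexivity. Qed.
Lemma Im_conj z : Im (Cconj z) = - Im z. Proof. reflexivity. Qed.
Lemma Re_Ci : Re Ci = 0. Proof. reflexivity. Qed.
Lemma Im_Ci : Im Ci = 1. Proof. reflexivity. Qed.
Lemma Re_inv z : Re (/ z)%C = Re z / (Re z ^ 2 + Im z ^ 2). Proof. reflexivity. Qed.
Lemma Im_inv z : Im (/ z)%C = - Im z / (Re z ^ 2 + Im z ^ 2). Proof. reflexivity. Qed.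
Lemma Re_pair a b : Re (a, b) = a. Proof. reflexivity. Qed.
Lemma Im_pair a b : Im (a, b) = b. Proof. reflexivity. Qed.

Ltac cre := repeat rewrite ?Re_minus, ?Im_minus, ?Re_plus, ?Im_plus, ?Re_opp, ?Im_opp,
  ?Re_mult, ?Im_mult, ?Re_RtoC, ?Im_RtoC, ?Re_conj, ?Im_conj, ?Re_Ci, ?Im_Ci, ?Re_pair, ?Im_pair.
Ltac cre_in H := repeat rewrite ?Re_minus, ?Im_minus, ?Re_plus, ?Im_plus, ?Re_opp, ?Im_opp,
  ?Re_mult, ?Im_mult, ?Re_RtoC, ?Im_RtoC, ?Re_conj, ?Im_conj, ?Re_Ci, ?Im_Ci, ?Re_pair, ?Im_pair in H.

Lemma Cmod_sqr z : Cmod z ^ 2 = Re z ^ 2 + Im z ^ 2.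
Proof. apply Cmod2_alt. Qed.

Lemma Cmod_sqr_inv z : Cmod z * Cmod z = Re z ^ 2 + Im z ^ 2.
Proof. rewrite <- Cmod_sqr. ring. Qed.

Lemma Re_div_pos (z w : C) : w <> RtoC 0 -> Re (z / w)%C = (Re z * Re w + Im z * Im w) / Cmod w ^ 2.
Proof.
  intros Hw. rewrite Cmod_sqr. unfold Cdiv. cre. rewrite Re_inv, Im_inv. unfold Rdiv. ring.
Qed.
Lemma Im_div (z w : C) : w <> RtoC 0 -> Im (z / w)%C = (Im z * Re w - Re z * Im w) / Cmod w ^ 2.
Proof.
  intros Hw. rewrite Cmod_sqr. unfold Cdiv. cre. rewrite Re_inv, Im_inv. unfold Rdiv. ring.
Qed.

Lemma Cmod_pos z : z <> RtoC 0 -> 0 < Cmod z.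
Proof. intros H. apply Cmod_gt_0; auto. Qed.

Lemma Cneq_Re z w : Re z <> Re w -> z <> w.
Proof. intros H E; apply H; rewrite E; reflexivity. Qed.
Lemma Cneq_Im z w : Im z <> Im w -> z <> w.
Proof. intros H E; apply H; rewrite E; reflexivity. Qed.

Lemma im_le_Cmod z : Rabs (Im z) <= Cmod z.
Proof.
  generalize (Rmax_Cmod z). intros H. eapply Rle_trans; [|apply H]. apply Rmax_r.
Qed.

Lemma Cmod_le_sum z : Cmod z <= Rabs (Re z) + Rabs (Im z).
Proof.
  replace z with (RtoC (Re z) + Ci * RtoC (Im z))%C at 1
    by (apply C_ext; cre; ring).
  eapply Rle_trans; [apply Cmod_triangle|].
  rewrite Cmod_mult, Cmod_Ci, !Cmod_R. lra.
Qed.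

Lemma Cmod_minus_sym z w : Cmod (z - w) = Cmod (w - z).
Proof. rewrite <- Cmod_opp. f_equal. ring. Qed.

Lemma Cmod_minus_tri z w : Cmod z - Cmod w <= Cmod (z - w).
Proof.
  generalize (Cmod_triangle (z - w) w). replace (z - w + w)%C with z by ring. lra.
Qed.

Lemma Cmod_minus_le z w : Cmod (z - w) <= Cmod z + Cmod w.
Proof.
  unfold Cminus. eapply Rle_trans; [apply Cmod_triangle|]. rewrite Cmod_opp. lra.
Qed.

Lemma Cminus_eq_0 z w : (z - w)%C = RtoC 0 -> z = w.
Proof. intros H. replace z with (z - w + w)%C by ring. rewrite H. ring. Qed.

Lemma Cmult_neq_0' z w : (z * w)%C <> RtoC 0 <-> z <> RtoC 0 /\ w <> RtoC 0.
Proof.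
  split.
  - intros H; split; intros E; apply H; rewrite E; ring.
  - intros [H1 H2]. apply Cmult_neq_0; auto.
Qed.

Lemma Cmult_integral z w : (z * w)%C = RtoC 0 -> z = RtoC 0 \/ w = RtoC 0.
Proof.
  intros H. destruct (classic (z = RtoC 0)) as [|Hz]; auto.
  destruct (classic (w = RtoC 0)) as [|Hw]; auto.
  exfalso. apply (Cmult_neq_0 z w); auto.
Qed.

Lemma Cinv_neq_0 z : z <> RtoC 0 -> (/ z)%C <> RtoC 0.
Proof.
  intros Hz E. apply Hz. assert (H : (z * / z)%C = RtoC 1) by (apply Cinv_r; auto).
  rewrite E in H. exfalso. assert (X: RtoC 1 = RtoC 0) by (rewrite <- H; ring).
  injection X; lra.
Qed.

(** * Derivatives and continuity *)

(* [gder D f z l]: [l] is the complex derivative of [f] at [z] along increments in [D];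
   [D] is everything for complex derivatives and the reals for derivatives of paths. *)
Definition gder (D : C -> Prop) (f : C -> C) (z l : C) : Prop :=
  forall eps, 0 < eps -> exists delta, 0 < delta /\ forall h, D h -> Cmod h < delta ->
    Cmod (f (z + h)%C - f z - l * h) <= eps * Cmod h.

Definition cder := gder (fun _ => True).
Definition rder := gder (fun h => Im h = 0).

(** The pointwise form of [cont_on]: [cont_on D f] unfolds to [cont_at D f z] for every [z] in [D],
    and many proofs below pass silently from one to the other. *)
Definition cont_at (D : C -> Prop) (f : C -> C) (z : C) : Prop :=
  forall eps, 0 < eps -> exists delta, 0 < delta /\
    forall u, D u -> Cmod (u - z) < delta -> Cmod (f u - f z) < eps.

Lemma gder_ext_loc D (f g : C -> C) z l r : 0 < r ->
  (forall h, D h -> Cmod h < r -> f (z + h)%C = g (z + h)%C) -> f z = g z ->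
  gder D f z l -> gder D g z l.
Proof.
  intros Hr E E0 H eps He. destruct (H eps He) as [d [Hd Hf]].
  exists (Rmin d r); split; [apply Rmin_pos; auto|].
  intros h Dh Hh. rewrite <- E0, <- E; auto.
  - apply Hf; auto. eapply Rlt_le_trans; [apply Hh|apply Rmin_l].
  - eapply Rlt_le_trans; [apply Hh|apply Rmin_r].
Qed.

Lemma cder_ext_loc (f g : C -> C) z l r : 0 < r ->
  (forall w, Cmod (w - z) < r -> f w = g w) -> cder f z l -> cder g z l.
Proof.
  intros Hr E. apply (gder_ext_loc _ f g z l r Hr).
  - intros h _ Hh. apply E. replace (z + h - z)%C with h by ring. auto.
  - apply E. replace (z - z)%C with (RtoC 0) by ring. rewrite Cmod_0; auto.
Qed.

Lemma gder_bound D f z l : gder D f z l -> exists d, 0 < d /\ forall h, D h -> Cmod h < d ->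
  Cmod (f (z + h)%C - f z) <= (1 + Cmod l) * Cmod h.
Proof.
  intros H. destruct (H 1 Rlt_0_1) as [d [Hd Hf]]. exists d; split; auto.
  intros h Dh Hh. specialize (Hf h Dh Hh).
  replace (f (z + h)%C - f z)%C with (f (z + h)%C - f z - l * h + l * h)%C by ring.
  eapply Rle_trans; [apply Cmod_triangle|]. rewrite Cmod_mult. lra.
Qed.

Lemma gder_const D c z : gder D (fun _ => c) z (RtoC 0).
Proof.
  intros eps He. exists 1; split; [lra|]. intros h _ _.
  replace (c - c - RtoC 0 * h)%C with (RtoC 0) by ring. rewrite Cmod_0.
  apply Rmult_le_pos; [lra|apply Cmod_ge_0].
Qed.

Lemma gder_id D z : gder D (fun w => w) z (RtoC 1).
Proof.
  intros eps He. exists 1; split; [lra|]. intros h _ _.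
  replace (z + h - z - RtoC 1 * h)%C with (RtoC 0) by ring. rewrite Cmod_0.
  apply Rmult_le_pos; [lra|apply Cmod_ge_0].
Qed.

Lemma gder_plus D f g z l m : gder D f z l -> gder D g z m ->
  gder D (fun w => f w + g w)%C z (l + m)%C.
Proof.
  intros Hf Hg eps He.
  destruct (Hf (eps/2)) as [d1 [H1 F1]]; [lra|]. destruct (Hg (eps/2)) as [d2 [H2 F2]]; [lra|].
  exists (Rmin d1 d2); split; [apply Rmin_pos; auto|]. intros h Dh Hh.
  specialize (F1 h Dh (Rlt_le_trans _ _ _ Hh (Rmin_l _ _))).
  specialize (F2 h Dh (Rlt_le_trans _ _ _ Hh (Rmin_r _ _))).
  replace (f (z + h)%C + g (z + h)%C - (f z + g z) - (l + m) * h)%C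
    with ((f (z + h)%C - f z - l * h) + (g (z + h)%C - g z - m * h))%C by ring.
  eapply Rle_trans; [apply Cmod_triangle|]. lra.
Qed.

Lemma gder_mult D f g z l m : gder D f z l -> gder D g z m ->
  gder D (fun w => f w * g w)%C z (l * g z + f z * m)%C.
Proof.
  intros Hf Hg eps He.
  destruct (gder_bound _ _ _ _ Hg) as [d0 [H0 B0]].
  set (G := Cmod (g z) + 1 + Cmod m). set (L := Cmod l * (1 + Cmod m)). set (A := Cmod (f z)).
  assert (P1 := Cmod_ge_0 (g z)). assert (P2 := Cmod_ge_0 m). assert (P3 := Cmod_ge_0 l).
  assert (P4 := Cmod_ge_0 (f z)).
  assert (HG : 0 < G) by (unfold G; lra). assert (HL : 0 <= L) by (apply Rmult_le_pos; lra).
  destruct (Hf (eps / (3 * G))) as [d1 [H1 F1]].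
  { apply Rdiv_lt_0_compat; lra. }
  destruct (Hg (eps / (3 * (A + 1)))) as [d2 [H2 F2]].
  { apply Rdiv_lt_0_compat; unfold A; lra. }
  set (d3 := eps / (3 * (L + 1))).
  assert (H3 : 0 < d3) by (apply Rdiv_lt_0_compat; lra).
  exists (Rmin (Rmin d0 1) (Rmin d3 (Rmin d1 d2))); split.
  { repeat apply Rmin_pos; auto; lra. }
  intros h Dh Hh.
  assert (h0 : Cmod h < d0) by (eapply Rlt_le_trans; [apply Hh|]; eapply Rle_trans; [apply Rmin_l|apply Rmin_l]).
  assert (h1' : Cmod h < 1) by (eapply Rlt_le_trans; [apply Hh|]; eapply Rle_trans; [apply Rmin_l|apply Rmin_r]).
  assert (h3 : Cmod h < d3) by (eapply Rlt_le_trans; [apply Hh|]; eapply Rle_trans; [apply Rmin_r|apply Rmin_l]).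
  assert (h1 : Cmod h < d1) by (eapply Rlt_le_trans; [apply Hh|]; eapply Rle_trans; [apply Rmin_r|];
    eapply Rle_trans; [apply Rmin_r|apply Rmin_l]).
  assert (h2 : Cmod h < d2) by (eapply Rlt_le_trans; [apply Hh|]; eapply Rle_trans; [apply Rmin_r|];
    eapply Rle_trans; [apply Rmin_r|apply Rmin_r]).
  specialize (F1 h Dh h1). specialize (F2 h Dh h2). specialize (B0 h Dh h0).
  assert (Ph := Cmod_ge_0 h).
  assert (BG : Cmod (g (z + h)%C) <= G).
  { replace (g (z + h)%C) with (g z + (g (z + h)%C - g z))%C by ring.
    eapply Rle_trans; [apply Cmod_triangle|]. unfold G. nra. }
  replace (f (z + h)%C * g (z + h)%C - f z * g z - (l * g z + f z * m) * h)%C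
    with ((f (z + h)%C - f z - l * h) * g (z + h)%C + (l * h * (g (z + h)%C - g z) + f z * (g (z + h)%C - g z - m * h)))%C by ring.
  eapply Rle_trans; [apply Cmod_triangle|].
  assert (T1 : Cmod ((f (z + h)%C - f z - l * h) * g (z + h)%C) <= eps / 3 * Cmod h).
  { rewrite Cmod_mult. apply Rle_trans with (eps / (3 * G) * Cmod h * G).
    - apply Rmult_le_compat; auto; apply Cmod_ge_0.
    - right. field. lra. }
  assert (T2 : Cmod (l * h * (g (z + h)%C - g z)) <= eps / 3 * Cmod h).
  { rewrite !Cmod_mult. apply Rle_trans with (Cmod l * Cmod h * ((1 + Cmod m) * Cmod h)).
    - apply Rmult_le_compat_l; auto. apply Rmult_le_pos; auto.
    - replace (Cmod l * Cmod h * ((1 + Cmod m) * Cmod h)) with (L * Cmod h * Cmod h) by (unfold L; ring).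
      apply Rmult_le_compat_r; auto.
      apply Rle_trans with (L * d3). { apply Rmult_le_compat_l; lra. }
      unfold d3. apply Rmult_le_reg_r with (3 * (L + 1)); [lra|].
      replace (L * (eps / (3 * (L + 1))) * (3 * (L + 1))) with (L * eps) by (field; lra).
      replace (eps / 3 * (3 * (L + 1))) with (eps * (L + 1)) by field. nra. }
  assert (T3 : Cmod (f z * (g (z + h)%C - g z - m * h)) <= eps / 3 * Cmod h).
  { rewrite Cmod_mult. apply Rle_trans with (A * (eps / (3 * (A + 1)) * Cmod h)).
    - apply Rmult_le_compat_l; auto.
    - rewrite <- Rmult_assoc. apply Rmult_le_compat_r; auto.
      unfold A in *. apply Rmult_le_reg_r with (3 * (Cmod (f z) + 1)); [lra|].
      replace (Cmod (f z) * (eps / (3 * (Cmod (f z) + 1))) * (3 * (Cmod (f z) + 1))) with (Cmod (f z) * eps) by (field; lra).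
      replace (eps / 3 * (3 * (Cmod (f z) + 1))) with (eps * (Cmod (f z) + 1)) by field. nra. }
  generalize (Cmod_triangle (l * h * (g (z + h)%C - g z)) (f z * (g (z + h)%C - g z - m * h))). lra.
Qed.

Lemma gder_scal D c f z l : gder D f z l -> gder D (fun w => c * f w)%C z (c * l)%C.
Proof.
  intros H. replace (c * l)%C with (RtoC 0 * f z + c * l)%C by ring.
  apply gder_mult; auto. apply gder_const.
Qed.

Lemma gder_opp D f z l : gder D f z l -> gder D (fun w => - f w)%C z (- l)%C.
Proof.
  intros H eps He. destruct (H eps He) as [d [Hd Hf]]. exists d; split; auto.
  intros h Dh Hh. replace (- f (z + h)%C - - f z - - l * h)%C with (- (f (z + h)%C - f z - l * h))%C by ring.
  rewrite Cmod_opp. auto.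
Qed.

Lemma gder_minus D f g z l m : gder D f z l -> gder D g z m ->
  gder D (fun w => f w - g w)%C z (l - m)%C.
Proof. intros. apply gder_plus; auto. apply gder_opp; auto. Qed.

Lemma gder_comp D f g z l m : gder D f z l -> cder g (f z) m ->
  gder D (fun w => g (f w)) z (m * l)%C.
Proof.
  intros Hf Hg eps He.
  destruct (gder_bound _ _ _ _ Hf) as [d0 [H0 B0]].
  assert (P3 := Cmod_ge_0 l). assert (P4 := Cmod_ge_0 m).
  destruct (Hg (eps / (2 * (1 + Cmod l)))) as [d1 [H1 F1]]. { apply Rdiv_lt_0_compat; lra. }
  destruct (Hf (eps / (2 * (1 + Cmod m)))) as [d2 [H2 F2]]. { apply Rdiv_lt_0_compat; lra. }
  set (d3 := d1 / (1 + Cmod l)). assert (H3 : 0 < d3) by (apply Rdiv_lt_0_compat; lra).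
  exists (Rmin d0 (Rmin d2 d3)); split; [repeat apply Rmin_pos; auto|].
  intros h Dh Hh.
  assert (h0 : Cmod h < d0) by (eapply Rlt_le_trans; [apply Hh|apply Rmin_l]).
  assert (h2 : Cmod h < d2) by (eapply Rlt_le_trans; [apply Hh|]; eapply Rle_trans; [apply Rmin_r|apply Rmin_l]).
  assert (h3 : Cmod h < d3) by (eapply Rlt_le_trans; [apply Hh|]; eapply Rle_trans; [apply Rmin_r|apply Rmin_r]).
  specialize (B0 h Dh h0). specialize (F2 h Dh h2). assert (Ph := Cmod_ge_0 h).
  set (k := (f (z + h)%C - f z)%C) in *.
  assert (Hk : Cmod k < d1).
  { eapply Rle_lt_trans; [apply B0|]. unfold d3 in h3.
    apply Rmult_lt_reg_r with (/ (1 + Cmod l)); [apply Rinv_0_lt_compat; lra|].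
    replace ((1 + Cmod l) * Cmod h * / (1 + Cmod l)) with (Cmod h) by (field; lra). exact h3. }
  specialize (F1 k I Hk). replace (f z + k)%C with (f (z + h)%C) in F1 by (unfold k; ring).
  replace (g (f (z + h)%C) - g (f z) - m * l * h)%C
    with ((g (f (z + h)%C) - g (f z) - m * k) + m * (k - l * h))%C by ring.
  eapply Rle_trans; [apply Cmod_triangle|]. rewrite Cmod_mult.
  assert (T1 : eps / (2 * (1 + Cmod l)) * Cmod k <= eps / 2 * Cmod h).
  { apply Rle_trans with (eps / (2 * (1 + Cmod l)) * ((1 + Cmod l) * Cmod h)).
    - apply Rmult_le_compat_l; auto. apply Rlt_le, Rdiv_lt_0_compat; lra.
    - right. field. lra. }
  assert (T2 : Cmod m * Cmod (k - l * h) <= eps / 2 * Cmod h).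
  { apply Rle_trans with (Cmod m * (eps / (2 * (1 + Cmod m)) * Cmod h)).
    - apply Rmult_le_compat_l; auto.
    - rewrite <- Rmult_assoc. apply Rmult_le_compat_r; auto.
      apply Rmult_le_reg_r with (2 * (1 + Cmod m)); [lra|].
      replace (Cmod m * (eps / (2 * (1 + Cmod m))) * (2 * (1 + Cmod m))) with (Cmod m * eps) by (field; lra).
      replace (eps / 2 * (2 * (1 + Cmod m))) with (eps * (1 + Cmod m)) by field. nra. }
  lra.
Qed.

Lemma gder_eq D f z l m : gder D f z l -> l = m -> gder D f z m.
Proof. intros H <-; auto. Qed.

Lemma cder_cont D f z l : cder f z l -> cont_at D f z.
Proof.
  intros H eps He. destruct (gder_bound _ _ _ _ H) as [d [Hd B]].
  assert (P := Cmod_ge_0 l).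
  exists (Rmin d (eps / (1 + Cmod l))); split.
  { apply Rmin_pos; auto. apply Rdiv_lt_0_compat; lra. }
  intros u _ Hu. specialize (B (u - z)%C I (Rlt_le_trans _ _ _ Hu (Rmin_l _ _))).
  replace (z + (u - z))%C with u in B by ring. eapply Rle_lt_trans; [apply B|].
  assert (X := Rlt_le_trans _ _ _ Hu (Rmin_r _ _)).
  replace eps with ((1 + Cmod l) * (eps / (1 + Cmod l))) by (field; lra).
  apply Rmult_lt_compat_l; lra.
Qed.

Lemma cder_inv z : z <> RtoC 0 -> cder (fun w => / w)%C z (- / (z * z))%C.
Proof.
  intros Hz eps He. assert (P := Cmod_pos z Hz).
  set (d := Rmin (Cmod z / 2) (eps * (Cmod z ^ 3 / 2))).
  assert (P3 : 0 < Cmod z ^ 3) by (apply pow_lt; auto).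
  exists d; split. { apply Rmin_pos; [lra|]. apply Rmult_lt_0_compat; lra. }
  intros h _ Hh.
  assert (h1 := Rlt_le_trans _ _ _ Hh (Rmin_l _ _)). assert (h2 := Rlt_le_trans _ _ _ Hh (Rmin_r _ _)).
  assert (Q : Cmod z / 2 <= Cmod (z + h)%C).
  { generalize (Cmod_minus_tri z (- h)%C). rewrite Cmod_opp. replace (z - - h)%C with (z + h)%C by ring. lra. }
  assert (Hzh : (z + h)%C <> RtoC 0). { apply Cmod_gt_0. lra. }
  replace (/ (z + h)%C - / z - - / (z * z) * h)%C with (h * h * / (z * z * (z + h)%C))%C by (field; auto).
  rewrite !Cmod_mult, Cmod_inv by (repeat apply Cmult_neq_0; auto). rewrite !Cmod_mult.
  assert (Ph := Cmod_ge_0 h).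
  rewrite (Rmult_comm eps), Rmult_assoc. apply Rmult_le_compat_l; auto.
  apply Rmult_le_reg_r with (Cmod z * Cmod z * Cmod (z + h)%C).
  { repeat apply Rmult_lt_0_compat; auto. lra. }
  rewrite Rmult_assoc, Rinv_l.
  - apply Rle_trans with (eps * (Cmod z ^ 3 / 2)); [lra|].
    apply Rmult_le_compat_l; [lra|]. replace (Cmod z ^ 3 / 2) with (Cmod z * Cmod z * (Cmod z / 2)) by field.
    apply Rmult_le_compat_l; auto. apply Rmult_le_pos; lra.
  - apply Rgt_not_eq. repeat apply Rmult_lt_0_compat; auto. lra.
Qed.

Lemma gder_inv D f z l : f z <> RtoC 0 -> gder D f z l ->
  gder D (fun w => / f w)%C z (- l / (f z * f z))%C.
Proof.
  intros Hz H. eapply gder_eq. { apply (gder_comp D f (fun w => / w)%C); eauto. apply cder_inv; auto. }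
  cbv beta; field; auto.
Qed.

Lemma gder_div D f g z l m : g z <> RtoC 0 -> gder D f z l -> gder D g z m ->
  gder D (fun w => f w / g w)%C z ((l * g z - f z * m) / (g z * g z))%C.
Proof.
  intros Hz Hf Hg. eapply gder_eq. { apply gder_mult; [apply Hf|]. apply gder_inv; eauto. }
  cbv beta; field; auto.
Qed.

Lemma cont_at_mono (D D' : C -> Prop) f z : (forall u, D' u -> D u) -> cont_at D f z -> cont_at D' f z.
Proof. intros HD H eps He. destruct (H eps He) as [d [Hd F]]. exists d; split; auto. Qed.

Lemma cont_at_ext_loc (D : C -> Prop) f g z r : 0 < r ->
  (forall u, D u -> Cmod (u - z) < r -> f u = g u) -> f z = g z -> cont_at D f z -> cont_at D g z.
Proof.
  intros Hr E E0 H eps He. destruct (H eps He) as [d [Hd F]].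
  exists (Rmin d r); split; [apply Rmin_pos; auto|]. intros u Du Hu.
  rewrite <- E0, <- E; auto.
  - apply F; auto. eapply Rlt_le_trans; [apply Hu|apply Rmin_l].
  - eapply Rlt_le_trans; [apply Hu|apply Rmin_r].
Qed.

Lemma cont_at_ext (D : C -> Prop) f g z : D z -> (forall u, D u -> f u = g u) -> cont_at D f z -> cont_at D g z.
Proof. intros Dz E. apply (cont_at_ext_loc D f g z 1); auto. lra. Qed.

Lemma cont_at_comp (D D' : C -> Prop) f g z : (forall u, D u -> D' (f u)) ->
  cont_at D f z -> cont_at D' g (f z) -> cont_at D (fun u => g (f u)) z.
Proof.
  intros HD Hf Hg eps He. destruct (Hg eps He) as [d [Hd G]]. destruct (Hf d Hd) as [d' [Hd' F]].
  exists d'; split; auto.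
Qed.

Lemma cont_at_cder (D : C -> Prop) f g z l : cont_at D f z -> cder g (f z) l -> cont_at D (fun u => g (f u)) z.
Proof.
  intros Hf Hg. apply (cont_at_comp D (fun _ => True)); auto. eapply cder_cont; eauto.
Qed.

Lemma cont_at_const D c z : cont_at D (fun _ => c) z.
Proof. eapply cder_cont. apply gder_const. Qed.

Lemma cont_at_id D z : cont_at D (fun u => u) z.
Proof. eapply cder_cont. apply gder_id. Qed.

Lemma cont_at_plus D f g z : cont_at D f z -> cont_at D g z -> cont_at D (fun u => f u + g u)%C z.
Proof.
  intros Hf Hg eps He. destruct (Hf (eps/2)) as [d1 [H1 F1]]; [lra|].
  destruct (Hg (eps/2)) as [d2 [H2 F2]]; [lra|].
  exists (Rmin d1 d2); split; [apply Rmin_pos; auto|]. intros u Du Hu.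
  specialize (F1 u Du (Rlt_le_trans _ _ _ Hu (Rmin_l _ _))).
  specialize (F2 u Du (Rlt_le_trans _ _ _ Hu (Rmin_r _ _))).
  replace (f u + g u - (f z + g z))%C with ((f u - f z) + (g u - g z))%C by ring.
  eapply Rle_lt_trans; [apply Cmod_triangle|]. lra.
Qed.

Lemma cont_at_opp D f z : cont_at D f z -> cont_at D (fun u => - f u)%C z.
Proof.
  intros Hf eps He. destruct (Hf eps He) as [d [Hd F]]. exists d; split; auto. intros u Du Hu.
  replace (- f u - - f z)%C with (- (f u - f z))%C by ring. rewrite Cmod_opp; auto.
Qed.

Lemma cont_at_minus D f g z : cont_at D f z -> cont_at D g z -> cont_at D (fun u => f u - g u)%C z.
Proof. intros. apply cont_at_plus; auto. apply cont_at_opp; auto. Qed.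

Lemma cont_at_conj D f z : cont_at D f z -> cont_at D (fun u => Cconj (f u)) z.
Proof.
  intros Hf eps He. destruct (Hf eps He) as [d [Hd F]]. exists d; split; auto. intros u Du Hu.
  rewrite <- Cminus_conj, Cmod_conj; auto.
Qed.

Lemma cont_at_mult D f g z : cont_at D f z -> cont_at D g z -> cont_at D (fun u => f u * g u)%C z.
Proof.
  intros Hf Hg eps He. set (A := Cmod (f z)). set (B := Cmod (g z)).
  assert (PA := Cmod_ge_0 (f z)). assert (PB := Cmod_ge_0 (g z)). fold A in PA. fold B in PB.
  destruct (Hf (Rmin 1 (eps / (2 * (B + 1))))) as [d1 [H1 F1]].
  { apply Rmin_pos; [lra|]. apply Rdiv_lt_0_compat; lra. }
  destruct (Hg (Rmin 1 (eps / (2 * (A + 1))))) as [d2 [H2 F2]].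
  { apply Rmin_pos; [lra|]. apply Rdiv_lt_0_compat; lra. }
  exists (Rmin d1 d2); split; [apply Rmin_pos; auto|]. intros u Du Hu.
  specialize (F1 u Du (Rlt_le_trans _ _ _ Hu (Rmin_l _ _))).
  specialize (F2 u Du (Rlt_le_trans _ _ _ Hu (Rmin_r _ _))).
  assert (F1a := Rlt_le_trans _ _ _ F1 (Rmin_l _ _)). assert (F1b := Rlt_le_trans _ _ _ F1 (Rmin_r _ _)).
  assert (F2b := Rlt_le_trans _ _ _ F2 (Rmin_r _ _)).
  replace (f u * g u - f z * g z)%C with (f u * (g u - g z) + g z * (f u - f z))%C by ring.
  eapply Rle_lt_trans; [apply Cmod_triangle|]. rewrite !Cmod_mult. fold B.
  assert (Bu : Cmod (f u) <= A + 1).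
  { replace (f u) with (f z + (f u - f z))%C by ring. eapply Rle_trans; [apply Cmod_triangle|]. fold A. lra. }
  assert (Q1 := Cmod_ge_0 (g u - g z)). assert (Q2 := Cmod_ge_0 (f u - f z)). assert (Q3 := Cmod_ge_0 (f u)).
  assert (E1 : (A + 1) * (eps / (2 * (A + 1))) = eps / 2) by (field; lra).
  assert (E2 : (B + 1) * (eps / (2 * (B + 1))) = eps / 2) by (field; lra).
  assert (I1 : Cmod (f u) * Cmod (g u - g z) < eps / 2).
  { rewrite <- E1. apply Rle_lt_trans with ((A + 1) * Cmod (g u - g z)).
    - apply Rmult_le_compat_r; auto.
    - apply Rmult_lt_compat_l; lra. }
  assert (I2 : B * Cmod (f u - f z) <= eps / 2).
  { rewrite <- E2. apply Rmult_le_compat; lra. }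
  lra.
Qed.

Lemma cont_at_inv D f z : f z <> RtoC 0 -> cont_at D f z -> cont_at D (fun u => / f u)%C z.
Proof.
  intros Hz H. eapply (cont_at_cder D f (fun w => / w)%C z); auto. apply cder_inv; auto.
Qed.

Lemma cont_at_div D f g z : g z <> RtoC 0 -> cont_at D f z -> cont_at D g z -> cont_at D (fun u => f u / g u)%C z.
Proof. intros. apply cont_at_mult; auto. apply cont_at_inv; auto. Qed.

Lemma cont_at_lip (g : C -> C) D f z : (forall a b, Cmod (g a - g b) <= Cmod (a - b)) ->
  cont_at D f z -> cont_at D (fun u => g (f u)) z.
Proof.
  intros Hg Hf eps He. destruct (Hf eps He) as [d [Hd F]]. exists d; split; auto.
  intros u Du Hu. eapply Rle_lt_trans; [apply Hg|]. auto.
Qed.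

Lemma cont_at_Re D f z : cont_at D f z -> cont_at D (fun u => RtoC (Re (f u))) z.
Proof.
  apply (cont_at_lip (fun w => RtoC (Re w))). intros a b. rewrite <- RtoC_minus, Cmod_R, <- Re_minus.
  apply re_le_Cmod.
Qed.
Lemma cont_at_Im D f z : cont_at D f z -> cont_at D (fun u => RtoC (Im (f u))) z.
Proof.
  apply (cont_at_lip (fun w => RtoC (Im w))). intros a b. rewrite <- RtoC_minus, Cmod_R, <- Im_minus.
  apply im_le_Cmod.
Qed.

Lemma cont_at_real (D : C -> Prop) (r : C -> R) (f : R -> R) z :
  cont_at D (fun u => RtoC (r u)) z -> continuity_pt f (r z) ->
  cont_at D (fun u => RtoC (f (r u))) z.
Proof.
  intros Hr Hf eps He. destruct (Hf eps He) as [d [Hd F]]. destruct (Hr d Hd) as [d' [Hd' G]].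
  exists d'; split; auto. intros u Du Hu. rewrite <- RtoC_minus, Cmod_R.
  specialize (G u Du Hu). rewrite <- RtoC_minus, Cmod_R in G.
  destruct (Req_dec (r u) (r z)) as [E|N].
  - rewrite E, Rminus_diag, Rabs_R0. auto.
  - apply F. split; [split; [exact I|auto]|exact G].
Qed.

(** * Connectedness, bisection, and lifting of maps on rectangles *)

(** Connectedness of the interval: the supremum of the initial segments on which [A] holds belongs
    to such a segment, and a neighbourhood of it does too. *)
Lemma locally_constant_unit (A : R -> Prop) :
  (forall t, 0 <= t <= 1 -> exists e, 0 < e /\ forall s, 0 <= s <= 1 -> Rabs (s - t) < e -> (A s <-> A t)) ->
  A 0 -> forall t, 0 <= t <= 1 -> A t.
Proof.
  intros Hloc H0 t0 Ht0.
  set (E := fun t => 0 <= t <= 1 /\ forall s, 0 <= s <= t -> A s).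
  assert (E0 : E 0). { split; [lra|]. intros s Hs. replace s with 0 by lra. auto. }
  destruct (completeness E) as [m [Hub Hlub]].
  { exists 1. intros x [Hx _]. lra. }
  { exists 0; auto. }
  assert (Hm : 0 <= m <= 1).
  { split; [apply Hub; auto|]. apply Hlub. intros x [Hx _]; lra. }
  destruct (Hloc m Hm) as [e [He F]].
  assert (G : exists x, E x /\ m - e < x).
  { apply NNPP. intros N. assert (m <= m - e); [|lra]. apply Hlub. intros x Hx.
    destruct (Rle_dec x (m - e)); auto. exfalso. apply N. exists x. split; auto. lra. }
  destruct G as [x [[Hx Ex] Hxm]].
  assert (x <= m) by (apply Hub; split; auto).
  assert (Am : A m). { apply (F x); auto. { rewrite Rabs_left1; lra. } apply Ex. lra. }
  assert (E2 : forall y, 0 <= y <= 1 -> y < m + e -> E y).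
  { intros y Hy Hye. split; auto. intros s Hs. destruct (Rle_dec s x).
    - apply Ex; lra.
    - apply (F s); auto; [lra|]. apply Rabs_def1; lra. }
  destruct (Rlt_dec t0 (m + e)) as [L|L].
  - destruct (E2 t0 Ht0 L) as [_ X]. apply X; lra.
  - exfalso. assert (E (m + e / 2)) by (apply E2; lra).
    assert (m + e / 2 <= m) by (apply Hub; auto). lra.
Qed.

Definition convex (D : C -> Prop) : Prop :=
  forall z w t, D z -> D w -> 0 <= t <= 1 -> D (z + RtoC t * (w - z))%C.

Lemma segment_cont (D : C -> Prop) f z w t : convex D -> D z -> D w -> 0 <= t <= 1 -> cont_on D f ->
  forall eps, 0 < eps -> exists d, 0 < d /\ forall s, 0 <= s <= 1 -> Rabs (s - t) < d ->
  Cmod (f (z + RtoC s * (w - z))%C - f (z + RtoC t * (w - z))%C) < eps.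
Proof.
  intros HD Hz Hw Ht Hf eps He.
  destruct (Hf _ (HD z w t Hz Hw Ht) eps He) as [d [Hd F]].
  assert (P := Cmod_ge_0 (w - z)).
  exists (d / (1 + Cmod (w - z))); split. { apply Rdiv_lt_0_compat; lra. }
  intros s Hs Hst. apply F; auto.
  replace (z + RtoC s * (w - z) - (z + RtoC t * (w - z)))%C with (RtoC (s - t) * (w - z))%C
    by (rewrite RtoC_minus; ring).
  rewrite Cmod_mult, Cmod_R.
  apply Rle_lt_trans with (Rabs (s - t) * (1 + Cmod (w - z))).
  { apply Rmult_le_compat_l; [apply Rabs_pos|lra]. }
  apply Rmult_lt_reg_r with (/ (1 + Cmod (w - z))). { apply Rinv_0_lt_compat; lra. }
  replace (Rabs (s - t) * (1 + Cmod (w - z)) * / (1 + Cmod (w - z))) with (Rabs (s - t)) by (field; lra).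
  exact Hst.
Qed.

(** The half of the covering property that yields uniqueness of lifts: near a point of a fibre,
    neighbouring fibres have at most one point. *)
Definition separated (Cov : C -> C -> Prop) : Prop :=
  forall x0 y0, Cov x0 y0 -> exists e, 0 < e /\ forall x y y', Cmod (x - x0) < e ->
    Cov x y -> Cov x y' -> Cmod (y - y0) < e -> Cmod (y' - y0) < e -> y = y'.

(** Along the segment from [z0] to [z] the set where the two lifts agree is open by separation and
    closed by continuity. *)
Lemma lift_unique (Cov : C -> C -> Prop) (D : C -> Prop) (phi psi psi' : C -> C) z0 :
  separated Cov -> convex D -> cont_on D phi -> cont_on D psi -> cont_on D psi' ->
  (forall z, D z -> Cov (phi z) (psi z)) -> (forall z, D z -> Cov (phi z) (psi' z)) ->
  D z0 -> psi z0 = psi' z0 -> forall z, D z -> psi z = psi' z.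
Proof.
  intros Hsep HD Hphi Hpsi Hpsi' C1 C2 D0 E0 z Dz.
  set (g := fun t => (z0 + RtoC t * (z - z0))%C).
  assert (G0 : g 0 = z0) by (unfold g; ring). assert (G1 : g 1 = z) by (unfold g; ring).
  rewrite <- G1. apply (locally_constant_unit (fun t => psi (g t) = psi' (g t))); [| |lra].
  2: { rewrite G0; auto. }
  intros t Ht. assert (Dt : D (g t)) by (apply HD; auto).
  destruct (classic (psi (g t) = psi' (g t))) as [E|N].
  - destruct (Hsep _ _ (C1 _ Dt)) as [e [He F]].
    destruct (segment_cont D phi z0 z t HD D0 Dz Ht Hphi e He) as [d1 [H1 F1]].
    destruct (segment_cont D psi z0 z t HD D0 Dz Ht Hpsi e He) as [d2 [H2 F2]].
    destruct (segment_cont D psi' z0 z t HD D0 Dz Ht Hpsi' e He) as [d3 [H3 F3]].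
    exists (Rmin d1 (Rmin d2 d3)); split; [repeat apply Rmin_pos; auto|].
    intros s Hs Hst. split; auto. intros _.
    apply (F (phi (g s))).
    + apply F1; auto. eapply Rlt_le_trans; [apply Hst|apply Rmin_l].
    + apply C1. apply HD; auto.
    + apply C2. apply HD; auto.
    + apply F2; auto. eapply Rlt_le_trans; [apply Hst|]. eapply Rle_trans; [apply Rmin_r|apply Rmin_l].
    + rewrite E. apply F3; auto. eapply Rlt_le_trans; [apply Hst|]. eapply Rle_trans; [apply Rmin_r|apply Rmin_r].
  - assert (P : 0 < Cmod (psi (g t) - psi' (g t))).
    { apply Cmod_pos. intros E. apply N. apply Cminus_eq_0; auto. }
    set (e := Cmod (psi (g t) - psi' (g t)) / 2). assert (He : 0 < e) by (unfold e; lra).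
    destruct (segment_cont D psi z0 z t HD D0 Dz Ht Hpsi e He) as [d2 [H2 F2]].
    destruct (segment_cont D psi' z0 z t HD D0 Dz Ht Hpsi' e He) as [d3 [H3 F3]].
    exists (Rmin d2 d3); split; [repeat apply Rmin_pos; auto|].
    intros s Hs Hst. split; [|intros; contradiction]. intros E. exfalso.
    specialize (F2 s Hs (Rlt_le_trans _ _ _ Hst (Rmin_l _ _))).
    specialize (F3 s Hs (Rlt_le_trans _ _ _ Hst (Rmin_r _ _))).
    fold (g s) (g t) in F2, F3. rewrite E in F2.
    assert (Cmod (psi (g t) - psi' (g t)) <= Cmod (psi' (g s) - psi (g t)) + Cmod (psi' (g s) - psi' (g t))).
    { rewrite (Cmod_minus_sym (psi' (g s)) (psi (g t))).
      replace (psi (g t) - psi' (g t))%C with ((psi (g t) - psi' (g s)) + (psi' (g s) - psi' (g t)))%C by ring.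
      apply Cmod_triangle. }
    unfold e in *. lra.
Qed.

(* Every dyadic subdivision shrinks to a point, where the local hypothesis applies. *)
Lemma rectangle_bisection (P : R -> R -> R -> R -> Prop) (X1 X2 Y1 Y2 : R) :
  X1 < X2 -> Y1 < Y2 ->
  (forall a m b c d, a < m < b -> c < d -> X1 <= a -> b <= X2 -> Y1 <= c -> d <= Y2 ->
     P a m c d -> P m b c d -> P a b c d) ->
  (forall a b c m d, a < b -> c < m < d -> X1 <= a -> b <= X2 -> Y1 <= c -> d <= Y2 ->
     P a b c m -> P a b m d -> P a b c d) ->
  (forall x y, X1 <= x <= X2 -> Y1 <= y <= Y2 -> exists delta, 0 < delta /\
     forall a b c d, a < b -> c < d -> X1 <= a <= x -> x <= b <= X2 -> Y1 <= c <= y -> y <= d <= Y2 ->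
       b - a < delta -> d - c < delta -> (b - a) * (Y2 - Y1) = (d - c) * (X2 - X1) -> P a b c d) ->
  P X1 X2 Y1 Y2.
Proof.
  intros HX HY Hx Hy Hloc. apply NNPP. intros NP.
  set (W := fun n => (X2 - X1) / 2 ^ n). set (H := fun n => (Y2 - Y1) / 2 ^ n).
  assert (p2 : forall n, 0 < 2 ^ n) by (intros; apply pow_lt; lra).
  assert (W0 : forall n, 0 < W n) by (intros; apply Rdiv_lt_0_compat; [lra|auto]).
  assert (H0 : forall n, 0 < H n) by (intros; apply Rdiv_lt_0_compat; [lra|auto]).
  assert (WS : forall n, W n = W (S n) + W (S n)).
  { intros. unfold W. simpl. field. apply Rgt_not_eq, p2. }
  assert (HS : forall n, H n = H (S n) + H (S n)).
  { intros. unfold H. simpl. field. apply Rgt_not_eq, p2. }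
  set (bad := fun n (q : R * R) => X1 <= fst q /\ fst q + W n <= X2 /\ Y1 <= snd q /\ snd q + H n <= Y2 /\
     ~ P (fst q) (fst q + W n) (snd q) (snd q + H n)).
  set (rel := fun n (q q' : R * R) => fst q <= fst q' /\ fst q' + W (S n) <= fst q + W n /\
     snd q <= snd q' /\ snd q' + H (S n) <= snd q + H n /\ bad (S n) q').
  assert (step : forall n q, bad n q -> exists q', rel n q q').
  { intros n [a c] [B1 [B2 [B3 [B4 B5]]]]. simpl in *.
    assert (w := W0 (S n)). assert (h := H0 (S n)). assert (ws := WS n). assert (hs := HS n).
    apply NNPP. intros N. apply B5.
    assert (Q : forall a' c', (a' = a \/ a' = a + W (S n)) -> (c' = c \/ c' = c + H (S n)) ->
       P a' (a' + W (S n)) c' (c' + H (S n))).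
    { intros a' c' Ha Hc. apply NNPP. intros N'. apply N. exists (a', c').
      unfold rel, bad; simpl. repeat split; auto; destruct Ha, Hc; subst; lra. }
    rewrite ws, hs. replace (a + (W (S n) + W (S n))) with (a + W (S n) + W (S n)) by ring.
    replace (c + (H (S n) + H (S n))) with (c + H (S n) + H (S n)) by ring.
    apply Hx with (a + W (S n)); try lra; apply Hy with (c + H (S n)); try lra; apply Q; auto. }
  (* Dependent choice of nested bad rectangles, made by [epsilon]. All of them are similar to the
     whole rectangle, which is the proportion passed to the local hypothesis. *)
  set (sq := fix sq n := match n with O => (X1, Y1) | S k => epsilon (inhabits (0, 0)) (rel k (sq k)) end).
  assert (Hbad : forall n, bad n (sq n)).
  { induction n.
    - unfold bad, W, H; simpl. repeat split; try lra.
      replace (X1 + (X2 - X1) / 1) with X2 by field. replace (Y1 + (Y2 - Y1) / 1) with Y2 by field. auto.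
    - simpl. destruct (epsilon_spec (inhabits (0, 0)) (rel n (sq n)) (step n _ IHn)) as [_ [_ [_ [_ B]]]]. exact B. }
  assert (Hrel : forall n, rel n (sq n) (sq (S n))).
  { intros n. simpl. apply epsilon_spec. apply step; auto. }
  assert (mono : forall n m, (n <= m)%nat -> fst (sq n) <= fst (sq m) /\ fst (sq m) + W m <= fst (sq n) + W n /\
     snd (sq n) <= snd (sq m) /\ snd (sq m) + H m <= snd (sq n) + H n).
  { intros n m L. induction L; [lra|]. destruct (Hrel m) as [R1 [R2 [R3 [R4 _]]]]. lra. }
  assert (bnd : forall n m, fst (sq m) <= fst (sq n) + W n /\ snd (sq m) <= snd (sq n) + H n).
  { intros n m. assert (w := W0 m). assert (h := H0 m). assert (w' := W0 n). assert (h' := H0 n).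
    destruct (Nat.le_ge_cases n m) as [L|L]; destruct (mono _ _ L); lra. }
  destruct (completeness (fun x => exists n, x = fst (sq n))) as [x [Ux Lx]].
  { exists (fst (sq 0%nat) + W 0%nat). intros y [n ->]. apply bnd. }
  { exists (fst (sq 0%nat)), 0%nat; auto. }
  destruct (completeness (fun x => exists n, x = snd (sq n))) as [y [Uy Ly]].
  { exists (snd (sq 0%nat) + H 0%nat). intros y [n ->]. apply bnd. }
  { exists (snd (sq 0%nat)), 0%nat; auto. }
  assert (Bx : forall n, fst (sq n) <= x <= fst (sq n) + W n).
  { intros n. split; [apply Ux; exists n; auto|]. apply Lx. intros z [m ->]. apply bnd. }
  assert (By : forall n, snd (sq n) <= y <= snd (sq n) + H n).
  { intros n. split; [apply Uy; exists n; auto|]. apply Ly. intros z [m ->]. apply bnd. }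
  destruct (Hloc x y) as [delta [Hd F]].
  { generalize (Bx 0%nat). unfold W. simpl. lra. }
  { generalize (By 0%nat). unfold H. simpl. lra. }
  destruct (pow_lt_1_zero (1/2)) with (y := delta / (X2 - X1 + (Y2 - Y1))) as [n Hn].
  { rewrite Rabs_right; lra. } { apply Rdiv_lt_0_compat; lra. }
  specialize (Hn n (le_n n)). rewrite Rabs_right in Hn by (apply Rle_ge, pow_le; lra).
  assert (Hn' : (X2 - X1 + (Y2 - Y1)) * (1/2)^n < delta).
  { apply Rmult_lt_reg_r with (/ (X2 - X1 + (Y2 - Y1))); [apply Rinv_0_lt_compat; lra|].
    replace ((X2 - X1 + (Y2 - Y1)) * (1/2)^n * / (X2 - X1 + (Y2 - Y1))) with ((1/2)^n) by (field; lra). exact Hn. }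
  assert (E : (1/2)^n = / 2^n). { unfold Rdiv. rewrite Rmult_1_l. apply pow_inv. }
  assert (wn := W0 n). assert (hn := H0 n).
  assert (WH : W n + H n < delta). { unfold W, H. rewrite E in Hn'. unfold Rdiv. lra. }
  destruct (Hbad n) as [B1 [B2 [B3 [B4 B5]]]]. apply B5.
  assert (bx := Bx n). assert (by' := By n).
  apply F; try lra. unfold W, H. field. apply Rgt_not_eq, p2.
Qed.

Definition rect (a b c d : R) (z : C) : Prop := a <= Re z <= b /\ c <= Im z <= d.

Lemma rect_convex a b c d : convex (rect a b c d).
Proof.
  intros z w t [[H1 H2] [H3 H4]] [[K1 K2] [K3 K4]] Ht. unfold rect. cre. repeat split; nra.
Qed.

Lemma convex_and D D' : convex D -> convex D' -> convex (fun z => D z /\ D' z).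
Proof. intros H H' z w t [A A'] [B B'] Ht. split; [apply H|apply H']; auto. Qed.

Lemma cont_on_mono (D D' : C -> Prop) f : (forall u, D' u -> D u) -> cont_on D f -> cont_on D' f.
Proof. intros H Hf z Dz. exact (cont_at_mono D D' f z H (Hf z (H z Dz))). Qed.

(* [s] is a real-linear coordinate, here the real or the imaginary part *)
Lemma cont_on_paste (D : C -> Prop) (s : C -> R) (m : R) (f g : C -> C) :
  (forall z w, Rabs (s z - s w) <= Cmod (z - w)) ->
  cont_on (fun z => D z /\ s z <= m) f -> cont_on (fun z => D z /\ m <= s z) g ->
  (forall z, D z -> s z = m -> f z = g z) ->
  cont_on D (fun z => if Rle_dec (s z) m then f z else g z).
Proof.
  intros Hs Hf Hg E z Dz eps He.
  destruct (Rtotal_order (s z) m) as [L|[L|L]].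
  - destruct (Hf z (conj Dz (Rlt_le _ _ L)) eps He) as [d [Hd F]].
    exists (Rmin d (m - s z)); split; [apply Rmin_pos; lra|]. intros u Du Hu.
    assert (U1 := Rlt_le_trans _ _ _ Hu (Rmin_l _ _)). assert (U2 := Rlt_le_trans _ _ _ Hu (Rmin_r _ _)).
    assert (s u < m). { generalize (Hs u z) (Rle_abs (s u - s z)). lra. }
    destruct (Rle_dec (s z) m); [|lra]. destruct (Rle_dec (s u) m); [|lra]. apply F; auto.
  - destruct (Hf z (conj Dz (Req_le _ _ L)) eps He) as [d [Hd F]].
    destruct (Hg z (conj Dz (Req_le _ _ (eq_sym L))) eps He) as [d' [Hd' G]].
    exists (Rmin d d'); split; [apply Rmin_pos; lra|]. intros u Du Hu.
    assert (U1 := Rlt_le_trans _ _ _ Hu (Rmin_l _ _)). assert (U2 := Rlt_le_trans _ _ _ Hu (Rmin_r _ _)).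
    destruct (Rle_dec (s z) m); [|lra]. destruct (Rle_dec (s u) m).
    + apply F; auto.
    + rewrite E by auto. apply G; auto. split; auto. lra.
  - destruct (Hg z (conj Dz (Rlt_le _ _ L)) eps He) as [d [Hd F]].
    exists (Rmin d (s z - m)); split; [apply Rmin_pos; lra|]. intros u Du Hu.
    assert (U1 := Rlt_le_trans _ _ _ Hu (Rmin_l _ _)). assert (U2 := Rlt_le_trans _ _ _ Hu (Rmin_r _ _)).
    assert (m < s u). { generalize (Hs u z) (Rle_abs (- (s u - s z))). rewrite Rabs_Ropp. lra. }
    destruct (Rle_dec (s z) m); [lra|]. destruct (Rle_dec (s u) m); [lra|]. apply F; auto. split; auto; lra.
Qed.

Lemma Re_lip z w : Rabs (Re z - Re w) <= Cmod (z - w).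
Proof. rewrite <- Re_minus. apply re_le_Cmod. Qed.
Lemma Im_lip z w : Rabs (Im z - Im w) <= Cmod (z - w).
Proof. rewrite <- Im_minus. apply im_le_Cmod. Qed.

(** The half of the covering property that yields existence of lifts: over a disc whose radius does
    not depend on the sheet, every point of a fibre extends to a holomorphic section. *)
Definition locally_sectioned (X : C -> Prop) (Cov : C -> C -> Prop) : Prop :=
  forall x0, X x0 -> exists r, 0 < r /\ forall x1 y1, Cmod (x1 - x0) < r -> Cov x1 y1 ->
    exists s : C -> C, s x1 = y1 /\ forall x, Cmod (x - x0) < r -> Cov x (s x) /\ exists l, cder s x l.

(** A lift is demanded through every point of every fibre over [D]; this is what allows lifts on
    adjacent pieces to be matched. *)
Definition liftable (Cov : C -> C -> Prop) (phi : C -> C) (D : C -> Prop) : Prop :=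
  forall z0 y0, D z0 -> Cov (phi z0) y0 -> exists psi : C -> C, psi z0 = y0 /\ cont_on D psi /\
    forall z, D z -> Cov (phi z) (psi z).

(** The lift on the piece containing [z0] prescribes, at the point [e] of the common edge, the
    initial value for the other piece. The edge is convex, so the two lifts agree on all of it by
    uniqueness. *)
Lemma liftable_paste (Cov : C -> C -> Prop) (phi : C -> C) (D : C -> Prop) (s : C -> R) m :
  separated Cov -> convex (fun z => D z /\ s z = m) -> (exists e, D e /\ s e = m) -> cont_on D phi ->
  (forall z w, Rabs (s z - s w) <= Cmod (z - w)) ->
  liftable Cov phi (fun z => D z /\ s z <= m) -> liftable Cov phi (fun z => D z /\ m <= s z) ->
  liftable Cov phi D.
Proof.
  intros Hsep Hcv [e [De Ee]] Hphi Hs L1 L2 z0 y0 D0 C0.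
  assert (G : forall f g : C -> C,
     cont_on (fun z => D z /\ s z <= m) f -> (forall z, D z /\ s z <= m -> Cov (phi z) (f z)) ->
     cont_on (fun z => D z /\ m <= s z) g -> (forall z, D z /\ m <= s z -> Cov (phi z) (g z)) ->
     f e = g e -> (forall z, D z -> s z = m -> f z = g z) /\
       cont_on D (fun z => if Rle_dec (s z) m then f z else g z) /\
       (forall z, D z -> Cov (phi z) (if Rle_dec (s z) m then f z else g z))).
  { intros f g Cf Vf Cg Vg E.
    assert (A : forall z, D z -> s z = m -> f z = g z).
    { intros z Dz Ez. apply (lift_unique Cov (fun z => D z /\ s z = m) phi f g e); auto.
      - apply (cont_on_mono D); auto. tauto.
      - apply (cont_on_mono _ _ f) with (2 := Cf). intros u [? ?]; split; auto; lra.
      - apply (cont_on_mono _ _ g) with (2 := Cg). intros u [? ?]; split; auto; lra.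
      - intros w [? ?]. apply Vf; split; auto; lra.
      - intros w [? ?]. apply Vg; split; auto; lra. }
    split; auto. split.
    - apply cont_on_paste; auto.
    - intros z Dz. destruct (Rle_dec (s z) m); [apply Vf|apply Vg]; split; auto; lra. }
  destruct (Rle_dec (s z0) m) as [Hz|Hz].
  - destruct (L1 z0 y0) as [f [F0 [Cf Vf]]]; auto.
    destruct (L2 e (f e)) as [g [G0 [Cg Vg]]]. { split; auto; lra. } { apply Vf. split; auto; lra. }
    destruct (G f g) as [_ [K1 K2]]; auto.
    exists (fun z => if Rle_dec (s z) m then f z else g z). split; auto.
    destruct (Rle_dec (s z0) m); [auto|lra].
  - destruct (L2 z0 y0) as [g [G0 [Cg Vg]]]; auto. { split; auto; lra. }
    destruct (L1 e (g e)) as [f [F0 [Cf Vf]]]. { split; auto; lra. } { apply Vg. split; auto; lra. }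
    destruct (G f g) as [_ [K1 K2]]; auto.
    exists (fun z => if Rle_dec (s z) m then f z else g z). split; auto.
    destruct (Rle_dec (s z0) m); [lra|auto].
Qed.

Lemma liftable_ext (Cov : C -> C -> Prop) phi (D D' : C -> Prop) :
  (forall z, D z <-> D' z) -> liftable Cov phi D -> liftable Cov phi D'.
Proof.
  intros E L z0 y0 D0 C0. destruct (L z0 y0) as [f [F0 [Cf Vf]]]; auto. { apply E; auto. }
  exists f; split; auto. split.
  - apply (cont_on_mono D); auto. intros; apply E; auto.
  - intros; apply Vf, E; auto.
Qed.

(** Small rectangles lift by a local section and adjacent lifts paste, so bisection gives the lift.
    The simple connectedness of a rectangle enters through the connectedness of the common edges. *)
Lemma rect_lift (X : C -> Prop) (Cov : C -> C -> Prop) (phi : C -> C) a b c d :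
  a < b -> c < d -> separated Cov -> locally_sectioned X Cov ->
  cont_on (rect a b c d) phi -> (forall z, rect a b c d z -> X (phi z)) ->
  liftable Cov phi (rect a b c d).
Proof.
  intros Hab Hcd Hsep Hloc Hphi HX.
  assert (sub : forall a' b' c' d', a <= a' -> b' <= b -> c <= c' -> d' <= d ->
    forall z, rect a' b' c' d' z -> rect a b c d z).
  { unfold rect; intros; lra. }
  apply (rectangle_bisection (fun a b c d => liftable Cov phi (rect a b c d))); auto.
  - intros a' m b' c' d' H1 H2 H3 H4 H5 H6 L1 L2.
    apply (liftable_paste Cov phi _ Re m); auto.
    + apply (convex_and (rect a' b' c' d') (fun z => Re z = m)). { apply rect_convex. }
      intros z w t Hz Hw Ht. cre. rewrite Hz, Hw. ring.
    + exists (m, c'). unfold rect; simpl; lra.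
    + apply (cont_on_mono (rect a b c d)); auto. apply sub; lra.
    + apply Re_lip.
    + apply liftable_ext with (2 := L1). unfold rect; intros; lra.
    + apply liftable_ext with (2 := L2). unfold rect; intros; lra.
  - intros a' b' c' m d' H1 H2 H3 H4 H5 H6 L1 L2.
    apply (liftable_paste Cov phi _ Im m); auto.
    + apply (convex_and (rect a' b' c' d') (fun z => Im z = m)). { apply rect_convex. }
      intros z w t Hz Hw Ht. cre. rewrite Hz, Hw. ring.
    + exists (a', m). unfold rect; simpl; lra.
    + apply (cont_on_mono (rect a b c d)); auto. apply sub; lra.
    + apply Im_lip.
    + apply liftable_ext with (2 := L1). unfold rect; intros; lra.
    + apply liftable_ext with (2 := L2). unfold rect; intros; lra.
  - intros x y Hx Hy. assert (Dxy : rect a b c d (x, y)) by (unfold rect; simpl; lra).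
    destruct (Hloc _ (HX _ Dxy)) as [r [Hr S]].
    destruct (Hphi _ Dxy r Hr) as [dl [Hdl F]].
    exists (dl / 2); split; [lra|].
    intros a' b' c' d' H1 H2 H3 H4 H5 H6 H7 H8 _ z0 y0 D0 C0.
    assert (N : forall z, rect a' b' c' d' z -> Cmod (phi z - phi (x, y)) < r).
    { intros z Hz. apply F. { apply (sub a' b' c' d'); auto; lra. }
      eapply Rle_lt_trans; [apply Cmod_le_sum|]. cre. unfold rect in Hz.
      apply Rlt_le_trans with (dl/2 + dl/2); [|lra]. apply Rplus_lt_compat; apply Rabs_def1; lra. }
    destruct (S _ _ (N _ D0) C0) as [s [S0 S1]].
    exists (fun z => s (phi z)). split; auto. split.
    + intros z Hz. destruct (S1 _ (N z Hz)) as [_ [l Hl]].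
      apply (cont_at_cder _ phi s z l); auto.
      assert (Z : rect a b c d z) by (apply (sub a' b' c' d'); auto; lra).
      refine (cont_at_mono (rect a b c d) _ phi z _ (Hphi z Z)).
      intros; apply (sub a' b' c' d'); auto; lra.
    + intros z Hz. apply S1. apply N; auto.
Qed.

Definition rect_open (a b c d : R) (z : C) : Prop := a < Re z < b /\ c < Im z < d.

(** Near an interior point a continuous lift coincides, by separation, with a holomorphic section
    composed with the lifted map. *)
Lemma lift_holo (X : C -> Prop) (Cov : C -> C -> Prop) (phi psi : C -> C) a b c d z l :
  separated Cov -> locally_sectioned X Cov ->
  cont_on (rect a b c d) phi -> cont_on (rect a b c d) psi ->
  (forall z, rect a b c d z -> X (phi z)) -> (forall z, rect a b c d z -> Cov (phi z) (psi z)) ->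
  rect_open a b c d z -> cder phi z l -> exists m, cder psi z m.
Proof.
  intros Hsep Hloc Hphi Hpsi HX HC Hz Hl.
  assert (Dz : rect a b c d z) by (unfold rect, rect_open in *; lra).
  destruct (Hloc _ (HX _ Dz)) as [r [Hr S]].
  destruct (S (phi z) (psi z)) as [s [S0 S1]].
  { replace (phi z - phi z)%C with (RtoC 0) by ring. rewrite Cmod_0; auto. } { auto. }
  assert (P0 : Cmod (phi z - phi z) < r).
  { replace (phi z - phi z)%C with (RtoC 0) by ring. rewrite Cmod_0; auto. }
  destruct (S1 (phi z) P0) as [_ [m Hm]].
  exists (m * l)%C.
  destruct (Hsep _ _ (HC _ Dz)) as [e [He U]].
  destruct (Hphi _ Dz (Rmin r e)) as [d1 [H1 F1]]. { apply Rmin_pos; auto. }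
  destruct (Hpsi _ Dz e He) as [d2 [H2 F2]].
  assert (Hs : cont_at (rect a b c d) (fun u => s (phi u)) z).
  { exact (cont_at_cder _ phi s z m (Hphi z Dz) Hm). }
  destruct (Hs e He) as [d3 [H3 F3]].
  set (d4 := Rmin (Rmin (Re z - a) (b - Re z)) (Rmin (Im z - c) (d - Im z))).
  assert (H4 : 0 < d4) by (unfold rect_open in Hz; unfold d4; repeat apply Rmin_pos; lra).
  apply (cder_ext_loc (fun u => s (phi u)) psi z (m * l)%C (Rmin (Rmin d1 d2) (Rmin d3 d4))).
  { repeat apply Rmin_pos; unfold rect_open in Hz; auto; lra. }
  2: apply gder_comp; auto.
  intros w Hw.
  assert (W1 := Rlt_le_trans _ _ _ Hw (Rmin_l _ _)). assert (W2 := Rlt_le_trans _ _ _ Hw (Rmin_r _ _)).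
  assert (w1 := Rlt_le_trans _ _ _ W1 (Rmin_l _ _)). assert (w2 := Rlt_le_trans _ _ _ W1 (Rmin_r _ _)).
  assert (w3 := Rlt_le_trans _ _ _ W2 (Rmin_l _ _)). assert (w4 := Rlt_le_trans _ _ _ W2 (Rmin_r _ _)).
  assert (Dw : rect a b c d w).
  { unfold d4 in w4. assert (A1 := Rlt_le_trans _ _ _ w4 (Rmin_l _ _)). assert (A2 := Rlt_le_trans _ _ _ w4 (Rmin_r _ _)).
    assert (B1 := Rlt_le_trans _ _ _ A1 (Rmin_l _ _)). assert (B2 := Rlt_le_trans _ _ _ A1 (Rmin_r _ _)).
    assert (B3 := Rlt_le_trans _ _ _ A2 (Rmin_l _ _)). assert (B4 := Rlt_le_trans _ _ _ A2 (Rmin_r _ _)).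
    generalize (Re_lip w z) (Im_lip w z). intros Q1 Q2.
    generalize (Rle_abs (Re w - Re z)) (Rle_abs (- (Re w - Re z))) (Rle_abs (Im w - Im z)) (Rle_abs (- (Im w - Im z))).
    rewrite !Rabs_Ropp. unfold rect. lra. }
  specialize (F1 w Dw w1). assert (F1a := Rlt_le_trans _ _ _ F1 (Rmin_l _ _)).
  assert (F1b := Rlt_le_trans _ _ _ F1 (Rmin_r _ _)).
  apply (U (phi w)); auto.
  - apply S1; auto.
  - rewrite <- S0. apply F3; auto.
Qed.

(** * Mean value inequality and inverse functions *)

Lemma rder_Re (F : C -> C) t l : rder F (RtoC t) l -> is_derive (fun x => Re (F (RtoC x))) t (Re l).
Proof.
  intros H. apply is_derive_Reals. intros eps He. destruct (H (eps/2)) as [d [Hd K]]; [lra|].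
  exists (mkposreal d Hd). intros h Hh Hhd. simpl in Hhd.
  specialize (K (RtoC h)). rewrite Im_RtoC, Cmod_R in K. specialize (K eq_refl Hhd).
  rewrite <- RtoC_plus in K.
  assert (Q := Rle_trans _ _ _ (re_le_Cmod _) K).
  rewrite !Re_minus, Re_mult, Re_RtoC, Im_RtoC in Q.
  replace ((Re (F (RtoC (t + h))) - Re (F (RtoC t))) / h - Re l)
    with ((Re (F (RtoC (t + h))) - Re (F (RtoC t)) - (Re l * h - Im l * 0)) / h) by (field; auto).
  unfold Rdiv. rewrite Rabs_mult, Rabs_inv.
  assert (0 < Rabs h) by (apply Rabs_pos_lt; auto).
  apply Rle_lt_trans with (eps/2 * Rabs h * / Rabs h).
  - apply Rmult_le_compat_r; auto. apply Rlt_le, Rinv_0_lt_compat; auto.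
  - rewrite Rmult_assoc, Rinv_r by lra. lra.
Qed.

Lemma rder_Im (F : C -> C) t l : rder F (RtoC t) l -> is_derive (fun x => Im (F (RtoC x))) t (Im l).
Proof.
  intros H. assert (H' : rder (fun z => - Ci * F z)%C (RtoC t) (- Ci * l)%C) by (apply gder_scal; auto).
  apply rder_Re in H'. cre_in H'. replace (Im l) with (- 0 * Re l - - (1) * Im l) by ring.
  refine (is_derive_ext _ _ _ _ _ H'). intros x. cbv beta. cre. simpl. ring.
Qed.

(** The real mean value theorem on the segment, for the real part of [f] times the conjugate of its
    increment; the increment of that function is the squared modulus. *)
Lemma mean_value_C (f df : C -> C) z w B :
  (forall t, 0 <= t <= 1 -> cder f (z + RtoC t * (w - z))%C (df (z + RtoC t * (w - z))%C)) ->
  (forall t, 0 <= t <= 1 -> Cmod (df (z + RtoC t * (w - z))%C) <= B) ->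
  Cmod (f w - f z) <= B * Cmod (w - z).
Proof.
  intros Hd HB.
  set (k := Cconj (f w - f z)).
  set (g := fun t : C => (k * f (z + t * (w - z)))%C).
  assert (D : forall t, 0 <= t <= 1 -> is_derive (fun t => Re (g (RtoC t))) t
     (Re (k * (df (z + RtoC t * (w - z))%C * (w - z))))).
  { intros t Ht. apply rder_Re. unfold g. apply gder_scal.
    apply (gder_comp _ (fun t => z + t * (w - z))%C f); [|apply Hd; auto].
    eapply gder_eq. { apply gder_plus; [apply gder_const|]. apply gder_mult; [apply gder_id|apply gder_const]. }
    cbv beta. ring. }
  destruct (MVT_gen (fun t => Re (g (RtoC t))) 0 1 (fun t => Re (k * (df (z + RtoC t * (w - z))%C * (w - z)))))
    as [c [Hc E]].
  - intros x. rewrite Rmin_left, Rmax_right by lra. intros. apply D; lra.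
  - intros x. rewrite Rmin_left, Rmax_right by lra. intros.
    apply continuity_pt_filterlim. apply (ex_derive_continuous (fun t => Re (g (RtoC t)))). eexists; apply D; lra.
  - rewrite Rmin_left, Rmax_right in Hc by lra.
    assert (E2 : Re (g (RtoC 1)) - Re (g (RtoC 0)) = Cmod (f w - f z) ^ 2).
    { unfold g. replace (z + RtoC 1 * (w - z))%C with w by ring. replace (z + RtoC 0 * (w - z))%C with z by ring.
      rewrite <- Re_minus. replace (k * f w - k * f z)%C with ((f w - f z) * k)%C by ring.
      unfold k. rewrite Cmod_sqr. cre. ring. }
    rewrite E2 in E. assert (P := Cmod_ge_0 (f w - f z)).
    assert (Q : Re (k * (df (z + RtoC c * (w - z))%C * (w - z))) <= Cmod (f w - f z) * (B * Cmod (w - z))).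
    { eapply Rle_trans; [apply Rle_abs|]. eapply Rle_trans; [apply re_le_Cmod|].
      rewrite !Cmod_mult. unfold k. rewrite Cmod_conj. apply Rmult_le_compat_l; auto.
      apply Rmult_le_compat_r; [apply Cmod_ge_0|]. apply HB; auto. }
    rewrite Rminus_0_r, Rmult_1_r in E. rewrite <- E in Q.
    destruct (Req_dec (Cmod (f w - f z)) 0) as [Z|Z].
    + rewrite Z. apply Rmult_le_pos; [|apply Cmod_ge_0]. eapply Rle_trans; [apply Cmod_ge_0|apply (HB 0); lra].
    + apply Rmult_le_reg_l with (Cmod (f w - f z)); [lra|]. simpl in Q. lra.
Qed.

Lemma zero_derivative_constant (f : C -> C) (D : C -> Prop) z w :
  (forall t, 0 <= t <= 1 -> cder f (z + RtoC t * (w - z))%C (RtoC 0)) -> f w = f z.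
Proof.
  intros H. apply Cminus_eq_0. apply Cmod_eq_0. apply Rle_antisym; [|apply Cmod_ge_0].
  rewrite <- (Rmult_0_l (Cmod (w - z))). apply (mean_value_C f (fun _ => RtoC 0)); auto.
  intros. rewrite Cmod_0; lra.
Qed.

Lemma Cmod_sub_bound z w : Cmod w <= Cmod z + Cmod (z - w).
Proof. replace w with (z - (z - w))%C at 1 by ring. apply Cmod_minus_le. Qed.

(** The expansion of [f] at [v y] bounds |h| below by |l|/2 times the increment of [v]; hence the
    error of [f], small against that increment, is small against h. *)
Lemma cder_inverse (f v : C -> C) y l r : 0 < r ->
  (forall y', Cmod (y' - y) < r -> f (v y') = y') -> cont_at (fun _ => True) v y ->
  cder f (v y) l -> l <> RtoC 0 -> cder v y (/ l)%C.
Proof.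
  intros Hr Hfv Hv Hl Nl eps He.
  assert (P := Cmod_pos l Nl).
  set (e := Rmin (Cmod l / 2) (eps * Cmod l * Cmod l / 2)).
  assert (He' : 0 < e). { unfold e. apply Rmin_pos; [lra|]. repeat apply Rmult_lt_0_compat; lra. }
  destruct (Hl e He') as [d [Hd K]]. destruct (Hv d Hd) as [d' [Hd' V]].
  exists (Rmin d' r); split; [apply Rmin_pos; auto|]. intros h _ Hh.
  assert (h1 := Rlt_le_trans _ _ _ Hh (Rmin_l _ _)). assert (h2 := Rlt_le_trans _ _ _ Hh (Rmin_r _ _)).
  set (k := (v (y + h)%C - v y)%C).
  assert (Hk : Cmod k < d). { apply V; auto. replace (y + h - y)%C with h by ring; auto. }
  specialize (K k I Hk). replace (v y + k)%C with (v (y + h)%C) in K by (unfold k; ring).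
  rewrite !Hfv in K.
  2: { replace (y - y)%C with (RtoC 0) by ring. rewrite Cmod_0; auto. }
  2: { replace (y + h - y)%C with h by ring; auto. }
  replace (y + h - y - l * k)%C with (h - l * k)%C in K by ring.
  assert (Pk := Cmod_ge_0 k). assert (Ph := Cmod_ge_0 h).
  assert (B : Cmod l / 2 * Cmod k <= Cmod h).
  { assert (T : Cmod (l * k) <= Cmod h + Cmod (h - l * k)).
    { apply Cmod_sub_bound. }
    rewrite Cmod_mult in T. assert (e <= Cmod l / 2) by apply Rmin_l. nra. }
  replace (k - / l * h)%C with (- (/ l * (h - l * k)))%C by (field; auto).
  rewrite Cmod_opp, Cmod_mult, Cmod_inv by auto.
  apply Rmult_le_reg_l with (Cmod l); auto.
  rewrite <- Rmult_assoc, Rinv_r, Rmult_1_l by lra.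
  eapply Rle_trans; [apply K|].
  apply Rle_trans with (eps * Cmod l * Cmod l / 2 * Cmod k). { apply Rmult_le_compat_r; auto. apply Rmin_r. }
  replace (eps * Cmod l * Cmod l / 2 * Cmod k) with ((eps * Cmod l) * (Cmod l / 2 * Cmod k)) by field.
  replace (Cmod l * (eps * Cmod h)) with ((eps * Cmod l) * Cmod h) by ring.
  apply Rmult_le_compat_l; auto. apply Rmult_le_pos; lra.
Qed.

(** The intervals with centres [x n] and radii 2 c / 2^n are nested, and the limit is the supremum
    of their left ends. *)
Lemma real_geometric_limit (x : nat -> R) c :
  (forall n, Rabs (x (S n) - x n) <= c * (1/2)^n) -> exists L, forall n, Rabs (x n - L) <= 2 * c * (1/2)^n.
Proof.
  intros H.
  assert (Hp : forall n, 0 < (1/2)^n) by (intros; apply pow_lt; lra).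
  assert (A : forall n k, x n - 2 * c * (1/2)^n <= x (n + k)%nat - 2 * c * (1/2)^(n+k) /\
     x (n + k)%nat + 2 * c * (1/2)^(n+k) <= x n + 2 * c * (1/2)^n).
  { intros n k. induction k. { rewrite Nat.add_0_r; lra. }
    rewrite Nat.add_succ_r. specialize (H (n + k)%nat). apply Rabs_le_between in H. simpl. lra. }
  assert (C0 : 0 <= c). { specialize (H 0%nat). simpl in H. generalize (Rabs_pos (x 1%nat - x 0%nat)). lra. }
  assert (B : forall n m, x m - 2 * c * (1/2)^m <= x n + 2 * c * (1/2)^n).
  { intros n m. assert (p := Hp n). assert (q := Hp m).
    destruct (Nat.le_ge_cases n m) as [L|L].
    - destruct (A n (m - n)%nat) as [A1 A2]. replace (n + (m - n))%nat with m in * by lia. nra.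
    - destruct (A m (n - m)%nat) as [A1 A2]. replace (m + (n - m))%nat with n in * by lia. nra. }
  destruct (completeness (fun y => exists n, y = x n - 2 * c * (1/2)^n)) as [L [U1 U2]].
  { exists (x 0%nat + 2 * c * (1/2)^0). intros y [n ->]. apply B. }
  { exists (x 0%nat - 2 * c * (1/2)^0), 0%nat; auto. }
  exists L. intros n. apply Rabs_le_between.
  assert (x n - 2 * c * (1/2)^n <= L) by (apply U1; exists n; auto).
  assert (L <= x n + 2 * c * (1/2)^n) by (apply U2; intros y [m ->]; apply B).
  lra.
Qed.

Lemma complex_geometric_limit (x : nat -> C) c :
  (forall n, Cmod (x (S n) - x n) <= c * (1/2)^n) -> exists L, forall n, Cmod (x n - L) <= 4 * c * (1/2)^n.
Proof.
  intros H.
  destruct (real_geometric_limit (fun n => Re (x n)) c) as [L1 H1].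
  { intros n. eapply Rle_trans; [|apply H]. apply Re_lip. }
  destruct (real_geometric_limit (fun n => Im (x n)) c) as [L2 H2].
  { intros n. eapply Rle_trans; [|apply H]. apply Im_lip. }
  exists (L1, L2). intros n. eapply Rle_trans; [apply Cmod_le_sum|]. cre. specialize (H1 n). specialize (H2 n). lra.
Qed.

Lemma convex_lt p q r t : 0 <= t <= 1 -> p < r -> q < r -> (1 - t) * p + t * q < r.
Proof.
  intros Ht Hp Hq. destruct (Req_dec t 0) as [->|N]; [lra|].
  assert (t * q < t * r) by (apply Rmult_lt_compat_l; lra).
  assert ((1 - t) * p <= (1 - t) * r) by (apply Rmult_le_compat_l; lra). lra.
Qed.

(** Newton's iteration with the derivative frozen at [u0]: where [df] differs from [A] by at most
    |A|/2, the map u + (y - f u)/A contracts by the factor 1/2. *)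
Lemma inverse_function (f df : C -> C) u0 r : 0 < r ->
  (forall u, Cmod (u - u0) < r -> cder f u (df u)) -> cont_at (fun _ => True) df u0 -> df u0 <> RtoC 0 ->
  exists rho sigma v, 0 < rho /\ 0 < sigma /\
    (forall y, Cmod (y - f u0) < sigma -> Cmod (v y - u0) < rho /\ f (v y) = y /\ exists m, cder v y m) /\
    (forall u u', Cmod (u - u0) < rho -> Cmod (u' - u0) < rho -> f u = f u' -> u = u') /\ rho <= r.
Proof.
  intros Hr Hd Hc Nz. set (A := df u0) in *. assert (PA := Cmod_pos A Nz).
  destruct (Hc (Cmod A / 2)) as [d [Hd0 Hcd]]; [lra|].
  set (rho := Rmin r d). assert (Hrho : 0 < rho) by (apply Rmin_pos; auto).
  assert (L : forall u u', Cmod (u - u0) < rho -> Cmod (u' - u0) < rho ->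
     Cmod (f u - f u' - A * (u - u')) <= Cmod A / 2 * Cmod (u - u')).
  { intros u u' Hu Hu'.
    replace (f u - f u' - A * (u - u'))%C with ((f u - A * u) - (f u' - A * u'))%C by ring.
    assert (K : forall t, 0 <= t <= 1 -> Cmod (u' + RtoC t * (u - u') - u0) < rho).
    { intros t Ht. replace (u' + RtoC t * (u - u') - u0)%C with (RtoC (1 - t) * (u' - u0) + RtoC t * (u - u0))%C
        by (rewrite RtoC_minus; ring).
      eapply Rle_lt_trans; [apply Cmod_triangle|]. rewrite !Cmod_mult, !Cmod_R.
      rewrite !Rabs_right by lra. apply convex_lt; auto. }
    apply (mean_value_C (fun u => f u - A * u)%C (fun u => df u - A)%C).
    - intros t Ht. apply gder_minus.
      + apply Hd. eapply Rlt_le_trans; [apply K; auto|apply Rmin_l].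
      + eapply gder_eq; [apply gder_scal, gder_id|ring].
    - intros t Ht. apply Rlt_le, Hcd; auto. eapply Rlt_le_trans; [apply K; auto|apply Rmin_r]. }
  assert (LB : forall u u', Cmod (u - u0) < rho -> Cmod (u' - u0) < rho ->
     Cmod A / 2 * Cmod (u - u') <= Cmod (f u - f u')).
  { intros u u' Hu Hu'. specialize (L u u' Hu Hu').
    assert (T : Cmod (A * (u - u')) <= Cmod (f u - f u') + Cmod (f u - f u' - A * (u - u'))).
    { apply Cmod_sub_bound. }
    rewrite Cmod_mult in T. lra. }
  assert (inj : forall u u', Cmod (u - u0) < rho -> Cmod (u' - u0) < rho -> f u = f u' -> u = u').
  { intros u u' Hu Hu' E. specialize (LB u u' Hu Hu'). rewrite E in LB.
    replace (f u' - f u')%C with (RtoC 0) in LB by ring. rewrite Cmod_0 in LB.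
    apply Cminus_eq_0, Cmod_eq_0. assert (Q := Cmod_ge_0 (u - u')). nra. }
  (* The first step of the iteration then has length at most rho/16, so all iterates stay within
     rho/8 of [u0], and their limit within rho/4. *)
  set (sigma := Cmod A * rho / 16). assert (Hs : 0 < sigma) by (unfold sigma; apply Rdiv_lt_0_compat; [apply Rmult_lt_0_compat|]; lra).
  assert (surj : forall y, Cmod (y - f u0) < sigma -> exists u, Cmod (u - u0) < rho /\ f u = y).
  { intros y Hy.
    set (phi := fun u : C => (u + (y - f u) / A)%C).
    assert (ctr : forall u u', Cmod (u - u0) < rho -> Cmod (u' - u0) < rho -> Cmod (phi u - phi u') <= 1/2 * Cmod (u - u')).
    { intros u u' Hu Hu'. specialize (L u u' Hu Hu'). unfold phi.
      replace (u + (y - f u) / A - (u' + (y - f u') / A))%C with (- ((f u - f u' - A * (u - u')) / A))%C by (field; auto).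
      rewrite Cmod_opp, Cmod_div by auto. apply Rmult_le_reg_r with (Cmod A); auto.
      unfold Rdiv at 1. rewrite Rmult_assoc, Rinv_l, Rmult_1_r by lra. lra. }
    set (x := fix x n := match n with O => u0 | S k => phi (x k) end).
    set (c := rho / 16).
    assert (C0 : Cmod (phi u0 - u0) <= c).
    { unfold phi. replace (u0 + (y - f u0) / A - u0)%C with ((y - f u0) / A)%C by ring.
      rewrite Cmod_div by auto. apply Rmult_le_reg_r with (Cmod A); auto.
      unfold Rdiv at 1. rewrite Rmult_assoc, Rinv_l, Rmult_1_r by lra. unfold c. unfold sigma in Hy. lra. }
    assert (Hx : forall n, Cmod (x (S n) - x n) <= c * (1/2)^n /\ Cmod (x n - u0) <= 2 * c * (1 - (1/2)^n)).
    { assert (Hp : forall n, 0 < (1/2)^n) by (intros; apply pow_lt; lra).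
      assert (c0 : 0 < c) by (unfold c; lra).
      induction n.
      - simpl. replace (u0 - u0)%C with (RtoC 0) by ring. rewrite Cmod_0. fold (phi u0). lra.
      - destruct IHn as [I1 I2].
        assert (Q : Cmod (x (S n) - u0) <= 2 * c * (1 - (1/2)^(S n))).
        { replace (x (S n) - u0)%C with ((x (S n) - x n) + (x n - u0))%C by ring.
          eapply Rle_trans; [apply Cmod_triangle|]. simpl pow. lra. }
        split; auto. change (x (S (S n))) with (phi (x (S n))). change (x (S n)) with (phi (x n)) at 2.
        assert (p := Hp n). assert (p' := Hp (S n)).
        eapply Rle_trans; [apply ctr|].
        + eapply Rle_lt_trans; [apply Q|]. unfold c. nra.
        + eapply Rle_lt_trans; [apply I2|]. unfold c. nra.
        + simpl pow. lra. }
    destruct (complex_geometric_limit x c) as [u Hu]. { intros n; apply Hx. }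
    assert (U : Cmod (u - u0) < rho).
    { specialize (Hu 0%nat). simpl in Hu. rewrite Cmod_minus_sym. unfold c in Hu. lra. }
    exists u; split; auto.
    assert (Z : Cmod (phi u - u) = 0).
    { apply Rle_antisym; [|apply Cmod_ge_0]. apply Rnot_lt_le. intros N.
      assert (c0 : 0 < c) by (unfold c; lra).
      destruct (pow_lt_1_zero (1/2)) with (y := Cmod (phi u - u) / (8 * c)) as [n Hn].
      { rewrite Rabs_right; lra. } { apply Rdiv_lt_0_compat; lra. }
      specialize (Hn n (le_n n)). rewrite Rabs_right in Hn by (apply Rle_ge, pow_le; lra).
      assert (T : Cmod (phi u - u) <= Cmod (phi u - phi (x n)) + Cmod (x (S n) - u)).
      { replace (phi u - u)%C with ((phi u - phi (x n)) + (x (S n) - u))%C by (simpl; ring). apply Cmod_triangle. }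
      assert (T1 : Cmod (phi u - phi (x n)) <= 1/2 * Cmod (u - x n)).
      { apply ctr; auto. destruct (Hx n) as [_ I2]. assert (0 < (1/2)^n) by (apply pow_lt; lra).
        eapply Rle_lt_trans; [apply I2|]. unfold c. nra. }
      assert (T2 := Hu n). assert (T3 := Hu (S n)). rewrite Cmod_minus_sym in T2. simpl pow in T3.
      assert (Hn' : (1/2)^n * (8 * c) < Cmod (phi u - u)).
      { apply Rmult_lt_reg_r with (/ (8 * c)); [apply Rinv_0_lt_compat; lra|].
        rewrite Rmult_assoc, Rinv_r, Rmult_1_r by lra. exact Hn. }
      lra. }
    apply Cmod_eq_0 in Z. unfold phi in Z.
    assert (Z2 : ((y - f u) / A)%C = RtoC 0) by (rewrite <- Z; ring).
    symmetry. apply Cminus_eq_0. replace (y - f u)%C with ((y - f u) / A * A)%C by (field; auto). rewrite Z2. ring. }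
  set (v := fun y => epsilon (inhabits (RtoC 0)) (fun u => Cmod (u - u0) < rho /\ f u = y)).
  assert (Hv : forall y, Cmod (y - f u0) < sigma -> Cmod (v y - u0) < rho /\ f (v y) = y).
  { intros y Hy. apply (epsilon_spec (inhabits (RtoC 0)) (fun u => Cmod (u - u0) < rho /\ f u = y)). apply surj; auto. }
  exists rho, sigma, v. repeat split; auto; try (apply Hv; auto; fail).
  2: apply Rmin_l.
  destruct (Hv y H) as [V1 V2]. exists (/ df (v y))%C.
  set (r' := sigma - Cmod (y - f u0)).
  assert (N : forall y', Cmod (y' - y) < r' -> Cmod (y' - f u0) < sigma).
  { intros y' Hy'. replace (y' - f u0)%C with ((y' - y) + (y - f u0))%C by ring.
    eapply Rle_lt_trans; [apply Cmod_triangle|]. unfold r' in Hy'. lra. }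
  apply (cder_inverse f v y _ r'); auto.
  - unfold r'; lra.
  - intros y' Hy'. apply Hv; auto.
  - intros eps He. exists (Rmin r' (eps * (Cmod A / 2))). split.
    { apply Rmin_pos; [unfold r'; lra|]. apply Rmult_lt_0_compat; lra. }
    intros y' _ Hy'. assert (h1 := Rlt_le_trans _ _ _ Hy' (Rmin_l _ _)). assert (h2 := Rlt_le_trans _ _ _ Hy' (Rmin_r _ _)).
    destruct (Hv y' (N y' h1)) as [W1 W2]. specialize (LB _ _ W1 V1). rewrite W2, V2 in LB.
    apply Rmult_lt_reg_l with (Cmod A / 2); lra.
  - apply Hd. eapply Rlt_le_trans; [apply V1|apply Rmin_l].
  - intros E. assert (X : Cmod (df (v y) - A) < Cmod A / 2).
    { apply Hcd; auto. eapply Rlt_le_trans; [apply V1|apply Rmin_r]. }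
    rewrite E in X. replace (RtoC 0 - A)%C with (- A)%C in X by ring. rewrite Cmod_opp in X. lra.
Qed.

(** * Goursat's theorem *)

(** The real part of the integral of f dz over the boundary, oriented counterclockwise. *)
Definition boundary_form (f : C -> C) (a b c d : R) : R :=
  RInt (fun x => Re (f (x, c)) - Re (f (x, d))) a b - RInt (fun y => Im (f (b, y)) - Im (f (a, y))) c d.

Lemma cont_continuous (f : C -> C) (p : R -> C) t L : (forall s, Cmod (p s - p t) <= L * Rabs (s - t)) -> 0 < L ->
  cont_at (fun _ => True) f (p t) -> continuous (fun s => Re (f (p s))) t /\ continuous (fun s => Im (f (p s))) t.
Proof.
  intros Hp HL Hf.
  assert (G : forall g : C -> R, (forall z w, Rabs (g z - g w) <= Cmod (z - w)) -> continuous (fun s => g (f (p s))) t).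
  { intros g Hg. apply continuity_pt_filterlim. intros eps He. destruct (Hf eps He) as [d [Hd F]].
    exists (d / L). split. { apply Rdiv_lt_0_compat; auto. }
    intros s [_ Hs]. simpl in *. unfold R_dist in *.
    eapply Rle_lt_trans; [apply Hg|]. apply F; auto.
    eapply Rle_lt_trans; [apply Hp|]. apply Rmult_lt_reg_r with (/ L); [apply Rinv_0_lt_compat; auto|].
    replace (L * Rabs (s - t) * / L) with (Rabs (s - t)) by (field; lra). exact Hs. }
  split; apply G; [apply Re_lip|apply Im_lip].
Qed.

Lemma cont_horizontal (f : C -> C) x y : cont_at (fun _ => True) f (x, y) ->
  continuous (fun s => Re (f (s, y))) x /\ continuous (fun s => Im (f (s, y))) x.
Proof.
  apply (cont_continuous f (fun s => (s, y)) x 1); [|lra]. intros s.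
  eapply Rle_trans; [apply Cmod_le_sum|]. cre. rewrite Rminus_diag, Rabs_R0. lra.
Qed.
Lemma cont_vertical (f : C -> C) x y : cont_at (fun _ => True) f (x, y) ->
  continuous (fun s => Re (f (x, s))) y /\ continuous (fun s => Im (f (x, s))) y.
Proof.
  apply (cont_continuous f (fun s => (x, s)) y 1); [|lra]. intros s.
  eapply Rle_trans; [apply Cmod_le_sum|]. cre. rewrite Rminus_diag, Rabs_R0. lra.
Qed.

Lemma RInt_near_constant (g : R -> R) a b k M : a <= b -> ex_RInt g a b ->
  (forall x, a < x < b -> Rabs (g x - k) <= M) -> Rabs (RInt g a b - k * (b - a)) <= M * (b - a).
Proof.
  intros Hab Hg Hb.
  assert (U : RInt g a b <= (k + M) * (b - a)).
  { replace ((k + M) * (b - a)) with (RInt (fun _ => k + M) a b) by (rewrite RInt_const; unfold scal; simpl; unfold mult; simpl; ring).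
    apply RInt_le; auto. { apply ex_RInt_const. } intros x Hx. specialize (Hb x Hx). apply Rabs_le_between in Hb. lra. }
  assert (L : (k - M) * (b - a) <= RInt g a b).
  { replace ((k - M) * (b - a)) with (RInt (fun _ => k - M) a b) by (rewrite RInt_const; unfold scal; simpl; unfold mult; simpl; ring).
    apply RInt_le; auto. { apply ex_RInt_const. } intros x Hx. specialize (Hb x Hx). apply Rabs_le_between in Hb. lra. }
  apply Rabs_le_between. lra.
Qed.

Lemma goursat_rectangle (f : C -> C) X1 X2 Y1 Y2 : X1 < X2 -> Y1 < Y2 ->
  (forall z, rect X1 X2 Y1 Y2 z -> exists l, cder f z l) -> boundary_form f X1 X2 Y1 Y2 = 0.
Proof.
  intros HX HY Hf.
  assert (Hc : forall z, rect X1 X2 Y1 Y2 z -> cont_at (fun _ => True) f z).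
  { intros z Hz. destruct (Hf z Hz) as [l Hl]. eapply cder_cont; eauto. }
  assert (I1 : forall a b y, X1 <= a <= X2 -> X1 <= b <= X2 -> Y1 <= y <= Y2 -> ex_RInt (fun x => Re (f (x, y))) a b).
  { intros a b y Ha Hb Hy. apply (ex_RInt_continuous (V:=R_CompleteNormedModule)). intros x Hx. apply cont_horizontal, Hc.
    unfold rect; cbn -[Rmin Rmax]. unfold Rmin, Rmax in Hx. destruct (Rle_dec a b); lra. }
  assert (I2 : forall c d x, Y1 <= c <= Y2 -> Y1 <= d <= Y2 -> X1 <= x <= X2 -> ex_RInt (fun y => Im (f (x, y))) c d).
  { intros c d x Hcc Hd Hx. apply (ex_RInt_continuous (V:=R_CompleteNormedModule)). intros y Hy. apply cont_vertical, Hc.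
    unfold rect; cbn -[Rmin Rmax]. unfold Rmin, Rmax in Hy. destruct (Rle_dec c d); lra. }
  assert (E : forall a b c d, X1 <= a <= X2 -> X1 <= b <= X2 -> Y1 <= c <= Y2 -> Y1 <= d <= Y2 ->
     boundary_form f a b c d = RInt (fun x => Re (f (x, c))) a b - RInt (fun x => Re (f (x, d))) a b
      - (RInt (fun y => Im (f (b, y))) c d - RInt (fun y => Im (f (a, y))) c d)).
  { intros. unfold boundary_form. rewrite !(RInt_minus (V:=R_CompleteNormedModule)); auto. }
  (* On a small rectangle of half perimeter s the linear part of [f] contributes nothing and the
     error is at most 2 eps s^2. As all rectangles of the subdivision are similar, this is eps [k]
     times the area, and the area is additive. *)
  set (k := 2 * ((X2 - X1) + (Y2 - Y1)) ^ 2 / ((X2 - X1) * (Y2 - Y1))).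
  assert (Pk : 0 < k).
  { unfold k. apply Rdiv_lt_0_compat; [|apply Rmult_lt_0_compat; lra].
    apply Rmult_lt_0_compat; [lra|]. apply pow_lt; lra. }
  assert (Main : forall eps, 0 < eps -> Rabs (boundary_form f X1 X2 Y1 Y2) <= eps * k * ((X2 - X1) * (Y2 - Y1))).
  { intros eps He.
    apply (rectangle_bisection (fun a b c d => Rabs (boundary_form f a b c d) <= eps * k * ((b - a) * (d - c)))); auto.
    - intros a m b c d H1 H2 H3 H4 H5 H6 L1 L2.
      replace (boundary_form f a b c d) with (boundary_form f a m c d + boundary_form f m b c d).
      { eapply Rle_trans; [apply Rabs_triang|]. replace (eps * k * ((b - a) * (d - c))) with (eps * k * ((m - a) * (d - c)) + eps * k * ((b - m) * (d - c))) by ring. lra. }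
      rewrite !E by lra.
      rewrite <- (RInt_Chasles (fun x => Re (f (x, c))) a m b), <- (RInt_Chasles (fun x => Re (f (x, d))) a m b)
        by (apply I1; lra).
      unfold plus; simpl. ring.
    - intros a b c m d H1 H2 H3 H4 H5 H6 L1 L2.
      replace (boundary_form f a b c d) with (boundary_form f a b c m + boundary_form f a b m d).
      { eapply Rle_trans; [apply Rabs_triang|]. replace (eps * k * ((b - a) * (d - c))) with (eps * k * ((b - a) * (m - c)) + eps * k * ((b - a) * (d - m))) by ring. lra. }
      rewrite !E by lra.
      rewrite <- (RInt_Chasles (fun y => Im (f (b, y))) c m d), <- (RInt_Chasles (fun y => Im (f (a, y))) c m d)
        by (apply I2; lra).
      unfold plus; simpl. ring.
    - intros x y Hx Hy. destruct (Hf (x, y)) as [l Hl]. { unfold rect; simpl; lra. }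
      destruct (Hl eps He) as [dl [Hdl F]]. exists (dl / 2); split; [lra|].
      intros a b c d H1 H2 H3 H4 H5 H6 H7 H8 Hr.
      set (s := (b - a) + (d - c)).
      assert (B : forall z, rect a b c d z -> Cmod (f z - f (x, y) - l * (z - (x, y))) <= eps * s).
      { intros z Hz. assert (Z : Cmod (z - (x, y)) <= s).
        { eapply Rle_trans; [apply Cmod_le_sum|]. cre. unfold rect in Hz. unfold s.
          apply Rplus_le_compat; apply Rabs_le; lra. }
        specialize (F (z - (x, y))%C I). replace ((x, y) + (z - (x, y)))%C with z in F by ring.
        eapply Rle_trans; [apply F|]. { unfold s in Z. lra. } apply Rmult_le_compat_l; lra. }
      assert (T1 : Rabs (RInt (fun x => Re (f (x, c)) - Re (f (x, d))) a b - Im l * (d - c) * (b - a)) <= 2 * eps * s * (b - a)).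
      { apply RInt_near_constant; [lra| |].
        - apply (ex_RInt_minus (V:=R_NormedModule)); apply I1; lra.
        - intros t Ht.
          assert (B1 := Rle_trans _ _ _ (re_le_Cmod _) (B (t, c) ltac:(unfold rect; simpl; lra))).
          assert (B2 := Rle_trans _ _ _ (re_le_Cmod _) (B (t, d) ltac:(unfold rect; simpl; lra))).
          cre_in B1. cre_in B2. apply Rabs_le_between in B1. apply Rabs_le_between in B2. apply Rabs_le_between. lra. }
      assert (T2 : Rabs (RInt (fun y => Im (f (b, y)) - Im (f (a, y))) c d - Im l * (b - a) * (d - c)) <= 2 * eps * s * (d - c)).
      { apply RInt_near_constant; [lra| |].
        - apply (ex_RInt_minus (V:=R_NormedModule)); apply I2; lra.
        - intros t Ht.
          assert (B1 := Rle_trans _ _ _ (im_le_Cmod _) (B (b, t) ltac:(unfold rect; simpl; lra))).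
          assert (B2 := Rle_trans _ _ _ (im_le_Cmod _) (B (a, t) ltac:(unfold rect; simpl; lra))).
          cre_in B1. cre_in B2. apply Rabs_le_between in B1. apply Rabs_le_between in B2. apply Rabs_le_between. lra. }
      assert (K : eps * k * ((b - a) * (d - c)) = 2 * eps * s * s).
      { assert (Hd : d - c = (b - a) * ((Y2 - Y1) / (X2 - X1))).
        { apply Rmult_eq_reg_r with (X2 - X1); [|lra]. rewrite <- Hr. field. lra. }
        unfold s, k. rewrite Hd. field. lra. }
      rewrite K. unfold boundary_form. apply Rabs_le_between in T1. apply Rabs_le_between in T2. apply Rabs_le_between.
      replace (2 * eps * s * s) with (2 * eps * s * (b - a) + 2 * eps * s * (d - c)) by (unfold s; ring).
      replace (Im l * (b - a) * (d - c)) with (Im l * (d - c) * (b - a)) in T2 by ring. lra. }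
  assert (Z : Rabs (boundary_form f X1 X2 Y1 Y2) = 0).
  { apply Rle_antisym; [|apply Rabs_pos]. apply Rnot_lt_le. intros N.
    set (q := k * ((X2 - X1) * (Y2 - Y1))). assert (Pq : 0 < q) by (unfold q; apply Rmult_lt_0_compat; [auto|apply Rmult_lt_0_compat; lra]).
    specialize (Main (Rabs (boundary_form f X1 X2 Y1 Y2) / (2 * q))).
    rewrite Rmult_assoc in Main. fold q in Main.
    replace (Rabs (boundary_form f X1 X2 Y1 Y2) / (2 * q) * q) with (Rabs (boundary_form f X1 X2 Y1 Y2) / 2) in Main by (field; lra).
    assert (0 < Rabs (boundary_form f X1 X2 Y1 Y2) / (2 * q)) by (apply Rdiv_lt_0_compat; lra). lra. }
  destruct (Req_dec (boundary_form f X1 X2 Y1 Y2) 0) as [|N]; auto. apply Rabs_pos_lt in N. lra.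
Qed.

Ltac rring := match goal with |- @eq _ ?x ?y => change (@eq R x y) end; ring.

(** * The principal square root *)

(** The complement of the cut (-oo, 0], the domain of the principal square root. *)
Definition slit (w : C) : Prop := 0 < Re w \/ Im w <> 0.

(** The vector w + |w| bisects the angle between w and the positive axis; its squared modulus is 2
    |w| (|w| + Re w), so the factor rescales it to length sqrt |w|. *)
Definition csqrt (w : C) : C := ((w + RtoC (Cmod w)) * RtoC (/ sqrt (2 * (Cmod w + Re w))))%C.

Lemma slit_pos w : slit w -> 0 < Cmod w + Re w.
Proof.
  intros [H|H].
  - generalize (Cmod_ge_0 w); lra.
  - assert (Q := Cmod_sqr w). assert (P := Cmod_ge_0 w). assert (0 < Im w ^ 2) by nra. nra.
Qed.

Lemma csqrt_sqr w : slit w -> (csqrt w * csqrt w)%C = w.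
Proof.
  intros H. apply slit_pos in H. unfold csqrt. set (s := sqrt (2 * (Cmod w + Re w))).
  assert (S : s * s = 2 * (Cmod w + Re w)) by (apply sqrt_sqrt; lra).
  assert (Ps : 0 < s) by (apply sqrt_lt_R0; lra).
  assert (E : / s * / s = / (2 * (Cmod w + Re w))). { rewrite <- Rinv_mult, S. reflexivity. }
  assert (Q := Cmod_sqr w).
  apply C_ext; cre.
  - replace ((((Re w + Cmod w) * / s - (Im w + 0) * 0) * ((Re w + Cmod w) * / s - (Im w + 0) * 0) -
      ((Re w + Cmod w) * 0 + (Im w + 0) * / s) * ((Re w + Cmod w) * 0 + (Im w + 0) * / s)))
      with (((Re w + Cmod w)^2 - Im w ^ 2) * (/ s * / s)) by ring.
    rewrite E. replace (Im w ^ 2) with (Cmod w ^ 2 - Re w ^ 2) by lra. field. lra.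
  - match goal with |- ?l = _ => replace l with (2 * (Re w + Cmod w) * Im w * (/ s * / s)) by ring end.
    rewrite E. field. lra.
Qed.

Lemma csqrt_Re_pos w : slit w -> 0 < Re (csqrt w).
Proof.
  intros H. apply slit_pos in H. unfold csqrt. cre.
  assert (0 < / sqrt (2 * (Cmod w + Re w))) by (apply Rinv_0_lt_compat, sqrt_lt_R0; lra).
  nra.
Qed.

Lemma csqrt_neq_0 w : slit w -> csqrt w <> RtoC 0.
Proof. intros H. apply Cneq_Re. rewrite Re_RtoC. apply Rgt_not_eq, csqrt_Re_pos, H. Qed.

Lemma slit_of_sqr r w : (r * r)%C = w -> 0 < Re r -> slit w.
Proof.
  intros <- H. unfold slit. cre. destruct (Req_dec (Im r) 0) as [E|N].
  - left. rewrite E. nra.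
  - right. nra.
Qed.

Lemma csqrt_unique r w : (r * r)%C = w -> 0 < Re r -> csqrt w = r.
Proof.
  intros E H. assert (S := slit_of_sqr r w E H).
  assert (Z : ((csqrt w - r) * (csqrt w + r))%C = RtoC 0).
  { replace ((csqrt w - r) * (csqrt w + r))%C with (csqrt w * csqrt w - r * r)%C by ring.
    rewrite csqrt_sqr, E by auto. ring. }
  destruct (Cmult_integral _ _ Z) as [A|A]. { apply Cminus_eq_0; auto. }
  exfalso. assert (P := csqrt_Re_pos w S). apply (f_equal Re) in A. cre_in A. lra.
Qed.

Lemma slit_conj w : slit w -> slit (Cconj w).
Proof. unfold slit. cre. intros [H|H]; [left|right]; lra. Qed.

Lemma csqrt_conj w : slit w -> csqrt (Cconj w) = Cconj (csqrt w).
Proof.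
  intros S. apply csqrt_unique.
  - rewrite <- Cmult_conj, csqrt_sqr; auto.
  - cre. apply csqrt_Re_pos; auto.
Qed.

Lemma csqrt_Im w : slit w -> Im w = 2 * Re (csqrt w) * Im (csqrt w).
Proof. intros S. rewrite <- (csqrt_sqr w S) at 1. cre. ring. Qed.

Lemma csqrt_Im_neg w : Im w < 0 -> Im (csqrt w) < 0.
Proof.
  intros H. assert (S : slit w) by (right; lra). assert (E := csqrt_Im w S). assert (P := csqrt_Re_pos w S). nra.
Qed.

Lemma csqrt_Re_sqr w : slit w -> Re (csqrt w) ^ 2 = (Cmod w + Re w) / 2.
Proof.
  intros S. assert (E : Cmod (csqrt w) * Cmod (csqrt w) = Cmod w).
  { rewrite <- Cmod_mult, csqrt_sqr; auto. }
  rewrite Cmod_sqr_inv in E.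
  assert (E2 : Re w = Re (csqrt w) ^ 2 - Im (csqrt w) ^ 2).
  { rewrite <- (csqrt_sqr w S) at 1. cre. ring. }
  lra.
Qed.

Lemma csqrt_mod w : slit w -> Cmod (csqrt w) ^ 2 = Cmod w.
Proof. intros S. rewrite <- (csqrt_sqr w S) at 2. rewrite Cmod_mult. ring. Qed.

(** A point -t of the cut has distance at least (Re r)^2 from w = r^2, because t + r^2 is the
    product of r + i sqrt t and r - i sqrt t, both of real part Re r. *)
Lemma slit_near w h m : slit w -> 0 < m <= Re (csqrt w) -> Cmod h < m ^ 2 -> slit (w + h)%C.
Proof.
  intros S Hm Hh. unfold slit. destruct (Rlt_dec 0 (Re (w + h)%C)) as [|NR]; [left; auto|].
  right. intros I0. set (t := - Re (w + h)%C).
  assert (Ht : 0 <= t) by (unfold t; lra).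
  assert (Eh : h = (- (RtoC t + csqrt w * csqrt w))%C).
  { rewrite csqrt_sqr by auto. unfold t. apply C_ext; cre_in I0; cre; lra. }
  set (p := Re (csqrt w)) in *. set (n := Im (csqrt w)).
  assert (Q : Cmod h ^ 2 = (t + (p * p - n * n))^2 + (2 * p * n) ^ 2).
  { rewrite Cmod_sqr, Eh. cre. fold p n. ring. }
  assert (B : m ^ 4 <= Cmod h ^ 2).
  { rewrite Q. assert (m^4 <= p^4) by (apply pow_incr; lra).
    assert (Z : p^4 <= (t + (p * p - n * n))^2 + (2 * p * n) ^ 2).
    { destruct (Rle_dec (n*n) t).
      - assert (0 <= p * p) by nra. nra.
      - assert (0 <= p * p) by nra. nra. }
    lra. }
  assert (P := Cmod_ge_0 h). nra.
Qed.

Lemma csqrt_lip w w' : slit w -> slit w' -> Cmod (csqrt w' - csqrt w) * Re (csqrt w) <= Cmod (w' - w).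
Proof.
  intros S S'.
  replace (Cmod (w' - w)) with (Cmod (csqrt w' - csqrt w) * Cmod (csqrt w' + csqrt w)).
  - apply Rmult_le_compat_l; [apply Cmod_ge_0|].
    eapply Rle_trans; [|apply re_le_Cmod]. eapply Rle_trans; [|apply Rle_abs].
    rewrite Re_plus. generalize (csqrt_Re_pos w' S'). lra.
  - rewrite <- Cmod_mult. f_equal.
    replace ((csqrt w' - csqrt w) * (csqrt w' + csqrt w))%C with (csqrt w' * csqrt w' - csqrt w * csqrt w)%C by ring.
    rewrite !csqrt_sqr; auto.
Qed.

Lemma cder_csqrt w : slit w -> cder csqrt w (/ (RtoC 2 * csqrt w))%C.
Proof.
  intros S. assert (Pm := csqrt_Re_pos w S). set (m := Re (csqrt w)) in *.
  assert (Pm2 : 0 < m ^ 2) by (apply pow_lt; auto).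
  apply (cder_inverse (fun z => z * z)%C csqrt w (RtoC 2 * csqrt w)%C (m ^ 2)); auto.
  - intros y Hy. apply csqrt_sqr. replace y with (w + (y - w))%C by ring.
    apply slit_near with m; auto; try (split; [exact Pm|apply Rle_refl]).
  - intros eps He. exists (Rmin (m^2) (eps * m)). split.
    { apply Rmin_pos; auto. apply Rmult_lt_0_compat; auto. }
    intros y _ Hy. assert (h1 := Rlt_le_trans _ _ _ Hy (Rmin_l _ _)). assert (h2 := Rlt_le_trans _ _ _ Hy (Rmin_r _ _)).
    assert (S' : slit y). { replace y with (w + (y - w))%C by ring. apply slit_near with m; auto; try (split; [exact Pm|apply Rle_refl]). }
    assert (L := csqrt_lip w y S S'). fold m in L. apply Rmult_lt_reg_r with m; lra.
  - eapply gder_eq. { apply gder_mult; apply gder_id. } cbv beta. ring.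
  - apply Cmult_neq_0; [apply Cneq_Re; rewrite !Re_RtoC; lra|]. apply csqrt_neq_0; auto.
Qed.

(** * Complex-valued integrals over a quarter period *)

Definition ccontinuous (f : R -> C) : Prop :=
  forall t, continuous (fun s => Re (f s)) t /\ continuous (fun s => Im (f s)) t.

Definition CI (f : R -> C) : C :=
  (RInt (fun t => Re (f t)) 0 (PI/2), RInt (fun t => Im (f t)) 0 (PI/2)).

Lemma ccontinuous_int f a b : ccontinuous f ->
  ex_RInt (fun t => Re (f t)) a b /\ ex_RInt (fun t => Im (f t)) a b.
Proof.
  intros H. split; apply (ex_RInt_continuous (V:=R_CompleteNormedModule)); intros; apply H.
Qed.

Lemma ccontinuous_of (F : C -> C) : (forall t : R, cont_at (fun z => Im z = 0) F (RtoC t)) ->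
  ccontinuous (fun t => F (RtoC t)).
Proof.
  intros H t.
  assert (A : cont_at (fun _ => True) (fun z => F (RtoC (Re z))) (RtoC t)).
  { intros eps He. destruct (H t eps He) as [d [Hd K]]. exists d; split; auto. intros u _ Hu.
    apply K; [reflexivity|]. rewrite <- RtoC_minus, Cmod_R.
    eapply Rle_lt_trans; [|apply Hu]. apply (Re_lip u (RtoC t)). }
  apply (cont_continuous (fun z => F (RtoC (Re z))) RtoC t 1); auto; [|lra].
  intros s. rewrite <- RtoC_minus, Cmod_R. lra.
Qed.

Lemma CI_lin f g k a b : ccontinuous f -> ccontinuous g -> (forall t, k t = (a * f t + b * g t)%C) ->
  CI k = (a * CI f + b * CI g)%C.
Proof.
  intros Hf Hg E.
  destruct (ccontinuous_int f 0 (PI/2) Hf) as [f1 f2]. destruct (ccontinuous_int g 0 (PI/2) Hg) as [g1 g2].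
  assert (L : forall (p q r s : R -> R) (x y z w : R), ex_RInt p 0 (PI/2) -> ex_RInt q 0 (PI/2) -> ex_RInt r 0 (PI/2) -> ex_RInt s 0 (PI/2) ->
    RInt (fun t => (x * p t + y * q t) + (z * r t + w * s t)) 0 (PI/2) =
    (x * RInt p 0 (PI/2) + y * RInt q 0 (PI/2)) + (z * RInt r 0 (PI/2) + w * RInt s 0 (PI/2))).
  { intros p q r s x y z w Hp Hq Hr Hs.
    assert (S : forall (x : R) (p : R -> R), ex_RInt p 0 (PI/2) -> is_RInt (fun t => x * p t) 0 (PI/2) (x * RInt p 0 (PI/2))).
    { intros x0 p0 H0. apply (is_RInt_scal (V:=R_NormedModule)). apply (RInt_correct (V:=R_CompleteNormedModule)); auto. }
    apply (is_RInt_unique (V:=R_CompleteNormedModule)).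
    apply (is_RInt_plus (V:=R_NormedModule) (fun t => x * p t + y * q t) (fun t => z * r t + w * s t));
      [apply (is_RInt_plus (V:=R_NormedModule) (fun t => x * p t) (fun t => y * q t))
      |apply (is_RInt_plus (V:=R_NormedModule) (fun t => z * r t) (fun t => w * s t))]; auto. }
  apply C_ext; cre; unfold CI; cre.
  - rewrite (RInt_ext _ (fun t => (Re a * Re (f t) + - Im a * Im (f t)) + (Re b * Re (g t) + - Im b * Im (g t)))).
    + rewrite L by auto. ring.
    + intros t _. cbv beta. rewrite E. cre. rring.
  - rewrite (RInt_ext _ (fun t => (Re a * Im (f t) + Im a * Re (f t)) + (Re b * Im (g t) + Im b * Re (g t)))).
    + rewrite L by auto. ring.
    + intros t _. cbv beta. rewrite E. cre. rring.
Qed.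

Lemma ccontinuous_lin f g a b : ccontinuous f -> ccontinuous g -> ccontinuous (fun t => a * f t + b * g t)%C.
Proof.
  intros Hf Hg t. destruct (Hf t) as [f1 f2]. destruct (Hg t) as [g1 g2]. split.
  - apply (continuous_ext (fun s => (Re a * Re (f s) + - Im a * Im (f s)) + (Re b * Re (g s) + - Im b * Im (g s)))).
    { intros x. cre. rring. }
    apply (continuous_plus (V:=R_NormedModule) (fun s => Re a * Re (f s) + - Im a * Im (f s)));
      [apply (continuous_plus (V:=R_NormedModule) (fun s => Re a * Re (f s)))
      |apply (continuous_plus (V:=R_NormedModule) (fun s => Re b * Re (g s)))];
      apply (continuous_scal_r (V:=R_NormedModule)); auto.
  - apply (continuous_ext (fun s => (Re a * Im (f s) + Im a * Re (f s)) + (Re b * Im (g s) + Im b * Re (g s)))).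
    { intros x. cre. rring. }
    apply (continuous_plus (V:=R_NormedModule) (fun s => Re a * Im (f s) + Im a * Re (f s)));
      [apply (continuous_plus (V:=R_NormedModule) (fun s => Re a * Im (f s)))
      |apply (continuous_plus (V:=R_NormedModule) (fun s => Re b * Im (g s)))];
      apply (continuous_scal_r (V:=R_NormedModule)); auto.
Qed.

Lemma ccontinuous_zero : ccontinuous (fun _ => RtoC 0).
Proof. intros t. split; apply continuous_const. Qed.

Lemma CI_scal f k a : ccontinuous f -> (forall t, k t = (a * f t)%C) -> CI k = (a * CI f)%C.
Proof.
  intros Hf E. rewrite (CI_lin f (fun _ => RtoC 0) k a (RtoC 0)); auto.
  - ring.
  - apply ccontinuous_zero.
  - intros; rewrite E; ring.
Qed.

Lemma ccontinuous_ext f g : (forall t, f t = g t) -> ccontinuous f -> ccontinuous g.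
Proof.
  intros E H t. destruct (H t) as [A B]. split.
  - apply (continuous_ext (fun s => Re (f s))); auto. intros; rewrite E; auto.
  - apply (continuous_ext (fun s => Im (f s))); auto. intros; rewrite E; auto.
Qed.

Lemma CI_ext f g : (forall t, f t = g t) -> CI f = CI g.
Proof.
  intros E. unfold CI. f_equal; apply RInt_ext; intros; rewrite E; auto.
Qed.

(** The factor is [PI] instead of [PI/2] because real and imaginary parts are estimated
    separately. *)
Lemma CI_bound f B : ccontinuous f -> (forall t, 0 < t < PI/2 -> Cmod (f t) <= B) -> Cmod (CI f) <= PI * B.
Proof.
  intros Hf HB. destruct (ccontinuous_int f 0 (PI/2) Hf) as [f1 f2].
  assert (Pp := PI_RGT_0).
  assert (A : forall g : R -> R, ex_RInt g 0 (PI/2) -> (forall t, 0 < t < PI/2 -> Rabs (g t) <= B) -> Rabs (RInt g 0 (PI/2)) <= B * (PI/2)).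
  { intros g Hg Hb. generalize (RInt_near_constant g 0 (PI/2) 0 B). rewrite Rmult_0_l, !Rminus_0_r.
    intros X. apply X; auto; [lra|]. intros. rewrite Rminus_0_r. auto. }
  eapply Rle_trans; [apply Cmod_le_sum|]. unfold CI. cre.
  assert (A1 : Rabs (RInt (fun t => Re (f t)) 0 (PI/2)) <= B * (PI/2)).
  { apply A; auto. intros t Ht. eapply Rle_trans; [apply re_le_Cmod|auto]. }
  assert (A2 : Rabs (RInt (fun t => Im (f t)) 0 (PI/2)) <= B * (PI/2)).
  { apply A; auto. intros t Ht. eapply Rle_trans; [apply im_le_Cmod|auto]. }
  lra.
Qed.

Lemma RInt_pos_cont (g : R -> R) : (forall t, continuous g t) -> (forall t, 0 < t < PI/2 -> 0 < g t) -> 0 < RInt g 0 (PI/2).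
Proof. intros. assert (Pp := PI_RGT_0). apply RInt_gt_0; auto. lra. Qed.

Lemma CI_Re_pos f : ccontinuous f -> (forall t, 0 < t < PI/2 -> 0 < Re (f t)) -> 0 < Re (CI f).
Proof. intros Hf H. apply RInt_pos_cont; auto. intros; apply Hf. Qed.
Lemma CI_Im_pos f : ccontinuous f -> (forall t, 0 < t < PI/2 -> 0 < Im (f t)) -> 0 < Im (CI f).
Proof. intros Hf H. apply RInt_pos_cont; auto. intros; apply Hf. Qed.

Lemma CI_conj f : ccontinuous f -> CI (fun t => Cconj (f t)) = Cconj (CI f).
Proof.
  intros Hf. unfold CI, Cconj. f_equal. simpl.
  destruct (ccontinuous_int f 0 (PI/2) Hf) as [f1 f2].
  rewrite <- (RInt_opp (V:=R_CompleteNormedModule)); auto.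
Qed.

Lemma CI_swap f : ccontinuous f -> CI (fun t => f (PI/2 - t)) = CI f.
Proof.
  intros Hf. destruct (ccontinuous_int f 0 (PI/2) Hf) as [f1 f2].
  assert (A : forall g : R -> R, ex_RInt g 0 (PI/2) -> RInt (fun t => g (PI/2 - t)) 0 (PI/2) = RInt g 0 (PI/2)).
  { intros g Hg. 
    assert (X : is_RInt (fun t => scal (-1) (g (-1 * t + PI/2))) 0 (PI/2) (RInt g (PI/2) 0)).
    { apply (is_RInt_comp_lin (V:=R_NormedModule) g (-1) (PI/2) 0 (PI/2)).
      replace (-1 * 0 + PI/2) with (PI/2) by ring. replace (-1 * (PI/2) + PI/2) with 0 by ring.
      apply (RInt_correct (V:=R_CompleteNormedModule)). apply ex_RInt_swap; auto. }
    apply (is_RInt_scal (V:=R_NormedModule)) with (k := -1) in X.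
    apply (is_RInt_unique (V:=R_CompleteNormedModule)).
    rewrite <- (opp_RInt_swap (V:=R_CompleteNormedModule)) in X by auto.
    replace (RInt g 0 (PI/2)) with (scal (-1) (opp (RInt g 0 (PI/2)))).
    - refine (is_RInt_ext _ _ _ _ _ _ X). intros x _. unfold scal; simpl; unfold mult; simpl.
      replace (-1 * x + PI/2) with (PI/2 - x) by ring. ring.
    - unfold scal, opp; simpl; unfold mult; simpl. ring. }
  unfold CI. f_equal; [apply (A (fun t => Re (f t)))|apply (A (fun t => Im (f t)))]; auto.
Qed.

Lemma CI_derivative (F dF : C -> C) : (forall t : R, rder F (RtoC t) (dF (RtoC t))) ->
  ccontinuous (fun t => dF (RtoC t)) -> CI (fun t => dF (RtoC t)) = (F (RtoC (PI/2)) - F (RtoC 0))%C.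
Proof.
  intros H Hc. apply C_ext; unfold CI; cre.
  - apply (is_RInt_unique (V:=R_CompleteNormedModule)). 
    apply (is_RInt_derive (V:=R_CompleteNormedModule) (fun t => Re (F (RtoC t)))).
    + intros. apply rder_Re; auto.
    + intros. apply Hc.
  - apply (is_RInt_unique (V:=R_CompleteNormedModule)). 
    apply (is_RInt_derive (V:=R_CompleteNormedModule) (fun t => Im (F (RtoC t)))).
    + intros. apply rder_Im; auto.
    + intros. apply Hc.
Qed.

(** * Complete elliptic integrals and their derivatives *)

Definition rr (u : C) (t : R) : C := csqrt (RtoC 1 - u * RtoC (sin t ^ 2))%C.

(* [slit (1 - u)] says that [u] is outside the cut [1,+oo) of the elliptic integrals. *)
Lemma slit_line u s : slit (RtoC 1 - u)%C -> 0 <= s <= 1 -> slit (RtoC 1 - u * RtoC s)%C.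
Proof.
  unfold slit. cre. intros H Hs. destruct (Req_dec (Im u) 0) as [E|N].
  - left. rewrite E. destruct H as [H|H]; [|lra]. destruct (Rle_dec (Re u) 0); nra.
  - destruct (Req_dec s 0) as [->|Ns]; [left; lra|]. right.
    replace (0 - (Re u * 0 + Im u * s)) with (- (Im u * s)) by ring.
    apply Ropp_neq_0_compat, Rmult_integral_contrapositive; auto.
Qed.

Lemma sin2_range t : 0 <= sin t ^ 2 <= 1.
Proof. generalize (SIN_bound t). intros. split; nra. Qed.

Lemma slit_rr u t : slit (RtoC 1 - u)%C -> slit (RtoC 1 - u * RtoC (sin t ^ 2))%C.
Proof. intros. apply slit_line; auto. apply sin2_range. Qed.

Lemma rr_sqr u t : slit (RtoC 1 - u)%C -> (rr u t * rr u t)%C = (RtoC 1 - u * RtoC (sin t ^ 2))%C.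
Proof. intros. apply csqrt_sqr, slit_rr; auto. Qed.

Lemma rr_neq_0 u t : slit (RtoC 1 - u)%C -> rr u t <> RtoC 0.
Proof. intros. apply csqrt_neq_0, slit_rr; auto. Qed.

Lemma cont_at_realpart (D : C -> Prop) (f : R -> R) z : continuity f -> cont_at D (fun z => RtoC (f (Re z))) z.
Proof.
  intros H. apply (cont_at_real D Re f); auto. apply (cont_at_Re D (fun u => u)). apply cont_at_id.
Qed.

Lemma continuity_sin2 : continuity (fun t => sin t ^ 2).
Proof. reg. Qed.
Lemma continuity_cos2 : continuity (fun t => cos t ^ 2).
Proof. reg. Qed.
Lemma continuity_one : continuity (fun _ => 1).
Proof. reg. Qed.

Lemma integrand_continuous (c : R -> R) (h : C -> C) u : continuity c -> slit (RtoC 1 - u)%C ->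
  (forall z, z <> RtoC 0 -> exists l, cder h z l) -> ccontinuous (fun t => RtoC (c t) * h (rr u t))%C.
Proof.
  intros Hc Hu Hh.
  apply (ccontinuous_of (fun z => RtoC (c (Re z)) * h (rr u (Re z)))%C).
  intros t. apply cont_at_mult.
  - apply cont_at_realpart; auto.
  - destruct (Hh (rr u t) (rr_neq_0 u t Hu)) as [l Hl].
    apply (cont_at_cder _ (fun z => rr u (Re z)) h _ l); [|exact Hl].
    unfold rr. apply (cont_at_cder _ (fun z => RtoC 1 - u * RtoC (sin (Re z) ^ 2))%C csqrt) with (l := (/ (RtoC 2 * rr u t))%C).
    + apply cont_at_minus; [apply cont_at_const|]. apply cont_at_mult; [apply cont_at_const|].
      apply (cont_at_realpart _ (fun t => sin t ^ 2)). apply continuity_sin2.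
    + apply cder_csqrt. apply slit_rr; auto.
Qed.

Lemma cder_inv_ex z : z <> RtoC 0 -> exists l, cder (fun w => / w)%C z l.
Proof. intros H. eexists; apply cder_inv; auto. Qed.
Lemma cder_inv3_ex z : z <> RtoC 0 -> exists l, cder (fun w => / (w * w * w))%C z l.
Proof.
  intros H. eexists. apply (gder_inv _ (fun w => w * w * w)%C).
  - repeat apply Cmult_neq_0; auto.
  - apply gder_mult; [apply gder_mult|]; apply gder_id.
Qed.

(** sin^2 t runs over the compact interval [0, 1], where a positive minimum is attained. This is the
    uniform bound behind differentiation under the integral sign. *)
Lemma rr_lower_bound u : slit (RtoC 1 - u)%C -> exists m, 0 < m /\ forall t, m <= Re (rr u t).
Proof.
  intros Hu.
  assert (HC : forall s, 0 <= s <= 1 -> continuity_pt (fun s => Re (csqrt (RtoC 1 - u * RtoC s)%C)) s).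
  { intros s Hs. apply continuity_pt_filterlim.
    apply (ex_derive_continuous (fun s => Re (csqrt (RtoC 1 - u * RtoC s)%C))). eexists.
    apply (rder_Re (fun z => csqrt (RtoC 1 - u * z)%C)).
    apply (gder_comp _ (fun z => RtoC 1 - u * z)%C csqrt).
    - apply gder_minus; [apply gder_const|]. apply gder_scal, gder_id.
    - apply cder_csqrt, slit_line; auto. }
  destruct (continuity_ab_min _ 0 1 Rle_0_1 HC) as [s [Hmin Hs]].
  exists (Re (csqrt (RtoC 1 - u * RtoC s)%C)). split.
  - apply csqrt_Re_pos, slit_line; auto.
  - intros t. apply (Hmin (sin t ^ 2)), sin2_range.
Qed.

(** The weight [c] lets one differentiation under the integral sign serve both [K] and [V]. *)
Definition KI (c : R -> R) (u : C) : C := CI (fun t => RtoC (c t) * / rr u t)%C.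

(** With r, r' the radicals at u and u + h and dl = r' - r, the second order remainder of 1/r is
    dl^2 (3 r + dl) / (2 r^3 r'). As |dl| is at most |h|/m, it is bounded by [B] |h|^2 uniformly in
    t. *)
Lemma cder_KI c u : continuity c -> (forall t, Rabs (c t) <= 1) -> slit (RtoC 1 - u)%C ->
  cder (KI c) u (CI (fun t => RtoC (c t * (sin t ^ 2 / 2)) * / (rr u t * rr u t * rr u t))%C).
Proof.
  intros Hc Hb Hu. destruct (rr_lower_bound u Hu) as [m [Hm Lm]].
  assert (Hm2 : 0 < m ^ 2) by (apply pow_lt; auto).
  set (B := (3 * (1 + Cmod u) + m / 2 + 1) / (m ^ 2 * (m ^ 3 * m))).
  assert (PB : 0 < B). { apply Rdiv_lt_0_compat. { generalize (Cmod_ge_0 u); lra. } assert (0 < m ^ 3) by (apply pow_lt; auto). apply Rmult_lt_0_compat; auto. apply Rmult_lt_0_compat; auto. }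
  assert (Pp := PI_RGT_0).
  intros eps He. exists (Rmin (m ^ 2 / 2) (eps / (PI * B))). split.
  { apply Rmin_pos; [lra|]. apply Rdiv_lt_0_compat; auto. apply Rmult_lt_0_compat; auto. }
  intros h _ Hh. assert (h1 := Rlt_le_trans _ _ _ Hh (Rmin_l _ _)). assert (h2 := Rlt_le_trans _ _ _ Hh (Rmin_r _ _)).
  assert (Hb1 : forall t, Cmod (h * RtoC (sin t ^ 2)) <= Cmod h).
  { intros t. rewrite Cmod_mult, Cmod_R. generalize (sin2_range t) (Cmod_ge_0 h). intros.
    rewrite Rabs_right by lra. nra. }
  assert (Hs : forall t, slit (RtoC 1 - (u + h) * RtoC (sin t ^ 2))%C).
  { intros t. replace (RtoC 1 - (u + h) * RtoC (sin t ^ 2))%C with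
      ((RtoC 1 - u * RtoC (sin t ^ 2)) + - (h * RtoC (sin t ^ 2)))%C by ring.
    apply slit_near with m; [apply slit_rr; auto|split; [auto|apply Lm]|].
    rewrite Cmod_opp. specialize (Hb1 t). lra. }
  assert (Hu' : slit (RtoC 1 - (u + h))%C).
  { specialize (Hs (PI/2)). rewrite sin_PI2 in Hs. replace (RtoC (1^2)) with (RtoC 1) in Hs by (f_equal; ring).
    replace ((u + h) * RtoC 1)%C with (u + h)%C in Hs by ring. exact Hs. }
  assert (c1 := integrand_continuous c (fun w => / w)%C u Hc Hu cder_inv_ex).
  assert (c2 := integrand_continuous c (fun w => / w)%C (u + h)%C Hc Hu' cder_inv_ex).
  assert (Hc3 : continuity (fun t => c t * (sin t ^ 2 / 2))).
  { apply (continuity_mult c); auto. reg. }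
  assert (c3 := integrand_continuous (fun t => c t * (sin t ^ 2 / 2)) (fun w => / (w * w * w))%C u Hc3 Hu cder_inv3_ex).
  set (f1 := fun t => (RtoC (c t) * / rr u t)%C) in *.
  set (f2 := fun t => (RtoC (c t) * / rr (u + h) t)%C) in *.
  set (f3 := fun t => (RtoC (c t * (sin t ^ 2 / 2)) * / (rr u t * rr u t * rr u t))%C) in *.
  unfold KI. fold f1 f2.
  set (g := fun t => (RtoC 1 * f2 t + - RtoC 1 * f1 t)%C).
  set (k := fun t => (RtoC 1 * g t + - h * f3 t)%C).
  assert (cg : ccontinuous g) by (apply ccontinuous_lin; auto).
  assert (E1 : CI g = (RtoC 1 * CI f2 + - RtoC 1 * CI f1)%C) by (apply CI_lin; auto).
  assert (E2 : CI k = (RtoC 1 * CI g + - h * CI f3)%C) by (apply CI_lin; auto).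
  replace (CI f2 - CI f1 - CI f3 * h)%C with (CI k) by (rewrite E2, E1; ring).
  assert (ck : ccontinuous k) by (apply ccontinuous_lin; auto).
  assert (Bk : Cmod (CI k) <= PI * (B * (Cmod h * Cmod h))).
  { apply CI_bound; auto. intros t _.
    set (r := rr u t). set (r' := rr (u + h) t). set (dl := (r' - r)%C). set (s := RtoC (sin t ^ 2)).
    assert (N : r <> RtoC 0) by (apply rr_neq_0; auto). assert (N' : r' <> RtoC 0) by (apply rr_neq_0; auto).
    assert (R1 : (r * r)%C = (RtoC 1 - u * s)%C) by (apply rr_sqr; auto).
    assert (R2 : (r' * r')%C = (RtoC 1 - (u + h) * s)%C) by (apply rr_sqr; auto).
    assert (R3 : (h * s)%C = (- (dl * (RtoC 2 * r + dl)))%C).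
    { replace (dl * (RtoC 2 * r + dl))%C with (r' * r' - r * r)%C by (unfold dl; ring). rewrite R1, R2. ring. }
    assert (Lr : m <= Re r) by apply Lm.
    assert (Mr : m <= Cmod r) by (generalize (re_le_Cmod r) (Rle_abs (Re r)); lra).
    assert (Dl : Cmod dl * m <= Cmod h).
    { apply Rle_trans with (Cmod dl * Re r). { apply Rmult_le_compat_l; auto. apply Cmod_ge_0. }
      eapply Rle_trans; [apply (csqrt_lip _ _ (slit_rr u t Hu) (Hs t))|].
      replace (RtoC 1 - (u + h) * RtoC (sin t ^ 2) - (RtoC 1 - u * RtoC (sin t ^ 2)))%C with (- (h * RtoC (sin t ^ 2)))%C by ring.
      rewrite Cmod_opp. apply Hb1. }
    assert (Dm : Cmod dl <= m / 2).
    { apply Rmult_le_reg_r with m; auto. apply Rle_trans with (m ^ 2 / 2); [lra|]. right; field. }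
    assert (Mr' : m / 2 <= Cmod r').
    { assert (X := Cmod_sub_bound r' r). fold dl in X. lra. }
    assert (Ur : Cmod r <= 1 + Cmod u).
    { assert (X : Cmod r * Cmod r <= 1 + Cmod u).
      { rewrite <- Cmod_mult, R1. eapply Rle_trans; [apply Cmod_minus_le|]. rewrite Cmod_1, Cmod_mult. unfold s. rewrite Cmod_R.
        generalize (sin2_range t) (Cmod_ge_0 u). intros. rewrite Rabs_right by lra. nra. }
      generalize (Cmod_ge_0 u). nra. }
    assert (Ek : k t = (RtoC (c t) * (dl * dl * (RtoC 3 * r + dl) * / (RtoC 2 * r * r * r * r')))%C).
    { unfold k, g, f1, f2, f3. fold r r'. rewrite RtoC_mult.
      replace (RtoC (sin t ^ 2 / 2)) with (s / RtoC 2)%C.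
      2: { unfold s, Rdiv. rewrite RtoC_mult, RtoC_inv by lra. reflexivity. }
      replace (RtoC 1 * (RtoC 1 * (RtoC (c t) * / r') + - RtoC 1 * (RtoC (c t) * / r)) + - h * (RtoC (c t) * (s / RtoC 2) * / (r * r * r)))%C
        with (RtoC (c t) * (/ r' - / r) - RtoC (c t) * (h * s) / (RtoC 2 * (r * r * r)))%C.
      - rewrite R3. assert (Er : r' = (r + dl)%C) by (unfold dl; ring). rewrite Er in *. field.
        split; [|auto]. exact N'.
      - field. auto. }
    rewrite Ek. rewrite !Cmod_mult, !Cmod_R, Cmod_inv.
    2: { repeat (apply Cmult_neq_0; [|assumption]). apply Cneq_Re; cre; lra. }
    rewrite !Cmod_mult, Cmod_R, (Rabs_right 2) by lra.
    assert (P0 := Cmod_ge_0 dl).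
    assert (Q1 : Cmod (RtoC 3 * r + dl) <= 3 * (1 + Cmod u) + m / 2 + 1).
    { eapply Rle_trans; [apply Cmod_triangle|]. rewrite Cmod_mult, Cmod_R, Rabs_right by lra. lra. }
    assert (P3 : 0 < m ^ 3) by (apply pow_lt; auto).
    assert (Q2 : m ^ 3 * m <= 2 * Cmod r * Cmod r * Cmod r * Cmod r').
    { replace (2 * Cmod r * Cmod r * Cmod r * Cmod r') with ((Cmod r) ^ 3 * (2 * Cmod r')) by ring.
      apply Rmult_le_compat; try lra. apply pow_incr; lra. }
    assert (Q3 : Cmod dl * Cmod dl <= Cmod h * Cmod h / m ^ 2).
    { apply Rmult_le_reg_r with (m ^ 2); auto. replace (Cmod h * Cmod h / m ^ 2 * m ^ 2) with (Cmod h * Cmod h) by (field; lra).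
      replace (Cmod dl * Cmod dl * m ^ 2) with ((Cmod dl * m) * (Cmod dl * m)) by ring.
      apply Rmult_le_compat; auto; apply Rmult_le_pos; lra. }
    apply Rle_trans with (1 * (Cmod dl * Cmod dl * Cmod (RtoC 3 * r + dl) * / (2 * Cmod r * Cmod r * Cmod r * Cmod r'))).
    { apply Rmult_le_compat_r; auto. apply Rmult_le_pos.
      - repeat apply Rmult_le_pos; auto; apply Cmod_ge_0.
      - apply Rlt_le, Rinv_0_lt_compat. eapply Rlt_le_trans; [|apply Q2]. apply Rmult_lt_0_compat; auto. }
    rewrite Rmult_1_l.
    apply Rle_trans with (Cmod h * Cmod h / m ^ 2 * (3 * (1 + Cmod u) + m / 2 + 1) * / (m ^ 3 * m)).
    { apply Rmult_le_compat.
      - repeat apply Rmult_le_pos; auto; apply Cmod_ge_0.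
      - apply Rlt_le, Rinv_0_lt_compat. eapply Rlt_le_trans; [|apply Q2]. apply Rmult_lt_0_compat; auto.
      - apply Rmult_le_compat; auto; try apply Cmod_ge_0. apply Rmult_le_pos; auto.
      - apply Rinv_le_contravar; auto. apply Rmult_lt_0_compat; auto. }
    right. unfold B. field. lra. }
  eapply Rle_trans; [apply Bk|].
  assert (Ph := Cmod_ge_0 h).
  replace (PI * (B * (Cmod h * Cmod h))) with ((Cmod h * (PI * B)) * Cmod h) by ring.
  apply Rmult_le_compat_r; auto.
  assert (0 < PI * B) by (apply Rmult_lt_0_compat; auto).
  apply Rmult_le_reg_r with (/ (PI * B)); [apply Rinv_0_lt_compat; auto|].
  rewrite Rmult_assoc, Rinv_r, Rmult_1_r by lra. apply Rlt_le, h2.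
Qed.

Lemma rder_real (f : R -> R) t l : derivable_pt_lim f t l -> rder (fun z => RtoC (f (Re z))) (RtoC t) (RtoC l).
Proof.
  intros H eps He. destruct (H eps He) as [d F]. exists d; split; [apply cond_pos|].
  intros h Hh Hd. assert (E : h = RtoC (Re h)) by (apply C_ext; cre; auto).
  rewrite E in *. rewrite <- RtoC_plus, !Re_RtoC, <- !RtoC_minus, <- RtoC_mult, <- RtoC_minus, !Cmod_R in *.
  destruct (Req_dec (Re h) 0) as [Z|N].
  - rewrite Z, Rplus_0_r, Rmult_0_r, !Rminus_diag, Rabs_R0. lra.
  - specialize (F (Re h) N Hd).
    replace (f (t + Re h) - f t - l * Re h) with (((f (t + Re h) - f t) / Re h - l) * Re h) by (field; auto).
    rewrite Rabs_mult. apply Rmult_le_compat_r; [apply Rabs_pos|lra].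
Qed.

Lemma rder_rr u t : slit (RtoC 1 - u)%C ->
  rder (fun z => rr u (Re z)) (RtoC t) (- (u * RtoC (sin t * cos t)) / rr u t)%C.
Proof.
  intros Hu. unfold rr at 1. eapply gder_eq.
  { apply (gder_comp _ (fun z => RtoC 1 - u * RtoC (sin (Re z) ^ 2))%C csqrt).
    - apply gder_minus; [apply gder_const|]. apply gder_scal.
      apply (rder_real (fun t => sin t ^ 2) t (2 * (sin t * cos t))).
      apply is_derive_Reals. auto_derive; auto. ring.
    - apply cder_csqrt. apply slit_rr; auto. }
  cbv beta. fold (rr u t). rewrite Re_RtoC. fold (rr u t).
  assert (N := rr_neq_0 u t Hu). rewrite !RtoC_mult. field. auto.
Qed.

Definition K (u : C) : C := KI (fun _ => 1) u.
(** Classically V = (E - (1 - u) K) / u with E the complete integral of the second kind. Its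
    advantage is that its integrand has positive real part. *)
Definition V (u : C) : C := KI (fun t => cos t ^ 2) u.

Lemma K_integrand u : slit (RtoC 1 - u)%C -> ccontinuous (fun t => RtoC 1 * / rr u t)%C.
Proof.
  intros H. apply (integrand_continuous (fun _ => 1) (fun w => / w)%C); auto.
  - apply continuity_one.
  - apply cder_inv_ex.
Qed.
Lemma V_integrand u : slit (RtoC 1 - u)%C -> ccontinuous (fun t => RtoC (cos t ^ 2) * / rr u t)%C.
Proof.
  intros H. apply (integrand_continuous (fun t => cos t ^ 2) (fun w => / w)%C); auto.
  - apply continuity_cos2.
  - apply cder_inv_ex.
Qed.

(* d/dt (sin t cos t / r) vanishes in the mean; the two derivative formulas below are combinations of it. *)
Lemma exact_integral u : slit (RtoC 1 - u)%C ->
  CI (fun t => RtoC (cos t ^ 2 - sin t ^ 2) * / rr u t +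
     u * (RtoC (cos t ^ 2 * sin t ^ 2) * / (rr u t * rr u t * rr u t)))%C = RtoC 0.
Proof.
  intros Hu.
  set (F := fun z : C => (RtoC (sin (Re z) * cos (Re z)) * / rr u (Re z))%C).
  set (dF := fun z : C => (RtoC (cos (Re z) ^ 2 - sin (Re z) ^ 2) * / rr u (Re z) +
     u * (RtoC (cos (Re z) ^ 2 * sin (Re z) ^ 2) * / (rr u (Re z) * rr u (Re z) * rr u (Re z))))%C).
  assert (C1 : continuity (fun t => cos t ^ 2 - sin t ^ 2)) by reg.
  assert (C2 : continuity (fun t => cos t ^ 2 * sin t ^ 2)) by reg.
  assert (c1 := integrand_continuous _ (fun w => / w)%C u C1 Hu cder_inv_ex).
  assert (c2 := integrand_continuous _ (fun w => / (w * w * w))%C u C2 Hu cder_inv3_ex).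
  transitivity (F (RtoC (PI/2)) - F (RtoC 0))%C.
  - apply (CI_derivative F dF).
    + intros t. unfold F, dF. eapply gder_eq.
      { apply gder_mult.
        - apply (rder_real (fun t => sin t * cos t) t (cos t ^ 2 - sin t ^ 2)). apply is_derive_Reals.
          auto_derive; auto. ring.
        - apply gder_inv; [|apply rder_rr; auto]. apply rr_neq_0; auto. }
      cbv beta. rewrite !Re_RtoC. assert (N := rr_neq_0 u t Hu).
      replace (cos t ^ 2 * sin t ^ 2) with ((sin t * cos t) * (sin t * cos t)) by ring.
      rewrite (RtoC_mult (sin t * cos t) (sin t * cos t)). field. auto.
    + apply (ccontinuous_ext (fun t => RtoC 1 * (RtoC (cos t ^ 2 - sin t ^ 2) * / rr u t) +
         u * (RtoC (cos t ^ 2 * sin t ^ 2) * / (rr u t * rr u t * rr u t)))%C).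
      * intros t. unfold dF. rewrite !Re_RtoC. ring.
      * apply ccontinuous_lin; auto.
  - unfold F. rewrite !Re_RtoC, cos_PI2, sin_0, Rmult_0_r, Rmult_0_l. ring.
Qed.

Lemma cos2_sin2 t : RtoC (cos t ^ 2) = (RtoC 1 - RtoC (sin t ^ 2))%C.
Proof.
  rewrite <- RtoC_minus. f_equal. generalize (sin2_cos2 t). unfold Rsqr. lra.
Qed.

Lemma cder_K u : slit (RtoC 1 - u)%C -> cder K u (V u / (RtoC 2 * (RtoC 1 - u)))%C.
Proof.
  intros Hu. eapply gder_eq.
  { apply (cder_KI (fun _ => 1)); auto. { apply continuity_one. } intros; rewrite Rabs_R1; lra. }
  assert (N1 : (RtoC 1 - u)%C <> RtoC 0).
  { intros E. rewrite E in Hu. destruct Hu as [A|A]; simpl in A; lra. }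
  assert (C2 : continuity (fun t => 1 * (sin t ^ 2 / 2))) by reg.
  assert (C3 : continuity (fun t => cos t ^ 2 - sin t ^ 2)) by reg.
  assert (C4 : continuity (fun t => cos t ^ 2 * sin t ^ 2)) by reg.
  assert (c2 := integrand_continuous _ (fun w => / (w * w * w))%C u C2 Hu cder_inv3_ex).
  assert (c3 := V_integrand u Hu).
  set (f := fun t => (RtoC (1 * (sin t ^ 2 / 2)) * / (rr u t * rr u t * rr u t))%C) in *.
  assert (E : (RtoC 2 * (RtoC 1 - u) * CI f + - RtoC 1 * V u)%C = (- CI (fun t => RtoC (cos t ^ 2 - sin t ^ 2) * / rr u t +
     u * (RtoC (cos t ^ 2 * sin t ^ 2) * / (rr u t * rr u t * rr u t))))%C).
  { unfold V, KI. rewrite <- (CI_lin f (fun t => RtoC (cos t ^ 2) * / rr u t)%C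
      (fun t => RtoC 2 * (RtoC 1 - u) * f t + - RtoC 1 * (RtoC (cos t ^ 2) * / rr u t))%C); auto.
    replace (CI (fun t => RtoC 2 * (RtoC 1 - u) * f t + - RtoC 1 * (RtoC (cos t ^ 2) * / rr u t)))%C
      with (CI (fun t => - RtoC 1 * (RtoC (cos t ^ 2 - sin t ^ 2) * / rr u t +
     u * (RtoC (cos t ^ 2 * sin t ^ 2) * / (rr u t * rr u t * rr u t))))%C).
    - rewrite (CI_scal (fun t => RtoC (cos t ^ 2 - sin t ^ 2) * / rr u t +
     u * (RtoC (cos t ^ 2 * sin t ^ 2) * / (rr u t * rr u t * rr u t)))%C _ (- RtoC 1)%C); auto.
      + ring.
      + apply (ccontinuous_ext (fun t => RtoC 1 * (RtoC (cos t ^ 2) * / rr u t) + - RtoC 2 * (RtoC 1 - u) * f t)%C).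
        * intros t. unfold f. assert (N := rr_neq_0 u t Hu). assert (S := rr_sqr u t Hu).
          rewrite RtoC_minus, !RtoC_mult, cos2_sin2. unfold Rdiv. rewrite RtoC_mult, RtoC_inv by lra.
          apply Cminus_eq_0. 
          match goal with |- ?l = _ => replace l with
            (((RtoC (sin t ^ 2) * (rr u t * rr u t)) - RtoC (sin t ^ 2) * (RtoC 1 - u * RtoC (sin t ^ 2)))
              / (rr u t * rr u t * rr u t))%C by (field; auto) end.
          rewrite S. unfold Cdiv. ring.
        * apply ccontinuous_lin; auto.
    - apply CI_ext. intros t. unfold f. assert (N := rr_neq_0 u t Hu). assert (S := rr_sqr u t Hu).
      rewrite RtoC_minus, !RtoC_mult, cos2_sin2. unfold Rdiv. rewrite RtoC_mult, RtoC_inv by lra.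
      apply Cminus_eq_0.
      match goal with |- ?l = _ => replace l with
            (((RtoC (sin t ^ 2) * (rr u t * rr u t)) - RtoC (sin t ^ 2) * (RtoC 1 - u * RtoC (sin t ^ 2)))
              / (rr u t * rr u t * rr u t))%C by (field; auto) end.
      rewrite S. unfold Cdiv. ring. }
  rewrite exact_integral in E by auto.
  assert (E2 : (RtoC 2 * (RtoC 1 - u) * CI f)%C = V u).
  { apply Cminus_eq_0. replace (RtoC 0) with (- RtoC 0)%C by ring. rewrite <- E. ring. }
  rewrite <- E2. field. auto.
Qed.

Lemma cder_V u : slit (RtoC 1 - u)%C -> exists l, cder V u l /\ (u * l)%C = (K u / RtoC 2 - V u)%C.
Proof.
  intros Hu. eexists; split.
  { apply (cder_KI (fun t => cos t ^ 2)); auto. { apply continuity_cos2. }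
    intros t. generalize (COS_bound t). intros. rewrite Rabs_right; nra. }
  assert (C2 : continuity (fun t => cos t ^ 2 * (sin t ^ 2 / 2))) by reg.
  assert (c2 := integrand_continuous _ (fun w => / (w * w * w))%C u C2 Hu cder_inv3_ex).
  assert (c3 := V_integrand u Hu). assert (c4 := K_integrand u Hu).
  set (f := fun t => (RtoC (cos t ^ 2 * (sin t ^ 2 / 2)) * / (rr u t * rr u t * rr u t))%C) in *.
  assert (E : (RtoC 2 * (u * CI f + RtoC 1 * V u) + - RtoC 1 * K u)%C = RtoC 0).
  { rewrite <- (exact_integral u Hu). unfold V, K, KI.
    rewrite <- (CI_lin f (fun t => RtoC (cos t ^ 2) * / rr u t)%C
      (fun t => u * f t + RtoC 1 * (RtoC (cos t ^ 2) * / rr u t))%C); auto.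
    symmetry. apply CI_lin; auto. { apply ccontinuous_lin; auto. }
    intros t. assert (N := rr_neq_0 u t Hu). unfold f.
    rewrite RtoC_minus, !RtoC_mult, cos2_sin2. unfold Rdiv. rewrite RtoC_mult, RtoC_inv by lra.
    field. auto. }
  assert (X : (u * CI f + RtoC 1 * V u)%C = (K u / RtoC 2)%C).
  { replace (u * CI f + RtoC 1 * V u)%C with ((RtoC 2 * (u * CI f + RtoC 1 * V u) + - RtoC 1 * K u) / RtoC 2 + K u / RtoC 2)%C by field.
    rewrite E. field. }
  rewrite <- X. ring.
Qed.

(** The quasi-derivative u (1 - u) K'. With it Legendre's equation becomes a first order system
    without diagonal terms, the one recorded in [ode]. *)
Definition vK (u : C) : C := (u * V u / RtoC 2)%C.

Lemma cder_vK u : slit (RtoC 1 - u)%C -> cder vK u (K u / RtoC 4)%C.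
Proof.
  intros Hu. destruct (cder_V u Hu) as [l [Hl E]]. eapply gder_eq.
  { apply gder_div; [|apply gder_mult; [apply gder_id|apply Hl]|apply gder_const]. apply Cneq_Re; cre; lra. }
  cbv beta. replace (RtoC 4) with (RtoC 2 * RtoC 2)%C by (rewrite <- RtoC_mult; f_equal; ring).
  replace (RtoC 1 * V u + u * l)%C with (K u / RtoC 2)%C by (rewrite E; ring). field.
Qed.

Lemma slit_neq_0 w : slit w -> w <> RtoC 0.
Proof. intros [H|H] E; rewrite E in H; simpl in H; lra. Qed.

Lemma cder_K' u : slit u -> slit (RtoC 1 - u)%C -> cder K u (vK u / (u * (RtoC 1 - u)))%C.
Proof.
  intros H0 Hu. eapply gder_eq; [apply cder_K; auto|]. unfold vK. field.
  split; apply slit_neq_0; auto.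
Qed.

Lemma K_Re_pos u : slit (RtoC 1 - u)%C -> 0 < Re (K u).
Proof.
  intros Hu. apply CI_Re_pos. { apply K_integrand; auto. }
  intros t _. assert (P := csqrt_Re_pos _ (slit_rr u t Hu)). fold (rr u t) in P.
  cre. rewrite Re_inv, Rmult_0_l, Rminus_0_r, Rmult_1_l. apply Rdiv_lt_0_compat; auto. nra.
Qed.

Lemma V_Re_pos u : slit (RtoC 1 - u)%C -> 0 < Re (V u).
Proof.
  intros Hu. apply CI_Re_pos. { apply V_integrand; auto. }
  intros t Ht. assert (P := csqrt_Re_pos _ (slit_rr u t Hu)). fold (rr u t) in P.
  cre. rewrite Re_inv, Rmult_0_l, Rminus_0_r. apply Rmult_lt_0_compat.
  - apply pow_lt, cos_gt_0; lra.
  - apply Rdiv_lt_0_compat; auto. nra.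
Qed.

Lemma K_neq_0 u : slit (RtoC 1 - u)%C -> K u <> RtoC 0.
Proof. intros H. apply Cneq_Re. rewrite Re_RtoC. apply Rgt_not_eq, K_Re_pos, H. Qed.

Lemma K_conj u : slit (RtoC 1 - u)%C -> K (Cconj u) = Cconj (K u).
Proof.
  intros Hu. unfold K, KI. rewrite <- CI_conj by (apply K_integrand; auto).
  apply CI_ext. intros t. rewrite Cmult_conj, Cinv_conj by (apply rr_neq_0; auto).
  unfold rr. rewrite <- csqrt_conj by (apply slit_rr; auto).
  rewrite Cminus_conj, Cmult_conj. f_equal; [apply C_ext; cre; ring|]. do 2 f_equal.
  f_equal; [|f_equal]; apply C_ext; cre; ring.
Qed.

Lemma K_Im_pos u : 0 < Im u -> 0 < Im (K u).
Proof.
  intros H. assert (Hu : slit (RtoC 1 - u)%C) by (right; cre; lra).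
  apply CI_Im_pos. { apply K_integrand; auto. }
  intros t Ht. assert (N : Im (rr u t) < 0).
  { apply csqrt_Im_neg. cre. assert (0 < sin t) by (apply sin_gt_0; lra). assert (0 < sin t ^ 2) by (apply pow_lt; auto). nra. }
  cre. rewrite Im_inv, Rmult_0_l, Rplus_0_r, Rmult_1_l. apply Rdiv_lt_0_compat; nra.
Qed.

(** Both roots have positive real part and nonpositive imaginary part, so their quotient lies in the
    right half plane and is the principal root. *)
Lemma csqrt_div_lower w z : 0 < Re w \/ Im w < 0 -> Im w <= 0 -> Im z < 0 ->
  csqrt (w / z)%C = (csqrt w / csqrt z)%C.
Proof.
  intros Hw Hw' Hz. assert (Sz : slit z) by (right; lra).
  assert (Sw : slit w) by (destruct Hw; [left|right]; lra).
  apply csqrt_unique.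
  - assert (N := csqrt_neq_0 z Sz).
    replace (csqrt w / csqrt z * (csqrt w / csqrt z))%C with ((csqrt w * csqrt w) / (csqrt z * csqrt z))%C by (field; auto).
    rewrite !csqrt_sqr; auto.
  - rewrite Re_div_pos by (apply csqrt_neq_0; auto). apply Rdiv_lt_0_compat.
    + assert (A := csqrt_Re_pos w Sw). assert (B := csqrt_Re_pos z Sz). assert (D := csqrt_Im_neg z Hz).
      assert (E := csqrt_Im w Sw). assert (Im (csqrt w) <= 0) by nra. nra.
    + apply pow_lt, Cmod_pos, csqrt_neq_0; auto.
Qed.

(* Pfaff's transformation: t -> PI/2 - t exchanges sin and cos. *)
Lemma pfaff_integrand u t : 0 < Im u ->
  rr (u / (u - RtoC 1))%C (PI/2 - t) = (rr u t / csqrt (RtoC 1 - u))%C.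
Proof.
  intros H. unfold rr. rewrite sin_shift, cos2_sin2.
  assert (N : (u - RtoC 1)%C <> RtoC 0) by (apply Cneq_Im; cre; lra).
  replace (RtoC 1 - u / (u - RtoC 1) * (RtoC 1 - RtoC (sin t ^ 2)))%C
    with ((RtoC 1 - u * RtoC (sin t ^ 2)) / (RtoC 1 - u))%C.
  2: { field. split; auto. intros E. apply N. replace (u - RtoC 1)%C with (- (RtoC 1 - u))%C by ring. rewrite E; ring. }
  assert (S := sin2_range t). apply csqrt_div_lower; cre; try nra.
  destruct (Req_dec (sin t ^ 2) 0) as [E|E]; [left; rewrite E; lra|right; nra].
Qed.

Lemma pfaff_slit u : 0 < Im u -> slit (RtoC 1 - u / (u - RtoC 1))%C.
Proof.
  intros H. assert (N : (u - RtoC 1)%C <> RtoC 0) by (apply Cneq_Im; cre; lra).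
  replace (RtoC 1 - u / (u - RtoC 1))%C with (/ (RtoC 1 - u))%C.
  - right. rewrite Im_inv. cre. apply Rgt_not_eq. apply Rdiv_lt_0_compat; [lra|]. assert (0 < Im u ^ 2) by (apply pow_lt; auto). generalize (pow2_ge_0 (1 - Re u)). lra.
  - field. split; auto. intros E. apply N. replace (u - RtoC 1)%C with (- (RtoC 1 - u))%C by ring. rewrite E; ring.
Qed.

Lemma pfaff_K u : 0 < Im u -> K (u / (u - RtoC 1))%C = (csqrt (RtoC 1 - u) * K u)%C.
Proof.
  intros H. assert (Hu : slit (RtoC 1 - u)%C) by (right; cre; lra).
  unfold K, KI. rewrite <- (CI_swap (fun t => RtoC 1 * / rr (u / (u - RtoC 1)) t)%C) by (apply K_integrand, pfaff_slit; auto).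
  apply CI_scal. { apply K_integrand; auto. }
  intros t. rewrite pfaff_integrand by auto.
  assert (N1 := rr_neq_0 u t Hu). assert (N2 := csqrt_neq_0 _ Hu). field. auto.
Qed.

Lemma pfaff_V u : 0 < Im u -> V (u / (u - RtoC 1))%C = (csqrt (RtoC 1 - u) * (K u - V u))%C.
Proof.
  intros H. assert (Hu : slit (RtoC 1 - u)%C) by (right; cre; lra).
  replace (csqrt (RtoC 1 - u) * (K u - V u))%C with (csqrt (RtoC 1 - u) * K u + - csqrt (RtoC 1 - u) * V u)%C by ring.
  unfold K, V, KI. rewrite <- (CI_swap (fun t => RtoC (cos t ^ 2) * / rr (u / (u - RtoC 1)) t)%C) by (apply V_integrand, pfaff_slit; auto).
  apply CI_lin. { apply K_integrand; auto. } { apply V_integrand; auto. }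
  intros t. rewrite pfaff_integrand by auto. rewrite cos_shift, cos2_sin2.
  assert (N1 := rr_neq_0 u t Hu). assert (N2 := csqrt_neq_0 _ Hu). field. auto.
Qed.

(** * Legendre's equation and the connection formula *)

(** The plane without the cuts (-oo, 0] and [1, +oo), on which both [K u] and [K (1 - u)] are
    holomorphic. *)
Definition Om (u : C) : Prop := slit u /\ slit (RtoC 1 - u)%C.

Lemma one_minus_one_minus (u : C) : (RtoC 1 - (RtoC 1 - u))%C = u.
Proof. ring. Qed.

Lemma Om_flip u : Om u -> Om (RtoC 1 - u)%C.
Proof. intros [H1 H2]. split; auto. rewrite one_minus_one_minus; auto. Qed.

Lemma Om_conj u : Om u -> Om (Cconj u).
Proof.
  intros [H1 H2]. split. { apply slit_conj; auto. }
  replace (RtoC 1 - Cconj u)%C with (Cconj (RtoC 1 - u))%C by (apply C_ext; cre; ring). apply slit_conj; auto.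
Qed.

Lemma Om_nonreal u : Im u <> 0 -> Om u.
Proof. intros H. split; right; cre; lra. Qed.

Lemma Om_real u : Im u = 0 -> Om u -> 0 < Re u < 1.
Proof. intros H [[A|A] [B|B]]; cre_in B; lra. Qed.

Lemma Om_interval u : 0 < Re u < 1 -> Om u.
Proof. intros H. split; left; cre; lra. Qed.

Lemma Om_neq u : Om u -> u <> RtoC 0 /\ (RtoC 1 - u)%C <> RtoC 0.
Proof. intros [A B]. split; apply slit_neq_0; auto. Qed.

Definition ode (y v : C -> C) (u : C) : Prop :=
  cder y u (v u / (u * (RtoC 1 - u)))%C /\ cder v u (y u / RtoC 4)%C.

Lemma ode_K u : Om u -> ode K vK u.
Proof. intros [A B]. split. { apply cder_K'; auto. } apply cder_vK; auto. Qed.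

Definition K1 (u : C) : C := K (RtoC 1 - u)%C.
Definition vK1 (u : C) : C := (- vK (RtoC 1 - u))%C.

Lemma cder_one_minus u : cder (fun u => RtoC 1 - u)%C u (- RtoC 1)%C.
Proof. eapply gder_eq. { apply gder_minus; [apply gder_const|apply gder_id]. } ring. Qed.

Lemma ode_K1 u : Om u -> ode K1 vK1 u.
Proof.
  intros H. destruct (Om_neq u H) as [N0 N1]. apply Om_flip in H. destruct H as [A B]. split.
  - eapply gder_eq. { apply (gder_comp _ (fun u => RtoC 1 - u)%C K); [apply cder_one_minus|]. apply cder_K'; auto. }
    unfold vK1. rewrite one_minus_one_minus. field. auto.
  - eapply gder_eq. { apply gder_opp. apply (gder_comp _ (fun u => RtoC 1 - u)%C vK); [apply cder_one_minus|]. apply cder_vK; auto. }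
    unfold K1. field.
Qed.

Definition wronskian (y1 v1 y2 v2 : C -> C) (u : C) : C := (y1 u * v2 u - v1 u * y2 u)%C.

(** In terms of quasi-derivatives the system has trace zero. *)
Lemma wronskian_constant y1 v1 y2 v2 z w :
  (forall t, 0 <= t <= 1 -> Om (z + RtoC t * (w - z))%C /\ ode y1 v1 (z + RtoC t * (w - z))%C /\ ode y2 v2 (z + RtoC t * (w - z))%C) ->
  wronskian y1 v1 y2 v2 w = wronskian y1 v1 y2 v2 z.
Proof.
  intros H. apply (zero_derivative_constant (wronskian y1 v1 y2 v2) (fun _ => True)).
  intros t Ht. destruct (H t Ht) as [O [[A1 A2] [B1 B2]]]. destruct (Om_neq _ O) as [N0 N1].
  set (u := (z + RtoC t * (w - z))%C) in *. eapply gder_eq.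
  { apply gder_minus; apply gder_mult; eauto. }
  field. auto.
Qed.

Lemma nonreal_segment z w t : 0 < Im z -> 0 < Im w -> 0 <= t <= 1 -> 0 < Im (z + RtoC t * (w - z))%C.
Proof. intros. cre. destruct (Req_dec t 0) as [->|]; nra. Qed.

Definition half : C := RtoC (1/2).

Lemma Om_star u t : Om u -> 0 <= t <= 1 -> Om (half + RtoC t * (u - half))%C.
Proof.
  intros H Ht. destruct (Req_dec (Im u) 0) as [E|E].
  - assert (R := Om_real u E H). apply Om_interval. unfold half. cre. nra.
  - destruct (Req_dec t 0) as [->|Nt].
    + apply Om_interval. unfold half. cre. lra.
    + apply Om_nonreal. unfold half. cre. replace (0 + (t * (Im u - 0) + 0 * (Re u - 1/2))) with (t * Im u) by ring.
      apply Rmult_integral_contrapositive; auto.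
Qed.

(** The Wronskian evaluated at 1/2, where [K1] equals [K] and [vK1] equals [- vK]. By Legendre's
    relation it is -pi/4; here its nonvanishing is read off from positive integrals. *)
Definition W0 : C := (- (RtoC 2 * K half * vK half))%C.

Lemma W0_neq_0 : W0 <> RtoC 0.
Proof.
  assert (S : slit (RtoC 1 - half)%C) by (left; unfold half; cre; lra).
  assert (A := K_neq_0 half S). assert (B : V half <> RtoC 0).
  { apply Cneq_Re. rewrite Re_RtoC. apply Rgt_not_eq, V_Re_pos, S. }
  unfold W0, vK. intros E. unfold half in E.
  assert (X : (RtoC 2 * K (RtoC (1/2)) * (RtoC (1/2) * V (RtoC (1/2)) / RtoC 2))%C = RtoC 0) by (replace (RtoC 0) with (- RtoC 0)%C by ring; rewrite <- E; ring).
  unfold half in *. revert X. change (RtoC 2 * K (RtoC (1 / 2)) * (RtoC (1 / 2) * V (RtoC (1 / 2)) / RtoC 2) <> RtoC 0)%C. unfold Cdiv. repeat apply Cmult_neq_0; auto; try (apply Cneq_Re; cre; lra).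
  apply Cinv_neq_0. apply Cneq_Re; cre; lra.
Qed.

Lemma wronskian_K_K1 u : Om u -> wronskian K vK K1 vK1 u = W0.
Proof.
  intros H. rewrite (wronskian_constant K vK K1 vK1 half u).
  - unfold wronskian, W0, K1, vK1. replace (RtoC 1 - half)%C with half by (unfold half; apply C_ext; cre; field). ring.
  - intros t Ht. assert (O := Om_star u t H Ht). split; auto. split; [apply ode_K|apply ode_K1]; auto.
Qed.

(* The solution q^(-1/2) K(1/q), q = 1 - u, of the same equation. *)
Definition y3 (u : C) : C := (K (/ (RtoC 1 - u)) / csqrt (RtoC 1 - u))%C.
Definition v3 (u : C) : C :=
  (u * K (/ (RtoC 1 - u)) / (RtoC 2 * csqrt (RtoC 1 - u)) - csqrt (RtoC 1 - u) * vK (/ (RtoC 1 - u)))%C.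

Lemma Im_inv_lower u : 0 < Im u -> 0 < Im (/ (RtoC 1 - u))%C.
Proof.
  intros H. rewrite Im_inv. cre. apply Rdiv_lt_0_compat; [lra|].
  assert (0 < Im u ^ 2) by (apply pow_lt; auto). generalize (pow2_ge_0 (1 - Re u)). lra.
Qed.

Lemma ode_y3 u : 0 < Im u -> ode y3 v3 u.
Proof.
  intros H. set (q := (RtoC 1 - u)%C). set (p := csqrt q).
  assert (Sq : slit q) by (right; unfold q; cre; lra).
  assert (Np : p <> RtoC 0) by (apply csqrt_neq_0; auto).
  assert (Nq : q <> RtoC 0) by (apply slit_neq_0; auto).
  assert (Ep : (p * p)%C = q) by (apply csqrt_sqr; auto).
  assert (Eu : u = (RtoC 1 - p * p)%C) by (rewrite Ep; unfold q; ring).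
  assert (Nu : (RtoC 1 - p * p)%C <> RtoC 0) by (rewrite <- Eu; apply Cneq_Im; cre; lra).
  assert (Ix : 0 < Im (/ q)%C) by (apply Im_inv_lower; auto).
  assert (S1 : slit (/ q)%C) by (right; lra).
  assert (S2 : slit (RtoC 1 - / q)%C) by (right; cre; lra).
  assert (Dq : cder (fun u => RtoC 1 - u)%C u (- RtoC 1)%C) by apply cder_one_minus.
  assert (Dx : cder (fun u => / (RtoC 1 - u))%C u (/ (q * q))%C).
  { eapply gder_eq. { apply (gder_inv _ (fun u => RtoC 1 - u)%C); [exact Nq|apply Dq]. } fold q. field. auto. }
  assert (DK : cder (fun u => K (/ (RtoC 1 - u)))%C u (vK (/ q) / (/ q * (RtoC 1 - / q)) * / (q * q))%C).
  { apply (gder_comp _ (fun u => / (RtoC 1 - u))%C K); auto. apply cder_K'; auto. }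
  assert (Dv : cder (fun u => vK (/ (RtoC 1 - u)))%C u (K (/ q) / RtoC 4 * / (q * q))%C).
  { apply (gder_comp _ (fun u => / (RtoC 1 - u))%C vK); auto. apply cder_vK; auto. }
  assert (Dp : cder (fun u => csqrt (RtoC 1 - u))%C u (/ (RtoC 2 * p) * - RtoC 1)%C).
  { apply (gder_comp _ (fun u => RtoC 1 - u)%C csqrt); auto. apply cder_csqrt; auto. }
  assert (T2 : RtoC 2 <> RtoC 0) by (apply Cneq_Re; cre; lra).
  assert (T4 : RtoC 4 = (RtoC 2 * RtoC 2)%C) by (rewrite <- RtoC_mult; f_equal; ring).
  assert (N' : (p * p - RtoC 1)%C <> RtoC 0).
  { intros E. apply Nu. replace (RtoC 1 - p * p)%C with (- (p * p - RtoC 1))%C by ring. rewrite E; ring. }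
  split.
  - eapply gder_eq. { apply gder_div; [exact Np|apply DK|apply Dp]. }
    cbv beta. unfold v3. fold q. fold p. generalize (K (/ q)) (vK (/ q)). intros a b.
    rewrite Eu, <- Ep. field. repeat split; auto.
  - eapply gder_eq.
    { apply gder_minus.
      - apply gder_div; [|apply gder_mult; [apply gder_id|apply DK]|apply gder_scal, Dp].
        apply Cmult_neq_0; auto.
      - apply gder_mult; [apply Dp|apply Dv]. }
    cbv beta. unfold y3. fold q. fold p. generalize (K (/ q)) (vK (/ q)). intros a b.
    rewrite T4, Eu, <- Ep. field. repeat split; auto.
Qed.

(** The primitive sixth root of unity exp(i pi/3). It is fixed by u -> 1/(1 - u), and Pfaff's
    transformation sends it to 1 - u, so all functions of the connection formula can be compared
    there. *)
Definition u0 : C := (1/2, sqrt 3 / 2).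

Lemma sqrt3_sqr : sqrt 3 * sqrt 3 = 3.
Proof. apply sqrt_sqrt; lra. Qed.
Lemma sqrt3_pos : 0 < sqrt 3.
Proof. apply sqrt_lt_R0; lra. Qed.

Lemma y3_value : y3 u0 = (K1 u0 + Ci * K u0)%C /\ v3 u0 = (vK1 u0 + Ci * vK u0)%C.
Proof.
  assert (s2 := sqrt3_sqr). assert (sp := sqrt3_pos).
  assert (I0 : 0 < Im u0) by (unfold u0; cre; lra).
  (* [p] and [r] are the twelfth roots of unity exp(-i pi/6) and exp(i pi/6). Pfaff's transformation
     expresses everything by K(u0) and V(u0), and identities between powers of [p] remain. *)
  set (p := (sqrt 3 / 2, - (1/2)) : C). 
  assert (Ep : csqrt (RtoC 1 - u0)%C = p).
  { apply csqrt_unique; [apply C_ext|]; unfold p, u0; cre; lra. }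
  assert (N : p <> RtoC 0) by (apply Cneq_Re; unfold p; cre; lra).
  set (r := (sqrt 3 / 2, 1/2) : C).
  assert (Er : (/ p)%C = r).
  { apply (f_equal (fun z => z)). assert (X : (p * r)%C = RtoC 1).
    { apply C_ext; unfold p, r; cre; [|lra]. replace (sqrt 3 / 2 * (sqrt 3 / 2) - - (1 / 2) * (1 / 2)) with (sqrt 3 * sqrt 3 / 4 + 1/4) by field. lra. }
    replace (/ p)%C with (/ p * (p * r))%C by (rewrite X; ring). field. auto. }
  assert (Eu : u0 = (r * r)%C).
  { apply C_ext; unfold r, u0; cre; [|lra]. replace (sqrt 3 / 2 * (sqrt 3 / 2) - 1 / 2 * (1 / 2)) with (sqrt 3 * sqrt 3 / 4 - 1/4) by field. lra. }
  assert (Eq : (RtoC 1 - u0)%C = (p * p)%C).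
  { rewrite <- Ep. symmetry. apply csqrt_sqr. right. cre. lra. }
  assert (Einv : (/ (RtoC 1 - u0))%C = u0).
  { rewrite Eq, Eu, <- Er. field. auto. }
  assert (EP : (u0 / (u0 - RtoC 1))%C = (RtoC 1 - u0)%C).
  { replace (u0 - RtoC 1)%C with (- (p * p))%C by (rewrite <- Eq; ring). rewrite Eq, Eu, <- Er.
    assert (X : (RtoC 1 + p * p * p * p * p * p)%C = RtoC 0).
    { apply C_ext; unfold p; cre.
      - replace (sqrt 3) with (sqrt 3 * 1) by ring. 
        match goal with |- ?l = _ => replace l with (1 + (sqrt 3 * sqrt 3) * (sqrt 3 * sqrt 3) * (sqrt 3 * sqrt 3) / 64
          - 15 / 64 * ((sqrt 3 * sqrt 3) * (sqrt 3 * sqrt 3)) + 15 / 64 * (sqrt 3 * sqrt 3) - 1/64) by field end.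
        rewrite s2. field.
      - match goal with |- ?l = _ => replace l with (sqrt 3 / 64 * (-6 * ((sqrt 3 * sqrt 3) * (sqrt 3 * sqrt 3)) + 20 * (sqrt 3 * sqrt 3) - 6)) by field end.
        rewrite s2. ring. }
    apply Cminus_eq_0. replace (/ p * / p / - (p * p) - p * p)%C with (- ((RtoC 1 + p * p * p * p * p * p) / (p * p * p * p)))%C by (field; auto).
    rewrite X. field. auto. }
  assert (A := pfaff_K u0 I0). assert (B := pfaff_V u0 I0). rewrite EP, Ep in A, B.
  assert (Z1 : (r - p - Ci)%C = RtoC 0) by (apply C_ext; unfold r, p; cre; lra).
  unfold y3, v3, K1, vK1, vK. rewrite Einv, Ep, A, B.
  generalize (K u0) (V u0). intros k v. split.
  - unfold Cdiv. rewrite Er. apply Cminus_eq_0.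
    replace (k * r - (p * k + Ci * k))%C with ((r - p - Ci) * k)%C by ring. rewrite Z1. ring.
  - rewrite Eq, Eu, <- Er in *.
    assert (Z2 : Ci = (/ p - p)%C) by (symmetry; apply Cminus_eq_0; rewrite <- Z1; rewrite Er; ring).
    assert (Z3 : (p * p * p * p - p * p + RtoC 1)%C = RtoC 0).
    { apply C_ext; unfold p; cre.
      - match goal with |- ?l = _ => replace l with ((sqrt 3 * sqrt 3) * (sqrt 3 * sqrt 3) / 16 - 6 / 16 * (sqrt 3 * sqrt 3) + 1/16
          - (sqrt 3 * sqrt 3) / 4 + 1/4 + 1) by field end. rewrite s2. field.
      - match goal with |- ?l = _ => replace l with (sqrt 3 / 4 * (1 - (sqrt 3 * sqrt 3)) + sqrt 3 / 2) by field end. rewrite s2. field. }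
    rewrite Z2. apply Cminus_eq_0.
    match goal with |- ?l = _ => replace l with ((k - v) * (p * p * p * p - p * p + RtoC 1) * (p * p + RtoC 1) / (RtoC 2 * p * p * p))%C by (field; auto) end.
    rewrite Z3. field. auto.
Qed.

(** The difference of the two sides solves the equation with zero initial data at [u0], so its
    Wronskians with [K] and [K1] vanish. As [K] and [K1] have Wronskian [W0], different from 0, the
    difference vanishes. The behaviour of the period ratio across the cuts follows from this
    formula. *)
Lemma y3_formula u : 0 < Im u -> y3 u = (K1 u + Ci * K u)%C.
Proof.
  intros H. destruct y3_value as [A B].
  assert (I0 : 0 < Im u0) by (unfold u0; cre; generalize sqrt3_pos; lra).
  set (y := fun u => (y3 u - K1 u - Ci * K u)%C). set (v := fun u => (v3 u - vK1 u - Ci * vK u)%C).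
  assert (O : forall w, 0 < Im w -> Om w) by (intros; apply Om_nonreal; lra).
  assert (D : forall w, 0 < Im w -> ode y v w).
  { intros w Hw. destruct (ode_y3 w Hw) as [a1 a2]. destruct (ode_K w (O w Hw)) as [b1 b2].
    destruct (ode_K1 w (O w Hw)) as [c1 c2]. destruct (Om_neq w (O w Hw)) as [n0 n1]. split; eapply gder_eq.
    - apply gder_minus; [apply gder_minus|apply gder_scal]; eauto.
    - unfold v. field. auto.
    - apply gder_minus; [apply gder_minus|apply gder_scal]; eauto.
    - unfold y. field. }
  assert (y0 : y u0 = RtoC 0) by (unfold y; rewrite A; ring).
  assert (v0 : v u0 = RtoC 0) by (unfold v; rewrite B; ring).
  assert (w1 : wronskian y v K vK u = RtoC 0).
  { rewrite (wronskian_constant y v K vK u0 u). { unfold wronskian. rewrite y0, v0. ring. }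
    intros t Ht. assert (Q := nonreal_segment u0 u t I0 H Ht). auto using ode_K. }
  assert (w2 : wronskian y v K1 vK1 u = RtoC 0).
  { rewrite (wronskian_constant y v K1 vK1 u0 u). { unfold wronskian. rewrite y0, v0. ring. }
    intros t Ht. assert (Q := nonreal_segment u0 u t I0 H Ht). auto using ode_K1. }
  assert (w3 := wronskian_K_K1 u (O u H)). unfold wronskian in *.
  assert (Z : (y u * W0)%C = RtoC 0).
  { rewrite <- w3. replace (y u * (K u * vK1 u - vK u * K1 u))%C
      with (K u * (y u * vK1 u - v u * K1 u) - K1 u * (y u * vK u - v u * K u))%C by ring.
    rewrite w1, w2. ring. }
  destruct (Cmult_integral _ _ Z) as [Q|Q].
  - unfold y in Q. apply Cminus_eq_0. rewrite <- Q. ring.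
  - exfalso. apply W0_neq_0; auto.
Qed.

(** * The period ratio *)

Definition T1 (u : C) : C := (Ci * K (RtoC 1 - u) / K u)%C.

Lemma T1_y3 u : 0 < Im u -> T1 u = (RtoC 1 + Ci * (y3 u / K u))%C.
Proof.
  intros H. rewrite y3_formula by auto. unfold T1, K1.
  assert (N := K_neq_0 u (proj2 (Om_nonreal u ltac:(lra)))).
  replace (Ci * ((K (RtoC 1 - u) + Ci * K u) / K u))%C with (Ci * K (RtoC 1 - u) / K u + Ci * Ci)%C by (field; auto).
  replace (Ci * Ci)%C with (- RtoC 1)%C by (apply C_ext; cre; ring). ring.
Qed.

Lemma y3_integral u : 0 < Im u ->
  ccontinuous (fun t => / csqrt (RtoC 1 - u) * (RtoC 1 * / rr (/ (RtoC 1 - u)) t))%C /\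
  y3 u = CI (fun t => / csqrt (RtoC 1 - u) * (RtoC 1 * / rr (/ (RtoC 1 - u)) t))%C.
Proof.
  intros H. assert (S2 : slit (RtoC 1 - / (RtoC 1 - u))%C).
  { right. cre. generalize (Im_inv_lower u H). lra. }
  assert (c := K_integrand _ S2). split.
  - apply (ccontinuous_ext (fun t => / csqrt (RtoC 1 - u) * (RtoC 1 * / rr (/ (RtoC 1 - u)) t) + RtoC 0 * (RtoC 1 * / rr (/ (RtoC 1 - u)) t))%C).
    + intros; ring.
    + apply ccontinuous_lin; auto.
  - unfold y3. symmetry. rewrite (CI_scal (fun t => RtoC 1 * / rr (/ (RtoC 1 - u)) t)%C _ (/ csqrt (RtoC 1 - u))%C); auto.
    unfold K, KI, Cdiv. ring.
Qed.

(** Both roots lie in the fourth quadrant. Their product lies in the lower half plane together with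
    its square cos^2 t - u, hence has positive real part and is the principal root. The new
    integrand displays the signs of [y3] and its growth as u tends to 0. *)
Lemma y3_integrand u t : 0 < Im u -> 0 < t < PI/2 ->
  (/ csqrt (RtoC 1 - u) * (RtoC 1 * / rr (/ (RtoC 1 - u)) t))%C = (/ csqrt (RtoC (cos t ^ 2) - u))%C.
Proof.
  intros H Ht. set (p := csqrt (RtoC 1 - u)%C). set (x := (/ (RtoC 1 - u))%C). set (r := rr x t).
  assert (Ix : 0 < Im x) by (apply Im_inv_lower; auto).
  assert (Sp : slit (RtoC 1 - u)%C) by (right; cre; lra).
  assert (Sx : slit (RtoC 1 - x)%C) by (right; cre; lra).
  assert (a1 := csqrt_Re_pos _ Sp). assert (a2 : Im p < 0) by (apply csqrt_Im_neg; cre; lra). fold p in a1.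
  assert (ss : 0 < sin t ^ 2) by (apply pow_lt, sin_gt_0; generalize PI_RGT_0; lra).
  assert (b1 : 0 < Re r) by (apply csqrt_Re_pos, slit_rr; auto).
  assert (b2 : Im r < 0) by (apply csqrt_Im_neg; cre; nra).
  assert (E : ((p * r) * (p * r))%C = (RtoC (cos t ^ 2) - u)%C).
  { replace ((p * r) * (p * r))%C with ((p * p) * (r * r))%C by ring. unfold p, r.
    rewrite csqrt_sqr, rr_sqr, cos2_sin2 by auto. unfold x. field. apply slit_neq_0; auto. }
  assert (R : 0 < Re (p * r)%C).
  { assert (J : Im ((p * r) * (p * r))%C < 0) by (rewrite E; cre; lra).
    assert (J2 : Im (p * r)%C < 0) by (cre; nra).
    rewrite Im_mult in J. nra. }
  rewrite (csqrt_unique _ _ E R). field. split; [apply rr_neq_0; auto|apply csqrt_neq_0; auto].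
Qed.

Lemma y3_Re_Im u : 0 < Im u -> 0 < Re (y3 u) /\ 0 < Im (y3 u).
Proof.
  intros H. destruct (y3_integral u H) as [c E]. rewrite E.
  assert (P : forall t, 0 < t < PI/2 -> 0 < Re (csqrt (RtoC (cos t ^ 2) - u)%C) /\ Im (csqrt (RtoC (cos t ^ 2) - u)%C) < 0).
  { intros t Ht. split; [apply csqrt_Re_pos; right; cre; lra|apply csqrt_Im_neg; cre; lra]. }
  split.
  - apply CI_Re_pos; auto. intros t Ht. rewrite y3_integrand by auto. destruct (P t Ht). rewrite Re_inv. apply Rdiv_lt_0_compat; nra.
  - apply CI_Im_pos; auto. intros t Ht. rewrite y3_integrand by auto. destruct (P t Ht). rewrite Im_inv. apply Rdiv_lt_0_compat; nra.
Qed.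

Lemma T1_Im_lower u : 0 < Im u -> Re (y3 u) * Re (K u) / Cmod (K u) ^ 2 <= Im (T1 u).
Proof.
  intros H. assert (S : slit (RtoC 1 - u)%C) by (right; cre; lra).
  rewrite T1_y3 by auto. cre. rewrite Re_div_pos by (apply K_neq_0; auto).
  destruct (y3_Re_Im u H). assert (A := K_Re_pos u S). assert (B := K_Im_pos u H).
  assert (Q : 0 < Cmod (K u) ^ 2) by (apply pow_lt, Cmod_pos, K_neq_0; auto).
  assert (0 < / Cmod (K u) ^ 2) by (apply Rinv_0_lt_compat; auto).
  unfold Rdiv. apply Rle_trans with ((Re (y3 u) * Re (K u) + Im (y3 u) * Im (K u)) * / Cmod (K u) ^ 2); [|right; ring].
  apply Rmult_le_compat_r; [lra|]. nra.
Qed.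

Lemma T1_conj u : Om u -> T1 (Cconj u) = (- Cconj (T1 u))%C.
Proof.
  intros H. destruct (Om_flip u H) as [_ A]. unfold T1.
  replace (RtoC 1 - Cconj u)%C with (Cconj (RtoC 1 - u))%C by (apply C_ext; cre; ring).
  rewrite !K_conj by (apply H || auto). rewrite Cdiv_conj by (apply K_neq_0, H).
  rewrite Cmult_conj. replace (Cconj Ci) with (- Ci)%C by (apply C_ext; cre; ring).
  unfold Cdiv. ring.
Qed.

Lemma T1_flip u : Om u -> T1 (RtoC 1 - u)%C = (- / T1 u)%C.
Proof.
  intros H. destruct (Om_flip u H) as [_ A]. assert (N1 := K_neq_0 u (proj2 H)). assert (N2 := K_neq_0 _ A).
  unfold T1. rewrite one_minus_one_minus in *.
  assert (Nc : Ci <> RtoC 0) by (apply Cneq_Im; cre; lra).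
  replace (- / (Ci * K (RtoC 1 - u) / K u))%C with ((Ci * Ci) * / (Ci * K (RtoC 1 - u) / K u))%C.
  - field. auto.
  - replace (Ci * Ci)%C with (- RtoC 1)%C by (apply C_ext; cre; ring). ring.
Qed.

Lemma T1_pfaff u : 0 < Im u -> T1 (u / (u - RtoC 1))%C = (T1 u - RtoC 1)%C.
Proof.
  intros H. assert (S : slit (RtoC 1 - u)%C) by (right; cre; lra).
  assert (Np := csqrt_neq_0 _ S). assert (Nk := K_neq_0 _ S).
  rewrite (T1_y3 u H). unfold T1. rewrite pfaff_K by auto.
  assert (N : (u - RtoC 1)%C <> RtoC 0) by (apply Cneq_Im; cre; lra).
  replace (RtoC 1 - u / (u - RtoC 1))%C with (/ (RtoC 1 - u))%C.
  - unfold y3. field. auto.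
  - field. split; auto. apply slit_neq_0; auto.
Qed.

Lemma T1_Im_pos u : Om u -> 0 < Im (T1 u).
Proof.
  intros H. assert (UH : forall w, 0 < Im w -> 0 < Im (T1 w)).
  { intros w Hw. eapply Rlt_le_trans; [|apply T1_Im_lower; auto].
    assert (S : slit (RtoC 1 - w)%C) by (right; cre; lra).
    destruct (y3_Re_Im w Hw). apply Rdiv_lt_0_compat.
    - apply Rmult_lt_0_compat; auto. apply K_Re_pos; auto.
    - apply pow_lt, Cmod_pos, K_neq_0; auto. }
  destruct (Rtotal_order 0 (Im u)) as [L|[E|L]]; auto.
  - assert (A1 := K_Re_pos u (proj2 H)). assert (A2 := K_Re_pos _ (proj2 (Om_flip u H))).
    assert (Cu : Cconj u = u) by (apply C_ext; cre; lra).
    assert (Cu' : Cconj (RtoC 1 - u)%C = (RtoC 1 - u)%C) by (apply C_ext; cre; lra).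
    assert (B1 := K_conj u (proj2 H)). assert (B2 := K_conj _ (proj2 (Om_flip u H))).
    rewrite Cu in B1. rewrite Cu' in B2. apply (f_equal Im) in B1. apply (f_equal Im) in B2. cre_in B1. cre_in B2.
    unfold T1. rewrite Im_div by (apply K_neq_0, H). apply Rdiv_lt_0_compat.
    + cre. replace (Im (K u)) with 0 by lra. nra.
    + apply pow_lt, Cmod_pos, K_neq_0, H.
  - assert (X := UH (Cconj u)). rewrite T1_conj in X by auto. cre_in X. lra.
Qed.

Definition dT1 (u : C) : C := (Ci * W0 / (u * (RtoC 1 - u) * (K u * K u)))%C.

Lemma cder_T1 u : Om u -> cder T1 u (dT1 u).
Proof.
  intros H. destruct (ode_K u H) as [a1 _]. destruct (ode_K1 u H) as [b1 _]. destruct (Om_neq u H) as [n0 n1].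
  assert (N := K_neq_0 u (proj2 H)). eapply gder_eq.
  { apply gder_div; [exact N|apply gder_scal, b1|apply a1]. }
  unfold dT1. rewrite <- (wronskian_K_K1 u H). unfold wronskian, K1. field. auto.
Qed.

Lemma dT1_neq_0 u : Om u -> dT1 u <> RtoC 0.
Proof.
  intros H. destruct (Om_neq u H) as [n0 n1]. assert (N := K_neq_0 u (proj2 H)). unfold dT1, Cdiv.
  apply Cmult_neq_0; [apply Cmult_neq_0|apply Cinv_neq_0; repeat apply Cmult_neq_0; auto].
  - apply Cneq_Im; cre; lra.
  - apply W0_neq_0.
Qed.

Lemma dT1_cont u : Om u -> cont_at (fun _ => True) dT1 u.
Proof.
  intros H. destruct (Om_neq u H) as [n0 n1]. assert (N := K_neq_0 u (proj2 H)).
  assert (C1 : cont_at (fun _ => True) K u) by (eapply cder_cont, cder_K, H).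
  unfold dT1. apply cont_at_div.
  - repeat apply Cmult_neq_0; auto.
  - apply cont_at_const.
  - apply cont_at_mult; [apply cont_at_mult; [apply cont_at_id|]|apply cont_at_mult; auto].
    apply cont_at_minus; [apply cont_at_const|apply cont_at_id].
Qed.

(** * The period ratio near the cusp *)

Lemma PI_gt_3 : 3 < PI.
Proof. generalize PI2_3_2. lra. Qed.

Lemma sin_ge_half x : 0 < x <= 1 -> x / 2 <= sin x.
Proof.
  intros Hx. destruct (MVT_gen sin 0 x cos) as [c [Hc E]].
  - intros y _. apply is_derive_Reals, derivable_pt_lim_sin.
  - intros y _. apply continuity_sin.
  - rewrite Rmin_left, Rmax_right in Hc by lra. rewrite sin_0 in E.
    assert (cos (PI/3) <= cos c). { generalize PI_gt_3. intros. apply cos_decr_1; lra. }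
    rewrite cos_PI3 in H. nra.
Qed.

Lemma inv_csqrt_Re_lower (c : R) (u : C) : 0 < c -> slit (RtoC (c ^ 2) - u)%C -> Cmod u <= c ^ 2 / 2 ->
  / (4 * c) <= Re (/ csqrt (RtoC (c ^ 2) - u))%C.
Proof.
  intros Hc S Hu. set (w := (RtoC (c ^ 2) - u)%C) in *.
  assert (c2 : 0 < c ^ 2) by (apply pow_lt; auto).
  assert (A := csqrt_Re_sqr w S). assert (B := csqrt_mod w S). assert (P := csqrt_Re_pos w S).
  assert (Rw : c ^ 2 / 2 <= Re w). { unfold w. cre. generalize (re_le_Cmod u) (Rle_abs (Re u)). lra. }
  assert (Mw : Cmod w <= 3 * c ^ 2 / 2).
  { unfold w. eapply Rle_trans; [apply Cmod_minus_le|]. rewrite Cmod_R, Rabs_right by lra. lra. }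
  assert (Mw' : Re w <= Cmod w) by (generalize (re_le_Cmod w) (Rle_abs (Re w)); lra).
  assert (Q : c / 2 <= Re (csqrt w)). { simpl in *. nra. }
  rewrite Re_inv. rewrite <- Cmod_sqr, B.
  apply Rle_trans with ((c / 2) / (2 * c ^ 2)). { right. field. lra. }
  unfold Rdiv. apply Rmult_le_compat; try lra.
  - left. apply Rinv_0_lt_compat; lra.
  - apply Rinv_le_contravar; lra.
Qed.

(** For small u the integrand is close to 1/cos t, whose integral diverges logarithmically. Up to
    distance exp(-N) from PI/2 it is at least 1/(4 (PI/2 - t)), which integrates to at least N/4. *)
Lemma y3_Re_lower N u : 0 < N -> 0 < Im u -> Cmod u < exp (- N) ^ 2 / 8 -> N / 4 <= Re (y3 u).
Proof.
  intros HN Hu Hm. destruct (y3_integral u Hu) as [c E]. rewrite E. unfold CI. cre.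
  set (f := fun t => Re (/ csqrt (RtoC 1 - u) * (RtoC 1 * / rr (/ (RtoC 1 - u)) t))%C).
  assert (Pp := PI_gt_3).
  set (eta := exp (- N)). assert (e0 : 0 < eta) by apply exp_pos.
  assert (e1 : eta < 1). { unfold eta. rewrite <- exp_0. apply exp_increasing. lra. }
  set (t1 := PI/2 - eta).
  assert (ex : forall a b, ex_RInt f a b) by (intros; apply (ccontinuous_int _ a b c)).
  assert (pos : forall t, 0 < t < PI/2 -> f t = Re (/ csqrt (RtoC (cos t ^ 2) - u))%C).
  { intros t Ht. unfold f. f_equal. apply y3_integrand; auto. }
  rewrite <- (RInt_Chasles f 0 t1 (PI/2)) by auto.
  assert (P2 : 0 <= RInt f t1 (PI/2)).
  { apply RInt_ge_0; auto. { unfold t1; lra. } intros t Ht. rewrite pos by (unfold t1 in Ht; lra).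
    rewrite Re_inv. apply Rlt_le, Rdiv_lt_0_compat.
    - apply csqrt_Re_pos. right; cre; lra.
    - rewrite <- Cmod_sqr. apply pow_lt, Cmod_pos, csqrt_neq_0. right; cre; lra. }
  assert (P1 : N / 4 <= RInt f 0 t1).
  { assert (D : is_RInt (fun t => / (4 * (PI/2 - t))) 0 t1 (minus (- ln (PI/2 - t1) / 4) (- ln (PI/2 - 0) / 4))).
    { apply (is_RInt_derive (V:=R_CompleteNormedModule) (fun t => - ln (PI/2 - t) / 4)).
      - intros x. rewrite Rmin_left, Rmax_right by (unfold t1; lra). intros Hx. unfold t1 in Hx.
        auto_derive. { lra. } field. lra.
      - intros x. rewrite Rmin_left, Rmax_right by (unfold t1; lra). intros Hx. unfold t1 in Hx.
        apply (ex_derive_continuous (fun t => / (4 * (PI/2 - t)))). auto_derive. lra. }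
    assert (V1 := is_RInt_unique _ _ _ _ D).
    apply Rle_trans with (RInt (fun t => / (4 * (PI/2 - t))) 0 t1).
    - rewrite V1. unfold minus, plus, opp; simpl. unfold t1. replace (PI/2 - (PI/2 - eta)) with eta by ring.
      unfold eta. rewrite ln_exp. assert (X : ln 1 <= ln (PI/2 - 0)) by (apply ln_le; lra). rewrite ln_1 in X. lra.
    - apply RInt_le; auto. { unfold t1; lra. } { eexists; apply D. }
      intros t Ht. unfold t1 in Ht. rewrite pos by lra.
      assert (c0 : 0 < cos t) by (apply cos_gt_0; lra).
      assert (c1 : cos t < PI/2 - t). { rewrite <- sin_shift. apply sin_lt_x. lra. }
      assert (c2 : eta / 2 <= cos t).
      { apply Rle_trans with (sin eta). { apply sin_ge_half; lra. }
        replace (sin eta) with (cos (PI/2 - eta)) by apply cos_shift. apply cos_decr_1; lra. }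
      apply Rle_trans with (/ (4 * cos t)). { apply Rinv_le_contravar; lra. }
      apply inv_csqrt_Re_lower; auto. { right; cre; lra. }
      fold eta in Hm. assert ((eta/2)^2 <= cos t ^ 2) by (apply pow_incr; lra). simpl in *. lra. }
  unfold plus; simpl. lra.
Qed.

Lemma K_bounds u : Cmod u <= 1/2 -> Im u <> 0 -> 1/2 <= Re (K u) /\ Cmod (K u) <= 2 * PI.
Proof.
  intros Hu Hi. assert (S : slit (RtoC 1 - u)%C) by (right; cre; lra).
  assert (c := K_integrand u S).
  assert (W : forall t, 1/2 <= Re (RtoC 1 - u * RtoC (sin t ^ 2))%C /\ Cmod (RtoC 1 - u * RtoC (sin t ^ 2))%C <= 3/2).
  { intros t. assert (Q := sin2_range t).
    assert (B : Cmod (u * RtoC (sin t ^ 2)) <= 1/2).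
    { rewrite Cmod_mult, Cmod_R, Rabs_right by lra. generalize (Cmod_ge_0 u). nra. }
    split.
    - rewrite Re_minus, Re_RtoC. generalize (re_le_Cmod (u * RtoC (sin t ^ 2))) (Rle_abs (Re (u * RtoC (sin t ^ 2)))). lra.
    - eapply Rle_trans; [apply Cmod_minus_le|]. rewrite Cmod_1. lra. }
  assert (Q : forall t, 1/2 <= Re (rr u t) /\ 1/2 <= Cmod (rr u t) ^ 2 <= 3/2).
  { intros t. destruct (W t) as [W1 W2]. assert (S' := slit_rr u t S).
    assert (A := csqrt_Re_sqr _ S'). assert (B := csqrt_mod _ S'). assert (P := csqrt_Re_pos _ S').
    fold (rr u t) in A, B, P. 
    assert (W3 := Rle_trans _ _ _ (Rle_abs _) (re_le_Cmod (RtoC 1 - u * RtoC (sin t ^ 2))%C)).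
    split; [|lra]. apply Rnot_lt_le. intros Hlt. assert (Re (rr u t) ^ 2 < 1/2) by (simpl; nra). lra. }
  assert (Pp := PI_gt_3). split.
  - apply Rle_trans with (1/3 * (PI/2 - 0)); [lra|].
    replace (1/3 * (PI/2 - 0)) with (RInt (fun _ => 1/3) 0 (PI/2)) by (rewrite RInt_const; unfold scal; simpl; unfold mult; simpl; ring).
    apply RInt_le. { lra. } { apply ex_RInt_const. } { apply (ccontinuous_int _ 0 (PI/2) c). }
    intros t Ht. destruct (Q t) as [Q1 Q2]. rewrite Re_mult, Re_RtoC, Im_RtoC, Re_inv, <- Cmod_sqr.
    rewrite Rmult_0_l, Rminus_0_r, Rmult_1_l. apply Rmult_le_reg_r with (Cmod (rr u t) ^ 2); [lra|].
    unfold Rdiv. rewrite (Rmult_assoc (Re (rr u t))), Rinv_l by lra. lra.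
  - replace (2 * PI) with (PI * 2) by ring. apply CI_bound; auto. intros t Ht. destruct (Q t) as [Q1 Q2].
    rewrite Cmod_mult, Cmod_1, Rmult_1_l, Cmod_inv by (apply rr_neq_0; auto).
    assert (1/2 <= Cmod (rr u t)). { generalize (Rle_abs (Re (rr u t))) (re_le_Cmod (rr u t)). lra. }
    replace 2 with (/ (1/2)) by field. apply Rinv_le_contravar; lra.
Qed.

Lemma T1_cusp B : exists d, 0 < d /\ forall u, Om u -> Cmod u < d -> B < Im (T1 u).
Proof.
  assert (Pp := PI_gt_3). assert (P4 := PI_4).
  (* Re [y3] is at least N/4, Re [K] at least 1/2 and |K|^2 at most 4 PI^2, so the quotient in
     [T1_Im_lower] is at least |B| + 2. *)
  set (N := 8 * (4 * PI ^ 2) * (Rabs B + 2)).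
  assert (HN : 0 < N). { unfold N. generalize (Rabs_pos B). intros. assert (0 < PI ^ 2) by (apply pow_lt; lra). apply Rmult_lt_0_compat; lra. }
  set (d := Rmin (1/2) (exp (- N) ^ 2 / 8)).
  assert (Hd : 0 < d). { apply Rmin_pos; [lra|]. apply Rdiv_lt_0_compat; [|lra]. apply pow_lt, exp_pos. }
  assert (UH : forall u, 0 < Im u -> Cmod u < d -> B + 1 < Im (T1 u)).
  { intros u Hu Hm. assert (m1 := Rlt_le_trans _ _ _ Hm (Rmin_l _ _)). assert (m2 := Rlt_le_trans _ _ _ Hm (Rmin_r _ _)).
    eapply Rlt_le_trans; [|apply T1_Im_lower; auto].
    destruct (K_bounds u) as [k1 k2]; [lra|lra|]. assert (y := y3_Re_lower N u HN Hu m2).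
    assert (M : 0 < Cmod (K u)). { apply Cmod_pos, K_neq_0. right; cre; lra. }
    assert (0 < Cmod (K u) ^ 2) by (apply pow_lt; auto).
    apply Rmult_lt_reg_r with (Cmod (K u) ^ 2); auto.
    unfold Rdiv. rewrite (Rmult_assoc (Re (y3 u) * Re (K u))), Rinv_l, Rmult_1_r by lra.
    apply Rle_lt_trans with ((Rabs B + 1) * (4 * PI ^ 2)).
    - apply Rle_trans with ((Rabs B + 1) * Cmod (K u) ^ 2).
      + apply Rmult_le_compat_r; [lra|]. generalize (Rle_abs B). lra.
      + apply Rmult_le_compat_l; [generalize (Rabs_pos B); lra|].
        replace (4 * PI ^ 2) with ((2 * PI) ^ 2) by ring. apply pow_incr; lra.
    - apply Rlt_le_trans with (N / 4 * (1/2)).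
      + unfold N. generalize (Rabs_pos B). intros. assert (0 < PI ^ 2) by (apply pow_lt; lra). nra.
      + apply Rmult_le_compat; lra. }
  assert (NR : forall u, Im u <> 0 -> Cmod u < d -> B + 1 < Im (T1 u)).
  { intros u Hu Hm. destruct (Rtotal_order 0 (Im u)) as [L|[L|L]]; [auto|lra|].
    assert (X := UH (Cconj u)). rewrite T1_conj in X by (apply Om_nonreal; auto). rewrite Cmod_conj in X. cre_in X. 
    rewrite Ropp_involutive in X. apply X; auto. lra. }
  exists d. split; auto. intros u Hu Hm.
  (* The integral estimates concern nonreal u. A real u is reached by continuity from a nearby point
     above it, at the cost of the extra 1 in [B + 1]. *)
  destruct (cder_cont (fun _ => True) _ _ _ (cder_T1 u Hu) 1 Rlt_0_1) as [e [He F]].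
  destruct (Req_dec (Im u) 0) as [E|E]; [|generalize (NR u E Hm); lra].
  set (h := Rmin (e / 2) ((d - Cmod u) / 2)).
  assert (Hh : 0 < h) by (unfold h; apply Rmin_pos; lra).
  assert (h1 : h <= e / 2) by apply Rmin_l. assert (h2 : h <= (d - Cmod u) / 2) by apply Rmin_r.
  set (w := (u + Ci * RtoC h)%C).
  assert (Mh : Cmod (Ci * RtoC h) = h) by (rewrite Cmod_mult, Cmod_Ci, Cmod_R, Rabs_right; lra).
  assert (X1 : B + 1 < Im (T1 w)).
  { apply NR; unfold w. { cre. lra. } eapply Rle_lt_trans; [apply Cmod_triangle|]. rewrite Mh. lra. }
  assert (X2 : Cmod (T1 w - T1 u) < 1).
  { apply F; auto. unfold w. replace (u + Ci * RtoC h - u)%C with (Ci * RtoC h)%C by ring. rewrite Mh. lra. }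
  generalize (Im_lip (T1 w) (T1 u)) (Rle_abs (Im (T1 w) - Im (T1 u))). lra.
Qed.

(** * Integer Moebius transformations *)

(** The entries are real because the normalizing maps of pairs of geodesics below are not
    integral. *)
Definition mat := (R * R * R * R)%type.
Definition det (m : mat) : R := let '(a, b, c, d) := m in a * d - b * c.
Definition mob (m : mat) (t : C) : C := let '(a, b, c, d) := m in ((RtoC a * t + RtoC b) / (RtoC c * t + RtoC d))%C.
Definition mmul (m n : mat) : mat :=
  let '(a, b, c, d) := m in let '(e, f, g, h) := n in
  (a * e + b * g, a * f + b * h, c * e + d * g, c * f + d * h).
Definition madj (m : mat) : mat := let '(a, b, c, d) := m in (d, - b, - c, a).
Definition denom (m : mat) (t : C) : C := let '(a, b, c, d) := m in (RtoC c * t + RtoC d)%C.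

Lemma denom_neq_0 m t : det m = 1 -> 0 < Im t -> denom m t <> RtoC 0.
Proof.
  destruct m as [[[a b] c] d]. simpl. intros D Ht E.
  assert (E1 := f_equal Re E). assert (E2 := f_equal Im E). cre_in E1. cre_in E2.
  assert (c = 0) by nra. subst c. nra.
Qed.

Lemma mob_Im m t : det m = 1 -> 0 < Im t -> Im (mob m t) = Im t / Cmod (denom m t) ^ 2.
Proof.
  intros D Ht. assert (N := denom_neq_0 m t D Ht). destruct m as [[[a b] c] d]. unfold mob, denom in *. simpl in D.
  rewrite Im_div by auto. f_equal. cre. transitivity ((a * d - b * c) * Im t); [ring|]. rewrite D. ring.
Qed.

Lemma mob_Im_pos m t : det m = 1 -> 0 < Im t -> 0 < Im (mob m t).
Proof.
  intros D Ht. rewrite mob_Im by auto. apply Rdiv_lt_0_compat; auto. apply pow_lt, Cmod_pos, denom_neq_0; auto.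
Qed.

Lemma det_mmul m n : det (mmul m n) = det m * det n.
Proof. destruct m as [[[a b] c] d], n as [[[e f] g] h]. simpl. ring. Qed.
Lemma det_madj m : det (madj m) = det m.
Proof. destruct m as [[[a b] c] d]. simpl. ring. Qed.

Lemma mob_mmul m n t : det m = 1 -> det n = 1 -> 0 < Im t -> mob (mmul m n) t = mob m (mob n t).
Proof.
  intros Dm Dn Ht. assert (N1 := denom_neq_0 n t Dn Ht).
  assert (N2 := denom_neq_0 m _ Dm (mob_Im_pos n t Dn Ht)).
  assert (N3 := denom_neq_0 (mmul m n) t ltac:(rewrite det_mmul, Dm, Dn; ring) Ht).
  destruct m as [[[a b] c] d], n as [[[e f] g] h]. unfold mob, mmul, denom in *.
  rewrite !RtoC_plus, !RtoC_mult in *. field. repeat split; auto.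
  intros E. apply N3. rewrite <- E. ring.
Qed.

Lemma mob_adj_l m t : det m = 1 -> 0 < Im t -> mob (madj m) (mob m t) = t.
Proof.
  intros D Ht. rewrite <- mob_mmul; auto; [|rewrite det_madj; auto].
  destruct m as [[[a b] c] d]. unfold madj, mmul, mob. simpl in D.
  replace (d * a + - b * c) with 1 by lra. replace (d * b + - b * d) with 0 by ring.
  replace (- c * a + a * c) with 0 by ring. replace (- c * b + a * d) with 1 by lra.
  field.
Qed.

Lemma mob_adj_r m t : det m = 1 -> 0 < Im t -> mob m (mob (madj m) t) = t.
Proof.
  intros D Ht. assert (X := mob_adj_l (madj m) t). rewrite det_madj in X. specialize (X D Ht).
  replace (madj (madj m)) with m in X; auto. destruct m as [[[a b] c] d]. unfold madj.
  repeat f_equal; ring.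
Qed.

Definition SL (m : mat) : Prop := exists a b c d : Z,
  m = (IZR a, IZR b, IZR c, IZR d) /\ (a * d - b * c = 1)%Z.
(* the principal congruence subgroup of level 2 *)
Definition G2 (m : mat) : Prop := exists a b c d : Z,
  m = (IZR (1 + 2 * a), IZR (2 * b), IZR (2 * c), IZR (1 + 2 * d)) /\ ((1 + 2 * a) * (1 + 2 * d) - 4 * b * c = 1)%Z.

Lemma SL_det m : SL m -> det m = 1.
Proof.
  intros [a [b [c [d [-> E]]]]]. simpl. rewrite <- !mult_IZR, <- minus_IZR, E. reflexivity.
Qed.
Lemma G2_SL m : G2 m -> SL m.
Proof.
  intros [a [b [c [d [-> E]]]]]. exists (1 + 2 * a)%Z, (2 * b)%Z, (2 * c)%Z, (1 + 2 * d)%Z. split; auto. lia.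
Qed.
Lemma G2_det m : G2 m -> det m = 1.
Proof. intros; apply SL_det, G2_SL; auto. Qed.

Lemma SL_mul m n : SL m -> SL n -> SL (mmul m n).
Proof.
  intros [a [b [c [d [-> E]]]]] [e [f [g [h [-> F]]]]].
  exists (a*e+b*g)%Z, (a*f+b*h)%Z, (c*e+d*g)%Z, (c*f+d*h)%Z. split.
  - unfold mmul. rewrite !plus_IZR, !mult_IZR. reflexivity.
  - replace ((a*e+b*g)*(c*f+d*h) - (a*f+b*h)*(c*e+d*g))%Z with ((a*d-b*c)*(e*h-f*g))%Z by ring. rewrite E, F. ring.
Qed.
Lemma SL_adj m : SL m -> SL (madj m).
Proof.
  intros [a [b [c [d [-> E]]]]]. exists d, (-b)%Z, (-c)%Z, a. split; [|lia].
  unfold madj. rewrite !opp_IZR. reflexivity.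
Qed.
Lemma G2_mul m n : G2 m -> G2 n -> G2 (mmul m n).
Proof.
  intros [a [b [c [d [-> E]]]]] [e [f [g [h [-> F]]]]].
  exists (a + e + 2*a*e + 2*b*g)%Z, ((1+2*a)*f + b*(1+2*h))%Z, (c*(1+2*e) + (1+2*d)*g)%Z, (2*c*f + d + h + 2*d*h)%Z. split.
  - unfold mmul. rewrite <- !mult_IZR, <- !plus_IZR. apply f_equal2; [apply f_equal2; [apply f_equal2|]|]; apply f_equal; ring.
  - match goal with |- ?l = _ => replace l with (((1+2*a)*(1+2*d) - 4*b*c) * ((1+2*e)*(1+2*h) - 4*f*g))%Z by ring end.
    rewrite E, F. reflexivity.
Qed.
Lemma G2_adj m : G2 m -> G2 (madj m).
Proof.
  intros [a [b [c [d [-> E]]]]]. exists d, (-b)%Z, (-c)%Z, a. split; [|lia].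
  unfold madj. rewrite <- !opp_IZR. apply f_equal2; [apply f_equal2; [apply f_equal2|]|]; apply f_equal; ring.
Qed.
Lemma G2_one : G2 (1, 0, 0, 1).
Proof. exists 0%Z, 0%Z, 0%Z, 0%Z. split; auto. Qed.

Lemma mob_one t : mob (1, 0, 0, 1) t = t.
Proof. unfold mob. field. Qed.

(** The right side is |c t^2 + e t - b|^2 at t = x + i y. If the discriminant is nonnegative and c
    is not 0, the roots are real, and t is at distance at least y from each of them. *)
Lemma quadratic_lower c e b x y : 0 < y -> 0 <= e ^ 2 + 4 * b * c ->
  (c ^ 2) * y ^ 4 <= (c * (x ^ 2 - y ^ 2) + e * x - b) ^ 2 + (y * (2 * c * x + e)) ^ 2.
Proof.
  intros Hy Hd.
  set (X := (2 * c * x + e) ^ 2). set (k := e ^ 2 + 4 * b * c) in *.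
  assert (HX : 0 <= X) by apply pow2_ge_0. assert (Hy2 : 0 <= y ^ 2) by apply pow2_ge_0.
  assert (Hc2 : 0 <= c ^ 2) by apply pow2_ge_0.
  destruct (Req_dec c 0) as [E0|Nc].
  { rewrite E0 at 1. replace (0 ^ 2 * y ^ 4) with 0 by ring. apply Rplus_le_le_0_compat; apply pow2_ge_0. }
  assert (P : 0 < c ^ 2) by (simpl; nra).
  apply Rmult_le_reg_l with (16 * c ^ 2); [lra|].
  replace (16 * c ^ 2 * ((c * (x ^ 2 - y ^ 2) + e * x - b) ^ 2 + (y * (2 * c * x + e)) ^ 2))
    with ((X - 4 * c ^ 2 * y ^ 2 - k) ^ 2 + 16 * (c ^ 2 * y ^ 2) * X) by (unfold X, k; ring).
  replace (16 * c ^ 2 * (c ^ 2 * y ^ 4)) with ((4 * (c ^ 2 * y ^ 2)) ^ 2) by ring.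
  set (q := c ^ 2 * y ^ 2). assert (Hq : 0 <= q) by (apply Rmult_le_pos; auto).
  replace (4 * c ^ 2 * y ^ 2) with (4 * q) by (unfold q; ring).
  replace ((X - 4 * q - k) ^ 2 + 16 * q * X) with ((X + 4 * q - k) ^ 2 + 16 * q * k) by ring.
  destruct (Rle_dec k (4 * q)).
  - assert ((4 * q - k) ^ 2 <= (X + 4 * q - k) ^ 2) by (apply pow_incr; lra). nra.
  - generalize (pow2_ge_0 (X + 4 * q - k)). nra.
Qed.

(* Elements of Gamma(2) have trace 2 mod 4, hence no elliptic elements. *)
Lemma G2_displacement m t : G2 m -> 0 < Im t ->
  mob m t = t \/ 4 <= Cmod (mob m t - t) ^ 2 \/ 4 * Im t ^ 3 * Im (mob m t) <= Cmod (mob m t - t) ^ 2.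
Proof.
  intros HG Ht. assert (D := G2_det m HG). assert (N := denom_neq_0 m t D Ht).
  assert (PI' := mob_Im m t D Ht).
  destruct HG as [a [b [c [d [-> E]]]]].
  (* For c = 0 the transformation is a translation by an even integer; otherwise the displacement is
     the quadratic of [quadratic_lower] divided by the denominator. *)
  destruct (Z.eq_dec c 0) as [->|Nc].
  - assert (Hs : (1 + 2 * a = 1 /\ 1 + 2 * d = 1 \/ 1 + 2 * a = -1 /\ 1 + 2 * d = -1)%Z).
    { assert (A : ((1 + 2 * a) * (1 + 2 * d) = 1)%Z) by lia. apply Z.eq_mul_1 in A. lia. }
    assert (X : exists k, mob (IZR (1 + 2 * a), IZR (2 * b), IZR (2 * 0), IZR (1 + 2 * d)) t = (t + RtoC (IZR (2 * k)))%C /\ (k = 0 -> b = 0)%Z).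
    { destruct Hs as [[-> ->]|[-> ->]].
      { exists b; split; [|lia]; unfold mob; simpl (2 * 0)%Z. field. }
      exists (-b)%Z; split; [|lia]; unfold mob; simpl (2 * 0)%Z.
      replace (2 * - b)%Z with (- (2 * b))%Z by ring. rewrite opp_IZR, RtoC_opp.
      replace (RtoC 0 * t + RtoC (-1))%C with (- RtoC 1)%C by (apply C_ext; cre; ring).
      replace (RtoC (-1)) with (- RtoC 1)%C by (apply C_ext; cre; ring). field. }
    destruct X as [k [-> Hk]]. replace (t + RtoC (IZR (2 * k)) - t)%C with (RtoC (IZR (2 * k))) by ring.
    rewrite Cmod_R. destruct (Z.eq_dec k 0) as [->|Nk].
    + left. simpl (2 * 0)%Z. ring.
    + right. left. rewrite pow2_abs. replace 4 with (IZR 4) by reflexivity. rewrite <- Rsqr_pow2. unfold Rsqr. rewrite <- mult_IZR.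
      apply IZR_le. assert (1 <= k * k)%Z by (destruct (Z_lt_le_dec k 0); nia). nia.
  - right. right. unfold mob at 2. unfold denom in *.
    set (A := IZR (1 + 2 * a)) in *. set (B := IZR (2 * b)) in *. set (C0 := IZR (2 * c)) in *. set (D0 := IZR (1 + 2 * d)) in *.
    assert (Q : ((RtoC A * t + RtoC B) / (RtoC C0 * t + RtoC D0) - t)%C = (- (RtoC C0 * t * t + RtoC (D0 - A) * t - RtoC B) / (RtoC C0 * t + RtoC D0))%C).
    { rewrite RtoC_minus. field. auto. }
    rewrite Q, Cmod_div, Cmod_opp by auto. rewrite PI'.
    assert (PD : 0 < Cmod (RtoC C0 * t + RtoC D0) ^ 2) by (apply pow_lt, Cmod_pos; auto).
    replace ((Cmod (RtoC C0 * t * t + RtoC (D0 - A) * t - RtoC B) / Cmod (RtoC C0 * t + RtoC D0)) ^ 2)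
      with (Cmod (RtoC C0 * t * t + RtoC (D0 - A) * t - RtoC B) ^ 2 / Cmod (RtoC C0 * t + RtoC D0) ^ 2).
    2: { field. apply Rgt_not_eq, Cmod_pos; auto. }
    replace (4 * Im t ^ 3 * (Im t / Cmod (RtoC C0 * t + RtoC D0) ^ 2)) with (4 * Im t ^ 4 / Cmod (RtoC C0 * t + RtoC D0) ^ 2).
    2: { field. apply Rgt_not_eq, Cmod_pos; auto. }
    unfold Rdiv. apply Rmult_le_compat_r. { left. apply Rinv_0_lt_compat; auto. }
    rewrite (Cmod_sqr (_ - _)%C).
    replace (Re (RtoC C0 * t * t + RtoC (D0 - A) * t - RtoC B)%C) with (C0 * (Re t ^ 2 - Im t ^ 2) + (D0 - A) * Re t - B) by (cre; ring).
    replace (Im (RtoC C0 * t * t + RtoC (D0 - A) * t - RtoC B)%C) with (Im t * (2 * C0 * Re t + (D0 - A))) by (cre; ring).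
    eapply Rle_trans; [|apply quadratic_lower; auto].
    + apply Rmult_le_compat_r; [apply pow_le; lra|]. unfold C0. rewrite <- Rsqr_pow2. unfold Rsqr. rewrite <- mult_IZR.
      apply (IZR_le 4). assert (1 <= c * c)%Z by (destruct (Z_lt_le_dec c 0); nia). nia.
    (* The discriminant is the squared trace minus 4. The determinant makes a + d even, so the trace
       is 2 mod 4 and has modulus at least 2. *)
    + assert (Z1 : (4 <= (1 + 2 * d + (1 + 2 * a)) ^ 2)%Z).
      { assert (exists k, a + d = 2 * k)%Z. { exists (b * c - a * d)%Z. lia. } destruct H as [k Hk].
        replace (1 + 2 * d + (1 + 2 * a))%Z with (2 + 4 * k)%Z by lia. nia. }
      simpl in D. fold A B C0 D0 in D.
      assert (Z2 : 4 <= (D0 + A) ^ 2).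
      { unfold D0, A. rewrite <- plus_IZR. rewrite <- Rsqr_pow2. unfold Rsqr. rewrite <- mult_IZR. apply (IZR_le 4). rewrite Z.pow_2_r in Z1. lia. }
      nra.
Qed.

Lemma cder_mob m t : det m = 1 -> 0 < Im t -> exists l, cder (mob m) t l.
Proof.
  intros D Ht. assert (N := denom_neq_0 m t D Ht). destruct m as [[[a b] c] d]. unfold mob, denom in *.
  eexists. apply gder_div; auto; apply gder_plus; try apply gder_const; apply gder_scal, gder_id.
Qed.

(** If c = 0 the height is unchanged; otherwise |c t + d| is at least Im t, and the new height is at
    most 1 / Im t. *)
Lemma SL_Im_bound m t B : SL m -> 0 < B -> / B <= Im t <= B -> Im (mob m t) <= B.
Proof.
  intros HS HB Ht. assert (IB : 0 < / B) by (apply Rinv_0_lt_compat; auto).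
  assert (D := SL_det m HS). rewrite mob_Im by (auto; lra).
  assert (N := denom_neq_0 m t D ltac:(lra)).
  destruct HS as [a [b [c [d [-> E]]]]]. unfold denom in *.
  assert (P : 0 < Cmod (RtoC (IZR c) * t + RtoC (IZR d)) ^ 2) by (apply pow_lt, Cmod_pos; auto).
  apply Rmult_le_reg_r with (Cmod (RtoC (IZR c) * t + RtoC (IZR d)) ^ 2); auto.
  unfold Rdiv. rewrite Rmult_assoc, Rinv_l, Rmult_1_r by lra.
  rewrite Cmod_sqr.
  replace (Re (RtoC (IZR c) * t + RtoC (IZR d))%C) with (IZR c * Re t + IZR d) by (cre; ring).
  replace (Im (RtoC (IZR c) * t + RtoC (IZR d))%C) with (IZR c * Im t) by (cre; ring).
  assert (S1 := pow2_ge_0 (IZR c * Re t + IZR d)).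
  destruct (Z.eq_dec c 0) as [->|Nc].
  - assert (Ed : (d = 1 \/ d = -1)%Z).
    { assert (X : (d * a = 1)%Z) by lia. apply Z.eq_mul_1 in X. auto. }
    apply Rle_trans with (B * 1); [lra|]. apply Rmult_le_compat_l; [lra|].
    destruct Ed as [->| ->]; lra.
  - assert (C2 : 1 <= IZR c ^ 2).
    { rewrite <- Rsqr_pow2. unfold Rsqr. rewrite <- mult_IZR. apply (IZR_le 1).
      destruct (Z_lt_le_dec c 0); nia. }
    assert (X : Im t <= B * Im t ^ 2).
    { replace (B * Im t ^ 2) with ((B * Im t) * Im t) by ring. assert (1 <= B * Im t).
      { apply Rmult_le_reg_l with (/ B); auto. rewrite <- Rmult_assoc, Rinv_l by lra. lra. }
      nra. }
    assert (Y : Im t ^ 2 <= (IZR c * Im t) ^ 2).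
    { replace ((IZR c * Im t) ^ 2) with (IZR c ^ 2 * Im t ^ 2) by ring. generalize (pow2_ge_0 (Im t)). nra. }
    nra.
Qed.

(** * Charts of the twice punctured plane and the covering relation *)

(** [Om] misses the real rays beyond 0 and 1. The involution of [cP] fixes 0 and exchanges 1 with
    infinity, that of [cI] fixes 1 and exchanges 0 with infinity; they carry the negative axis and
    (1, +oo) into (0, 1). *)
Inductive chart := cid | cP | cI.

Definition cmap (g : chart) (u : C) : C :=
  match g with cid => u | cP => (u / (u - RtoC 1))%C | cI => (/ u)%C end.
(** The change of the period ratio under [cmap g] over the upper half plane, so that all three
    sheets coincide with [T1] there. *)
Definition rho (g : chart) : mat :=
  match g with cid => (1, 0, 0, 1) | cP => (1, 1, 0, 1) | cI => (1, 0, 1, 1) end.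
Definition punctured (u : C) : Prop := u <> RtoC 0 /\ u <> RtoC 1.

Lemma rho_SL g : SL (rho g).
Proof.
  destruct g; [exists 1%Z, 0%Z, 0%Z, 1%Z|exists 1%Z, 1%Z, 0%Z, 1%Z|exists 1%Z, 0%Z, 1%Z, 1%Z]; split; auto.
Qed.
Lemma rho_det g : det (rho g) = 1.
Proof. apply SL_det, rho_SL. Qed.

Lemma minus_1_neq u : u <> RtoC 1 -> (u - RtoC 1)%C <> RtoC 0.
Proof. intros H E. apply H, Cminus_eq_0, E. Qed.

Lemma cmap_punctured g u : punctured u -> punctured (cmap g u).
Proof.
  intros [H0 H1]. assert (N := minus_1_neq u H1). destruct g; simpl; split; auto; intros E.
  - apply H0. replace u with (u / (u - RtoC 1) * (u - RtoC 1))%C by (field; auto). rewrite E. ring.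
  - assert (X : (u - RtoC 1)%C = u).
    { replace u with (u / (u - RtoC 1) * (u - RtoC 1))%C at 2 by (field; auto). rewrite E. ring. }
    apply (f_equal Re) in X. cre_in X. lra.
  - apply (Cinv_neq_0 u); auto.
  - apply H1. replace u with (/ / u)%C by (field; auto). rewrite E. field.
Qed.

Lemma cmap_invol g u : punctured u -> cmap g (cmap g u) = u.
Proof.
  intros [H0 H1]. assert (N := minus_1_neq u H1). destruct g; simpl; auto.
  - field. split; auto. intros E. apply (f_equal Re) in E. cre_in E. lra.
  - field. auto.
Qed.

Lemma cder_cmap g u : punctured u -> exists l, cder (cmap g) u l.
Proof.
  intros [H0 H1]. assert (N := minus_1_neq u H1). destruct g; simpl; eexists.
  - apply gder_id.
  - apply gder_div; [exact N|apply gder_id|apply gder_minus; [apply gder_id|apply gder_const]].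
  - apply cder_inv; auto.
Qed.

Lemma Om_punctured u : Om u -> punctured u.
Proof.
  intros H. destruct (Om_neq u H) as [A B]. split; auto. intros E. apply B. rewrite E. ring.
Qed.

Lemma real_RtoC u : Im u = 0 -> u = RtoC (Re u).
Proof. intros. apply C_ext; cre; auto. Qed.

Lemma cmap_real g u : punctured u -> Im u = 0 -> cmap g u = RtoC (match g with cid => Re u | cP => Re u / (Re u - 1) | cI => / Re u end).
Proof.
  intros [H0 H1] E. set (x := Re u). assert (X : u = RtoC x) by (apply real_RtoC; auto). rewrite X in *. destruct g; simpl; auto.
  - rewrite RtoC_div, RtoC_minus; auto. intros Z. apply H1. f_equal. lra.
  - rewrite RtoC_inv; auto. intros Z. apply H0. rewrite Z; auto.
Qed.

Definition real_chart (u : C) : chart :=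
  if Req_EM_T (Im u) 0 then (if Rle_dec (Re u) 0 then cP else if Rle_dec 1 (Re u) then cI else cid) else cid.

Lemma real_chart_Om u : punctured u -> Om (cmap (real_chart u) u).
Proof.
  intros Hp. unfold real_chart. destruct (Req_EM_T (Im u) 0) as [E|E]; [|apply Om_nonreal; auto].
  assert (x0 : Re u <> 0) by (intros Z; apply (proj1 Hp); rewrite (real_RtoC u E), Z; auto).
  assert (x1 : Re u <> 1) by (intros Z; apply (proj2 Hp); rewrite (real_RtoC u E), Z; auto).
  set (x := Re u) in *.
  destruct (Rle_dec x 0); [|destruct (Rle_dec 1 x)];
  rewrite (cmap_real _ u Hp E); fold x; apply Om_interval; rewrite Re_RtoC.
  - replace (x / (x - 1)) with ((- x) / (1 - x)) by (field; lra). split.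
    + apply Rdiv_lt_0_compat; lra.
    + apply Rmult_lt_reg_r with (1 - x); [lra|]. unfold Rdiv. rewrite Rmult_assoc, Rinv_l by lra. lra.
  - split. { apply Rinv_0_lt_compat; lra. } rewrite <- Rinv_1. apply Rinv_lt_contravar; lra.
  - lra.
Qed.

Lemma chart_exists u : punctured u -> exists g, Om (cmap g u).
Proof. intros Hp. exists (real_chart u). apply real_chart_Om; auto. Qed.

(** Each of the intervals (-oo, 0), (0, 1), (1, +oo) is mapped into [Om] by exactly one of the
    charts, so compatibility of charts is a question about nonreal points only. *)
Lemma chart_real_unique g g' u : punctured u -> Im u = 0 -> Om (cmap g u) -> Om (cmap g' u) -> g = g'.
Proof.
  intros Hp E.
  assert (K : forall g, Om (cmap g u) -> match g with cid => 0 < Re u < 1 | cP => Re u < 0 | cI => 1 < Re u end).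
  { intros h O. rewrite (cmap_real h u Hp E) in O. apply Om_real in O; [|reflexivity]. rewrite Re_RtoC in O.
    destruct Hp as [H0 H1]. destruct h; auto.
    - assert (N : Re u - 1 <> 0). { intros Z. apply H1. rewrite (real_RtoC u E). f_equal; lra. }
      assert (X : Re u = Re u / (Re u - 1) * (Re u - 1)) by (field; auto).
      assert (Y : Re u / (Re u - 1) = 1 + / (Re u - 1)) by (field; auto).
      assert (Z : / (Re u - 1) < 0) by lra.
      assert (Re u - 1 < 0). { apply Rnot_le_lt. intros Q. assert (0 < / (Re u - 1)) by (apply Rinv_0_lt_compat; lra). lra. }
      nra.
    - assert (N : Re u <> 0). { intros Z. apply H0. rewrite (real_RtoC u E). f_equal; lra. }
      assert (P : 0 < Re u). { rewrite <- (Rinv_inv (Re u)). apply Rinv_0_lt_compat; lra. }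
      assert (X : Re u * / Re u = 1) by (field; auto). nra. }
  intros O O'. apply K in O. apply K in O'. destruct g, g'; auto; lra.
Qed.

Definition sheet (g : chart) (u : C) : C := mob (rho g) (T1 (cmap g u)).

Lemma sheet_Im g u : Om (cmap g u) -> 0 < Im (sheet g u).
Proof. intros H. apply mob_Im_pos; [apply rho_det|apply T1_Im_pos; auto]. Qed.

Lemma Im_inv_nonreal u : Im u <> 0 -> Im (/ u)%C <> 0.
Proof.
  intros H. rewrite Im_inv. unfold Rdiv.
  apply Rmult_integral_contrapositive. split; [lra|]. apply Rinv_neq_0_compat.
  assert (0 < Im u ^ 2) by (simpl; nra). generalize (pow2_ge_0 (Re u)). lra.
Qed.

Lemma Om_inv_nonreal u : Im u <> 0 -> Om (/ u)%C.
Proof. intros H. apply Om_nonreal, Im_inv_nonreal, H. Qed.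

Lemma T1_pfaff_lower u : Im u < 0 -> T1 (u / (u - RtoC 1))%C = (T1 u + RtoC 1)%C.
Proof.
  intros H. assert (O : Om (Cconj u)) by (apply Om_nonreal; cre; lra).
  assert (X := T1_pfaff (Cconj u) ltac:(cre; lra)).
  assert (N : (u - RtoC 1)%C <> RtoC 0) by (apply Cneq_Im; cre; lra).
  replace (Cconj u / (Cconj u - RtoC 1))%C with (Cconj (u / (u - RtoC 1)))%C in X.
  2: { rewrite Cdiv_conj, Cminus_conj by auto. f_equal. f_equal. f_equal. apply C_ext; cre; ring. }
  rewrite !T1_conj in X.
  - apply (f_equal Cconj) in X. apply C_ext; [apply (f_equal Re) in X|apply (f_equal Im) in X]; cre_in X; cre; lra.
  - apply Om_nonreal; lra.
  - apply Om_nonreal. replace (u / (u - RtoC 1))%C with (RtoC 1 + / (u - RtoC 1))%C by (field; auto).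
    rewrite Im_plus, Im_RtoC, Rplus_0_l. apply Im_inv_nonreal. cre. lra.
Qed.

Lemma T1_neq_0 u : Om u -> T1 u <> RtoC 0.
Proof. intros H. apply Cneq_Im. generalize (T1_Im_pos u H). cre. lra. Qed.

(* 1/u is 1 - P(1 - u) with P(u) = u/(u - 1) *)
Lemma T1_inv u s : Im u <> 0 -> T1 ((RtoC 1 - u) / ((RtoC 1 - u) - RtoC 1))%C = (T1 (RtoC 1 - u) + RtoC s)%C ->
  Om (/ u)%C -> (RtoC s - / T1 u)%C <> RtoC 0 /\ T1 (/ u)%C = (- / (RtoC s - / T1 u))%C.
Proof.
  intros H E O. assert (Ou := Om_nonreal u H). rewrite T1_flip in E by auto.
  assert (N : u <> RtoC 0) by (apply Om_punctured; auto).
  assert (E2 : ((RtoC 1 - u) / ((RtoC 1 - u) - RtoC 1))%C = (RtoC 1 - / u)%C).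
  { field. split; auto. intros Z. apply N. replace u with (- (RtoC 1 - u - RtoC 1))%C by ring. rewrite Z. ring. }
  rewrite E2 in E. assert (X := T1_neq_0 _ (Om_flip _ O)). rewrite E in X.
  assert (E3 : (- / T1 u + RtoC s)%C = (RtoC s - / T1 u)%C) by ring. rewrite E3 in *.
  split; auto. rewrite <- E, <- T1_flip by (apply Om_flip; auto). f_equal. ring.
Qed.

Lemma sheet_upper g u : 0 < Im u -> sheet g u = T1 u.
Proof.
  intros H. assert (P := T1_Im_pos u (Om_nonreal u ltac:(lra))). assert (N := T1_neq_0 u (Om_nonreal u ltac:(lra))).
  unfold sheet. destruct g; simpl cmap.
  - apply mob_one.
  - rewrite T1_pfaff by auto. unfold mob, rho. field.
  - destruct (T1_inv u 1) as [X ->]; [lra| |apply Om_inv_nonreal; lra|].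
    { apply T1_pfaff_lower. cre. lra. }
    assert (N1 : (T1 u - RtoC 1)%C <> RtoC 0) by (apply Cneq_Im; cre; lra).
    unfold mob, rho. field. repeat split; auto.
    intros Z. apply (f_equal Re) in Z. cre_in Z. lra.
Qed.

(** Continuing from above across (-oo, 0) or (1, +oo) instead of (0, 1) amounts to circling a
    puncture; the matrices generating the monodromy appear. *)
Lemma sheet_lower g u : Im u < 0 -> sheet g u = mob (match g with cid => (1,0,0,1) | cP => (1,2,0,1) | cI => (1,0,2,1) end) (T1 u).
Proof.
  intros H. assert (P := T1_Im_pos u (Om_nonreal u ltac:(lra))). assert (N := T1_neq_0 u (Om_nonreal u ltac:(lra))).
  unfold sheet. destruct g; simpl cmap; auto.
  - rewrite T1_pfaff_lower by auto. unfold mob, rho. replace (RtoC 2) with (RtoC 1 + RtoC 1)%C by (rewrite <- RtoC_plus; f_equal; ring). field.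
  - destruct (T1_inv u (-1)) as [X ->]; [lra| |apply Om_inv_nonreal; lra|].
    { rewrite T1_pfaff by (cre; lra). apply C_ext; cre; ring. }
    assert (N1 : (T1 u + RtoC 1)%C <> RtoC 0) by (apply Cneq_Im; cre; lra).
    assert (N2 : (RtoC 2 * T1 u + RtoC 1)%C <> RtoC 0) by (apply Cneq_Im; cre; lra).
    replace (RtoC (-1)) with (- RtoC 1)%C in * by (apply C_ext; cre; ring).
    assert (N3 : (- T1 u - RtoC 1)%C <> RtoC 0) by (apply Cneq_Im; cre; lra).
    unfold mob, rho. replace (RtoC 2) with (RtoC 1 + RtoC 1)%C in * by (rewrite <- RtoC_plus; f_equal; ring).
    field. repeat split; auto.
    + intros Z. apply N2. rewrite <- Z. ring.
    + intros Z. apply N3. rewrite <- Z. ring.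
    + intros Z. apply N2. replace (RtoC 0) with (- RtoC 0)%C by ring. rewrite <- Z. ring.
Qed.

Lemma sheet_nonreal g u : Im u <> 0 -> exists m, G2 m /\ sheet g u = mob m (T1 u).
Proof.
  intros H. destruct (Rtotal_order 0 (Im u)) as [L|[L|L]]; [|lra|].
  - exists (1,0,0,1). split; [apply G2_one|]. rewrite sheet_upper, mob_one; auto.
  - eexists. split; [|apply sheet_lower; auto]. destruct g; [apply G2_one| |].
    + exists 0%Z, 1%Z, 0%Z, 0%Z. split; auto.
    + exists 0%Z, 0%Z, 1%Z, 0%Z. split; auto.
Qed.

(* [Cov u tau]: tau is a period ratio of the curve y^2 = x(x-1)(x-u) for some marking of level 2 *)
Definition Cov (u t : C) : Prop :=
  punctured u /\ exists g m, G2 m /\ Om (cmap g u) /\ t = mob m (sheet g u).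

Lemma Cov_Im u t : Cov u t -> 0 < Im t.
Proof. intros [_ [g [m [Hm [O ->]]]]]. apply mob_Im_pos; [apply G2_det; auto|apply sheet_Im; auto]. Qed.

Lemma Cov_chart g u t : Cov u t -> Om (cmap g u) -> exists m, G2 m /\ t = mob m (sheet g u).
Proof.
  intros [Hp [h [m [Hm [O ->]]]]] O'. destruct (Req_dec (Im u) 0) as [E|E].
  - rewrite (chart_real_unique h g u Hp E O O'). exists m; auto.
  - destruct (sheet_nonreal h u E) as [m1 [G1 E1]]. destruct (sheet_nonreal g u E) as [m2 [G' E2]].
    assert (P := T1_Im_pos u (Om_nonreal u E)).
    exists (mmul m (mmul m1 (madj m2))). split.
    { repeat apply G2_mul; auto. apply G2_adj; auto. }
    rewrite E1, E2. rewrite mob_mmul; try apply G2_det; auto.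
    2: { apply G2_mul; auto. apply G2_adj; auto. } 2: { apply mob_Im_pos; auto. apply G2_det; auto. }
    rewrite mob_mmul; try apply G2_det; auto; [| apply G2_adj; auto|apply mob_Im_pos; auto; apply G2_det; auto].
    rewrite mob_adj_l; auto. apply G2_det; auto.
Qed.

Lemma Cov_sheet g u : punctured u -> Om (cmap g u) -> Cov u (sheet g u).
Proof. intros H O. split; [exact H|]. exists g, (1,0,0,1). split; [apply G2_one|]. rewrite mob_one; auto. Qed.

Lemma Cov_act u t m : Cov u t -> G2 m -> Cov u (mob m t).
Proof.
  intros [Hp [h [n [Hn [O ->]]]]] Hm. split; auto. exists h, (mmul m n). split; [apply G2_mul; auto|]. split; auto.
  rewrite mob_mmul; auto; try apply G2_det; auto. apply sheet_Im; auto.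
Qed.

Lemma Cov_orbit u t t' : Cov u t -> Cov u t' -> exists m, G2 m /\ t' = mob m t.
Proof.
  intros H H'. destruct H as [Hp [h [n [Hn [O E]]]]]. destruct (Cov_chart h u t' H' O) as [m [Hm E']].
  exists (mmul m (madj n)). split; [apply G2_mul; auto; apply G2_adj; auto|].
  assert (S := sheet_Im h u O).
  assert (It : 0 < Im t). { rewrite E. apply mob_Im_pos; auto. apply G2_det; auto. }
  rewrite mob_mmul; auto; try (apply G2_det; auto). { rewrite E', E. rewrite mob_adj_l; auto. apply G2_det; auto. }
  apply G2_adj; auto.
Qed.

Lemma Cov_separated : separated Cov.
Proof.
  intros u0 t0 H0. assert (P := Cov_Im _ _ H0). set (y := Im t0 / 2). assert (Hy : 0 < y) by (unfold y; lra).
  assert (y2 : 0 < y ^ 2) by (apply pow_lt; auto).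
  (* Distinct points of a fibre above height [y] are at distance at least 2 or at least 2 y^2 by
     [G2_displacement]. The radius is at most half of either bound, and at most [y] so that both
     points stay above that height. *)
  exists (Rmin (Rmin 1 y) (y ^ 2)). split. { repeat apply Rmin_pos; lra. }
  intros u t t' _ H H' Ht Ht'.
  assert (A1 := Rlt_le_trans _ _ _ Ht (Rmin_l _ _)). assert (A2 := Rlt_le_trans _ _ _ Ht (Rmin_r _ _)).
  assert (B1 := Rlt_le_trans _ _ _ Ht' (Rmin_l _ _)). assert (B2 := Rlt_le_trans _ _ _ Ht' (Rmin_r _ _)).
  assert (A3 := Rlt_le_trans _ _ _ A1 (Rmin_l _ _)). assert (A4 := Rlt_le_trans _ _ _ A1 (Rmin_r _ _)).
  assert (B3 := Rlt_le_trans _ _ _ B1 (Rmin_l _ _)). assert (B4 := Rlt_le_trans _ _ _ B1 (Rmin_r _ _)).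
  assert (I1 : y < Im t). { generalize (Im_lip t t0) (Rle_abs (- (Im t - Im t0))). rewrite Rabs_Ropp. unfold y in *. lra. }
  assert (I2 : y < Im t'). { generalize (Im_lip t' t0) (Rle_abs (- (Im t' - Im t0))). rewrite Rabs_Ropp. unfold y in *. lra. }
  assert (D : Cmod (t' - t) <= Cmod (t' - t0) + Cmod (t - t0)).
  { replace (t' - t)%C with ((t' - t0) - (t - t0))%C by ring. apply Cmod_minus_le. }
  assert (P0 := Cmod_ge_0 (t' - t)).
  destruct (Cov_orbit u t t' H H') as [m [Hm E]]. rewrite E in *.
  destruct (G2_displacement m t Hm ltac:(lra)) as [Q|[Q|Q]]; auto; exfalso.
  - simpl in Q. nra.
  - assert (y ^ 3 <= Im t ^ 3) by (apply pow_incr; lra). assert (0 < y ^ 3) by (apply pow_lt; auto).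
    assert (4 * y ^ 3 * y <= 4 * Im t ^ 3 * Im (mob m t)) by (apply Rmult_le_compat; lra).
    assert (Cmod (mob m t - t) ^ 2 < (2 * y ^ 2) ^ 2). { assert (Z : Cmod (mob m t - t) * Cmod (mob m t - t) < (2 * y ^ 2) * (2 * y ^ 2)) by (apply Rmult_le_0_lt_compat; lra). lra. }
    assert ((2 * y ^ 2) ^ 2 = 4 * y ^ 3 * y) by ring. lra.
Qed.

Lemma slit_open w : slit w -> exists r, 0 < r /\ forall z, Cmod (z - w) < r -> slit z.
Proof.
  intros S. assert (P := csqrt_Re_pos w S). exists (Re (csqrt w) ^ 2). split; [apply pow_lt; auto|].
  intros z Hz. replace z with (w + (z - w))%C by ring. apply slit_near with (Re (csqrt w)); auto. lra.
Qed.

Lemma Om_open u : Om u -> exists r, 0 < r /\ forall w, Cmod (w - u) < r -> Om w.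
Proof.
  intros [A B]. destruct (slit_open _ A) as [r [Hr F]]. destruct (slit_open _ B) as [s [Hs G]].
  exists (Rmin r s). split; [apply Rmin_pos; auto|]. intros w Hw. split.
  - apply F. eapply Rlt_le_trans; [apply Hw|apply Rmin_l].
  - apply G. replace (RtoC 1 - w - (RtoC 1 - u))%C with (- (w - u))%C by ring. rewrite Cmod_opp.
    eapply Rlt_le_trans; [apply Hw|apply Rmin_r].
Qed.

Lemma chart_near g u v r : punctured u -> v = cmap g u -> 0 < r ->
  exists s, 0 < s /\ forall w, Cmod (w - u) < s -> punctured w /\ Cmod (cmap g w - v) < r.
Proof.
  intros [H0 H1] -> Hr. destruct (cder_cmap g u (conj H0 H1)) as [l Hl].
  destruct (cder_cont (fun _ => True) _ _ _ Hl r Hr) as [d [Hd F]].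
  assert (P0 := Cmod_pos _ H0). assert (P1 := Cmod_pos _ (minus_1_neq _ H1)).
  exists (Rmin d (Rmin (Cmod u) (Cmod (u - RtoC 1)))). split; [repeat apply Rmin_pos; auto|].
  intros w Hw. assert (A := Rlt_le_trans _ _ _ Hw (Rmin_l _ _)). assert (B := Rlt_le_trans _ _ _ Hw (Rmin_r _ _)).
  assert (B1 := Rlt_le_trans _ _ _ B (Rmin_l _ _)). assert (B2 := Rlt_le_trans _ _ _ B (Rmin_r _ _)).
  split; [split|auto]; intros E; rewrite E, Cmod_minus_sym in *.
  - replace (u - RtoC 0)%C with u in B1 by ring. lra.
  - lra.
Qed.

Lemma cder_sheet g u : punctured u -> Om (cmap g u) -> exists l, cder (sheet g) u l.
Proof.
  intros Hp O. destruct (cder_cmap g u Hp) as [l1 D1].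
  destruct (cder_mob (rho g) _ (rho_det g) (T1_Im_pos _ O)) as [l2 D2].
  eexists. apply (gder_comp _ (fun w => T1 (cmap g w)) (mob (rho g))); [|exact D2].
  apply (gder_comp _ (cmap g) T1); [exact D1|]. apply cder_T1; auto.
Qed.

Lemma Cov_sectioned : locally_sectioned punctured Cov.
Proof.
  intros u0 Hp. destruct (chart_exists u0 Hp) as [g O]. destruct (Om_open _ O) as [r [Hr F]].
  destruct (chart_near g u0 _ r Hp eq_refl Hr) as [s [Hs G]].
  exists s. split; auto. intros u1 t1 H1 C1. destruct (G u1 H1) as [p1 q1].
  destruct (Cov_chart g u1 t1 C1 (F _ q1)) as [m [Hm E]].
  exists (fun u => mob m (sheet g u)). split; [symmetry; exact E|]. intros u Hu. destruct (G u Hu) as [p q]. split.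
  - apply Cov_act; [|exact Hm]. apply Cov_sheet; [exact p|apply F; exact q].
  - destruct (cder_sheet g u p (F _ q)) as [l1 D1].
    destruct (cder_mob m _ (G2_det _ Hm) (sheet_Im g u (F _ q))) as [l2 D2].
    eexists. apply (gder_comp _ (sheet g) (mob m)); eauto.
Qed.

(** [T1] of the chart coordinate and -1 over it, which is [T1] of the flipped coordinate, are both
    images of [t] under integral matrices of determinant 1. *)
Lemma chart_height g u t B : Om (cmap g u) -> 0 < B -> Cov u t -> / B <= Im t <= B ->
  Im (T1 (cmap g u)) <= B /\ Im (T1 (RtoC 1 - cmap g u)%C) <= B.
Proof.
  intros O HB HC Ht. destruct (Cov_chart g u t HC O) as [m [Hm E]].
  assert (P := T1_Im_pos _ O). assert (IB : 0 < / B) by (apply Rinv_0_lt_compat; auto).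
  set (n := mmul m (rho g)).
  assert (Sn : SL n) by (apply SL_mul; [apply G2_SL; auto|apply rho_SL]).
  assert (En : t = mob n (T1 (cmap g u))).
  { rewrite E. unfold sheet, n. rewrite mob_mmul; auto; [apply G2_det; auto|apply rho_det]. }
  assert (Et : T1 (cmap g u) = mob (madj n) t). { rewrite En, mob_adj_l; auto. apply SL_det; auto. }
  split.
  - rewrite Et. apply SL_Im_bound; auto. apply SL_adj; auto.
  - assert (SS : SL (0, -1, 1, 0)) by (exists 0%Z, (-1)%Z, 1%Z, 0%Z; split; auto).
    assert (X : T1 (RtoC 1 - cmap g u)%C = mob (mmul (0, -1, 1, 0) (madj n)) t).
    { rewrite mob_mmul; try (apply SL_det; auto; fail); [|apply SL_det, SL_adj; auto|lra].
      rewrite <- Et, T1_flip by auto. unfold mob.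
      replace (RtoC (-1)) with (- RtoC 1)%C by (apply C_ext; cre; ring).
      field. apply T1_neq_0; auto. }
    rewrite X. apply SL_Im_bound; auto. apply SL_mul; auto. apply SL_adj; auto.
Qed.

Lemma not_Om_real u : ~ Om u -> Im u = 0 /\ (Re u <= 0 \/ 1 <= Re u).
Proof.
  intros H. destruct (Req_dec (Im u) 0) as [E|N]; [|exfalso; apply H, Om_nonreal; auto]. split; auto.
  destruct (Rle_dec (Re u) 0); auto. destruct (Rle_dec 1 (Re u)); auto. exfalso. apply H, Om_interval. lra.
Qed.

(* Near the punctures every period ratio is high in some cusp. *)
Lemma Cov_proper B : 0 < B -> exists d, 0 < d /\ forall u t, Cov u t -> / B <= Im t <= B ->
  d <= Cmod u /\ d <= Cmod (u - RtoC 1) /\ Cmod u <= / d.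
Proof.
  intros HB. destruct (T1_cusp B) as [e [He F]].
  set (d := Rmin (1/2) (e / 2)). assert (Hd : 0 < d) by (unfold d; apply Rmin_pos; lra).
  assert (d1 : d <= 1/2) by apply Rmin_l. assert (d2 : d <= e / 2) by apply Rmin_r.
  exists d. split; auto. intros u t HC Ht. assert (Hp : punctured u) by apply HC.
  (* By [T1_cusp] the height bound keeps every chart coordinate away from 0 and, through the flip,
     from 1. The rest selects a chart in which the given puncture sits at 0 or at 1. *)
  assert (K1 : forall g, Om (cmap g u) -> Cmod (cmap g u) < e -> False).
  { intros g O L. destruct (chart_height g u t B O HB HC Ht) as [X _]. specialize (F _ O L). lra. }
  assert (K2 : forall g, Om (cmap g u) -> Cmod (RtoC 1 - cmap g u) < e -> False).
  { intros g O L. destruct (chart_height g u t B O HB HC Ht) as [_ X]. specialize (F _ (Om_flip _ O) L). lra. }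
  destruct Hp as [p0 p1]. assert (N := minus_1_neq u p1).
  assert (M0 := Cmod_pos u p0). assert (M1 := Cmod_pos _ N).
  assert (Chart : forall g x, x = cmap g u -> Im x = 0 -> 0 < Re x < 1 -> Om (cmap g u)).
  { intros g x <- _ R. apply Om_interval; auto. }
  split; [|split]; apply Rnot_lt_le; intros L.
  - destruct (classic (Om u)) as [O|NO]. { apply (K1 cid O). simpl. lra. }
    destruct (not_Om_real u NO) as [E R].
    assert (x0 : Re u < 0).
    { destruct R as [R|R]; [|generalize (re_le_Cmod u) (Rle_abs (Re u)); lra].
      destruct R as [R|R]; auto. exfalso. apply p0. rewrite (real_RtoC u E), R; auto. }
    destruct (chart_exists u (conj p0 p1)) as [g O].
    assert (Lu : 1 / 2 <= Cmod (u - RtoC 1)).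
    { generalize (Cmod_sub_bound u (RtoC 1)). rewrite Cmod_1. lra. }
    assert (g = cP).
    { rewrite (cmap_real g u (conj p0 p1) E) in O. apply Om_real in O; [|reflexivity]. rewrite Re_RtoC in O.
      destruct g; auto; [lra|]. destruct O as [O _]. assert (/ Re u < 0) by (apply Rinv_lt_0_compat; auto). lra. }
    subst g. apply (K1 cP O). simpl. rewrite Cmod_div by auto. apply Rmult_lt_reg_r with (Cmod (u - RtoC 1)); auto.
    unfold Rdiv. rewrite Rmult_assoc, Rinv_l, Rmult_1_r by lra. nra.
  - destruct (classic (Om u)) as [O|NO]. { apply (K2 cid O). simpl. rewrite Cmod_minus_sym. lra. }
    destruct (not_Om_real u NO) as [E R].
    assert (x0 : 1 < Re u).
    { destruct R as [R|R].
      - exfalso. generalize (re_le_Cmod (u - RtoC 1)) (Rle_abs (- Re (u - RtoC 1)%C)). rewrite Rabs_Ropp. cre. lra.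
      - destruct R as [R|R]; auto. exfalso. apply p1. rewrite (real_RtoC u E), <- R; auto. }
    assert (O : Om (cmap cI u)).
    { rewrite (cmap_real cI u (conj p0 p1) E). apply Om_interval. rewrite Re_RtoC. split.
      - apply Rinv_0_lt_compat; lra.
      - rewrite <- Rinv_1. apply Rinv_lt_contravar; lra. }
    apply (K2 cI O). simpl. replace (RtoC 1 - / u)%C with ((u - RtoC 1) / u)%C by (field; auto).
    rewrite Cmod_div by auto. assert (1 <= Cmod u) by (generalize (re_le_Cmod u) (Rle_abs (Re u)); lra).
    apply Rmult_lt_reg_r with (Cmod u); auto. unfold Rdiv. rewrite Rmult_assoc, Rinv_l, Rmult_1_r by lra. nra.
  - assert (D2 : 2 <= / d). { replace 2 with (/ (1/2)) by field. apply Rinv_le_contravar; lra. }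
    assert (I1 : / Cmod u < d). { rewrite <- (Rinv_inv d). apply Rinv_lt_contravar; auto. apply Rmult_lt_0_compat; lra. }
    assert (KI' : Om (cmap cI u) -> False).
    { intros O. apply (K1 cI O). simpl. rewrite Cmod_inv by auto. lra. }
    destruct (Req_dec (Im u) 0) as [E|E]; [|apply KI', Om_inv_nonreal; auto].
    destruct (Rlt_dec 0 (Re u)) as [R|R].
    + apply KI'. rewrite (cmap_real cI u (conj p0 p1) E). apply Om_interval. rewrite Re_RtoC.
      assert (Cmod u = Re u) by (rewrite (real_RtoC u E), Cmod_R, Rabs_right; auto; cre; lra).
      split; [apply Rinv_0_lt_compat; auto|]. rewrite <- Rinv_1. apply Rinv_lt_contravar; lra.
    + assert (Ru : Re u < 0). { destruct (Req_dec (Re u) 0) as [Z|Z]; [|lra]. exfalso; apply p0. rewrite (real_RtoC u E), Z; auto. }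
      assert (Mu : Cmod u = - Re u) by (rewrite (real_RtoC u E), Cmod_R, Rabs_left; auto; cre; lra).
      assert (O : Om (cmap cP u)).
      { rewrite (cmap_real cP u (conj p0 p1) E). apply Om_interval. rewrite Re_RtoC.
        replace (Re u / (Re u - 1)) with ((- Re u) / (1 - Re u)) by (field; lra). split.
        + apply Rdiv_lt_0_compat; lra.
        + apply Rmult_lt_reg_r with (1 - Re u); [lra|]. unfold Rdiv. rewrite Rmult_assoc, Rinv_l by lra. lra. }
      apply (K2 cP O). simpl. replace (RtoC 1 - u / (u - RtoC 1))%C with (- / (u - RtoC 1))%C by (field; auto).
      rewrite Cmod_opp, Cmod_inv by auto.
      assert (Mv : Cmod (u - RtoC 1) = 1 - Re u).
      { rewrite (real_RtoC u E), <- RtoC_minus, Cmod_R, Rabs_left; cre; lra. }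
      rewrite Mv. apply Rlt_trans with (/ Cmod u); [apply Rinv_lt_contravar; [apply Rmult_lt_0_compat|]; lra|lra].
Qed.

(* pseudo-hyperbolic disc *)
Definition hdisc (h : R) (a t : C) : Prop := 0 < Im t /\ Cmod (t - a) < h * Cmod (t - Cconj a).

Lemma hdisc_mob m h a t : det m = 1 -> 0 < Im a -> hdisc h a t -> hdisc h (mob m a) (mob m t).
Proof.
  intros D Ha [Ht L]. split. { apply mob_Im_pos; auto. }
  assert (N1 := denom_neq_0 m a D Ha). assert (N2 := denom_neq_0 m t D Ht).
  destruct m as [[[p q] r] s]. unfold mob, denom in *. simpl in D.
  assert (N3 : (RtoC r * Cconj a + RtoC s)%C <> RtoC 0).
  { intros E. apply N1. replace (RtoC r * a + RtoC s)%C with (Cconj (RtoC r * Cconj a + RtoC s)) by (apply C_ext; cre; ring).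
    rewrite E. apply C_ext; cre; ring. }
  assert (D' : (RtoC p * RtoC s - RtoC q * RtoC r)%C = RtoC 1) by (rewrite <- !RtoC_mult, <- RtoC_minus, D; auto).
  assert (E1 : ((RtoC p * t + RtoC q) / (RtoC r * t + RtoC s) - (RtoC p * a + RtoC q) / (RtoC r * a + RtoC s))%C
    = ((t - a) / ((RtoC r * t + RtoC s) * (RtoC r * a + RtoC s)))%C).
  { replace (t - a)%C with ((RtoC p * RtoC s - RtoC q * RtoC r) * (t - a))%C by (rewrite D'; ring). field. auto. }
  assert (E2 : ((RtoC p * t + RtoC q) / (RtoC r * t + RtoC s) - Cconj ((RtoC p * a + RtoC q) / (RtoC r * a + RtoC s)))%C
    = ((t - Cconj a) / ((RtoC r * t + RtoC s) * (RtoC r * Cconj a + RtoC s)))%C).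
  { rewrite Cdiv_conj, !Cplus_conj, !Cmult_conj by auto.
    assert (RC : forall x, Cconj (RtoC x) = RtoC x) by (intros; apply C_ext; cre; ring). rewrite !RC.
    replace (t - Cconj a)%C with ((RtoC p * RtoC s - RtoC q * RtoC r) * (t - Cconj a))%C by (rewrite D'; ring). field. auto. }
  rewrite E1, E2, !Cmod_div, !Cmod_mult by (apply Cmult_neq_0; auto).
  assert (E3 : Cmod (RtoC r * Cconj a + RtoC s) = Cmod (RtoC r * a + RtoC s)).
  { rewrite <- (Cmod_conj (RtoC r * a + RtoC s)). f_equal. apply C_ext; cre; ring. }
  rewrite E3. assert (P1 := Cmod_pos _ N1). assert (P2 := Cmod_pos _ N2).
  assert (0 < / (Cmod (RtoC r * t + RtoC s) * Cmod (RtoC r * a + RtoC s))).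
  { apply Rinv_0_lt_compat, Rmult_lt_0_compat; auto. }
  unfold Rdiv. rewrite <- Rmult_assoc. apply Rmult_lt_compat_r; auto.
Qed.

(** An inverse branch on a disc of pseudo-hyperbolic radius [h] about [t]. Such discs are carried to
    each other by real Moebius maps, so one radius serves all points of a fibre. *)
Definition local_inverse (h : R) (u t : C) : Prop :=
  exists w : C -> C, w t = u /\ forall s, hdisc h t s -> Cov (w s) s /\ exists l, cder w s l.

Lemma local_inverse_near u0 : punctured u0 -> exists h r, 0 < h /\ 0 < r /\
  forall u t, Cmod (u - u0) < r -> Cov u t -> local_inverse h u t.
Proof.
  intros Hp. destruct (chart_exists u0 Hp) as [g O]. set (v0 := cmap g u0) in *.
  destruct (Om_open _ O) as [r1 [Hr1 F]].
  destruct (inverse_function T1 dT1 v0 r1 Hr1) as [q [sg [vT [Hq [Hs [I1 [I2 I3]]]]]]].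
  { intros. apply cder_T1; auto. } { apply dT1_cont; auto. } { apply dT1_neq_0; auto. }
  destruct (cder_cont (fun _ => True) _ _ _ (cder_T1 v0 O) (sg/2)) as [d [Hd G]]; [lra|].
  set (Y := Im (T1 v0) + sg). assert (HY : 0 < Y) by (unfold Y; generalize (T1_Im_pos v0 O); lra).
  (* About a point of height at most [Y], a disc of pseudo-hyperbolic radius h not above 1/2 has
     Euclidean radius at most 4 h Y, which is at most sg/4. *)
  set (h := Rmin (1/2) (sg / (16 * Y))).
  assert (Hh : 0 < h). { unfold h. apply Rmin_pos; [lra|]. apply Rdiv_lt_0_compat; lra. }
  assert (h1 : h <= 1/2) by apply Rmin_l. assert (h2 : h <= sg / (16 * Y)) by apply Rmin_r.
  destruct (chart_near g u0 v0 (Rmin q d) Hp eq_refl) as [r [Hr N]]. { apply Rmin_pos; auto. }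
  exists h, r. split; auto. split; auto. intros u t Hu HC. destruct (N u Hu) as [pu Hv].
  assert (Hv1 := Rlt_le_trans _ _ _ Hv (Rmin_l _ _)). assert (Hv2 := Rlt_le_trans _ _ _ Hv (Rmin_r _ _)).
  set (v := cmap g u) in *. assert (Ov : Om v) by (apply F; lra).
  destruct (Cov_chart g u t HC Ov) as [m [Hm E]].
  set (n := mmul m (rho g)).
  assert (Dn : det n = 1) by (unfold n; rewrite det_mmul, (G2_det m Hm), rho_det; ring).
  assert (Pv := T1_Im_pos v Ov).
  assert (Et : t = mob n (T1 v)).
  { rewrite E. unfold sheet, n. rewrite mob_mmul; auto; [apply G2_det; auto|apply rho_det]. }
  assert (Et' : mob (madj n) t = T1 v) by (rewrite Et, mob_adj_l; auto).
  assert (Tv : Cmod (T1 v - T1 v0) < sg / 2) by (apply G; auto).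
  assert (Yv : Im (T1 v) <= Y).
  { generalize (Im_lip (T1 v) (T1 v0)) (Rle_abs (Im (T1 v) - Im (T1 v0))). unfold Y. lra. }
  exists (fun s => cmap g (vT (mob (madj n) s))). split.
  - rewrite Et'. destruct (I1 (T1 v)) as [J1 [J2 _]]; [lra|].
    rewrite (I2 (vT (T1 v)) v); auto. unfold v. apply cmap_invol; auto.
  - intros s Hsd. assert (Is : 0 < Im s) by apply Hsd. assert (It := Cov_Im _ _ HC).
    assert (Hsd' := hdisc_mob (madj n) h t s ltac:(rewrite det_madj; auto) It Hsd). rewrite Et' in Hsd'.
    set (y := mob (madj n) s) in *. destruct Hsd' as [Iy Ly].
    assert (Ly2 : Cmod (y - T1 v) < sg / 2).
    { assert (Q : Cmod (y - Cconj (T1 v)) <= Cmod (y - T1 v) + 2 * Im (T1 v)).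
      { replace (y - Cconj (T1 v))%C with ((y - T1 v) + (T1 v - Cconj (T1 v)))%C by ring.
        eapply Rle_trans; [apply Cmod_triangle|]. apply Rplus_le_compat_l.
        replace (T1 v - Cconj (T1 v))%C with (Ci * RtoC (2 * Im (T1 v)))%C by (apply C_ext; cre; ring).
        rewrite Cmod_mult, Cmod_Ci, Cmod_R, Rabs_right; lra. }
      assert (P0 := Cmod_ge_0 (y - T1 v)).
      assert (X : h * Y <= sg / 16).
      { apply Rle_trans with (sg / (16 * Y) * Y); [apply Rmult_le_compat_r; lra|]. right; field; lra. }
      nra. }
    assert (Ly3 : Cmod (y - T1 v0) < sg).
    { replace (y - T1 v0)%C with ((y - T1 v) + (T1 v - T1 v0))%C by ring. eapply Rle_lt_trans; [apply Cmod_triangle|]. lra. }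
    destruct (I1 y Ly3) as [J1 [J2 [l Jl]]]. assert (Ow : Om (vT y)) by (apply F; lra).
    assert (pw : punctured (vT y)) by (apply Om_punctured; auto).
    assert (Ei : cmap g (cmap g (vT y)) = vT y) by (apply cmap_invol; auto).
    split.
    + split; [apply cmap_punctured; auto|]. exists g, m. rewrite Ei. split; [exact Hm|]. split; [exact Ow|].
      unfold sheet. rewrite Ei, J2. rewrite <- mob_mmul; auto; [|apply G2_det; auto|apply rho_det].
      unfold y. fold n. rewrite mob_adj_r; auto.
    + destruct (cder_mob (madj n) s ltac:(rewrite det_madj; auto) Is) as [l1 D1].
      destruct (cder_cmap g (vT y) pw) as [l2 D2].
      eexists. apply (gder_comp _ (fun s => vT (mob (madj n) s)) (cmap g)); [|exact D2].
      apply (gder_comp _ (mob (madj n)) vT); [exact D1|exact Jl].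
Qed.

Lemma hdisc_mono h h' a t : h <= h' -> hdisc h a t -> hdisc h' a t.
Proof.
  intros H [A B]. split; auto. eapply Rlt_le_trans; [apply B|]. apply Rmult_le_compat_r; auto. apply Cmod_ge_0.
Qed.

Lemma local_inverse_mono h h' u t : h <= h' -> local_inverse h' u t -> local_inverse h u t.
Proof.
  intros H [w [E F]]. exists w. split; auto. intros s Hs. apply F. apply hdisc_mono with h; auto.
Qed.

(** By [Cov_proper] the admissible u stay in a compact part of the punctured plane. Bisection of a
    square containing it takes the place of a finite subcover; near the two punctures the claim is
    vacuous. *)
Lemma local_inverse_uniform B : 0 < B -> exists h, 0 < h /\ forall u t, Cov u t -> / B <= Im t <= B -> local_inverse h u t.
Proof.
  intros HB. destruct (Cov_proper B HB) as [d [Hd F]].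
  assert (Pd : 0 < / d) by (apply Rinv_0_lt_compat; auto).
  assert (M : exists h, 0 < h /\ forall u, rect (- / d) (/ d) (- / d) (/ d) u -> forall t, Cov u t -> / B <= Im t <= B -> local_inverse h u t).
  { apply (rectangle_bisection (fun a b c e => exists h, 0 < h /\ forall u, rect a b c e u -> forall t, Cov u t -> / B <= Im t <= B -> local_inverse h u t)); try lra.
    - intros a m b c e H1 H2 _ _ _ _ [h1 [P1 Q1]] [h2 [P2 Q2]]. exists (Rmin h1 h2). split; [apply Rmin_pos; auto|].
      intros u Hu t HC Ht. unfold rect in *. destruct (Rle_dec (Re u) m).
      + apply local_inverse_mono with h1; [apply Rmin_l|]. apply Q1; auto. lra.
      + apply local_inverse_mono with h2; [apply Rmin_r|]. apply Q2; auto. lra.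
    - intros a b c m e H1 H2 _ _ _ _ [h1 [P1 Q1]] [h2 [P2 Q2]]. exists (Rmin h1 h2). split; [apply Rmin_pos; auto|].
      intros u Hu t HC Ht. unfold rect in *. destruct (Rle_dec (Im u) m).
      + apply local_inverse_mono with h1; [apply Rmin_l|]. apply Q1; auto. lra.
      + apply local_inverse_mono with h2; [apply Rmin_r|]. apply Q2; auto. lra.
    - intros x y Hx Hy.
      assert (Near : forall r, 0 < r -> (exists h, 0 < h /\ forall u t, Cmod (u - (x, y)) < r -> Cov u t -> / B <= Im t <= B -> local_inverse h u t) ->
        exists delta, 0 < delta /\ forall a b c e, a < b -> c < e -> - / d <= a <= x -> x <= b <= / d -> - / d <= c <= y -> y <= e <= / d ->
        b - a < delta -> e - c < delta -> (b - a) * (/ d - - / d) = (e - c) * (/ d - - / d) ->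
        exists h, 0 < h /\ forall u, rect a b c e u -> forall t, Cov u t -> / B <= Im t <= B -> local_inverse h u t).
      { intros r Hr [h [Hh Q]]. exists (r / 2). split; [lra|]. intros a b c e _ _ Ha Hb Hc' He L1 L2 _.
        exists h. split; auto. intros u Hu t. apply Q. unfold rect in Hu.
        eapply Rle_lt_trans; [apply Cmod_le_sum|]. cre. apply Rlt_le_trans with (r/2 + r/2); [|lra].
        apply Rplus_lt_compat; apply Rabs_def1; lra. }
      destruct (classic ((x, y) = RtoC 0)) as [E|N0].
      { apply (Near d Hd). exists 1. split; [lra|]. intros u t L HC Ht. exfalso. rewrite E in L.
        destruct (F u t HC Ht) as [X _]. replace (u - RtoC 0)%C with u in L by ring. lra. }
      destruct (classic ((x, y) = RtoC 1)) as [E|N1].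
      { apply (Near d Hd). exists 1. split; [lra|]. intros u t L HC Ht. exfalso. rewrite E in L.
        destruct (F u t HC Ht) as [_ [X _]]. lra. }
      destruct (local_inverse_near (x, y) (conj N0 N1)) as [h [r [Hh [Hr Q]]]].
      apply (Near r Hr). exists h. split; auto. }
  destruct M as [h [Hh Q]]. exists h. split; auto. intros u t HC Ht. apply Q; auto.
  destruct (F u t HC Ht) as [_ [_ X]].
  assert (A := re_le_Cmod u). assert (A' := im_le_Cmod u). unfold rect.
  split; apply Rabs_le_between; lra.
Qed.

(** The relation with base and fibre exchanged: a lift for [Cov'] is a composition with the modular
    function. *)
Definition Cov' (t u : C) : Prop := Cov u t.

Lemma Cov'_sectioned : locally_sectioned (fun t => 0 < Im t) Cov'.
Proof.
  (* All heights within a factor 2 of Im t0 lie between 1/B and B. *)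
  intros t0 H0. set (B := 2 * Im t0 + 2 / Im t0).
  assert (P : 0 < / Im t0) by (apply Rinv_0_lt_compat; auto).
  assert (HB : 0 < B) by (unfold B, Rdiv; lra).
  destruct (local_inverse_uniform B HB) as [h [Hh Q]].
  set (r := Rmin (Im t0 / 2) (h * Im t0 / 2)).
  assert (Hr : 0 < r). { unfold r. apply Rmin_pos; [lra|]. apply Rdiv_lt_0_compat; [apply Rmult_lt_0_compat|]; lra. }
  assert (r1 : r <= Im t0 / 2) by apply Rmin_l. assert (r2 : r <= h * Im t0 / 2) by apply Rmin_r.
  exists r. split; auto. intros t1 u1 L1 HC. unfold Cov' in HC.
  assert (I1 : forall t, Cmod (t - t0) < r -> Im t0 / 2 < Im t < 2 * Im t0).
  { intros t L. generalize (Im_lip t t0). intros X. assert (Y := Rle_lt_trans _ _ _ X L). apply Rabs_def2 in Y. lra. }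
  assert (IB : / B <= Im t0 / 2).
  { rewrite <- (Rinv_inv (Im t0 / 2)). apply Rinv_le_contravar.
    - apply Rinv_0_lt_compat; lra.
    - replace (/ (Im t0 / 2)) with (2 / Im t0) by (field; lra). unfold B. lra. }
  destruct (Q u1 t1 HC) as [w [E F]].
  { specialize (I1 t1 L1). unfold B, Rdiv in *. lra. }
  exists w. split; [exact E|]. intros t L. refine (F t _). specialize (I1 t L) as It. specialize (I1 t1 L1) as It1.
  split; [lra|].
  assert (X : Cmod (t - t1) < 2 * r).
  { replace (t - t1)%C with ((t - t0) - (t1 - t0))%C by ring. eapply Rle_lt_trans; [apply Cmod_minus_le|]. lra. }
  assert (Y : Im t0 <= Cmod (t - Cconj t1)).
  { generalize (im_le_Cmod (t - Cconj t1)) (Rle_abs (Im (t - Cconj t1)%C)). cre. lra. }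
  nra.
Qed.

(** Near (u0, t0) the relation is the graph of one branch t = s u, by separation of [Cov]; this
    branch is injective because [T1] is locally injective. *)
Lemma Cov'_separated : separated Cov'.
Proof.
  intros t0 u0 H0. unfold Cov' in *. assert (Hp : punctured u0) by apply H0.
  destruct (chart_exists u0 Hp) as [g O]. set (v0 := cmap g u0) in *.
  destruct (Om_open _ O) as [r1 [Hr1 F]].
  destruct (inverse_function T1 dT1 v0 r1 Hr1) as [q [sg [vT [Hq [Hs [I1 [I2 I3]]]]]]].
  { intros. apply cder_T1; auto. } { apply dT1_cont; auto. } { apply dT1_neq_0; auto. }
  destruct (Cov_chart g u0 t0 H0 O) as [m [Hm E0]].
  destruct (Cov_separated u0 t0 H0) as [e [He S]].
  set (s := fun u => mob m (sheet g u)).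
  assert (Cs : cont_at (fun _ => True) s u0).
  { destruct (cder_sheet g u0 Hp O) as [l1 D1].
    destruct (cder_mob m _ (G2_det _ Hm) (sheet_Im g u0 O)) as [l2 D2].
    apply (cder_cont _ s u0 (l2 * l1)%C). apply (gder_comp _ (sheet g) (mob m)); auto. }
  destruct (Cs e He) as [d1 [Hd1 G1]].
  destruct (chart_near g u0 v0 q Hp eq_refl Hq) as [d2 [Hd2 G2']].
  exists (Rmin e (Rmin d1 d2)). split; [repeat apply Rmin_pos; auto|].
  assert (K : forall t u, Cmod (t - t0) < Rmin e (Rmin d1 d2) -> Cov u t -> Cmod (u - u0) < Rmin e (Rmin d1 d2) ->
    punctured u /\ Cmod (cmap g u - v0) < q /\ t = s u).
  { intros t u Lt HC Lu. assert (Lt1 := Rlt_le_trans _ _ _ Lt (Rmin_l _ _)).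
    assert (Lu1 := Rlt_le_trans _ _ _ Lu (Rmin_l _ _)). assert (Lu2 := Rlt_le_trans _ _ _ Lu (Rmin_r _ _)).
    assert (Lu3 := Rlt_le_trans _ _ _ Lu2 (Rmin_l _ _)). assert (Lu4 := Rlt_le_trans _ _ _ Lu2 (Rmin_r _ _)).
    destruct (G2' u Lu4) as [pu qu]. split; [exact pu|]. split; [exact qu|].
    apply (S u); [exact Lu1|exact HC| |exact Lt1|].
    - apply Cov_act; [|exact Hm]. apply Cov_sheet; [exact pu|]. apply F. lra.
    - rewrite E0. apply G1; [exact I|exact Lu3]. }
  intros t u u' Lt HC HC' Lu Lu'.
  destruct (K t u Lt HC Lu) as [pu [qu Eu]]. destruct (K t u' Lt HC' Lu') as [pu' [qu' Eu']].
  assert (Ou : Om (cmap g u)) by (apply F; lra). assert (Ou' : Om (cmap g u')) by (apply F; lra).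
  rewrite <- (cmap_invol g u pu), <- (cmap_invol g u' pu'). f_equal. apply I2; auto.
  assert (Es : s u = s u') by (rewrite <- Eu; auto). unfold s in Es.
  apply (f_equal (mob (madj m))) in Es. rewrite !mob_adj_l in Es; try (apply G2_det; auto); try (apply sheet_Im; auto).
  unfold sheet in Es. apply (f_equal (mob (madj (rho g)))) in Es.
  rewrite !mob_adj_l in Es; auto; try apply rho_det; apply T1_Im_pos; auto.
Qed.

(** * Exponential and logarithm *)

Definition cexp (z : C) : C := (exp (Re z) * cos (Im z), exp (Re z) * sin (Im z)).

Lemma cexp_plus z w : cexp (z + w)%C = (cexp z * cexp w)%C.
Proof.
  unfold cexp. apply C_ext; cre; rewrite exp_plus, ?cos_plus, ?sin_plus; ring.
Qed.

Lemma Cmod_cexp z : Cmod (cexp z) = exp (Re z).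
Proof.
  assert (P := exp_pos (Re z)). apply Rsqr_inj; [apply Cmod_ge_0|lra|].
  rewrite !Rsqr_pow2, Cmod_sqr. unfold cexp. cre.
  generalize (sin2_cos2 (Im z)). unfold Rsqr. intros H.
  replace ((exp (Re z) * cos (Im z)) ^ 2 + (exp (Re z) * sin (Im z)) ^ 2)
    with (exp (Re z) ^ 2 * (sin (Im z) * sin (Im z) + cos (Im z) * cos (Im z))) by ring.
  rewrite H. ring.
Qed.

Lemma cexp_neq_0 z : cexp z <> RtoC 0.
Proof. intros E. apply (f_equal Cmod) in E. rewrite Cmod_cexp, Cmod_0 in E. generalize (exp_pos (Re z)). lra. Qed.

Lemma expansion_at (f : R -> R) t l eps : derivable_pt_lim f t l -> 0 < eps -> exists d, 0 < d /\
  forall h, Rabs h < d -> Rabs (f (t + h) - f t - l * h) <= eps * Rabs h.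
Proof.
  intros H He. destruct (H eps He) as [d F]. exists d. split; [apply cond_pos|]. intros h Hh.
  destruct (Req_dec h 0) as [->|N].
  - rewrite Rplus_0_r, Rmult_0_r, !Rminus_diag, Rabs_R0. lra.
  - specialize (F h N Hh). replace (f (t + h) - f t - l * h) with (((f (t + h) - f t) / h - l) * h) by (field; auto).
    rewrite Rabs_mult. apply Rmult_le_compat_r; [apply Rabs_pos|lra].
Qed.

Lemma cder_cexp z : cder cexp z (cexp z).
Proof.
  intros eps He. assert (Pz := exp_pos (Re z)). set (A := exp (Re z)) in *.
  set (e := Rmin (1/2) (eps / (12 * A))).
  assert (Pe : 0 < e). { apply Rmin_pos; [lra|]. apply Rdiv_lt_0_compat; lra. }
  assert (e1 : e <= 1/2) by apply Rmin_l. assert (e2 : e <= eps / (12 * A)) by apply Rmin_r.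
  destruct (expansion_at exp 0 1 e) as [d1 [H1 F1]]. { assert (X := derivable_pt_lim_exp 0). rewrite exp_0 in X. exact X. } { auto. }
  destruct (expansion_at cos 0 0 e) as [d2 [H2 F2]]. { assert (X := derivable_pt_lim_cos 0). rewrite sin_0, Ropp_0 in X. exact X. } { auto. }
  destruct (expansion_at sin 0 1 e) as [d3 [H3 F3]]. { assert (X := derivable_pt_lim_sin 0). rewrite cos_0 in X. exact X. } { auto. }
  exists (Rmin (Rmin d1 d2) (Rmin d3 e)). split; [apply Rmin_pos; apply Rmin_pos; auto|]. intros h _ Hh.
  assert (A1 := Rlt_le_trans _ _ _ Hh (Rmin_l _ _)). assert (A2 := Rlt_le_trans _ _ _ Hh (Rmin_r _ _)).
  assert (h1 := Rlt_le_trans _ _ _ A1 (Rmin_l _ _)). assert (h2 := Rlt_le_trans _ _ _ A1 (Rmin_r _ _)).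
  assert (h3 := Rlt_le_trans _ _ _ A2 (Rmin_l _ _)). assert (h4 := Rlt_le_trans _ _ _ A2 (Rmin_r _ _)).
  rewrite cexp_plus. replace (cexp z * cexp h - cexp z - cexp z * h)%C with (cexp z * (cexp h - RtoC 1 - h))%C by ring.
  rewrite Cmod_mult, Cmod_cexp. fold A.
  assert (rx := re_le_Cmod h). assert (ry := im_le_Cmod h). set (x := Re h) in *. set (y := Im h) in *. set (m := Cmod h) in *.
  assert (G1 := F1 x ltac:(lra)). assert (G2 := F2 y ltac:(lra)). assert (G3 := F3 y ltac:(lra)).
  rewrite Rplus_0_l, exp_0 in G1. rewrite Rplus_0_l, cos_0, Rmult_0_l, Rminus_0_r in G2.
  rewrite Rplus_0_l, sin_0, Rminus_0_r in G3.
  assert (Pm : 0 <= m) by apply Cmod_ge_0.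
  assert (G1' : Rabs (exp x - 1 - 1 * x) <= e * m) by (eapply Rle_trans; [apply G1|]; apply Rmult_le_compat_l; lra).
  assert (G2' : Rabs (cos y - 1) <= e * m) by (eapply Rle_trans; [apply G2|]; apply Rmult_le_compat_l; lra).
  assert (G3' : Rabs (sin y - 1 * y) <= e * m) by (eapply Rle_trans; [apply G3|]; apply Rmult_le_compat_l; lra).
  apply Rabs_le_between in G1'. apply Rabs_le_between in G2'. apply Rabs_le_between in G3'.
  apply Rabs_le_between in rx. apply Rabs_le_between in ry.
  assert (Ex : 0 < exp x <= 2). { split; [apply exp_pos|]. nra. }
  assert (R1 : Rabs (Re (cexp h - RtoC 1 - h)%C) <= 4 * e * m).
  { unfold cexp. cre. fold x y. replace (exp x * cos y - 1 - x) with ((exp x - 1 - 1 * x) + exp x * (cos y - 1)) by ring.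
    apply Rabs_le. split; nra. }
  assert (R2 : Rabs (Im (cexp h - RtoC 1 - h)%C) <= 5 * e * m).
  { unfold cexp. cre. fold x y. replace (exp x * sin y - 0 - y) with (exp x * (sin y - 1 * y) + (exp x - 1) * y) by ring.
    assert (X1 : Rabs (exp x * (sin y - 1 * y)) <= 2 * (e * m)).
    { rewrite Rabs_mult. apply Rmult_le_compat; try apply Rabs_pos; [rewrite Rabs_right; lra|apply Rabs_le; lra]. }
    assert (X2 : Rabs ((exp x - 1) * y) <= (2 * e) * m).
    { rewrite Rabs_mult. apply Rmult_le_compat; try apply Rabs_pos; apply Rabs_le; [|lra]. nra. }
    eapply Rle_trans; [apply Rabs_triang|]. nra. }
  assert (R3 : Cmod (cexp h - RtoC 1 - h) <= 9 * e * m) by (eapply Rle_trans; [apply Cmod_le_sum|]; lra).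
  apply Rle_trans with (A * (9 * e * m)). { apply Rmult_le_compat_l; lra. }
  replace (A * (9 * e * m)) with ((A * 9 * e) * m) by ring. apply Rmult_le_compat_r; auto.
  apply Rle_trans with (A * 9 * (eps / (12 * A))). { apply Rmult_le_compat_l; lra. }
  replace (A * 9 * (eps / (12 * A))) with (9 / 12 * eps) by (field; lra). lra.
Qed.

Definition clogR (w : C) : C := (ln (Cmod w), atan (Im w / Re w)).

Lemma cexp_clogR w : 0 < Re w -> cexp (clogR w) = w.
Proof.
  intros H. assert (P : 0 < Cmod w). { generalize (re_le_Cmod w) (Rle_abs (Re w)). lra. }
  unfold clogR, cexp. cre. rewrite exp_ln by auto. rewrite cos_atan, sin_atan.
  set (t := Im w / Re w). assert (E : Cmod w = Re w * sqrt (1 + t²)).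
  { rewrite <- (sqrt_Rsqr (Re w)) by lra. rewrite <- sqrt_mult; try apply Rle_0_sqr.
    2: { generalize (Rle_0_sqr t). lra. }
    rewrite <- (sqrt_Rsqr (Cmod w)) by lra. f_equal. rewrite Rsqr_pow2, Cmod_sqr. unfold t, Rsqr. field. lra. }
  assert (Q : 0 < sqrt (1 + t²)). { apply sqrt_lt_R0. generalize (Rle_0_sqr t). lra. }
  rewrite E. apply C_ext; cre; unfold t; field; repeat split; try lra; fold t; lra.
Qed.

Lemma cont_at_Cmod D f z : cont_at D f z -> cont_at D (fun u => RtoC (Cmod (f u))) z.
Proof.
  apply (cont_at_lip (fun w => RtoC (Cmod w))). intros a b. rewrite <- RtoC_minus, Cmod_R.
  apply Rabs_le. generalize (Cmod_minus_tri a b) (Cmod_minus_tri b a). rewrite (Cmod_minus_sym b a). lra.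
Qed.

Lemma cont_clogR w : 0 < Re w -> cont_at (fun _ => True) clogR w.
Proof.
  intros H. assert (P : 0 < Cmod w). { generalize (re_le_Cmod w) (Rle_abs (Re w)). lra. }
  assert (C1 : cont_at (fun _ => True) (fun w => RtoC (ln (Cmod w)) + Ci * RtoC (atan (Im w / Re w)))%C w).
  { apply cont_at_plus.
    - apply (cont_at_real _ Cmod ln). { apply (cont_at_Cmod _ (fun u => u)), cont_at_id. }
      apply derivable_continuous_pt. exists (/ Cmod w). apply derivable_pt_lim_ln; auto.
    - apply cont_at_mult; [apply cont_at_const|].
      apply (cont_at_real _ (fun w => Im w / Re w) atan).
      + apply (cont_at_ext_loc _ (fun u => RtoC (Im u) / RtoC (Re u))%C _ _ (Re w)); auto.
        * intros u _ Hu. rewrite RtoC_div; auto. generalize (Re_lip u w) (Rle_abs (- (Re u - Re w))). rewrite Rabs_Ropp. lra.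
        * rewrite RtoC_div; auto; lra.
        * apply cont_at_div. { apply Cneq_Re. cre. lra. }
          -- apply (cont_at_Im _ (fun u => u)), cont_at_id.
          -- apply (cont_at_Re _ (fun u => u)), cont_at_id.
      + apply derivable_continuous_pt. eexists. apply derivable_pt_lim_atan. }
  apply (cont_at_ext _ (fun w => RtoC (ln (Cmod w)) + Ci * RtoC (atan (Im w / Re w)))%C); auto.
  intros u _. apply C_ext; unfold clogR; cre; ring.
Qed.

Lemma cder_clogR w : 0 < Re w -> cder clogR w (/ w)%C.
Proof.
  intros H. assert (E := cexp_clogR w H). rewrite <- E at 2.
  apply (cder_inverse cexp clogR w _ (Re w)); auto.
  - intros y Hy. apply cexp_clogR. generalize (Re_lip y w) (Rle_abs (- (Re y - Re w))). rewrite Rabs_Ropp. lra.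
  - apply cont_clogR; auto.
  - apply cder_cexp.
  - apply cexp_neq_0.
Qed.

(** The branch with argument in (0, PI), obtained from the arctangent branch of the right half plane
    by a quarter turn. *)
Definition clog (w : C) : C := (clogR (- Ci * w) + Ci * RtoC (PI/2))%C.

Lemma clog_Re_arg w : Re (- Ci * w)%C = Im w.
Proof. cre. ring. Qed.

Lemma cexp_clog w : 0 < Im w -> cexp (clog w) = w.
Proof.
  intros H. unfold clog. rewrite cexp_plus, cexp_clogR by (rewrite clog_Re_arg; auto).
  replace (cexp (Ci * RtoC (PI/2))) with Ci.
  - apply C_ext; cre; ring.
  - unfold cexp. cre. replace (0 * (PI/2) - 1 * 0) with 0 by ring. replace (0 * 0 + 1 * (PI/2)) with (PI/2) by ring.
    rewrite exp_0, cos_PI2, sin_PI2. apply C_ext; cre; ring.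
Qed.

Lemma clog_Re w : 0 < Im w -> Re (clog w) = ln (Cmod w).
Proof.
  intros H. unfold clog, clogR. cre. replace (Cmod (- Ci * w)) with (Cmod w). { ring. }
  rewrite Cmod_mult, Cmod_opp, Cmod_Ci. ring.
Qed.

Lemma clog_Im w : 0 < Im w -> 0 < Im (clog w) < PI.
Proof.
  intros H. unfold clog, clogR. cre. generalize (atan_bound (Im (- Ci * w)%C / Re (- Ci * w)%C)). cre. lra.
Qed.

Lemma cder_clog w : 0 < Im w -> exists l, cder clog w l.
Proof.
  intros H. eexists. apply gder_plus; [|apply gder_const].
  apply (gder_comp _ (fun w => - Ci * w)%C clogR). { apply gder_scal, gder_id. }
  apply cder_clogR. rewrite clog_Re_arg; auto.
Qed.

(** * Pairs of geodesics *)

(* [true]: the totally real problem, [false]: one real point and a conjugate pair. *)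
Definition geo (e : bool) (t : C) : Prop := if e then Re t = 0 else Cmod t = 1.

(* [Phi] maps the upper half plane into the part [0 < Im < bound] of the plane such that the
   geodesic [geo e] and its image under [m] become the vertical lines [Re = 0] and [Re = l];
   [Psi] is a left inverse defined on all of that part. *)
Definition straightening (Psi Phi : C -> C) (bd : R -> Prop) (e : bool) (m : mat) (l : R) : Prop :=
  (forall t, 0 < Im t -> 0 < Im (Phi t) /\ bd (Im (Phi t)) /\ Psi (Phi t) = t /\ exists k, cder Phi t k) /\
  (forall q, 0 < Im q -> bd (Im q) -> 0 < Im (Psi q) /\ exists k, cder Psi q k) /\
  (forall t, 0 < Im t -> (geo e t -> Re (Phi t) = 0) /\ (geo e (mob (madj m) t) -> Re (Phi t) = l)) /\
  (forall q, 0 < Im q -> bd (Im q) -> (Re q = 0 -> geo e (Psi q)) /\ (Re q = l -> geo e (mob (madj m) (Psi q)))).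

(** If its modulus exceeds 1, this is up to sign the hyperbolic cosine of the distance between
    [geo e] and its image under [m]. *)
Definition tval (e : bool) (m : mat) : R :=
  let '(a, b, c, d) := m in if e then a * d + b * c else (a ^ 2 + d ^ 2 - b ^ 2 - c ^ 2) / 2.

Lemma geo_true_image m t : det m = 1 -> 0 < Im t ->
  (geo true (mob (madj m) t) <-> let '(a, b, c, d) := m in c * d * Cmod t ^ 2 - (a * d + b * c) * Re t + a * b = 0).
Proof.
  intros D Ht. assert (N := denom_neq_0 (madj m) t ltac:(rewrite det_madj; auto) Ht).
  destruct m as [[[a b] c] d]. unfold geo, mob, madj, denom in *. rewrite Re_div_pos by auto.
  assert (P : 0 < Cmod (RtoC (- c) * t + RtoC a) ^ 2) by (apply pow_lt, Cmod_pos; auto).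
  rewrite (Cmod_sqr t).
  assert (E : Re (RtoC d * t + RtoC (- b))%C * Re (RtoC (- c) * t + RtoC a)%C + Im (RtoC d * t + RtoC (- b))%C * Im (RtoC (- c) * t + RtoC a)%C
    = - (c * d * (Re t ^ 2 + Im t ^ 2) - (a * d + b * c) * Re t + a * b)) by (cre; ring).
  rewrite E. split; intros H.
  - apply Rmult_integral in H. destruct H as [H|H]; [lra|]. exfalso. apply Rinv_neq_0_compat in H; lra.
  - rewrite H. unfold Rdiv. ring.
Qed.

Lemma Cmod_eq_sqr z r : 0 <= r -> Cmod z ^ 2 = r ^ 2 -> Cmod z = r.
Proof. intros Hr H. apply Rsqr_inj; auto; [apply Cmod_ge_0|]. rewrite !Rsqr_pow2. auto. Qed.

Lemma straightening_hyperbolic m : det m = 1 -> 1 < Rabs (tval true m) ->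
  exists Psi Phi l, straightening Psi Phi (fun y => y < PI) true m l /\
    ln (Rabs (tval true m)) <= Rabs l <= ln (2 * Rabs (tval true m)).
Proof.
  intros D Ht. destruct m as [[[a b] c] d]. unfold tval in *. simpl in D.
  set (t := a * d + b * c) in *. set (P := a * b). set (Q := c * d).
  assert (Et : t ^ 2 = 1 + 4 * (P * Q)).
  { unfold t, P, Q. replace ((a * d + b * c) ^ 2) with ((a * d - b * c) ^ 2 + 4 * (a * b * (c * d))) by ring. rewrite D. ring. }
  assert (T2 : 1 < t ^ 2). { rewrite <- (pow2_abs t). simpl. nra. }
  assert (PQ : 0 < P * Q) by lra.
  assert (NQ : Q <> 0) by (intros Z; rewrite Z, Rmult_0_r in PQ; lra).
  assert (Hpq : 0 < P / Q).
  { replace (P / Q) with (P * Q * / (Q * Q)) by (field; auto). apply Rmult_lt_0_compat; auto. apply Rinv_0_lt_compat. nra. }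
  (* The half circle |z| = p is the common perpendicular of the two geodesics, since P/Q is the
     product of the end points of the second. The map [n] is (z + p)/(p - z); it turns the
     perpendicular into the imaginary axis and the geodesics into the half circles |z| = 1 and |z| =
     |k|, which the logarithm straightens. *)
  set (p := sqrt (P / Q)). assert (Pp : 0 < p) by (apply sqrt_lt_R0; auto).
  assert (p2 : Q * (p * p) = P). { unfold p. rewrite sqrt_sqrt by lra. field. auto. }
  set (s := / sqrt (2 * p)). assert (s2 : s * s * (2 * p) = 1).
  { unfold s. rewrite <- Rinv_mult, sqrt_sqrt by lra. field. lra. }
  assert (sp : 0 < s) by (apply Rinv_0_lt_compat, sqrt_lt_R0; lra).
  set (n := (s, s * p, - s, s * p) : mat).
  assert (Dn : det n = 1) by (simpl; lra).
  set (k := t + 2 * p * Q). set (k' := t - 2 * p * Q).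
  assert (kk : k * k' = 1).
  { unfold k, k'. replace ((t + 2 * p * Q) * (t - 2 * p * Q)) with (t ^ 2 - 4 * (Q * (p * p)) * Q) by ring. rewrite p2, Et. ring. }
  assert (kn : k <> 0) by (intros Z; rewrite Z in kk; lra).
  set (l := ln (Rabs k)).
  assert (Form : forall z, 0 < Im z -> Cmod (mob n z) ^ 2 * ((p - Re z) ^ 2 + Im z ^ 2) = (Re z + p) ^ 2 + Im z ^ 2 /\ 0 < (p - Re z) ^ 2 + Im z ^ 2).
  { intros z Hz. assert (Y : 0 < (p - Re z) ^ 2 + Im z ^ 2). { generalize (pow2_ge_0 (p - Re z)) (pow_lt (Im z) 2 Hz). lra. }
    split; auto.
    assert (N := denom_neq_0 n z Dn Hz). unfold n, mob, denom in *. rewrite Cmod_div by auto.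
    assert (X1 : Cmod (RtoC s * z + RtoC (s * p)) ^ 2 = s ^ 2 * ((Re z + p) ^ 2 + Im z ^ 2)) by (rewrite Cmod_sqr; cre; ring).
    assert (X2 : Cmod (RtoC (- s) * z + RtoC (s * p)) ^ 2 = s ^ 2 * ((p - Re z) ^ 2 + Im z ^ 2)) by (rewrite Cmod_sqr; cre; ring).
    unfold Rdiv. rewrite Rpow_mult_distr, pow_inv, X1, X2. field. split; [lra|]. lra. }
  assert (Sq : forall z, 0 < Im z -> Cmod (mob n z) = 1 <-> Re z = 0).
  { intros z Hz. destruct (Form z Hz) as [F1 F2]. split; intros E.
    - rewrite E in F1. nra.
    - apply Cmod_eq_sqr; [lra|]. rewrite E in *. apply Rmult_eq_reg_r with ((p - 0) ^ 2 + Im z ^ 2); [|lra]. rewrite F1. ring. }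
  assert (Sl : forall z, 0 < Im z -> Cmod (mob n z) = Rabs k <-> Q * Cmod z ^ 2 - t * Re z + P = 0).
  { intros z Hz. destruct (Form z Hz) as [F1 F2]. rewrite Cmod_sqr.
    assert (A : (Re z + p) ^ 2 + Im z ^ 2 = (Re z ^ 2 + Im z ^ 2 + p * p) + 2 * p * Re z) by ring.
    assert (B : (p - Re z) ^ 2 + Im z ^ 2 = (Re z ^ 2 + Im z ^ 2 + p * p) - 2 * p * Re z) by ring.
    set (S := Re z ^ 2 + Im z ^ 2 + p * p) in *. set (x := Re z) in *.
    replace (Q * (x ^ 2 + Im z ^ 2) - t * x + P) with (Q * S - t * x) by (unfold S; rewrite <- p2; ring).
    rewrite A, B in F1. rewrite B in F2. split; intros E.
    - rewrite E, pow2_abs in F1.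
      assert (F3 : k' * (k ^ 2 * (S - 2 * p * x)) = k' * (S + 2 * p * x)) by (rewrite F1; auto).
      replace (k' * (k ^ 2 * (S - 2 * p * x))) with ((k * k') * k * (S - 2 * p * x)) in F3 by ring.
      assert (F4 : 4 * p * (Q * S - t * x) = k * (S - 2 * p * x) - k' * (S + 2 * p * x)) by (unfold k, k'; ring).
      rewrite kk in F3. assert (F5 : 4 * p * (Q * S - t * x) = 0) by lra.
      apply Rmult_integral in F5. destruct F5; lra.
    - apply Cmod_eq_sqr; [apply Rabs_pos|]. rewrite pow2_abs.
      apply Rmult_eq_reg_r with (S - 2 * p * x); [|lra]. rewrite F1.
      assert (F3 : k' * (S + 2 * p * x) = k * (S - 2 * p * x)).
      { assert (k * (S - 2 * p * x) - k' * (S + 2 * p * x) = 4 * p * (Q * S - t * x)) by (unfold k, k'; ring). rewrite E in H. lra. }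
      replace (S + 2 * p * x) with ((k * k') * (S + 2 * p * x)) by (rewrite kk; ring).
      rewrite Rmult_assoc, F3. ring. }
  assert (Ak : 0 < Rabs k) by (apply Rabs_pos_lt; auto).
  exists (fun q => mob (madj n) (cexp q)), (fun z => clog (mob n z)), l. split.
  - assert (Dn' : det (madj n) = 1) by (rewrite det_madj; auto).
    assert (Iexp : forall q, 0 < Im q -> Im q < PI -> 0 < Im (cexp q)).
    { intros q H1 H2. unfold cexp. cre. apply Rmult_lt_0_compat; [apply exp_pos|apply sin_gt_0; auto]. }
    split; [|split; [|split]].
    + intros z Hz. assert (I := mob_Im_pos n z Dn Hz). destruct (clog_Im _ I) as [C1 C2].
      split; [exact C1|]. split; [exact C2|]. split. { rewrite cexp_clog by auto. apply mob_adj_l; auto. }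
      destruct (cder_mob n z Dn Hz) as [l1 D1]. destruct (cder_clog _ I) as [l2 D2]. eexists. apply (gder_comp _ (mob n) clog); eauto.
    + intros q H1 H2. assert (I := Iexp q H1 H2). split. { apply mob_Im_pos; auto. }
      destruct (cder_mob (madj n) _ Dn' I) as [l1 D1]. eexists. apply (gder_comp _ cexp (mob (madj n))); [apply cder_cexp|exact D1].
    + intros z Hz. assert (I := mob_Im_pos n z Dn Hz). rewrite clog_Re by auto. split; intros G.
      * rewrite (proj2 (Sq z Hz) G). apply ln_1.
      * apply (geo_true_image (a, b, c, d) z D Hz) in G. unfold l. f_equal. apply Sl; auto.
    + intros q H1 H2. assert (I := Iexp q H1 H2). assert (I' := mob_Im_pos _ _ Dn' I).
      assert (E : mob n (mob (madj n) (cexp q)) = cexp q) by (apply mob_adj_r; auto). split; intros G.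
      * apply Sq; auto. rewrite E, Cmod_cexp, G. apply exp_0.
      * apply (geo_true_image (a, b, c, d) _ D I'). apply Sl; auto. rewrite E, Cmod_cexp, G. unfold l. apply exp_ln; auto.
  (* Of the reciprocal numbers k and k' the larger modulus is |t| + |2 p Q|. It lies between |t| and
     2 |t| because (2 p Q)^2 = t^2 - 1. *)
  - assert (Hk : Rabs k = Rabs t + Rabs (2 * p * Q) \/ Rabs k' = Rabs t + Rabs (2 * p * Q)).
    { unfold k, k'. generalize (2 * p * Q). intros r.
      unfold Rabs. repeat destruct Rcase_abs; first [left; lra|right; lra]. }
    assert (Hq : 0 <= Rabs (2 * p * Q) <= Rabs t).
    { split; [apply Rabs_pos|]. apply Rsqr_incr_0; try apply Rabs_pos. rewrite !Rsqr_pow2, !pow2_abs.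
      replace ((2 * p * Q) ^ 2) with (4 * (Q * (p * p)) * Q) by ring. rewrite p2. lra. }
    assert (Kk : Rabs k * Rabs k' = 1) by (rewrite <- Rabs_mult, kk, Rabs_R1; auto).
    assert (G : forall z, z = Rabs t + Rabs (2 * p * Q) -> ln (Rabs t) <= ln z <= ln (2 * Rabs t) /\ 0 <= ln z).
    { intros z ->. split; [split; apply ln_le; lra|]. rewrite <- ln_1. apply ln_le; lra. }
    unfold l. destruct Hk as [Hk|Hk]; destruct (G _ Hk) as [G1 G2].
    + rewrite (Rabs_right (ln (Rabs k))) by lra. exact G1.
    + assert (Rabs k = / Rabs k'). { apply Rmult_eq_reg_r with (Rabs k'); [rewrite Rinv_l; lra|]; lra. }
      rewrite H, ln_Rinv by lra. rewrite Rabs_Ropp, (Rabs_right (ln (Rabs k'))) by lra. exact G1.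
Qed.

(** Since t^2 = 1 + 4 P Q, one of P, Q vanishes: the image has the end point 0 or infinity in common
    with the imaginary axis. In the latter case it is already a vertical line, in the former z ->
    -1/z makes it one. *)
Lemma straightening_parabolic m : det m = 1 -> Rabs (tval true m) = 1 ->
  exists Psi Phi l, straightening Psi Phi (fun _ => True) true m l.
Proof.
  intros D Ht. destruct m as [[[a b] c] d]. unfold tval in *. simpl in D.
  set (t := a * d + b * c) in *. set (P := a * b). set (Q := c * d).
  assert (T2 : t ^ 2 = 1) by (rewrite <- (pow2_abs t), Ht; ring).
  assert (Et : t ^ 2 = 1 + 4 * (P * Q)).
  { unfold t, P, Q. replace ((a * d + b * c) ^ 2) with ((a * d - b * c) ^ 2 + 4 * (a * b * (c * d))) by ring. rewrite D. ring. }
  assert (tn : t <> 0) by (intros Z; rewrite Z in T2; lra).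
  assert (PQ : P * Q = 0) by lra. apply Rmult_integral in PQ. destruct PQ as [Z|Z].
  - set (S := (0, -1, 1, 0) : mat). assert (DS : det S = 1) by (simpl; ring).
    assert (Inv : forall z, 0 < Im z -> mob S (mob S z) = z).
    { intros z Hz. unfold S, mob. assert (z <> RtoC 0) by (apply Cneq_Im; cre; lra).
      replace (RtoC (-1)) with (- RtoC 1)%C by (apply C_ext; cre; ring). field. auto. }
    assert (ReS : forall z, 0 < Im z -> Re (mob S z) * Cmod z ^ 2 = - Re z /\ 0 < Cmod z ^ 2).
    { intros z Hz. assert (N : z <> RtoC 0) by (apply Cneq_Im; cre; lra). 
      assert (Pz : 0 < Cmod z ^ 2) by (apply pow_lt, Cmod_pos; auto). split; auto. unfold S, mob.
      replace (RtoC 1 * z + RtoC 0)%C with z by ring. rewrite Re_div_pos by auto. cre. field. apply Rgt_not_eq, Cmod_pos; auto. }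
    assert (K : forall z, 0 < Im z -> (geo true (mob (madj (a, b, c, d)) z) <-> Re (mob S z) = - Q / t)).
    { intros z Hz. rewrite (geo_true_image (a, b, c, d) z D Hz). fold t P Q. destruct (ReS z Hz) as [R1 R2]. rewrite Z.
      split; intros G.
      - apply Rmult_eq_reg_r with (t * Cmod z ^ 2). { replace (Re (mob S z) * (t * Cmod z ^ 2)) with (t * (Re (mob S z) * Cmod z ^ 2)) by ring.
          rewrite R1. field_simplify; auto. lra. } apply Rmult_integral_contrapositive; split; lra.
      - rewrite G in R1. assert (Q * Cmod z ^ 2 = t * Re z); [|lra].
        replace (Re z) with (- (- Q / t * Cmod z ^ 2)) by lra. field. auto. }
    exists (mob S), (mob S), (- Q / t). split; [|split; [|split]].
    + intros z Hz. split. { apply mob_Im_pos; auto. } split; auto. split; auto. apply cder_mob; auto.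
    + intros q Hq _. split. { apply mob_Im_pos; auto. } apply cder_mob; auto.
    + intros z Hz. destruct (ReS z Hz) as [R1 R2]. split; intros G.
      * unfold geo in G. rewrite G in R1. apply Rmult_eq_reg_r with (Cmod z ^ 2); lra.
      * apply K; auto.
    + intros q Hq _. assert (I := mob_Im_pos S q DS Hq). split; intros G.
      * destruct (ReS q Hq) as [R1 R2]. unfold geo. rewrite G in R1. apply Rmult_eq_reg_r with (Cmod q ^ 2); lra.
      * apply K; auto. rewrite Inv; auto.
  - assert (K : forall z, 0 < Im z -> (geo true (mob (madj (a, b, c, d)) z) <-> Re z = P / t)).
    { intros z Hz. rewrite (geo_true_image (a, b, c, d) z D Hz). fold t P Q. rewrite Z. split; intros G.
      - apply Rmult_eq_reg_r with t; auto. unfold Rdiv. rewrite Rmult_assoc, Rinv_l by auto. lra.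
      - rewrite G. field. auto. }
    exists (fun q => q), (fun q => q), (P / t). split; [|split; [|split]].
    + intros z Hz. repeat split; auto. eexists. apply gder_id.
    + intros q Hq _. split; auto. eexists. apply gder_id.
    + intros z Hz. split; auto. apply K; auto.
    + intros q Hq _. split; auto. apply K; auto.
Qed.

(* rotation of order 4 carrying the imaginary axis to the unit circle *)
Definition rot4 : mat := (sqrt (1/2), - sqrt (1/2), sqrt (1/2), sqrt (1/2)).

Lemma sqrt_half_sqr : sqrt (1/2) * sqrt (1/2) = 1/2.
Proof. apply sqrt_sqrt; lra. Qed.

Lemma rot4_det : det rot4 = 1.
Proof. simpl. generalize sqrt_half_sqr. lra. Qed.

Lemma geo_rot4 t : 0 < Im t -> (geo false t <-> geo true (mob (madj rot4) t)).
Proof.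
  intros Ht. rewrite (geo_true_image rot4 t rot4_det Ht). unfold rot4, geo. assert (s := sqrt_half_sqr).
  set (r := sqrt (1/2)) in *.
  replace (r * r * Cmod t ^ 2 - (r * r + - r * r) * Re t + r * - r) with ((r * r) * (Cmod t ^ 2 - 1)) by ring. rewrite s.
  split; intros G.
  - rewrite G. ring.
  - apply Cmod_eq_sqr; lra.
Qed.

Definition conj_rot4 (m : mat) : mat := mmul (madj rot4) (mmul m rot4).

Lemma tval_rot4 m : tval true (conj_rot4 m) = tval false m.
Proof.
  destruct m as [[[a b] c] d]. unfold conj_rot4, rot4, madj, mmul, tval. assert (s := sqrt_half_sqr).
  set (r := sqrt (1/2)) in *.
  match goal with |- ?l = _ => replace l with ((r * r) * (r * r) * (2 * (a ^ 2 + d ^ 2 - b ^ 2 - c ^ 2))) by ring end.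
  rewrite s. field.
Qed.

Lemma straightening_rot4 Psi Phi bd m l : det m = 1 -> straightening Psi Phi bd true (conj_rot4 m) l ->
  straightening (fun q => mob rot4 (Psi q)) (fun t => Phi (mob (madj rot4) t)) bd false m l.
Proof.
  intros D [H1 [H2 [H3 H4]]]. assert (Dr := rot4_det). assert (Dr' : det (madj rot4) = 1) by (rewrite det_madj; auto).
  assert (Dm' : det (madj m) = 1) by (rewrite det_madj; auto).
  assert (Dc : det (conj_rot4 m) = 1) by (unfold conj_rot4; rewrite !det_mmul, Dr', D, Dr; ring).
  assert (Cj : forall t, 0 < Im t -> mob (madj (conj_rot4 m)) (mob (madj rot4) t) = mob (madj rot4) (mob (madj m) t)).
  { intros t Ht. assert (It := mob_Im_pos _ t Dr' Ht). assert (Im' := mob_Im_pos _ t Dm' Ht).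
    assert (X : mob (conj_rot4 m) (mob (madj rot4) (mob (madj m) t)) = mob (madj rot4) t).
    { unfold conj_rot4. rewrite mob_mmul; auto; [|rewrite det_mmul, D, Dr; ring|apply mob_Im_pos; auto].
      rewrite mob_mmul; auto; [|apply mob_Im_pos; auto]. rewrite mob_adj_r; auto. rewrite mob_adj_r; auto. }
    rewrite <- X. apply mob_adj_l; auto. apply mob_Im_pos; auto. }
  split; [|split; [|split]].
  - intros t Ht. assert (It := mob_Im_pos _ t Dr' Ht). destruct (H1 _ It) as [A [B [E [k Hk]]]].
    split; [exact A|]. split; [exact B|]. split. { rewrite E. apply mob_adj_r; auto. }
    destruct (cder_mob (madj rot4) t Dr' Ht) as [l1 D1]. eexists. apply (gder_comp _ (mob (madj rot4)) Phi); eauto.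
  - intros q Hq Bq. destruct (H2 q Hq Bq) as [A [k Hk]]. split. { apply mob_Im_pos; auto. }
    destruct (cder_mob rot4 _ Dr A) as [l1 D1]. eexists. apply (gder_comp _ Psi (mob rot4)); eauto.
  - intros t Ht. assert (It := mob_Im_pos _ t Dr' Ht). destruct (H3 _ It) as [A B]. split; intros G.
    + apply A. apply geo_rot4; auto.
    + apply B. rewrite Cj by auto. apply geo_rot4; auto. apply mob_Im_pos; auto.
  - intros q Hq Bq. destruct (H4 q Hq Bq) as [A B]. destruct (H2 q Hq Bq) as [I _].
    assert (Ir := mob_Im_pos rot4 _ Dr I). split; intros G.
    + apply geo_rot4; auto. rewrite mob_adj_l by auto. auto.
    + apply geo_rot4. { apply mob_Im_pos; auto. } rewrite <- Cj by auto. rewrite mob_adj_l by auto. auto.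
Qed.

Lemma straightening_exists e m : det m = 1 ->
  (1 < Rabs (tval e m) -> exists Psi Phi l, straightening Psi Phi (fun y => y < PI) e m l /\
    ln (Rabs (tval e m)) <= Rabs l <= ln (2 * Rabs (tval e m))) /\
  (Rabs (tval e m) = 1 -> exists Psi Phi l, straightening Psi Phi (fun _ => True) e m l).
Proof.
  intros D. destruct e.
  - split; [apply straightening_hyperbolic|apply straightening_parabolic]; auto.
  - assert (Dc : det (conj_rot4 m) = 1).
    { unfold conj_rot4. rewrite !det_mmul, det_madj, D, rot4_det; ring. }
    rewrite <- tval_rot4. split; intros H.
    + destruct (straightening_hyperbolic _ Dc H) as [Psi [Phi [l [S B]]]].
      do 3 eexists. split; [apply straightening_rot4; eauto|exact B].
    + destruct (straightening_parabolic _ Dc H) as [Psi [Phi [l S]]].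
      do 3 eexists. apply straightening_rot4; eauto.
Qed.

(** * Cauchy's theorem for maps into a strip *)

Lemma rect_uniformly_continuous (f : C -> C) a b c d eps : a < b -> c < d -> 0 < eps -> cont_on (rect a b c d) f ->
  exists delta, 0 < delta /\ forall z w, rect a b c d z -> rect a b c d w -> Cmod (w - z) < delta -> Cmod (f w - f z) < eps.
Proof.
  intros Hab Hcd He Hf.
  assert (M : exists delta, 0 < delta /\ forall z, rect a b c d z -> forall w, rect a b c d w -> Cmod (w - z) < delta -> Cmod (f w - f z) < eps).
  { apply (rectangle_bisection (fun a' b' c' d' => exists delta, 0 < delta /\ forall z, rect a' b' c' d' z -> forall w, rect a b c d w -> Cmod (w - z) < delta -> Cmod (f w - f z) < eps)); auto.
    - intros a' m b' c' d' _ _ _ _ _ _ [h1 [P1 Q1]] [h2 [P2 Q2]]. exists (Rmin h1 h2). split; [apply Rmin_pos; auto|].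
      intros z Hz w Hw L. unfold rect in Hz. destruct (Rle_dec (Re z) m).
      + apply Q1; auto. { unfold rect; lra. } eapply Rlt_le_trans; [apply L|apply Rmin_l].
      + apply Q2; auto. { unfold rect; lra. } eapply Rlt_le_trans; [apply L|apply Rmin_r].
    - intros a' b' c' m d' _ _ _ _ _ _ [h1 [P1 Q1]] [h2 [P2 Q2]]. exists (Rmin h1 h2). split; [apply Rmin_pos; auto|].
      intros z Hz w Hw L. unfold rect in Hz. destruct (Rle_dec (Im z) m).
      + apply Q1; auto. { unfold rect; lra. } eapply Rlt_le_trans; [apply L|apply Rmin_l].
      + apply Q2; auto. { unfold rect; lra. } eapply Rlt_le_trans; [apply L|apply Rmin_r].
    - intros x y Hx Hy. assert (D : rect a b c d (x, y)) by (unfold rect; simpl; lra).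
      destruct (Hf _ D (eps/2)) as [r [Hr F]]; [lra|]. exists (r / 4). split; [lra|].
      intros a' b' c' d' _ _ Ha Hb Hc Hd L1 L2 _. exists (r / 2). split; [lra|]. intros z Hz w Hw L.
      assert (Dz : Cmod (z - (x, y)) < r / 2).
      { eapply Rle_lt_trans; [apply Cmod_le_sum|]. cre. unfold rect in Hz.
        apply Rlt_le_trans with (r/4 + r/4); [|lra]. apply Rplus_lt_compat; apply Rabs_def1; lra. }
      assert (F1 := F z). assert (F2 := F w Hw).
      replace (f w - f z)%C with ((f w - f (x, y)) - (f z - f (x, y)))%C by ring.
      eapply Rle_lt_trans; [apply Cmod_minus_le|].
      assert (Cmod (f w - f (x, y)) < eps / 2).
      { apply F2. replace (w - (x, y))%C with ((w - z) + (z - (x, y)))%C by ring. eapply Rle_lt_trans; [apply Cmod_triangle|]. lra. }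
      assert (Cmod (f z - f (x, y)) < eps / 2).
      { apply F1; [|lra]. unfold rect in *. lra. }
      lra. }
  destruct M as [delta [Hd F]]. exists delta. split; auto.
Qed.

Lemma RInt_abs_bound (g : R -> R) a b M : a <= b -> ex_RInt g a b -> (forall x, a < x < b -> Rabs (g x) <= M) ->
  Rabs (RInt g a b) <= M * (b - a).
Proof.
  intros Hab Hg Hb. generalize (RInt_near_constant g a b 0 M Hab Hg). rewrite Rmult_0_l, Rminus_0_r.
  intros X. apply X. intros x Hx. rewrite Rminus_0_r. auto.
Qed.

(* Cauchy's theorem bounds the width of a holomorphic image of a rectangle in a strip:
   the real part of the boundary integral of g is l * width minus an integral of differences of Im g. *)
Lemma strip_width (g : C -> C) x0 y0 bw ah l : 0 < bw -> 0 < ah ->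
  cont_on (rect x0 (x0 + bw) y0 (y0 + ah)) g ->
  (forall z, rect_open x0 (x0 + bw) y0 (y0 + ah) z -> exists k, cder g z k) ->
  (forall z, rect x0 (x0 + bw) y0 (y0 + ah) z -> 0 < Im (g z) < PI) ->
  (forall x, x0 < x < x0 + bw -> Re (g (x, y0)) = 0 /\ Re (g (x, y0 + ah)) = l) ->
  Rabs l * bw <= PI * ah.
Proof.
  intros Hb Ha Hc Hd HI HB. assert (Pp := PI_RGT_0).
  apply Rnot_lt_le. intros N.
  set (gap := Rabs l * bw - PI * ah). assert (Hgap : 0 < gap) by (unfold gap; lra).
  assert (Pl := Rabs_pos l).
  (* Goursat's theorem asks for differentiability up to the boundary, so the rectangle is shrunk.
     Uniform continuity keeps the real parts on the horizontal sides within [eta] of 0 and [l], and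
     the total loss stays below [gap]. *)
  set (eps := Rmin (bw / 4) (gap / (8 * (Rabs l + 1)))).
  assert (He : 0 < eps). { unfold eps. apply Rmin_pos; [lra|]. apply Rdiv_lt_0_compat; lra. }
  assert (e1 : eps <= bw / 4) by apply Rmin_l. assert (e2 : eps <= gap / (8 * (Rabs l + 1))) by apply Rmin_r.
  set (eta := gap / (8 * bw)). assert (Heta : 0 < eta) by (unfold eta; apply Rdiv_lt_0_compat; lra).
  destruct (rect_uniformly_continuous g x0 (x0 + bw) y0 (y0 + ah) eta) as [dl [Hdl U]]; try lra; auto.
  set (s := Rmin (ah / 4) (dl / 2)). assert (Hs : 0 < s) by (unfold s; apply Rmin_pos; lra).
  assert (s1 : s <= ah / 4) by apply Rmin_l. assert (s2 : s <= dl / 2) by apply Rmin_r.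
  set (X1 := x0 + eps). set (X2 := x0 + bw - eps). set (Y1 := y0 + s). set (Y2 := y0 + ah - s).
  assert (Dg : forall z, rect X1 X2 Y1 Y2 z -> exists k, cder g z k).
  { intros z Hz. apply Hd. unfold rect, rect_open, X1, X2, Y1, Y2 in *. lra. }
  assert (G := goursat_rectangle g X1 X2 Y1 Y2 ltac:(unfold X1, X2; lra) ltac:(unfold Y1, Y2; lra) Dg).
  unfold boundary_form in G.
  assert (Cg : forall z, rect X1 X2 Y1 Y2 z -> cont_at (fun _ => True) g z).
  { intros z Hz. destruct (Dg z Hz) as [k Hk]. eapply cder_cont; eauto. }
  assert (I1 : forall y, Y1 <= y <= Y2 -> ex_RInt (fun x => Re (g (x, y))) X1 X2).
  { intros y Hy. apply (ex_RInt_continuous (V:=R_CompleteNormedModule)). intros x. rewrite Rmin_left, Rmax_right by (unfold X1, X2; lra). intros Hx.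
    apply cont_horizontal, Cg. unfold rect; cre; lra. }
  assert (I2 : forall x, X1 <= x <= X2 -> ex_RInt (fun y => Im (g (x, y))) Y1 Y2).
  { intros x Hx. apply (ex_RInt_continuous (V:=R_CompleteNormedModule)). intros y. rewrite Rmin_left, Rmax_right by (unfold Y1, Y2; lra). intros Hy.
    apply cont_vertical, Cg. unfold rect; cre; lra. }
  assert (T1 : Rabs (RInt (fun x => Re (g (x, Y1)) - Re (g (x, Y2))) X1 X2 - (- l) * (X2 - X1)) <= 2 * eta * (X2 - X1)).
  { apply RInt_near_constant. { unfold X1, X2; lra. }
    { apply (ex_RInt_minus (V:=R_NormedModule)); apply I1; unfold Y1, Y2; lra. }
    intros x Hx. assert (Hx' : x0 < x < x0 + bw) by (unfold X1, X2 in Hx; lra). destruct (HB x Hx') as [B1 B2].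
    assert (D1 : Cmod (g (x, Y1) - g (x, y0)) < eta).
    { apply U; try (unfold rect, Y1; cre; lra). eapply Rle_lt_trans; [apply Cmod_le_sum|]. cre. rewrite Rminus_diag, Rabs_R0. unfold Y1.
      rewrite Rabs_right; lra. }
    assert (D2 : Cmod (g (x, Y2) - g (x, y0 + ah)) < eta).
    { apply U; try (unfold rect, Y2; cre; lra). eapply Rle_lt_trans; [apply Cmod_le_sum|]. cre. rewrite Rminus_diag, Rabs_R0. unfold Y2.
      rewrite Rabs_left; lra. }
    assert (R1 := Re_lip (g (x, Y1)) (g (x, y0))). assert (R2 := Re_lip (g (x, Y2)) (g (x, y0 + ah))).
    rewrite B1 in R1. rewrite B2 in R2. apply Rabs_le_between in R1. apply Rabs_le_between in R2. apply Rabs_le_between. lra. }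
  assert (T2 : Rabs (RInt (fun y => Im (g (X2, y)) - Im (g (X1, y))) Y1 Y2) <= PI * (Y2 - Y1)).
  { apply RInt_abs_bound. { unfold Y1, Y2; lra. }
    { apply (ex_RInt_minus (V:=R_NormedModule)); apply I2; unfold X1, X2; lra. }
    intros y Hy. assert (A1 := HI (X1, y) ltac:(unfold rect, X1, Y1, Y2 in *; cre; lra)).
    assert (A2 := HI (X2, y) ltac:(unfold rect, X2, Y1, Y2 in *; cre; lra)). apply Rabs_le. lra. }
  assert (Q : Rabs l * (X2 - X1) <= 2 * eta * (X2 - X1) + PI * (Y2 - Y1)).
  { assert (E : RInt (fun x => Re (g (x, Y1)) - Re (g (x, Y2))) X1 X2 = RInt (fun y => Im (g (X2, y)) - Im (g (X1, y))) Y1 Y2) by lra.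
    rewrite E in T1. set (J := RInt (fun y => Im (g (X2, y)) - Im (g (X1, y))) Y1 Y2) in *.
    rewrite <- (Rabs_right (X2 - X1)) at 1 by (unfold X1, X2; lra). rewrite <- Rabs_mult.
    replace (l * (X2 - X1)) with ((J - - l * (X2 - X1)) - J) by ring.
    eapply Rle_trans; [apply Rabs_triang|]. rewrite Rabs_Ropp. lra. }
  assert (E1 : X2 - X1 = bw - 2 * eps) by (unfold X1, X2; ring). assert (E2 : Y2 - Y1 = ah - 2 * s) by (unfold Y1, Y2; ring).
  rewrite E1, E2 in Q.
  assert (Z1 : 2 * Rabs l * eps <= gap / 4).
  { apply Rle_trans with (2 * Rabs l * (gap / (8 * (Rabs l + 1)))). { apply Rmult_le_compat_l; lra. }
    apply Rmult_le_reg_r with (8 * (Rabs l + 1)); [lra|].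
    replace (2 * Rabs l * (gap / (8 * (Rabs l + 1))) * (8 * (Rabs l + 1))) with (2 * Rabs l * gap) by (field; lra). nra. }
  assert (Z2 : 2 * eta * bw = gap / 4) by (unfold eta; field; lra).
  assert (Z3 : 2 * eta * (bw - 2 * eps) <= gap / 4) by (rewrite <- Z2; apply Rmult_le_compat_l; lra).
  assert (Z4 : PI * (ah - 2 * s) <= PI * ah) by (apply Rmult_le_compat_l; lra).
  unfold gap in *. lra.
Qed.

Import ListNotations.

(** * Word matrices and syllables *)

Definition tmat (t : bool * Z) : mat :=
  if fst t then (1, IZR (2 * snd t), 0, 1) else (1, 0, IZR (2 * - snd t), 1).
Definition wmat (w : fword) : mat := fold_right (fun t m => mmul (tmat t) m) (1, 0, 0, 1) w.

Lemma tmat_G2 t : G2 (tmat t).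
Proof.
  destruct t as [[|] n]; unfold tmat; simpl fst; simpl snd.
  - exists 0%Z, n, 0%Z, 0%Z. split; [reflexivity|lia].
  - exists 0%Z, 0%Z, (- n)%Z, 0%Z. split; [reflexivity|lia].
Qed.

Lemma wmat_G2 w : G2 (wmat w).
Proof. induction w; [apply G2_one|]. simpl. apply G2_mul; auto. apply tmat_G2. Qed.

(* right action of a term on an integer row vector *)
Definition rstep (r : Z * Z) (t : bool * Z) : Z * Z :=
  if fst t then (fst r, snd r + 2 * snd t * fst r)%Z else (fst r - 2 * snd t * snd r, snd r)%Z.

Lemma wmat_rows w (x y : Z) :
  let '(a, b, c, d) := wmat w in let r := fold_left rstep w (x, y) in
  IZR (fst r) = IZR x * a + IZR y * c /\ IZR (snd r) = IZR x * b + IZR y * d.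
Proof.
  revert x y. induction w as [|[g n] w IH]; intros x y.
  - simpl. lra.
  - change (wmat ((g, n) :: w)) with (mmul (tmat (g, n)) (wmat w)). destruct (wmat w) as [[[a b] c] d]. cbv zeta in *. destruct g.
    + change (fold_left rstep ((true, n) :: w) (x, y)) with (fold_left rstep w (x, (y + 2 * n * x)%Z)).
      destruct (IH x (y + 2 * n * x)%Z) as [E1 E2]. rewrite E1, E2.
      unfold mmul, tmat. cbn [fst snd]. rewrite ?plus_IZR, ?minus_IZR, ?mult_IZR, ?opp_IZR. split; ring.
    + change (fold_left rstep ((false, n) :: w) (x, y)) with (fold_left rstep w ((x - 2 * n * y)%Z, y)).
      destruct (IH (x - 2 * n * y)%Z y) as [E1 E2]. rewrite E1, E2.
      unfold mmul, tmat. cbn [fst snd]. rewrite ?plus_IZR, ?minus_IZR, ?mult_IZR, ?opp_IZR. split; ring.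
Qed.

Local Open Scope Z_scope.

(** The row recursion without signs: [e] is the sign of the last exponent, [p] the entry changed
    last, [q] the other one. An exponent of the same sign subtracts [q], one of opposite sign adds
    it. *)
Fixpoint evol (e p q : Z) (l : list Z) : Z * Z * Z :=
  match l with
  | [] => (e, p, q)
  | n :: l' => evol (Z.sgn n) (2 * Z.abs n * p - e * Z.sgn n * q) p l'
  end.

(* A row reached after a term with generator [g] and exponent of sign [e]: up to the sign [s], its large
   entry is [p], and its small entry has absolute value [q] with a sign governed by [e]. *)
Definition row_of (g : bool) (s e p q : Z) : Z * Z :=
  if g then (s * e * q, s * p) else (- (s * p), s * e * q).

Lemma rstep_row g s e p q n : n <> 0 -> s * s = 1 ->
  rstep (row_of g s e p q) (negb g, n) =
  row_of (negb g) (if g then s * Z.sgn n else - (s * Z.sgn n)) (Z.sgn n) (2 * Z.abs n * p - e * Z.sgn n * q) p.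
Proof.
  intros Hn Hs. assert (E1 : Z.sgn n * Z.sgn n = 1) by (destruct n; simpl; lia).
  assert (E2 : Z.abs n = Z.sgn n * n) by (rewrite Z.mul_comm; symmetry; apply Z.sgn_abs).
  unfold rstep, row_of. destruct g; cbn [fst snd negb]; rewrite E2.
  - f_equal.
    + transitivity (s * (e * q) * (Z.sgn n * Z.sgn n) - (Z.sgn n * Z.sgn n) * s * 2 * n * p); [rewrite E1; ring|ring].
    + transitivity (s * p * (Z.sgn n * Z.sgn n)); [rewrite E1; ring|ring].
  - f_equal.
    + transitivity (- (s * p) * (Z.sgn n * Z.sgn n)); [rewrite E1; ring|ring].
    + transitivity (s * (e * q) * (Z.sgn n * Z.sgn n) - (Z.sgn n * Z.sgn n) * s * 2 * n * p); [rewrite E1; ring|ring].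
Qed.

(** The last clause follows a second row with the same [g'] and [s'], so the relative sign of the
    two rows of a matrix is under control. *)
Lemma rows_evol w g s e p q : s * s = 1 -> (forall t, In t w -> snd t <> 0) ->
  alternating ((g, 1) :: w) ->
  exists g' s', s' * s' = 1 /\ fold_left rstep w (row_of g s e p q) =
    (let '(e', p', q') := evol e p q (map snd w) in row_of g' s' e' p' q') /\
    forall s2 e2 p2 q2, s2 * s2 = 1 -> e2 = e -> fold_left rstep w (row_of g s2 e2 p2 q2) =
    (let '(e', p', q') := evol e2 p2 q2 (map snd w) in row_of g' (s2 * s * s') e' p' q').
Proof.
  revert g s e p q. induction w as [|[h n] w IH]; intros g s e p q Hs Hn Ha.
  - exists g, s. split; auto. split; [reflexivity|]. intros s2 e2 p2 q2 H2 ->. simpl.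
    replace (s2 * s * s) with (s2 * (s * s)) by ring. rewrite Hs, Z.mul_1_r. reflexivity.
  - destruct Ha as [Hgh Ha]. assert (h = negb g) by (destruct g, h; auto; exfalso; apply Hgh; auto). subst h.
    assert (Nn : n <> 0) by (apply (Hn (negb g, n)); simpl; auto).
    assert (E1 : Z.sgn n * Z.sgn n = 1) by (destruct n; simpl; lia).
    simpl fold_left. rewrite rstep_row by auto.
    set (s1 := if g then s * Z.sgn n else - (s * Z.sgn n)).
    assert (Hs1 : s1 * s1 = 1).
    { unfold s1. destruct g; [replace (s * Z.sgn n * (s * Z.sgn n)) with ((s * s) * (Z.sgn n * Z.sgn n)) by ring
        |replace (- (s * Z.sgn n) * - (s * Z.sgn n)) with ((s * s) * (Z.sgn n * Z.sgn n)) by ring]; rewrite Hs, E1; ring. }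
    destruct (IH (negb g) s1 (Z.sgn n) (2 * Z.abs n * p - e * Z.sgn n * q) p Hs1) as [g' [s' [Hs' [E F]]]].
    { intros; apply Hn; simpl; auto. }
    { destruct w as [|[h m] w]; simpl in *; auto. }
    exists g', s'. split; auto. split; [exact E|]. intros s2 e2 p2 q2 H2 ->.
    cbn [map fold_left snd]. rewrite rstep_row by auto. cbn [evol].
    rewrite F; auto.
    + replace ((if g then s2 * Z.sgn n else - (s2 * Z.sgn n)) * s1 * s') with (s2 * s * s'); auto.
      unfold s1. destruct g; (transitivity (s2 * s * s' * (Z.sgn n * Z.sgn n)); [rewrite E1; ring|ring]) || (symmetry; transitivity (s2 * s * s' * (Z.sgn n * Z.sgn n)); [ring|rewrite E1; ring]).
    + destruct g; (transitivity ((s2 * s2) * (Z.sgn n * Z.sgn n)); [ring|rewrite H2, E1; ring]).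
Qed.

Lemma evol_e_indep e p q p2 q2 l : fst (fst (evol e p q l)) = fst (fst (evol e p2 q2 l)).
Proof. revert e p q p2 q2. induction l; intros; simpl; auto. Qed.

(** Used with k = 1 and k = -1: in the second problem 2 t is, up to sign, (p1 - p2)(p1 + p2) - (q1 -
    q2)(q1 + q2), so the sum and the difference of the rows are the natural states. *)
Lemma evol_linear e k p q p2 q2 l :
  let '(_, x, y) := evol e p q l in let '(_, x2, y2) := evol e p2 q2 l in
  exists e', evol e (p + k * p2) (q + k * q2) l = (e', x + k * x2, y + k * y2).
Proof.
  revert e p q p2 q2. induction l as [|n l IH]; intros; cbn [evol].
  - exists e; auto.
  - specialize (IH (Z.sgn n) (2 * Z.abs n * p - e * Z.sgn n * q) p (2 * Z.abs n * p2 - e * Z.sgn n * q2) p2).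
    destruct (evol (Z.sgn n) (2 * Z.abs n * p - e * Z.sgn n * q) p l) as [[? x] y].
    destruct (evol (Z.sgn n) (2 * Z.abs n * p2 - e * Z.sgn n * q2) p2 l) as [[? x2] y2].
    destruct IH as [e' IH]. exists e'. rewrite <- IH. f_equal; ring.
Qed.

Definition sdprod (l : list nat) : Z := fold_right (fun d acc => (4 * Z.of_nat d - 1) * acc) 1 l.

Lemma sdprod_app l l' : sdprod (l ++ l') = sdprod l * sdprod l'.
Proof.
  induction l; [symmetry; apply Z.mul_1_l|].
  change (sdprod ((a :: l) ++ l')) with ((4 * Z.of_nat a - 1) * sdprod (l ++ l')).
  change (sdprod (a :: l)) with ((4 * Z.of_nat a - 1) * sdprod l). rewrite IHl. ring.
Qed.

Lemma sgn_cases n : n <> 0 -> (Z.sgn n = 1 /\ Z.abs n = n) \/ (Z.sgn n = -1 /\ Z.abs n = - n).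
Proof. intros. destruct n; simpl; lia. Qed.

Lemma evol_nonneg e p q l : (e = 1 \/ e = -1) -> 0 <= q <= p -> (forall n, In n l -> n <> 0) ->
  let '(_, p', q') := evol e p q l in 0 <= q' <= p' /\ p <= p' /\ (l <> [] -> p <= q').
Proof.
  revert e p q. induction l as [|n l IH]; intros e p q He Hpq Hn; cbn [evol].
  - split; [lia|]. split; [lia|congruence].
  - assert (Nn : n <> 0) by (apply Hn; simpl; auto).
    assert (Q : p <= 2 * Z.abs n * p - e * Z.sgn n * q).
    { destruct (sgn_cases n Nn) as [[S A]|[S A]]; rewrite S; destruct He; subst e; nia. }
    specialize (IH (Z.sgn n) (2 * Z.abs n * p - e * Z.sgn n * q) p).
    destruct (evol _ _ p l) as [[e' p'] q'] eqn:E.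
    assert (X : 0 <= q' <= p' /\ 2 * Z.abs n * p - e * Z.sgn n * q <= p' /\ (l <> [] -> 2 * Z.abs n * p - e * Z.sgn n * q <= q')).
    { apply IH. { destruct n; simpl; lia. } { lia. } intros; apply Hn; simpl; auto. }
    split; [tauto|]. split; [lia|]. intros _. destruct l; [|destruct X as [_ [_ X]]; specialize (X ltac:(congruence)); lia].
    cbn [evol] in E. inversion E; subst. lia.
Qed.

(* The state of the syllable parser against the row [(p, q)]; [D] is the product over the finished syllables.
   In a run of [c] equal unit exponents the row moves linearly, [p = y + c dl]; the constants 9/7 and 2/3
   are what makes the estimates [p^2 >= D] close up under all transitions. *)
Definition inv (cur : option (Z * nat)) (e p q D : Z) : Prop :=
  0 < D /\ (e = 1 \/ e = -1) /\
  match cur with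
  | None => 9 * D <= 7 * (p * p) /\ 0 <= 3 * q <= p /\ 0 < p <= D
  | Some (n, c) => n = e /\ (0 < c)%nat /\ exists y dl, p = y + Z.of_nat c * dl /\ q = p - dl /\
      0 < y <= D /\ 0 < dl <= 2 * y /\ 0 <= q /\ ((D <= y * y /\ y <= dl) \/ (9 * D <= 7 * (y * y) /\ 2 * y <= 3 * dl))
  end.

Lemma inv_flush cur e p q D : inv cur e p q D ->
  D * sdprod (flush cur) <= p * p /\ 0 <= q <= p /\ 0 < p <= D * sdprod (flush cur) /\ 0 < sdprod (flush cur).
Proof.
  intros [HD [He H]]. destruct cur as [[n c]|]; unfold flush, sdprod; cbn [fold_right].
  - destruct H as [-> [Hc [y [dl [-> [-> [Hy [Hd [Hq H]]]]]]]]]. set (k := Z.of_nat c) in *. assert (Hk : 1 <= k) by lia.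
    replace (D * ((4 * k - 1) * 1)) with (D * (4 * k - 1)) by ring.
    assert (Y1 : 0 < y * y) by (apply Z.mul_pos_pos; lia).
    assert (K1 : 0 <= k * dl) by (apply Z.mul_nonneg_nonneg; lia).
    assert (K2 : k * dl <= k * (2 * y)) by (apply Z.mul_le_mono_nonneg_l; lia).
    assert (K3 : (4 * k - 1) * y <= (4 * k - 1) * D) by (apply Z.mul_le_mono_nonneg_l; lia).
    assert (K4 : dl <= k * dl) by (replace dl with (1 * dl) at 1 by ring; apply Z.mul_le_mono_nonneg_r; lia).
    assert (K5 : (2 * k - 2) * y >= 0) by (apply Z.le_ge, Z.mul_nonneg_nonneg; lia).
    split; [|lia].
    (* The two cases rest on (1 + k)^2 - (4 k - 1) = (k - 1)^2 + 1 and (3 + 2 k)^2 - 7 (4 k - 1) = 4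
       (k - 2)^2. The second is sharp at k = 2, which ties the constant 9/7 to the slope 2/3. *)
    destruct H as [[H1 H2]|[H1 H2]].
    + assert (A : (1 + k) * y <= y + k * dl).
      { assert (k * y <= k * dl) by (apply Z.mul_le_mono_nonneg_l; lia). lia. }
      assert (B : (1 + k) * y * ((1 + k) * y) <= (y + k * dl) * (y + k * dl)).
      { apply Z.mul_le_mono_nonneg; auto; apply Z.mul_nonneg_nonneg; lia. }
      assert (E := Z.square_nonneg (k - 1)).
      assert (F : (4 * k - 1) * (y * y) <= (1 + k) * (1 + k) * (y * y)) by (apply Z.mul_le_mono_nonneg_r; lia).
      assert (G : D * (4 * k - 1) <= (y * y) * (4 * k - 1)) by (apply Z.mul_le_mono_nonneg_r; lia). lia.
    + assert (A : (3 + 2 * k) * y <= 3 * (y + k * dl)).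
      { assert (k * (2 * y) <= k * (3 * dl)) by (apply Z.mul_le_mono_nonneg_l; lia). lia. }
      assert (B : (3 + 2 * k) * y * ((3 + 2 * k) * y) <= (3 * (y + k * dl)) * (3 * (y + k * dl))).
      { apply Z.mul_le_mono_nonneg; auto; apply Z.mul_nonneg_nonneg; lia. }
      assert (E := Z.square_nonneg (k - 2)).
      assert (F : 7 * (4 * k - 1) * (y * y) <= (3 + 2 * k) * (3 + 2 * k) * (y * y)) by (apply Z.mul_le_mono_nonneg_r; lia).
      assert (G : 9 * D * (4 * k - 1) <= 7 * (y * y) * (4 * k - 1)) by (apply Z.mul_le_mono_nonneg_r; lia). lia.
  - destruct H as [H1 [H2 H3]]. lia.
Qed.

(** A term with |n| = k multiplies the large entry by a factor between 2 k - 1 and 2 k + 1, and 2 k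
    + 1 is at most the 4 k - 1 gained by [D]. *)
Lemma inv_big e p q D n : 0 < D -> D <= p * p -> 0 <= q <= p -> 0 < p <= D -> (e = 1 \/ e = -1) -> 2 <= Z.abs n ->
  inv None (Z.sgn n) (2 * Z.abs n * p - e * Z.sgn n * q) p (D * (4 * Z.abs n - 1)).
Proof.
  intros HD Hp Hq Hp2 He Hn. set (k := Z.abs n) in *.
  assert (Hs : Z.sgn n = 1 \/ Z.sgn n = -1) by (destruct n; simpl in *; lia).
  assert (A : (2 * k - 1) * p <= 2 * k * p - e * Z.sgn n * q <= (2 * k + 1) * p).
  { destruct Hs as [-> | ->], He as [-> | ->]; lia. }
  set (p' := 2 * k * p - e * Z.sgn n * q) in *.
  assert (K1 : 3 * p <= (2 * k - 1) * p) by (apply Z.mul_le_mono_nonneg_r; lia).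
  assert (K2 : (4 * k - 1) * p <= (4 * k - 1) * D) by (apply Z.mul_le_mono_nonneg_l; lia).
  assert (K3 : (2 * k + 1) * p <= (4 * k - 1) * p) by (apply Z.mul_le_mono_nonneg_r; lia).
  assert (K4 : 0 < D * (4 * k - 1)) by (apply Z.mul_pos_pos; lia).
  split; [exact K4|]. split; [auto|]. split; [|lia].
  assert (B : (2 * k - 1) * p * ((2 * k - 1) * p) <= p' * p').
  { apply Z.mul_le_mono_nonneg; try lia; apply Z.mul_nonneg_nonneg; lia. }
  (* This product is 7 (2 k - 1)^2 - 9 (4 k - 1); it vanishes at k = 2, so 9/7 is the best constant
     here. *)
  assert (E : 0 <= (k - 2) * (28 * k - 8)) by (apply Z.mul_nonneg_nonneg; lia).
  assert (F : 9 * (4 * k - 1) * (p * p) <= 7 * ((2 * k - 1) * (2 * k - 1)) * (p * p)).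
  { apply Z.mul_le_mono_nonneg_r; [apply Z.mul_nonneg_nonneg|]; lia. }
  assert (G : D * (4 * k - 1) <= p * p * (4 * k - 1)) by (apply Z.mul_le_mono_nonneg_r; lia). lia.
Qed.

(** After a change of sign the increment dl = p + q is at least p. After a large term it may be p -
    q, but then 3 q <= p still gives dl at least 2 p / 3. These are the two alternatives of
    [inv]. *)
Lemma inv_start_run e p q D n : 0 < D -> D <= p * p -> 0 <= q <= p -> 0 < p <= D -> (e = 1 \/ e = -1) -> Z.abs n = 1 ->
  (Z.sgn n = - e \/ (9 * D <= 7 * (p * p) /\ 3 * q <= p)) ->
  inv (Some (n, 1%nat)) (Z.sgn n) (2 * Z.abs n * p - e * Z.sgn n * q) p D.
Proof.
  intros HD Hp Hq Hp2 He Hn Hc. assert (Hs : Z.sgn n = n) by (destruct n as [|[| |]|[| |]]; simpl in *; lia).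
  assert (Hn' : n = 1 \/ n = -1) by lia. rewrite Hn, Hs in *.
  split; [auto|]. split; [auto|]. split; [auto|]. split; [lia|]. exists p, (p - e * n * q).
  split; [lia|]. split; [lia|]. split; [lia|].
  destruct Hn' as [-> | ->], He as [-> | ->]; destruct Hc as [Hc|[Hc Hc']]; try lia.
Qed.

Lemma evol_inv l : forall cur e p q D, (forall n, In n l -> n <> 0) -> inv cur e p q D ->
  let '(_, p', q') := evol e p q l in
  D * sdprod (sd_aux cur l) <= p' * p' /\ 0 <= q' <= p' /\ 0 < p' <= D * sdprod (sd_aux cur l).
Proof.
  induction l as [|n l IH]; intros cur e p q D Hn HI.
  - simpl. destruct (inv_flush _ _ _ _ _ HI) as [A [B [Hc _]]]. auto.
  - assert (Nn : n <> 0) by (apply Hn; simpl; auto).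
    assert (Hl : forall m, In m l -> m <> 0) by (intros; apply Hn; simpl; auto).
    assert (He : e = 1 \/ e = -1) by apply HI. assert (HD : 0 < D) by apply HI.
    destruct (inv_flush _ _ _ _ _ HI) as [A [B [Hc Hf]]].
    cbn [evol sd_aux]. destruct (Z.leb_spec 2 (Z.abs n)) as [L|L].
    + assert (X := inv_big e p q (D * sdprod (flush cur)) n ltac:(nia) A B Hc He L).
      specialize (IH None _ _ _ _ Hl X).
      destruct (evol _ _ p l) as [[e' p'] q'].
      rewrite sdprod_app. unfold sdprod at 2 4. cbn [fold_right]. fold (sdprod (sd_aux None l)).
      rewrite Zabs2Nat.id_abs.
      replace (D * (sdprod (flush cur) * ((4 * Z.abs n - 1) * sdprod (sd_aux None l))))
        with (D * sdprod (flush cur) * (4 * Z.abs n - 1) * sdprod (sd_aux None l)) by ring. exact IH.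
    + assert (Hu : Z.abs n = 1) by lia.
      assert (Hs : Z.sgn n = n) by (destruct n as [|[| |]|[| |]]; simpl in *; lia).
      destruct cur as [[m c]|].
      * destruct (Z.eqb_spec m n) as [E|E].
        -- apply IH; auto. destruct HI as [_ [_ [-> [Hc0 [y [dl [-> [-> [Hy [Hd [Hq H]]]]]]]]]]].
           assert (Hee : e * Z.sgn n = 1) by (rewrite Hs, <- E; destruct He; subst; reflexivity).
           split; [auto|]. split; [rewrite Hs, <- E; auto|]. split; [lia|]. split; [lia|]. exists y, dl.
           rewrite Hee, Hu, Nat2Z.inj_succ. split; [ring|]. split; [ring|]. split; [auto|]. split; [auto|]. split; [nia|auto].
        -- assert (Em : m = e) by apply HI.
           assert (X := inv_start_run e p q (D * sdprod (flush (Some (m, c)))) n ltac:(nia) A B Hc He Hu ltac:(left; lia)).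
           specialize (IH _ _ _ _ _ Hl X). destruct (evol _ _ p l) as [[e' p'] q'].
           unfold flush, sdprod at 1 3 in IH. cbn [fold_right] in IH.
           unfold sdprod at 1 2. cbn [fold_right]. fold (sdprod (sd_aux (Some (n, 1%nat)) l)).
           replace (D * ((4 * Z.of_nat c - 1) * sdprod (sd_aux (Some (n, 1%nat)) l)))
             with (D * ((4 * Z.of_nat c - 1) * 1) * sdprod (sd_aux (Some (n, 1%nat)) l)) by ring. exact IH.
      * destruct HI as [_ [_ [I1 [I2 I3]]]]. apply IH; auto. apply inv_start_run; auto; try lia.
Qed.

(** The two initial states that occur: the row (2 |n|, 1) changed by the first term for f = 0, and
    the sum of both rows for f = 1. *)
Lemma inv_start n f : n <> 0 -> f = 0 \/ f = 1 ->
  exists cur D, inv cur (Z.sgn n) (2 * Z.abs n + f) 1 D /\ forall l, sdprod (sd_aux None (n :: l)) = D * sdprod (sd_aux cur l).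
Proof.
  intros Nn Hf. assert (Hs : Z.sgn n = 1 \/ Z.sgn n = -1) by (destruct n; simpl in *; lia).
  assert (E1 : Z.sgn n * Z.sgn n = 1) by (destruct Hs as [-> | ->]; reflexivity).
  cbn [sd_aux]. destruct (Z.leb_spec 2 (Z.abs n)) as [L|L].
  - exists None, (4 * Z.abs n - 1). split.
    + set (k := Z.abs n) in *. assert (0 <= (k - 2) * (28 * k - 8)) by (apply Z.mul_nonneg_nonneg; lia).
      split; [lia|]. split; [exact Hs|]. destruct Hf; subst f; lia.
    + intros l. unfold sdprod. cbn [flush app fold_right]. rewrite Zabs2Nat.id_abs. reflexivity.
  - exists (Some (n, 1%nat)), 1. split.
    + assert (Hn : Z.sgn n = n /\ Z.abs n = 1) by (destruct n as [|[| |]|[| |]]; simpl in *; lia).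
      destruct Hn as [Hn Hn']. rewrite Hn, Hn' in *. split; [lia|]. split; [exact Hs|]. split; [reflexivity|]. split; [lia|].
      exists 1, (1 + f). lia.
    + intros l. lia.
Qed.

(** Applied to the difference of the two rows, whose gap p - q starts at 2 |n| - 2. A term with
    exponent [e] preserves the gap, and the first other term raises it to at least 2; this is where
    nonexceptional words of the second problem differ from exceptional ones. *)
Lemma evol_gap l : forall e p q, (e = 1 \/ e = -1) -> 0 <= q <= p -> (forall n, In n l -> n <> 0) ->
  (2 <= p - q \/ (p = q /\ 1 <= p /\ exists n, In n l /\ n <> e)) ->
  let '(_, p', q') := evol e p q l in 2 <= p' - q'.
Proof.
  induction l as [|n l IH]; intros e p q He Hpq Hn H.
  - simpl. destruct H as [H|[_ [_ [n [[] _]]]]]; auto.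
  - assert (Nn : n <> 0) by (apply Hn; simpl; auto). cbn [evol].
    assert (Q : p <= 2 * Z.abs n * p - e * Z.sgn n * q).
    { destruct (sgn_cases n Nn) as [[S A]|[S A]]; rewrite S; destruct He; subst e; nia. }
    apply IH.
    + destruct n; simpl; lia.
    + lia.
    + intros; apply Hn; simpl; auto.
    + assert (Hs : Z.sgn n = 1 \/ Z.sgn n = -1) by (destruct n; simpl in *; lia).
      destruct (Z.eq_dec n e) as [E|E].
      * subst n. assert (E1 : e * Z.sgn e = 1 /\ Z.abs e = 1 /\ Z.sgn e = e) by (destruct He; subst e; simpl; lia).
        destruct E1 as [E1 [E2 E3]]. rewrite E1, E2, E3. destruct H as [H|[H1 [H2 [m [Hm H3]]]]]; [left; lia|].
        right. split; [lia|]. split; [lia|]. exists m. split; auto. destruct Hm; congruence.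
      * left. assert (Hp : 1 <= p) by lia. assert (K : e * Z.sgn n = -1 \/ 2 <= Z.abs n).
        { destruct (Z_le_dec 2 (Z.abs n)); auto. left. destruct n as [|[| |]|[| |]]; simpl in *; try lia. }
        assert (K2 : e * Z.sgn n = 1 \/ e * Z.sgn n = -1) by (destruct He, Hs; subst e; rewrite H1; auto).
        destruct K2 as [K2|K2]; rewrite K2.
        -- assert (4 * p <= 2 * Z.abs n * p) by (apply Z.mul_le_mono_nonneg_r; lia). lia.
        -- assert (2 * p <= 2 * Z.abs n * p) by (apply Z.mul_le_mono_nonneg_r; lia). lia.
Qed.

Lemma evol_all_equal l : forall e p q, (e = 1 \/ e = -1) -> (forall n, In n l -> n = e) ->
  let '(_, p', q') := evol e p q l in p' - q' = p - q.
Proof.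
  induction l as [|n l IH]; intros e p q He Hl; [reflexivity|].
  cbn [evol]. rewrite (Hl n) by (simpl; auto).
  assert (E1 : e * Z.sgn e = 1 /\ Z.abs e = 1 /\ Z.sgn e = e) by (destruct He; subst e; simpl; lia).
  destruct E1 as [E1 [E2 E3]]. rewrite E1, E2, E3.
  specialize (IH e (2 * 1 * p - 1 * q) p He ltac:(intros; apply Hl; simpl; auto)).
  destruct (evol e _ p l) as [[e' p'] q']. lia.
Qed.

(* [(p1, q1)] and [(p2, q2)] are the two rows of the matrix up to sign, the former the one that the first term affects. *)
Lemma wmat_entries g n w : reduced ((g, n) :: w) ->
  let '(_, p1, q1) := evol (Z.sgn n) (2 * Z.abs n) 1 (map snd w) in
  let '(_, p2, q2) := evol (Z.sgn n) 1 0 (map snd w) in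
  Z.abs (q1 * p2 - p1 * q2) = 1 /\
  Rabs (tval true (wmat ((g, n) :: w))) = IZR (Z.abs (q1 * p2 + p1 * q2)) /\
  (2 * Rabs (tval false (wmat ((g, n) :: w))) = IZR (Z.abs (p1 * p1 + q2 * q2 - q1 * q1 - p2 * p2)))%R.
Proof.
  intros [Hn Ha]. assert (Nn : n <> 0) by (apply (Hn (g, n)); simpl; auto).
  assert (Ha' : alternating ((negb g, 1) :: (g, n) :: w)) by (split; [destruct g; simpl; congruence|exact Ha]).
  set (e0 := - Z.sgn n). assert (He0 : e0 * e0 = 1) by (unfold e0; destruct n; simpl; lia).
  destruct (rows_evol ((g, n) :: w) (negb g) 1 e0 0 0 eq_refl Hn Ha') as [g' [s' [Hs' [_ F]]]].
  assert (F1 := F (if g then -1 else 1) e0 1 0 ltac:(destruct g; reflexivity) eq_refl).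
  assert (F2 := F e0 e0 0 1 He0 eq_refl).
  cbn [map snd evol] in F1, F2.
  replace (2 * Z.abs n * 1 - e0 * Z.sgn n * 0) with (2 * Z.abs n) in F1 by ring.
  replace (2 * Z.abs n * 0 - e0 * Z.sgn n * 1) with 1 in F2 by (unfold e0; destruct n; simpl in *; lia).
  assert (Ee := evol_e_indep (Z.sgn n) (2 * Z.abs n) 1 1 0 (map snd w)).
  assert (Ee1 : let '(e, _, _) := evol (Z.sgn n) (2 * Z.abs n) 1 (map snd w) in e * e = 1).
  { assert (X : forall l e p q, e * e = 1 -> (forall m, In m l -> m <> 0) -> let '(e', _, _) := evol e p q l in e' * e' = 1).
    { induction l as [|m l IH]; intros e p q He Hl; [exact He|]. cbn [evol]. apply IH; [|intros; apply Hl; simpl; auto].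
      assert (m <> 0) by (apply Hl; simpl; auto). destruct m; simpl; lia. }
    apply X; [destruct n; simpl; lia|]. intros m Hm. apply in_map_iff in Hm. destruct Hm as [t [<- Ht]]. apply Hn. simpl; auto. }
  destruct (evol (Z.sgn n) (2 * Z.abs n) 1 (map snd w)) as [[e1 p1] q1].
  destruct (evol (Z.sgn n) 1 0 (map snd w)) as [[e2 p2] q2]. simpl in Ee. subst e2.
  assert (R1 := wmat_rows ((g, n) :: w) 1 0). assert (R2 := wmat_rows ((g, n) :: w) 0 1).
  assert (DW : det (wmat ((g, n) :: w)) = 1%R) by (apply G2_det, wmat_G2).
  destruct (wmat ((g, n) :: w)) as [[[a b] c] d]. cbv zeta in R1, R2. simpl in DW.
  assert (Q1 : exists u v, (u * u = 1)%Z /\ (v * v = 1)%Z /\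
    ((g = true /\ fold_left rstep ((g, n) :: w) (1, 0) = row_of g' u e1 p1 q1 /\ fold_left rstep ((g, n) :: w) (0, 1) = row_of g' v e1 p2 q2) \/
     (g = false /\ fold_left rstep ((g, n) :: w) (0, 1) = row_of g' u e1 p1 q1 /\ fold_left rstep ((g, n) :: w) (1, 0) = row_of g' v e1 p2 q2))).
  { exists ((if g then -1 else 1) * 1 * s'), (e0 * 1 * s').
    split. { transitivity (s' * s'); [destruct g; ring|exact Hs']. }
    split. { transitivity ((e0 * e0) * (s' * s')); [ring|]. rewrite He0, Hs'. reflexivity. }
    rewrite <- F1, <- F2. destruct g; [left|right]; split; auto; split; f_equal; unfold row_of; simpl negb; cbv iota; f_equal; lia. }
  assert (Z1 : exists aa bb cc dd, (a = IZR aa /\ b = IZR bb /\ c = IZR cc /\ d = IZR dd) /\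
     fold_left rstep ((g, n) :: w) (1, 0) = (aa, bb) /\ fold_left rstep ((g, n) :: w) (0, 1) = (cc, dd)).
  { destruct (fold_left rstep ((g, n) :: w) (1, 0)) as [aa bb] eqn:G1. destruct (fold_left rstep ((g, n) :: w) (0, 1)) as [cc dd] eqn:G2.
    exists aa, bb, cc, dd. simpl fst in *; simpl snd in *. split; auto. lra. }
  destruct Z1 as [aa [bb [cc [dd [[-> [-> [-> ->]]] [G1 G2]]]]]]. rewrite G1, G2 in Q1.
  rewrite <- !mult_IZR, <- minus_IZR in DW. apply eq_IZR in DW.
  destruct Q1 as [u [v [Hu [Hv Q]]]]. unfold tval.
  replace ((IZR aa ^ 2 + IZR dd ^ 2 - IZR bb ^ 2 - IZR cc ^ 2) / 2)%R
    with ((IZR (aa * aa + dd * dd - bb * bb - cc * cc)) / 2)%R by (rewrite !minus_IZR, plus_IZR, !mult_IZR; field).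
  unfold Rdiv. rewrite Rabs_mult, (Rabs_right (/ 2)) by lra.
  replace (2 * (Rabs (IZR (aa * aa + dd * dd - bb * bb - cc * cc)) * / 2))%R with (Rabs (IZR (aa * aa + dd * dd - bb * bb - cc * cc))) by field.
  rewrite <- !mult_IZR, <- plus_IZR, !Rabs_Zabs.
  assert (S1 : u = 1 \/ u = -1) by nia. assert (S2 : v = 1 \/ v = -1) by nia. assert (S3 : e1 = 1 \/ e1 = -1) by nia.
  clear - Q DW S1 S2 S3.
  assert (exists x y, (x = 1 \/ x = -1) /\ (y = 1 \/ y = -1) /\ aa * dd - bb * cc = x * (q1 * p2 - p1 * q2) /\ aa * dd + bb * cc = y * (q1 * p2 + p1 * q2) /\
    (aa * aa + dd * dd - bb * bb - cc * cc = p1 * p1 + q2 * q2 - q1 * q1 - p2 * p2 \/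
     aa * aa + dd * dd - bb * bb - cc * cc = - (p1 * p1 + q2 * q2 - q1 * q1 - p2 * p2))).
  { exists (if g then u * v * e1 else - (u * v * e1)), (if g' then u * v * e1 else - (u * v * e1)).
    split; [|split]; try solve [destruct S1 as [-> | ->], S2 as [-> | ->], S3 as [-> | ->]; destruct g, g'; lia].
    destruct Q as [[-> [Q1 Q2]]|[-> [Q1 Q2]]]; destruct g'; unfold row_of in *; injection Q1 as -> ->; injection Q2 as -> ->; 
    destruct S1 as [-> | ->], S2 as [-> | ->], S3 as [-> | ->]; (split; [lia|split; [lia|(left; lia) || (right; lia)]]). }
  destruct H as [x [y [Hx [Hy [H1 [H2 H3]]]]]].
  split; [destruct Hx as [-> | ->]; lia|]. split; apply (f_equal IZR); [rewrite H2; destruct Hy as [-> | ->]; lia|lia].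
Qed.

Lemma sd_aux_pos l cur : (forall n, In n l -> n <> 0) -> (match cur with Some (_, c) => (0 < c)%nat | None => True end) ->
  List.Forall (fun d => (0 < d)%nat) (sd_aux cur l).
Proof.
  revert cur. induction l as [|n l IH]; intros cur Hn Hc.
  - destruct cur as [[m c]|]; simpl; auto.
  - assert (Nn : n <> 0) by (apply Hn; simpl; auto).
    assert (Hl : forall m, In m l -> m <> 0) by (intros; apply Hn; simpl; auto).
    cbn [sd_aux]. destruct (2 <=? Z.abs n).
    + apply Forall_app. split; [destruct cur as [[m c]|]; simpl; auto|]. constructor; [lia|]. apply IH; auto.
    + destruct cur as [[m c]|]; [destruct (m =? n)|]; try constructor; auto; apply IH; auto.
Qed.

Lemma ln_sdprod l : List.Forall (fun d => (0 < d)%nat) l ->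
  0 < sdprod l /\ fold_right (fun d acc => (ln (4 * INR d - 1) + acc)%R) 0%R l = ln (IZR (sdprod l)).
Proof.
  induction 1 as [|d l Hd Hl [IH1 IH2]].
  - split; [reflexivity|]. simpl. symmetry. apply ln_1.
  - unfold sdprod. cbn [fold_right]. fold (sdprod l). split; [apply Z.mul_pos_pos; lia|].
    rewrite IH2, mult_IZR, minus_IZR, mult_IZR, <- INR_IZR_INZ.
    symmetry. apply ln_mult.
    + assert (1 <= INR d)%R by (apply (le_INR 1); lia). lra.
    + apply IZR_lt. exact IH1.
Qed.

Lemma word_bounds_real (P : Z) (t : R) : (1 < t)%R -> (IZR P <= t * t)%R -> 2 <= P -> (t <= 2 * (IZR P * IZR P))%R ->
  (0 < ln (IZR P) /\ ln (IZR P) / 2 <= ln t /\ ln (2 * t) <= 4 * ln (IZR P))%R.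
Proof.
  intros Ht H1 HP H2. apply IZR_le in HP.
  assert (L : (0 < ln (IZR P))%R) by (rewrite <- ln_1 at 1; apply ln_increasing; lra).
  split; [auto|]. split.
  - assert (ln (IZR P) <= ln (t * t))%R by (apply ln_le; lra). rewrite ln_mult in H by lra. lra.
  (* Twice t is at most 4 P^2, which is at most P^4 because P is at least 2. *)
  - replace (4 * ln (IZR P))%R with (ln (IZR P * IZR P * (IZR P * IZR P)))%R.
    + apply ln_le; [lra|]. assert (4 <= IZR P * IZR P)%R by nra. nra.
    + rewrite !ln_mult by nra. ring.
Qed.

Definition exceptional (e : bool) (w : fword) : bool :=
  if e then Nat.leb (length w) 1
  else (forallb (fun t => Z.eqb (snd t) 1) w || forallb (fun t => Z.eqb (snd t) (-1)) w)%bool.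

Lemma map_snd_nonzero w : (forall t : bool * Z, In t w -> snd t <> 0) -> forall n, In n (map snd w) -> n <> 0.
Proof. intros H n Hn. apply in_map_iff in Hn. destruct Hn as [t [<- Ht]]. auto. Qed.

Lemma exceptional_tval e w : reduced w -> exceptional e w = true -> Rabs (tval e (wmat w)) = 1%R.
Proof.
  intros Hr He. destruct w as [|[g n] w].
  - unfold tval. simpl. destruct e; [rewrite Rabs_right; lra|]. rewrite Rabs_right; lra.
  - destruct e; unfold exceptional in He.
    + destruct w as [|? ?]; [|discriminate]. unfold wmat, tmat, tval. simpl fold_right. cbn [fst snd]. destruct g; simpl mmul; cbv beta iota;
      match goal with |- Rabs ?x = _ => replace x with 1%R by ring end; apply Rabs_R1.
    + assert (X : exists f, (f = 1 \/ f = -1) /\ forall t, In t ((g, n) :: w) -> snd t = f).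
      { apply orb_prop in He. destruct He as [He|He]; rewrite forallb_forall in He; [exists 1|exists (-1)]; split; auto;
        intros t Ht; apply Z.eqb_eq, He; auto. }
      destruct X as [f [Hf Hall]]. assert (n = f) by (apply (Hall (g, n)); simpl; auto). subst n.
      assert (E := wmat_entries g f w Hr).
      assert (Hl : forall n, In n (map snd w) -> n = Z.sgn f).
      { intros n Hn. apply in_map_iff in Hn. destruct Hn as [t [<- Ht]]. rewrite (Hall t) by (simpl; auto).
        destruct Hf; subst; reflexivity. }
      assert (A := evol_linear (Z.sgn f) (-1) (2 * Z.abs f) 1 1 0 (map snd w)).
      assert (B := evol_linear (Z.sgn f) 1 (2 * Z.abs f) 1 1 0 (map snd w)).
      assert (Hs : Z.sgn f = 1 \/ Z.sgn f = -1) by (destruct Hf; subst; auto).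
      assert (I := evol_nonneg (Z.sgn f) (2 * Z.abs f + -1 * 1) (1 + -1 * 0) (map snd w) Hs).
      assert (U : Z.abs f = 1) by (destruct Hf; subst; reflexivity). rewrite U in *.
      assert (A' := evol_all_equal (map snd w) (Z.sgn f) (2 * 1 + -1 * 1) (1 + -1 * 0) Hs Hl).
      assert (B' := evol_all_equal (map snd w) (Z.sgn f) (2 * 1 + 1 * 1) (1 + 1 * 0) Hs Hl).
      destruct (evol (Z.sgn f) (2 * 1) 1 (map snd w)) as [[e1 p1] q1].
      destruct (evol (Z.sgn f) 1 0 (map snd w)) as [[e2 p2] q2].
      destruct A as [ea A], B as [eb B]. rewrite A in A'. rewrite B in B'.
      destruct E as [E1 [_ E2]].
      assert (T : (2 * Rabs (tval false (wmat ((g, f) :: w))) = 2 * 1)%R); [|lra].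
      rewrite E2. rewrite <- mult_IZR. apply (f_equal IZR).
      replace (p1 * p1 + q2 * q2 - q1 * q1 - p2 * p2) with
        ((p1 + -1 * p2) * (p1 + 1 * p2) - (q1 + -1 * q2) * (q1 + 1 * q2)) by ring.
      replace (p1 + -1 * p2) with (q1 + -1 * q2) by lia. replace (p1 + 1 * p2) with (q1 + 1 * q2 + 2) by lia.
      (* The differences p1 - p2 and q1 - q2 coincide, and their common value divides the
         determinant. *)
      assert (D : (q1 + -1 * q2) = 1).
      { 
        rewrite A in I. destruct I as [I _]; [lia|intros m Hm; rewrite (Hl m Hm); lia|]. nia. }
      rewrite D. lia.
Qed.

Lemma word_bounds e w : reduced w -> exceptional e w = false ->
  (1 < Rabs (tval e (wmat w)) /\ 0 < Lw w /\ Lw w / 2 <= ln (Rabs (tval e (wmat w))) /\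
   ln (2 * Rabs (tval e (wmat w))) <= 4 * Lw w)%R.
Proof.
  intros Hr He. destruct w as [|[g n] w]; [destruct e; discriminate|].
  assert (E := wmat_entries g n w Hr). destruct Hr as [Hn Ha].
  assert (Nn : n <> 0) by (apply (Hn (g, n)); simpl; auto).
  assert (Hl : forall m, In m (map snd w) -> m <> 0).
  { apply map_snd_nonzero. intros; apply Hn; simpl; auto. }
  assert (Hs : Z.sgn n = 1 \/ Z.sgn n = -1) by (destruct n; simpl in *; lia).
  assert (A := evol_linear (Z.sgn n) (-1) (2 * Z.abs n) 1 1 0 (map snd w)).
  assert (B := evol_linear (Z.sgn n) 1 (2 * Z.abs n) 1 1 0 (map snd w)).
  assert (I1 := evol_nonneg (Z.sgn n) (2 * Z.abs n) 1 (map snd w) Hs ltac:(lia) Hl).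
  assert (I2 := evol_nonneg (Z.sgn n) 1 0 (map snd w) Hs ltac:(lia) Hl).
  assert (I3 := evol_nonneg (Z.sgn n) (2 * Z.abs n + -1 * 1) (1 + -1 * 0) (map snd w) Hs ltac:(lia) Hl).
  assert (G := evol_gap (map snd w) (Z.sgn n) (2 * Z.abs n + -1 * 1) (1 + -1 * 0) Hs ltac:(lia) Hl).
  assert (Lpos := ln_sdprod (sd_aux None (n :: map snd w)) ltac:(apply sd_aux_pos; [intros m [<-|Hm]; auto|exact I])).
  destruct Lpos as [P1 P2]. change (Lw ((g, n) :: w)) with (fold_right (fun d acc => (ln (4 * INR d - 1) + acc)%R) 0%R (sd_aux None (n :: map snd w))).
  rewrite P2.
  destruct (inv_start n 0 Nn ltac:(auto)) as [cur [D [J1 J2]]].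
  destruct (inv_start n 1 Nn ltac:(auto)) as [cur' [D' [K1 K2]]].
  apply (evol_inv (map snd w)) in J1; [|exact Hl]. apply (evol_inv (map snd w)) in K1; [|exact Hl].
  rewrite <- J2 in J1. rewrite <- K2 in K1. clear J2 K2. set (P := sdprod _) in *. clearbody P.
  replace (2 * Z.abs n + 0) with (2 * Z.abs n) in J1 by lia.
  replace (2 * Z.abs n + 1) with (2 * Z.abs n + 1 * 1) in K1 by lia.
  change (evol (Z.sgn n) (2 * Z.abs n + 1 * 1) 1 (map snd w)) with (evol (Z.sgn n) (2 * Z.abs n + 1 * 1) (1 + 1 * 0) (map snd w)) in K1.
  assert (Hgap : e = false -> 2 <= 2 * Z.abs n + -1 * 1 - (1 + -1 * 0) \/
     (2 * Z.abs n + -1 * 1 = 1 + -1 * 0 /\ 1 <= 2 * Z.abs n + -1 * 1 /\ exists m, In m (map snd w) /\ m <> Z.sgn n)).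
  { intros ->. destruct (Z_le_dec 2 (Z.abs n)) as [L|L]; [left; lia|right]. split; [lia|]. split; [lia|].
    assert (Hsn : Z.sgn n = n) by (destruct n as [|[| |]|[| |]]; simpl in *; lia). rewrite Hsn in *.
    apply NNPP. intros X. apply orb_false_elim in He. destruct He as [He1 He2].
    assert (X' : forall t, In t w -> snd t = n).
    { intros t Ht. apply NNPP. intros X2. apply X. exists (snd t). split; auto. apply in_map; auto. }
    destruct Hs as [Hs|Hs]; rewrite Hs in *.
    - assert (Y : forallb (fun t : bool * Z => snd t =? 1) ((g, 1) :: w) = true); [|congruence].
      apply forallb_forall. intros t [<-|Ht]; [reflexivity|]. apply Z.eqb_eq; auto.
    - assert (Y : forallb (fun t : bool * Z => snd t =? -1) ((g, -1) :: w) = true); [|congruence].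
      apply forallb_forall. intros t [<-|Ht]; [reflexivity|]. apply Z.eqb_eq; auto. }
  destruct (evol (Z.sgn n) (2 * Z.abs n) 1 (map snd w)) as [[e1 p1] q1].
  destruct (evol (Z.sgn n) 1 0 (map snd w)) as [[e2 p2] q2].
  destruct A as [ea A], B as [eb B]. rewrite A in I3, G. rewrite B in K1. clear A B.
  destruct E as [E0 [E1 E2]].
  assert (Q0 : 0 <= p2 /\ 0 <= q2 /\ 2 <= p1 /\ p2 <= p1 /\ q2 <= q1 /\ q1 <= p1 /\ q2 <= p2) by lia.
  assert (HP : 2 <= P) by lia.
  assert (PP : p1 * p1 <= P * P) by (apply Z.mul_le_mono_nonneg; lia).
  assert (X1 : p2 * p2 <= p1 * p1) by (apply Z.mul_le_mono_nonneg; lia).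
  assert (X2 : q1 * p2 <= p1 * p1) by (apply Z.mul_le_mono_nonneg; lia).
  assert (X3 : p1 * q2 <= p1 * p1) by (apply Z.mul_le_mono_nonneg; lia).
  assert (X4 : q1 * q1 <= p1 * p1) by (apply Z.mul_le_mono_nonneg; lia).
  assert (X5 : q2 * q2 <= p2 * p2) by (apply Z.mul_le_mono_nonneg; lia).
  destruct e.
  - assert (W : map snd w <> []) by (destruct w; [discriminate|simpl; congruence]).
    destruct I2 as [_ [_ I2]]. specialize (I2 W).
    assert (X6 : p1 * 1 <= p1 * q2) by (apply Z.mul_le_mono_nonneg_l; lia).
    assert (X7 : 0 <= q1 * p2) by (apply Z.mul_nonneg_nonneg; lia).
    rewrite E1. rewrite Z.abs_eq by lia. set (t := q1 * p2 + p1 * q2) in *.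
    (* The products q1 p2 and p1 q2 differ by 1, and p1 q2 is at least p1. *)
    assert (T1 : 2 * p1 - 1 <= t) by lia. assert (T2 : P <= t * t).
    { assert (p1 * p1 <= t * t) by (apply Z.mul_le_mono_nonneg; lia). lia. }
    split; [apply IZR_lt; lia|]. apply word_bounds_real; auto.
    + apply IZR_lt; lia.
    + rewrite <- mult_IZR. apply IZR_le, T2.
    + rewrite <- !mult_IZR. apply IZR_le. lia.
  - specialize (G (Hgap eq_refl)).
    set (t := Rabs (tval false _)) in *.
    (* In the factorization p1 - p2 exceeds q1 - q2 by at least 2, while q1 + q2 is at most p1 + p2.
       So the value is bounded below by the sum row, to which the syllable estimate applies. *)
    assert (Y1 : 2 * (p1 + 1 * p2) <= p1 * p1 + q2 * q2 - q1 * q1 - p2 * p2).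
    { replace (p1 * p1 + q2 * q2 - q1 * q1 - p2 * p2) with
        ((p1 + -1 * p2) * (p1 + 1 * p2) - (q1 + -1 * q2) * (q1 + 1 * q2)) by ring.
      assert ((q1 + -1 * q2) * (q1 + 1 * q2) <= (q1 + -1 * q2) * (p1 + 1 * p2)) by (apply Z.mul_le_mono_nonneg_l; lia).
      assert (2 * (p1 + 1 * p2) <= (p1 + -1 * p2 - (q1 + -1 * q2)) * (p1 + 1 * p2)) by (apply Z.mul_le_mono_nonneg_r; lia). lia. }
    assert (S1 : (IZR (p1 + 1 * p2) <= t)%R).
    { apply Rmult_le_reg_l with 2%R; [lra|]. rewrite E2, <- mult_IZR. apply IZR_le. lia. }
    assert (S2 : (2 <= IZR (p1 + 1 * p2))%R) by (apply IZR_le; lia).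
    assert (S3 : (IZR P <= t * t)%R).
    { apply Rle_trans with (IZR (p1 + 1 * p2) * IZR (p1 + 1 * p2))%R; [rewrite <- mult_IZR; apply IZR_le; lia|].
      apply Rmult_le_compat; lra. }
    split; [lra|]. apply word_bounds_real; auto; [lra|].
    rewrite <- !mult_IZR. apply Rmult_le_reg_l with 2%R; [lra|]. rewrite E2, <- mult_IZR. apply IZR_le. lia.
Qed.

Local Close Scope Z_scope.

(** * The antiholomorphic symmetries *)

(* [iota e] is the reflection in [geo e]; [biota e] is the symmetry of the twice punctured plane that it covers. *)
Definition iota (e : bool) (t : C) : C := if e then (- Cconj t)%C else (/ Cconj t)%C.
Definition biota (e : bool) (u : C) : C := if e then Cconj u else (RtoC 1 - Cconj u)%C.
Definition miota (e : bool) (m : mat) : mat :=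
  let '(a, b, c, d) := m in if e then (a, - b, - c, d) else (d, c, b, a).

Lemma Cconj_neq_0 z : z <> RtoC 0 -> Cconj z <> RtoC 0.
Proof. intros H E. apply H. rewrite <- (Cconj_conj z), E. apply C_ext; cre; lra. Qed.

Lemma Cconj_div z w : Cconj (z / w)%C = (Cconj z / Cconj w)%C.
Proof.
  unfold Cdiv. apply C_ext; cre; rewrite ?Re_inv, ?Im_inv; cre; replace ((- Im w) ^ 2) with (Im w ^ 2) by ring; unfold Rdiv; ring.
Qed.

Lemma upper_neq_0 t : 0 < Im t -> t <> RtoC 0.
Proof. intros H E. rewrite E in H. rewrite Im_RtoC in H. lra. Qed.

Lemma iota_Im e t : 0 < Im t -> 0 < Im (iota e t).
Proof.
  intros H. destruct e; unfold iota; cre. { lra. } rewrite Im_inv. cre. apply Rdiv_lt_0_compat. { lra. }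
  assert (0 <= Re t ^ 2) by apply pow2_ge_0. assert (0 < Im t ^ 2) by (apply pow_lt; auto).
  replace ((- Im t) ^ 2) with (Im t ^ 2) by ring. lra.
Qed.

Lemma geo_iota e t : 0 < Im t -> (geo e t <-> iota e t = t).
Proof.
  intros H. destruct e; simpl.
  - split; intros E.
    + apply C_ext; cre; lra.
    + apply (f_equal Re) in E. cre_in E. lra.
  - assert (N := Cconj_neq_0 t (upper_neq_0 t H)).
    assert (X : (t * Cconj t)%C = RtoC (Cmod t ^ 2)) by (rewrite Cmod_sqr; apply C_ext; cre; ring).
    split; intros E.
    + rewrite E in X. replace (/ Cconj t)%C with (RtoC (1 ^ 2) / Cconj t)%C by (rewrite pow1; field; auto).
      rewrite <- X. field. auto.
    + assert (Y : (t * Cconj t)%C = RtoC 1) by (rewrite <- E at 1; field; auto).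
      rewrite X in Y. apply RtoC_inj in Y. assert (P := Cmod_ge_0 t). nra.
Qed.

Lemma miota_G2 e m : G2 m -> G2 (miota e m).
Proof.
  intros [a [b [c [d [-> E]]]]]. destruct e; unfold miota.
  - exists a, (- b)%Z, (- c)%Z, d. split; [|lia]. rewrite <- !opp_IZR. apply f_equal2; [apply f_equal2; [apply f_equal2|]|]; apply f_equal; ring.
  - exists d, c, b, a. split; [reflexivity|lia].
Qed.

Lemma iota_mob e m t : det m = 1 -> 0 < Im t -> iota e (mob m t) = mob (miota e m) (iota e t).
Proof.
  intros D Ht. assert (N := Cconj_neq_0 _ (denom_neq_0 m t D Ht)).
  assert (N' := Cconj_neq_0 _ (upper_neq_0 _ (mob_Im_pos m t D Ht))).
  assert (N2 := Cconj_neq_0 t (upper_neq_0 t Ht)).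
  destruct m as [[[a b] c] d]. unfold iota, miota, mob, denom in *.
  assert (K : forall x y, Cconj (RtoC x * t + RtoC y)%C = (RtoC x * Cconj t + RtoC y)%C) by (intros; apply C_ext; cre; ring).
  assert (Dn : (RtoC c * t + RtoC d)%C <> RtoC 0).
  { intros Z. apply N. rewrite Z. apply C_ext; cre; lra. }
  rewrite Cconj_div in *. rewrite !K in *.
  destruct e.
  - rewrite !RtoC_opp. field. repeat split; first [exact N | intros Z; apply N; rewrite <- Z; ring].
  - assert (N4 : (RtoC a * Cconj t + RtoC b)%C <> RtoC 0).
    { intros Z. apply N'. rewrite Z. unfold Cdiv. ring. }
    field. repeat split; first [exact N | exact N2 | exact N4 | intros Z; apply N4; rewrite <- Z; ring].
Qed.

Lemma cmap_conj g u : punctured u -> cmap g (Cconj u) = Cconj (cmap g u).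
Proof.
  intros [H0 H1]. assert (N := minus_1_neq u H1). destruct g; simpl; auto.
  - rewrite Cconj_div. f_equal. apply C_ext; cre; ring.
  - apply C_ext; rewrite ?Re_inv, ?Im_inv; cre; rewrite ?Re_inv, ?Im_inv; replace ((- Im u) ^ 2) with (Im u ^ 2) by ring; unfold Rdiv; ring.
Qed.

Lemma sheet_conj g u : punctured u -> Om (cmap g u) ->
  exists m, G2 m /\ iota true (sheet g u) = mob m (sheet g (Cconj u)).
Proof.
  intros Hp O. assert (T := T1_Im_pos _ O). unfold sheet. rewrite cmap_conj by auto. rewrite T1_conj by auto.
  change (- Cconj (T1 (cmap g u)))%C with (iota true (T1 (cmap g u))).
  rewrite iota_mob by (auto; apply rho_det).
  assert (T' := iota_Im true _ T).
  exists (match g with cid => (1,0,0,1) | cP => (1,-2,0,1) | cI => (1,0,-2,1) end). split.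
  { destruct g; [exists 0%Z, 0%Z, 0%Z, 0%Z|exists 0%Z, (-1)%Z, 0%Z, 0%Z|exists 0%Z, 0%Z, (-1)%Z, 0%Z]; split; auto. }
  rewrite <- mob_mmul; [|destruct g; simpl; ring|apply rho_det|exact T'].
  destruct g; simpl; f_equal; repeat apply f_equal2; ring.
Qed.

Lemma flip_punctured u : punctured u -> punctured (RtoC 1 - u)%C.
Proof.
  intros [H0 H1]. split; intros E.
  - apply H1. apply (f_equal (fun z => (RtoC 1 - z)%C)) in E. transitivity (RtoC 1 - (RtoC 1 - u))%C; [ring|]. rewrite E. ring.
  - apply H0. apply (f_equal (fun z => (RtoC 1 - z)%C)) in E. transitivity (RtoC 1 - (RtoC 1 - u))%C; [ring|]. rewrite E. ring.
Qed.

Lemma biota_punctured e u : punctured u -> punctured (biota e u).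
Proof.
  intros Hp. assert (X : punctured (Cconj u)).
  { destruct Hp as [H0 H1]. split; intros E; [apply H0|apply H1]; rewrite <- (Cconj_conj u), E; apply C_ext; cre; lra. }
  destruct e; simpl; auto. apply flip_punctured; auto.
Qed.

Lemma iota_T1 u : Om u -> iota false (T1 u) = T1 (RtoC 1 - Cconj u)%C.
Proof.
  intros H. rewrite T1_flip by (apply Om_conj; auto). rewrite T1_conj by auto. unfold iota.
  assert (N := Cconj_neq_0 _ (T1_neq_0 u H)). field. auto.
Qed.

Lemma T1_real_unit x : 0 < x < 1 -> iota true (T1 (RtoC x)) = T1 (RtoC x).
Proof.
  intros H. simpl. rewrite <- T1_conj by (apply Om_interval; auto). f_equal. apply C_ext; cre; lra.
Qed.

(** Off the real axis [cid] serves both points. On it u -> 1 - u exchanges the intervals of [cP] and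
    [cI], and [T1] is purely imaginary at the chart coordinate. *)
Lemma sheet_flip u : punctured u -> exists g h m, Om (cmap g u) /\ Om (cmap h (biota false u)) /\ G2 m /\
  iota false (sheet g u) = mob m (sheet h (biota false u)).
Proof.
  intros Hp. destruct (Req_dec (Im u) 0) as [E|E].
  2: { exists cid, cid, (1,0,0,1). assert (O := Om_nonreal u E). assert (O' := Om_flip _ (Om_conj u O)).
       split; [exact O|]. split; [exact O'|]. split; [apply G2_one|].
       unfold sheet, rho, cmap. rewrite !mob_one. apply iota_T1; auto. }
  assert (X : biota false u = RtoC (1 - Re u)) by (apply C_ext; unfold biota; cre; lra).
  destruct (chart_exists u Hp) as [g O]. assert (Er := cmap_real g u Hp E). set (x := Re u) in *.
  assert (Eu : u = RtoC x) by (apply real_RtoC; auto).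
  assert (x0 : x <> 0) by (intros Z; apply (proj1 Hp); rewrite Eu, Z; auto).
  assert (x1 : x <> 1) by (intros Z; apply (proj2 Hp); rewrite Eu, Z; auto).
  set (q := match g with cid => x | cP => x / (x - 1) | cI => / x end) in *.
  assert (Hq : 0 < q < 1). { rewrite Er in O. apply Om_real in O; [|reflexivity]. rewrite Re_RtoC in O. exact O. }
  set (h := match g with cid => cid | cP => cI | cI => cP end).
  assert (Eh : cmap h (biota false u) = RtoC (1 - q)).
  { rewrite cmap_real; [|apply biota_punctured; auto|rewrite X; apply Im_RtoC]. rewrite X, Re_RtoC. f_equal.
    unfold h, q. destruct g; auto; field; lra. }
  exists g, h, (1,0,0,1). split; [exact O|]. split. { rewrite Eh. apply Om_interval. rewrite Re_RtoC; lra. }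
  split; [apply G2_one|]. rewrite mob_one. unfold sheet. rewrite Eh, Er.
  assert (Oq : Om (RtoC q)) by (apply Om_interval; rewrite Re_RtoC; auto).
  rewrite RtoC_minus, T1_flip by auto. assert (T := T1_Im_pos _ Oq).
  rewrite iota_mob by (auto; apply rho_det). unfold iota.
  assert (F := T1_real_unit q Hq). simpl in F. assert (N := T1_neq_0 _ Oq).
  assert (F' : Cconj (T1 (RtoC q)) = (- T1 (RtoC q))%C) by (rewrite <- F at 2; ring).
  rewrite F'. set (t := T1 (RtoC q)) in *. unfold h, mob, rho, miota.
  assert (N1 : (RtoC 1 - t)%C <> RtoC 0) by (apply Cneq_Im; cre; lra).
  assert (N2 : (t - RtoC 1)%C <> RtoC 0) by (apply Cneq_Im; cre; lra).
  destruct g; field; repeat split; auto; try (apply Cneq_Im; cre; lra).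
Qed.

Lemma Cov_iota e u t : Cov u t -> Cov (biota e u) (iota e t).
Proof.
  intros H. assert (Hp : punctured u) by apply H. assert (Hp' := biota_punctured e u Hp).
  destruct e.
  - destruct H as [_ [g [m [Hm [O ->]]]]]. destruct (sheet_conj g u Hp O) as [m' [Hm' E]].
    rewrite iota_mob; [|apply G2_det; auto|apply sheet_Im; auto]. rewrite E.
    assert (O' : Om (cmap g (Cconj u))) by (rewrite cmap_conj by auto; apply Om_conj; auto).
    apply Cov_act; [|apply miota_G2; auto]. apply Cov_act; auto. apply Cov_sheet; auto.
  - destruct (sheet_flip u Hp) as [g [h [m' [O [O' [Hm' E]]]]]].
    destruct (Cov_chart g u t H O) as [m [Hm ->]].
    rewrite iota_mob; [|apply G2_det; auto|apply sheet_Im; auto]. rewrite E.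
    apply Cov_act; [|apply miota_G2; auto]. apply Cov_act; auto. apply Cov_sheet; auto.
Qed.

Lemma cont_iota e D f z : 0 < Im (f z) -> cont_at D f z -> cont_at D (fun w => iota e (f w)) z.
Proof.
  intros H Hf. destruct e; simpl.
  - apply cont_at_opp, cont_at_conj, Hf.
  - apply cont_at_inv; [apply Cconj_neq_0, upper_neq_0; auto|]. apply cont_at_conj, Hf.
Qed.

Lemma cont_mob m D f z : det m = 1 -> 0 < Im (f z) -> cont_at D f z -> cont_at D (fun w => mob m (f w)) z.
Proof. intros Dm H Hf. destruct (cder_mob m (f z) Dm H) as [l Hl]. eapply cont_at_cder; eauto. Qed.

(** The reflected lift covers the same map, because the base map is fixed by [biota], and agrees
    with the lift at [z0]; uniqueness makes the lift symmetric everywhere. *)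
Lemma lift_on_geodesic e m (D : C -> Prop) (phi psi : C -> C) z0 : G2 m -> convex D ->
  cont_on D phi -> cont_on D psi -> (forall z, D z -> Cov (phi z) (psi z)) ->
  (forall z, D z -> biota e (phi z) = phi z) -> D z0 -> geo e (mob m (psi z0)) ->
  forall z, D z -> geo e (mob m (psi z)).
Proof.
  intros Hm HD Hphi Hpsi HC Hb H0 Hg z Hz. assert (Dm := G2_det m Hm).
  assert (IP : forall w, D w -> 0 < Im (mob m (psi w))).
  { intros w Hw. apply mob_Im_pos; auto. eapply Cov_Im, HC, Hw. }
  assert (IQ : forall w, D w -> 0 < Im (psi w)). { intros w Hw. eapply Cov_Im, HC, Hw. }
  apply geo_iota; [auto|].
  apply (lift_unique Cov D phi (fun w => iota e (mob m (psi w))) (fun w => mob m (psi w)) z0); auto.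
  - apply Cov_separated.
  - intros w Hw. exact (cont_iota e D (fun w => mob m (psi w)) w (IP w Hw) (cont_mob m D psi w Dm (IQ w Hw) (Hpsi w Hw))).
  - intros w Hw. exact (cont_mob m D psi w Dm (IQ w Hw) (Hpsi w Hw)).
  - intros w Hw. rewrite <- (Hb w Hw). apply Cov_iota. apply Cov_act; auto. 
  - intros w Hw. apply Cov_act; auto.
  - apply geo_iota; auto.
Qed.

(** The same reflection argument in the opposite direction, with uniqueness for [Cov']. It serves
    the construction of rectangles, the other one the lower bound. *)
Lemma base_on_geodesic e m (D : C -> Prop) (phi psi : C -> C) z0 : G2 m -> convex D ->
  cont_on D phi -> cont_on D psi -> (forall z, D z -> Cov (phi z) (psi z)) ->
  (forall z, D z -> geo e (mob m (psi z))) -> D z0 -> biota e (phi z0) = phi z0 ->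
  forall z, D z -> biota e (phi z) = phi z.
Proof.
  intros Hm HD Hphi Hpsi HC Hg H0 Hb z Hz. assert (Dm := G2_det m Hm).
  apply (lift_unique Cov' D (fun w => mob m (psi w)) (fun w => biota e (phi w)) phi z0); auto.
  - apply Cov'_separated.
  - intros w Hw. exact (cont_mob m D psi w Dm (Cov_Im _ _ (HC w Hw)) (Hpsi w Hw)).
  - intros w Hw. destruct e.
    + exact (cont_at_conj D phi w (Hphi w Hw)).
    + exact (cont_at_minus D _ _ w (cont_at_const D (RtoC 1) w) (cont_at_conj D phi w (Hphi w Hw))).
  - intros w Hw. unfold Cov'. assert (E := proj1 (geo_iota e _ (mob_Im_pos m _ Dm (Cov_Im _ _ (HC w Hw)))) (Hg w Hw)).
    rewrite <- E. apply Cov_iota, Cov_act; auto.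
  - intros w Hw. apply Cov_act; auto.
Qed.

Import ListNotations.

(** * Sections over the closed half planes *)

(** The inverses of the matrices of [sheet_lower], so that the corrected sheets agree with [T1] on
    the lower half plane. *)
Definition corr (s : bool) (g : chart) : mat :=
  if s then (1, 0, 0, 1) else match g with cid => (1, 0, 0, 1) | cP => (1, -2, 0, 1) | cI => (1, 0, -2, 1) end.

(* Extends [T1] from the upper half plane ([s = true]) or from the lower one to the boundary. *)
Definition hsec (s : bool) (u : C) : C := mob (corr s (real_chart u)) (sheet (real_chart u) u).

Definition half_plane (s : bool) (u : C) : Prop := punctured u /\ if s then 0 <= Im u else Im u <= 0.

Lemma corr_G2 s g : G2 (corr s g).
Proof.
  destruct s, g; simpl; try apply G2_one.
  - exists 0%Z, (-1)%Z, 0%Z, 0%Z. split; auto.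
  - exists 0%Z, 0%Z, (-1)%Z, 0%Z. split; auto.
Qed.

Lemma Cov_hsec s u : punctured u -> Cov u (hsec s u).
Proof. intros H. apply Cov_act; [apply Cov_sheet; auto; apply real_chart_Om; auto|apply corr_G2]. Qed.

Lemma hsec_chart s g u : half_plane s u -> Om (cmap g u) -> hsec s u = mob (corr s g) (sheet g u).
Proof.
  intros [Hp Hu] O. assert (O' := real_chart_Om u Hp). unfold hsec.
  destruct (Req_dec (Im u) 0) as [E|E].
  { rewrite (chart_real_unique _ g u Hp E O' O). reflexivity. }
  assert (K : forall g, mob (corr s g) (sheet g u) = T1 u); [|rewrite !K; reflexivity].
  intros h. assert (T := T1_Im_pos u (Om_nonreal u E)). destruct s.
  - rewrite sheet_upper by lra. apply mob_one.
  - rewrite sheet_lower by lra. rewrite <- mob_mmul; auto; try (destruct h; simpl; ring).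
    rewrite <- (mob_one (T1 u)) at 2. f_equal. destruct h; simpl; repeat apply f_equal2; ring.
Qed.

Lemma cont_hsec s u : half_plane s u -> cont_at (half_plane s) (hsec s) u.
Proof.
  intros H. assert (Hp := proj1 H). assert (O := real_chart_Om u Hp). set (g := real_chart u) in *.
  destruct (Om_open _ O) as [r [Hr F]]. destruct (chart_near g u _ r Hp eq_refl Hr) as [d [Hd G]].
  apply (cont_at_ext_loc _ (fun w => mob (corr s g) (sheet g w)) _ _ d Hd).
  - intros w Hw Hwd. symmetry. apply hsec_chart; auto. apply F, G; auto.
  - symmetry. apply hsec_chart; auto.
  - apply cont_mob; [apply G2_det, corr_G2|apply sheet_Im; auto|].
    destruct (cder_sheet g u Hp O) as [l Hl]. eapply cder_cont; eauto.
Qed.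

(** * Lifts of paths of configurations *)

(* [Reals] exports another [c1]. *)
Notation c1 := Defs.c1.

(** Paths on [0, 1] are treated as functions of the imaginary part, so that the lemmas on [cont_at]
    and the uniqueness of lifts apply to them. *)
Definition istrip (z : C) : Prop := 0 <= Im z <= 1.
Definition pcont (f : R -> C) : Prop := cont_on istrip (fun z => f (Im z)).

Definition ucoord (z : conf) : C := ((c2 z - c1 z) / (c3 z - c1 z))%C.

(* Along [p] a lift [T] of the cross ratio runs from [t0] to [t1], and a logarithm [Z] of [z3 - z1] from [z0] to [z1]. *)
Definition plift (p : R -> conf) (q0 : conf) (t0 z0 : C) (q1 : conf) (t1 z1 : C) : Prop :=
  exists T Z : R -> C, (pcont (fun t => c1 (p t)) /\ pcont (fun t => c2 (p t)) /\ pcont (fun t => c3 (p t))) /\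
    pcont T /\ pcont Z /\
    (forall t, 0 <= t <= 1 -> Cov (ucoord (p t)) (T t) /\ cexp (Z t) = (c3 (p t) - c1 (p t))%C) /\
    (p 0 = q0 /\ T 0 = t0 /\ Z 0 = z0) /\ (p 1 = q1 /\ T 1 = t1 /\ Z 1 = z1).

Lemma pcont_ext f g : (forall t, 0 <= t <= 1 -> f t = g t) -> pcont f -> pcont g.
Proof. intros E H z Hz. refine (cont_at_ext istrip (fun w => f (Im w)) _ z Hz _ (H z Hz)). intros u Hu; apply E; exact Hu. Qed.

Lemma cont_at_RtoC_Im D z : cont_at D (fun w => RtoC (Im w)) z.
Proof. apply cont_at_Im, cont_at_id. Qed.

Lemma pcont_affine (D : C -> Prop) f a b : pcont f -> (forall z, D z -> 0 <= a * Im z + b <= 1) ->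
  cont_on D (fun z => f (a * Im z + b)).
Proof.
  intros Hf HD z Hz.
  assert (E : forall u, Im (Ci * (RtoC a * RtoC (Im u) + RtoC b))%C = a * Im u + b) by (intros; cre; ring).
  apply (cont_at_ext D (fun w => f (Im (Ci * (RtoC a * RtoC (Im w) + RtoC b))%C))); auto; [intros u _; rewrite E; auto|].
  apply (cont_at_comp D istrip (fun w => (Ci * (RtoC a * RtoC (Im w) + RtoC b))%C) (fun w => f (Im w))).
  - intros u Hu. unfold istrip. rewrite E. auto.
  - apply cont_at_mult; [apply cont_at_const|]. apply cont_at_plus; [|apply cont_at_const].
    apply cont_at_mult; [apply cont_at_const|apply cont_at_RtoC_Im].
  - refine (Hf _ _). unfold istrip. rewrite E. auto.
Qed.

Lemma glue_range th t : 0 < th < 1 -> (0 <= t <= th -> 0 <= t / th <= 1) /\ (th <= t <= 1 -> 0 <= (t - th) / (1 - th) <= 1).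
Proof.
  intros H. assert (0 < / th) by (apply Rinv_0_lt_compat; lra). assert (0 < / (1 - th)) by (apply Rinv_0_lt_compat; lra).
  split; intros Ht; (split; [apply Rmult_le_pos; lra|]).
  - apply Rmult_le_reg_r with th; [lra|]. unfold Rdiv. rewrite Rmult_assoc, Rinv_l; lra.
  - apply Rmult_le_reg_r with (1 - th); [lra|]. unfold Rdiv. rewrite Rmult_assoc, Rinv_l; lra.
Qed.

Lemma pcont_glue th f g h : 0 < th < 1 -> pcont f -> pcont g -> f 1 = g 0 ->
  (forall t, 0 <= t <= th -> h t = f (t / th)) -> (forall t, th < t <= 1 -> h t = g ((t - th) / (1 - th))) -> pcont h.
Proof.
  intros Ht Hf Hg E H1 H2.
  assert (A1 : forall t, / th * t + 0 = t / th) by (intros; field; lra).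
  assert (A2 : forall t, / (1 - th) * t + - th / (1 - th) = (t - th) / (1 - th)) by (intros; field; lra).
  assert (L : cont_on istrip (fun z => if Rle_dec (Im z) th then f (/ th * Im z + 0) else g (/ (1 - th) * Im z + - th / (1 - th)))).
  { apply (cont_on_paste istrip Im th (fun z => f (/ th * Im z + 0)) (fun z => g (/ (1 - th) * Im z + - th / (1 - th)))).
    - apply Im_lip.
    - apply pcont_affine; auto. intros z [Hz Hzt]. rewrite A1. unfold istrip in Hz. apply glue_range; lra.
    - apply pcont_affine; auto. intros z [Hz Hzt]. rewrite A2. unfold istrip in Hz. apply glue_range; lra.
    - intros z Hz Ez. rewrite A1, A2, Ez. replace (th / th) with 1 by (field; lra). replace ((th - th) / (1 - th)) with 0 by (field; lra). exact E. }
  intros z Hz. refine (cont_at_ext istrip _ _ z Hz _ (L z Hz)).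
  intros u Hu. unfold istrip in Hu. rewrite A1, A2. destruct (Rle_dec (Im u) th); symmetry; [apply H1|apply H2]; lra.
Qed.

Lemma plift_ext p p' q0 t0 z0 q1 t1 z1 : (forall t, 0 <= t <= 1 -> p t = p' t) ->
  plift p q0 t0 z0 q1 t1 z1 -> plift p' q0 t0 z0 q1 t1 z1.
Proof.
  intros E [T [Z [[C1 [C2 C3]] [CT [CZ [HC [H0 H1]]]]]]]. exists T, Z. rewrite <- !E by lra.
  split. { split; [|split]; (eapply pcont_ext; [intros t Ht; rewrite <- (E t Ht); reflexivity|assumption]). }
  split; [auto|]. split; [auto|]. split; [intros t Ht; rewrite <- (E t Ht); auto|auto].
Qed.

Lemma plift_glue th p p1 p2 q0 t0 z0 q1 t1 z1 q2 t2 z2 : 0 < th < 1 ->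
  (forall t, 0 <= t <= th -> p t = p1 (t / th)) -> (forall t, th < t <= 1 -> p t = p2 ((t - th) / (1 - th))) ->
  plift p1 q0 t0 z0 q1 t1 z1 -> plift p2 q1 t1 z1 q2 t2 z2 -> plift p q0 t0 z0 q2 t2 z2.
Proof.
  intros Hth E1 E2 [T [Z [[C1 [C2 C3]] [CT [CZ [HC [[P0 [T0 Z0]] [P1 [T1 Z1]]]]]]]]].
  intros [T' [Z' [[C1' [C2' C3']] [CT' [CZ' [HC' [[P0' [T0' Z0']] [P1' [T1' Z1']]]]]]]]].
  set (gl := fun (f g : R -> C) t => if Rle_dec t th then f (t / th) else g ((t - th) / (1 - th))).
  assert (G1 : forall f g t, 0 <= t <= th -> gl f g t = f (t / th)).
  { intros f g t Ht. unfold gl. destruct (Rle_dec t th); auto; lra. }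
  assert (G2 : forall f g t, th < t <= 1 -> gl f g t = g ((t - th) / (1 - th))).
  { intros f g t Ht. unfold gl. destruct (Rle_dec t th); auto; lra. }
  assert (F0 : 0 / th = 0) by (field; lra). assert (F1 : (1 - th) / (1 - th) = 1) by (field; lra).
  assert (GC : forall f g, pcont f -> pcont g -> f 1 = g 0 -> pcont (gl f g)).
  { intros f g Hf Hg E. apply (pcont_glue th f g); auto. }
  exists (gl T T'), (gl Z Z'). split; [|split; [|split; [|split; [|split]]]].
  - assert (PE : p1 1 = p2 0) by congruence. split; [|split].
    + apply (pcont_glue th (fun t => c1 (p1 t)) (fun t => c1 (p2 t))); auto; [congruence|intros; f_equal; auto|intros; f_equal; auto].
    + apply (pcont_glue th (fun t => c2 (p1 t)) (fun t => c2 (p2 t))); auto; [congruence|intros; f_equal; auto|intros; f_equal; auto].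
    + apply (pcont_glue th (fun t => c3 (p1 t)) (fun t => c3 (p2 t))); auto; [congruence|intros; f_equal; auto|intros; f_equal; auto].
  - apply GC; auto; congruence.
  - apply GC; auto; congruence.
  - intros t Ht. destruct (Rle_dec t th) as [L|L].
    + rewrite E1, !G1 by lra. apply HC. apply glue_range; lra.
    + rewrite E2, !G2 by lra. apply HC'. apply glue_range; lra.
  - rewrite E1, !G1, F0 by lra. auto.
  - rewrite E2, !G2, F1 by lra. auto.
Qed.

(** * Half turns *)

Lemma rot_cexp x : rot x = cexp (0, x).
Proof. unfold rot, cexp. simpl. rewrite exp_0. f_equal; ring. Qed.

Lemma cont_rot D k z : cont_at D (fun w => rot (k * Im w)) z.
Proof.
  apply (cont_at_ext_loc D (fun w => cexp (Ci * (RtoC k * RtoC (Im w)))%C) _ _ 1); [lra| | |].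
  - intros u _ _. rewrite rot_cexp. f_equal. apply C_ext; cre; ring.
  - rewrite rot_cexp. f_equal. apply C_ext; cre; ring.
  - refine (cont_at_cder D (fun w => (Ci * (RtoC k * RtoC (Im w)))%C) cexp z _ _ (cder_cexp _)).
    apply cont_at_mult; [apply cont_at_const|]. apply cont_at_mult; [apply cont_at_const|apply cont_at_RtoC_Im].
Qed.

Lemma affine_rot_neq_0 a b x : a ^ 2 <> b ^ 2 -> (RtoC a + RtoC b * rot x)%C <> RtoC 0.
Proof.
  intros H E. assert (E1 := f_equal Re E). assert (E2 := f_equal Im E). unfold rot in *. cre_in E1. cre_in E2.
  assert (S := sin2_cos2 x). unfold Rsqr in S. apply H.
  assert (A : a = - (b * cos x)) by lra. assert (B : b * sin x = 0) by lra. rewrite A.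
  replace ((- (b * cos x)) ^ 2) with (b ^ 2 * (sin x * sin x + cos x * cos x) - (b * sin x) * (b * sin x)) by ring.
  rewrite S, B. ring.
Qed.

(** During a half turn each strand moves as a + b [rot] x with real a and b, where b = 0 for a
    resting strand; the cross ratio is then a quotient of this form. *)
Definition quot (a b c d x : R) : C := ((RtoC a + RtoC b * rot x) / (RtoC c + RtoC d * rot x))%C.

Lemma quot_punctured a b c d x : a ^ 2 <> b ^ 2 -> c ^ 2 <> d ^ 2 -> (a - c) ^ 2 <> (b - d) ^ 2 -> punctured (quot a b c d x).
Proof.
  intros H1 H2 H3. assert (N1 := affine_rot_neq_0 a b x H1). assert (N2 := affine_rot_neq_0 c d x H2).
  assert (N3 := affine_rot_neq_0 _ _ x H3). unfold quot. split; intros E.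
  - apply N1. transitivity ((RtoC a + RtoC b * rot x) / (RtoC c + RtoC d * rot x) * (RtoC c + RtoC d * rot x))%C; [field; auto|].
    rewrite E. ring.
  - apply N3. rewrite !RtoC_minus.
    transitivity (((RtoC a + RtoC b * rot x) / (RtoC c + RtoC d * rot x) - RtoC 1) * (RtoC c + RtoC d * rot x))%C; [field; auto|].
    rewrite E. ring.
Qed.

(** The imaginary part keeps its sign during a half turn. So the cross ratio stays in a closed half
    plane, where [hsec] lifts it explicitly. *)
Lemma quot_Im a b c d x : c ^ 2 <> d ^ 2 ->
  exists k, 0 < k /\ Im (quot a b c d x) = (b * c - a * d) * sin x * k.
Proof.
  intros H. assert (N := affine_rot_neq_0 c d x H). exists (/ Cmod (RtoC c + RtoC d * rot x) ^ 2).
  split. { apply Rinv_0_lt_compat, pow_lt, Cmod_pos; auto. }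
  unfold quot. rewrite Im_div by auto. unfold Rdiv. f_equal. unfold rot. cre. ring.
Qed.

Lemma cexp_ln r x : 0 < r -> cexp (ln r, x) = (RtoC r * rot x)%C.
Proof. intros H. unfold cexp, rot. simpl. rewrite exp_ln by auto. apply C_ext; cre; simpl; ring. Qed.

Lemma clogR_real r : 0 < r -> clogR (RtoC r) = (ln r, 0).
Proof.
  intros H. unfold clogR. rewrite Cmod_R, Rabs_right by lra. rewrite Im_RtoC, Re_RtoC.
  unfold Rdiv. rewrite Rmult_0_l, atan_0. reflexivity.
Qed.

Lemma rot_0 : rot 0 = RtoC 1.
Proof. unfold rot. rewrite cos_0, sin_0. reflexivity. Qed.

Lemma rot_sign_PI sg : sg = 1 \/ sg = -1 -> rot (sg * PI) = RtoC (-1).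
Proof.
  intros [-> | ->]; unfold rot.
  - rewrite Rmult_1_l, cos_PI, sin_PI. reflexivity.
  - replace (-1 * PI) with (- PI) by ring. rewrite cos_neg, sin_neg, cos_PI, sin_PI. unfold RtoC. f_equal; ring.
Qed.

Lemma rot_plus x y : rot (x + y) = (rot x * rot y)%C.
Proof. unfold rot. rewrite cos_plus, sin_plus. apply C_ext; cre; ring. Qed.

(** Here c + d [rot] is z3 - z1. Either the outer strands turn about each other, c = 0, and the
    argument changes by half a turn; or |d| < |c|, the difference stays in a half plane, and its
    argument returns. *)
Lemma log_move sg c d f eps phi : sg = 1 \/ sg = -1 -> c ^ 2 <> d ^ 2 -> rot phi = RtoC eps -> eps = 1 \/ eps = -1 ->
  0 < eps * (c + d) -> (c = 0 /\ f = 1) \/ (d ^ 2 < c ^ 2 /\ f = 0) ->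
  exists Z : R -> C, pcont Z /\ (forall t, cexp (Z t) = (RtoC c + RtoC d * rot (sg * PI * t))%C) /\
    Z 0 = (ln (Rabs (c + d)), phi) /\ Z 1 = (ln (Rabs (c - d)), phi + f * (sg * PI)).
Proof.
  intros Hs Hcd Hr He Hp [[-> ->]|[Hd ->]].
  - assert (Ed : Rabs d = eps * d).
    { replace (0 + d) with d in Hp by ring. destruct He as [-> | ->]; [rewrite Rabs_right by lra|rewrite Rabs_left by lra]; ring. }
    assert (Pd : 0 < Rabs d) by (rewrite Ed; replace d with (0 + d) by ring; exact Hp).
    exists (fun t => (ln (Rabs d), phi + sg * PI * t)). split; [|split; [|split]].
    + intros z Hz. refine (cont_at_ext istrip (fun w => ((ln (Rabs d), phi) + Ci * (RtoC (sg * PI) * RtoC (Im w)))%C) _ z Hz _ _).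
      * intros u _. apply C_ext; cre; simpl; ring.
      * apply cont_at_plus; [apply cont_at_const|]. apply cont_at_mult; [apply cont_at_const|].
        apply cont_at_mult; [apply cont_at_const|apply cont_at_RtoC_Im].
    + intros t. rewrite cexp_ln, rot_plus, Hr, Ed by auto. rewrite RtoC_mult.
      assert (E2 : (RtoC eps * RtoC eps)%C = RtoC 1) by (rewrite <- RtoC_mult; f_equal; destruct He as [-> | ->]; ring).
      transitivity ((RtoC eps * RtoC eps) * RtoC d * rot (sg * PI * t))%C; [ring|]. rewrite E2. ring.
    + f_equal; [f_equal; f_equal; ring|ring].
    + replace (0 - d) with (- d) by ring. rewrite Rabs_Ropp. f_equal. ring.
  - assert (Pd : 0 < eps * c /\ Rabs d < eps * c).
    { assert (X : Rabs d < Rabs c) by (apply Rsqr_lt_abs_0; unfold Rsqr; lra).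
      assert (Y : eps * c = Rabs c \/ eps * c = - Rabs c).
      { unfold Rabs at 1 2. destruct (Rcase_abs c), He as [-> | ->]; lra. }
      destruct Y as [Y|Y]; [rewrite Y; split; auto; generalize (Rabs_pos d); lra|].
      assert (eps * d <= Rabs d). { unfold Rabs. destruct (Rcase_abs d), He as [-> | ->]; lra. } lra. }
    destruct Pd as [P1 P2].
    assert (Q : forall x, -1 <= x <= 1 -> 0 < eps * (c + d * x)).
    { intros x Hx. assert (X : Rabs (eps * (d * x)) <= Rabs d).
      { rewrite !Rabs_mult. assert (Rabs eps = 1) by (destruct He as [-> | ->]; [apply Rabs_R1|rewrite Rabs_left; lra]).
        rewrite H, Rmult_1_l. replace (Rabs d) with (Rabs d * 1) at 2 by ring. apply Rmult_le_compat_l; [apply Rabs_pos|].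
        apply Rabs_le; auto. }
      apply Rabs_le_between in X. lra. }
    assert (Q' : forall t, 0 < Re (RtoC eps * (RtoC c + RtoC d * rot (sg * PI * t)))%C).
    { intros t. specialize (Q (cos (sg * PI * t)) (COS_bound _)). unfold rot. cre. lra. }
    assert (Er : forall x, 0 < eps * (c + d * x) -> Rabs (c + d * x) = eps * (c + d * x)).
    { intros x Hx. destruct He as [-> | ->]; [rewrite Rabs_right by lra|rewrite Rabs_left by lra]; ring. }
    exists (fun t => ((0, phi) + clogR (RtoC eps * (RtoC c + RtoC d * rot (sg * PI * t))))%C). split; [|split; [|split]].
    + intros z Hz. refine (cont_at_plus istrip (fun _ => (0, phi)) _ z (cont_at_const _ _ _) _).
      refine (cont_at_comp istrip (fun _ => True) (fun w => (RtoC eps * (RtoC c + RtoC d * rot (sg * PI * Im w)))%C) clogR z (fun _ _ => I) _ (cont_clogR _ (Q' _))).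
      apply cont_at_mult; [apply cont_at_const|]. apply cont_at_plus; [apply cont_at_const|].
      apply cont_at_mult; [apply cont_at_const|apply cont_rot].
    + intros t. rewrite cexp_plus, <- rot_cexp, cexp_clogR, Hr by apply Q'.
      assert (E2 : (RtoC eps * RtoC eps)%C = RtoC 1) by (rewrite <- RtoC_mult; f_equal; destruct He as [-> | ->]; ring).
      transitivity ((RtoC eps * RtoC eps) * (RtoC c + RtoC d * rot (sg * PI * t)))%C; [ring|]. rewrite E2. ring.
    + rewrite Rmult_0_r, rot_0, <- !RtoC_mult, <- RtoC_plus, <- RtoC_mult.
      rewrite clogR_real by (apply Q; lra). rewrite <- Er by (apply Q; lra). rewrite Rmult_1_r. apply C_ext; cre; simpl; ring.
    + rewrite Rmult_1_r, rot_sign_PI, <- !RtoC_mult, <- RtoC_plus, <- RtoC_mult by auto.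
      rewrite clogR_real by (apply Q; lra). rewrite <- Er by (apply Q; lra). replace (c + d * -1) with (c - d) by ring.
      apply C_ext; cre; simpl; ring.
Qed.

Lemma affine_move sg a1 b1 a2 b2 a3 b3 f eps phi s N p : sg = 1 \/ sg = -1 -> G2 N ->
  (a2 - a1) ^ 2 <> (b2 - b1) ^ 2 -> (a3 - a1) ^ 2 <> (b3 - b1) ^ 2 -> (a3 - a2) ^ 2 <> (b3 - b2) ^ 2 ->
  (let k := sg * ((b2 - b1) * (a3 - a1) - (a2 - a1) * (b3 - b1)) in if s : bool then 0 <= k else k <= 0) ->
  rot phi = RtoC eps -> eps = 1 \/ eps = -1 -> 0 < eps * (a3 - a1 + (b3 - b1)) ->
  (a3 - a1 = 0 /\ f = 1) \/ ((b3 - b1) ^ 2 < (a3 - a1) ^ 2 /\ f = 0) ->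
  (forall t, p t = ((RtoC a1 + RtoC b1 * rot (sg * PI * t))%C, (RtoC a2 + RtoC b2 * rot (sg * PI * t))%C,
                    (RtoC a3 + RtoC b3 * rot (sg * PI * t))%C)) ->
  plift p (RtoC (a1 + b1), RtoC (a2 + b2), RtoC (a3 + b3))
    (mob N (hsec s (RtoC ((a2 + b2 - (a1 + b1)) / (a3 + b3 - (a1 + b1)))))) (ln (Rabs (a3 + b3 - (a1 + b1))), phi)
    (RtoC (a1 - b1), RtoC (a2 - b2), RtoC (a3 - b3))
    (mob N (hsec s (RtoC ((a2 - b2 - (a1 - b1)) / (a3 - b3 - (a1 - b1)))))) (ln (Rabs (a3 - b3 - (a1 - b1))), phi + f * (sg * PI)).
Proof.
  intros Hs HN H1 H2 H3 Hk Hr He Hp Hf Ep.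
  destruct (log_move sg (a3 - a1) (b3 - b1) f eps phi Hs H2 Hr He Hp Hf) as [Z [CZ [EZ [Z0 Z1]]]].
  set (q := fun t => quot (a2 - a1) (b2 - b1) (a3 - a1) (b3 - b1) (sg * PI * t)).
  assert (U : forall t, ucoord (p t) = q t).
  { intros t. rewrite Ep. unfold ucoord, q, quot, Defs.c1, c2, c3. cbn [fst snd]. rewrite !RtoC_minus. f_equal; ring. }
  assert (PQ : forall t, punctured (q t)).
  { intros t. apply quot_punctured; auto. intros E. apply H3.
    replace ((a3 - a2) ^ 2) with ((a2 - a1 - (a3 - a1)) ^ 2) by ring. rewrite E. ring. }
  assert (HQ : forall t, 0 <= t <= 1 -> half_plane s (q t)).
  { intros t Ht. split; [apply PQ|]. destruct (quot_Im (a2 - a1) (b2 - b1) (a3 - a1) (b3 - b1) (sg * PI * t) H2) as [k [Hk0 Ek]].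
    assert (Pp := PI_RGT_0). assert (S : 0 <= sin (PI * t)) by (apply sin_ge_0; nra).
    assert (S2 : sin (sg * PI * t) = sg * sin (PI * t)).
    { destruct Hs as [-> | ->]; [rewrite !Rmult_1_l; auto|]. replace (-1 * PI * t) with (- (PI * t)) by ring. rewrite sin_neg. ring. }
    unfold q. rewrite Ek, S2. cbv zeta in Hk. set (m := (b2 - b1) * (a3 - a1) - (a2 - a1) * (b3 - b1)) in *.
    replace (m * (sg * sin (PI * t)) * k) with (sg * m * (sin (PI * t) * k)) by ring.
    assert (0 <= sin (PI * t) * k) by (apply Rmult_le_pos; lra). destruct s; nra. }
  assert (DN := G2_det N HN).
  exists (fun t => mob N (hsec s (q t))), Z. split; [|split; [|split; [|split; [|split]]]].
  - assert (CC : forall a b z, cont_at istrip (fun w => RtoC a + RtoC b * rot (sg * PI * Im w))%C z).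
    { intros a b z. apply cont_at_plus; [apply cont_at_const|]. apply cont_at_mult; [apply cont_at_const|apply cont_rot]. }
    split; [|split]; intros z Hz.
    + refine (cont_at_ext istrip _ _ z Hz _ (CC a1 b1 z)). intros u _. rewrite Ep. reflexivity.
    + refine (cont_at_ext istrip _ _ z Hz _ (CC a2 b2 z)). intros u _. rewrite Ep. reflexivity.
    + refine (cont_at_ext istrip _ _ z Hz _ (CC a3 b3 z)). intros u _. rewrite Ep. reflexivity.
  - intros z Hz. apply (cont_mob N istrip (fun w => hsec s (q (Im w))) z DN); [eapply Cov_Im, Cov_hsec, PQ|].
    refine (cont_at_comp istrip (half_plane s) (fun w => q (Im w)) (hsec s) z (fun u Hu => HQ (Im u) Hu) _ (cont_hsec s _ (HQ _ Hz))).
    apply cont_at_div; [apply affine_rot_neq_0; auto| |]; (apply cont_at_plus; [apply cont_at_const|];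
      apply cont_at_mult; [apply cont_at_const|apply cont_rot]).
  - exact CZ.
  - intros t Ht. split; [rewrite U; apply Cov_act; auto; apply Cov_hsec, PQ|].
    rewrite EZ, Ep. unfold Defs.c1, c3. cbn [fst snd]. rewrite !RtoC_minus. ring.
  - assert (E0 : q 0 = RtoC ((a2 + b2 - (a1 + b1)) / (a3 + b3 - (a1 + b1)))).
    { unfold q, quot. rewrite Rmult_0_r, rot_0. rewrite <- !RtoC_mult, <- !RtoC_plus, <- RtoC_div.
      - apply (f_equal RtoC). apply (f_equal2 Rdiv); ring.
      - intros E. apply H2. replace (a3 - a1) with (- ((b3 - b1) * 1)) by lra. ring. }
    rewrite Ep, E0, Rmult_0_r, rot_0, <- !RtoC_mult, <- !RtoC_plus, !Rmult_1_r.
    split; [reflexivity|]. split; [reflexivity|]. rewrite Z0. apply (f_equal2 pair); [|reflexivity]. apply (f_equal ln), (f_equal Rabs). ring.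
  - assert (E1 : q 1 = RtoC ((a2 - b2 - (a1 - b1)) / (a3 - b3 - (a1 - b1)))).
    { unfold q, quot. rewrite Rmult_1_r, rot_sign_PI by auto. rewrite <- !RtoC_mult, <- !RtoC_plus, <- RtoC_div.
      - apply (f_equal RtoC). apply (f_equal2 Rdiv); ring.
      - intros E. apply H2. replace (a3 - a1) with (- ((b3 - b1) * -1)) by lra. ring. }
    rewrite Ep, E1, Rmult_1_r, rot_sign_PI, <- !RtoC_mult, <- !RtoC_plus by auto.
    split; [apply f_equal2; [apply f_equal2|]; apply (f_equal RtoC); ring|]. split; [reflexivity|]. rewrite Z1. apply (f_equal2 pair); [|reflexivity]. apply (f_equal ln), (f_equal Rabs). ring.
Qed.

(** 1/2 is fixed by u -> 1 - u, hence its period ratio by t -> -1/t. *)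
Lemma T1_half : T1 (RtoC (1 / 2)) = Ci.
Proof.
  assert (O : Om (RtoC (1 / 2))) by (apply Om_interval; rewrite Re_RtoC; lra).
  assert (P := T1_Im_pos _ O). assert (F := T1_flip _ O). assert (N := T1_neq_0 _ O).
  replace (RtoC 1 - RtoC (1 / 2))%C with (RtoC (1 / 2)) in F by (apply C_ext; cre; lra).
  set (t := T1 (RtoC (1 / 2))) in *.
  assert (E : (t * t)%C = RtoC (-1)).
  { rewrite F at 1. transitivity (- RtoC 1)%C; [field; auto|apply C_ext; cre; lra]. }
  assert (E1 := f_equal Re E). assert (E2 := f_equal Im E). cre_in E1. cre_in E2.
  assert (Re t = 0) by nra. apply C_ext; cre; nra.
Qed.

(** * The motions of the generators *)

(** The state [p] records through [posr] where strands one, two and three are; a letter exchanges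
    the strands at two neighbouring positions. *)
Definition nextp (g : bool) (p : perm3) : perm3 :=
  match p with
  | P123 => if g then P213 else P132 | P213 => if g then P123 else P312
  | P132 => if g then P231 else P123 | P231 => if g then P132 else P321
  | P312 => if g then P321 else P213 | P321 => if g then P312 else P231
  end.

Definition posr (p : perm3) : R * R * R :=
  match p with
  | P123 => (-1, 0, 1) | P132 => (-1, 1, 0) | P213 => (0, -1, 1)
  | P231 => (0, 1, -1) | P312 => (1, -1, 0) | P321 => (1, 0, -1)
  end.
Definition posn (p : perm3) : conf := permute p (RtoC (-1), RtoC 0, RtoC 1).
Definition ucr (p : perm3) : R := match p with P123 | P321 => 1/2 | P213 | P231 => -1 | P132 | P312 => 2 end.
Definition dist (p : perm3) : R := match p with P123 | P321 => 2 | _ => 1 end.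
Definition orient (p : perm3) : R := match p with P123 | P132 | P213 => 1 | _ => -1 end.

(* the half plane in which the cross ratio moves under the letter [(g, pos)] *)
Definition side (g pos : bool) (p : perm3) : bool :=
  Bool.eqb pos (Bool.eqb g (match p with P123 | P231 | P312 => true | _ => false end)).
(* does the letter exchange the first and the third strand? *)
Definition outer (g : bool) (p : perm3) : bool :=
  match p with P132 | P231 => g | P213 | P312 => negb g | _ => false end.
(** Since [Ci] lies over 1/2, the period ratios over the other two positions -1 and 2 of the cross
    ratio are its images under these matrices. *)
Definition corner (s : bool) (p : perm3) : mat :=
  let e := if s then 1 else -1 in
  match p with P123 | P321 => (1, 0, 0, 1) | P213 | P231 => (1, e, 0, 1) | P132 | P312 => (1, 0, e, 1) end.
Definition sgb (pos : bool) : R := if pos then 1 else -1.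

Lemma sgb_cases pos : sgb pos = 1 \/ sgb pos = -1.
Proof. destruct pos; auto. Qed.

Lemma hsec_corner s p : hsec s (RtoC (ucr p)) = mob (corner s p) Ci.
Proof.
  assert (H1 : T1 (RtoC (1/2)) = Ci) by apply T1_half.
  assert (Ip : 0 < Im Ci) by (simpl; lra).
  assert (X : forall u g, half_plane s u -> cmap g u = RtoC (1/2) -> hsec s u = mob (mmul (corr s g) (rho g)) Ci).
  { intros u g Hu E. rewrite (hsec_chart s g u Hu); [|rewrite E; apply Om_interval; rewrite Re_RtoC; lra].
    unfold sheet. rewrite E, H1. symmetry. apply mob_mmul; auto; [apply G2_det, corr_G2|apply rho_det]. }
  assert (HP : forall x, x <> 0 -> x <> 1 -> half_plane s (RtoC x)).
  { intros x H0 Hx. split; [split; intros E; apply RtoC_inj in E; auto|]. rewrite Im_RtoC. destruct s; lra. }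
  assert (A1 : hsec s (RtoC (1/2)) = mob (1, 0, 0, 1) Ci).
  { rewrite (X _ cid); [|apply HP; lra|reflexivity]. f_equal. destruct s; simpl; repeat apply f_equal2; ring. }
  assert (A2 : hsec s (RtoC (-1)) = mob (1, if s then 1 else -1, 0, 1) Ci).
  { rewrite (X _ cP); [|apply HP; lra|].
    - f_equal. destruct s; simpl; repeat apply f_equal2; ring.
    - simpl. rewrite <- RtoC_minus, <- RtoC_div by lra. f_equal. field. }
  assert (A3 : hsec s (RtoC 2) = mob (1, 0, if s then 1 else -1, 1) Ci).
  { rewrite (X _ cI); [|apply HP; lra|].
    - f_equal. destruct s; simpl; repeat apply f_equal2; ring.
    - simpl. rewrite <- RtoC_inv by lra. f_equal. field. }
  destruct p; unfold ucr, corner; auto.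
Qed.

(** The centre of the half turn if the strand at [x] moves, and [x] itself if it rests. *)
Definition al (g : bool) (x : R) : R :=
  if g then (if Rlt_dec x (1/2) then -1/2 else x) else (if Rlt_dec (-1/2) x then 1/2 else x).

Lemma gmove_affine g pos s x : gmove (g, pos) s (RtoC x) =
  (RtoC (al g x) + RtoC (x - al g x) * rot (sgb pos * PI * s))%C.
Proof.
  unfold gmove, al, sgb. cbn [fst snd]. rewrite Re_RtoC. destruct g.
  - destruct (Rlt_dec x (1/2)); rewrite RtoC_minus; [ring|]. ring.
  - destruct (Rlt_dec (-1/2) x); rewrite RtoC_minus; [ring|]. ring.
Qed.

Lemma al_values : (al true (-1) = -1/2 /\ al true 0 = -1/2 /\ al true 1 = 1) /\
  (al false (-1) = -1 /\ al false 0 = 1/2 /\ al false 1 = 1/2).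
Proof.
  unfold al. repeat split; repeat (match goal with |- context [Rlt_dec ?a ?b] => destruct (Rlt_dec a b) end); lra.
Qed.

Lemma plift_letter g pos p N phi : G2 N -> rot phi = RtoC (orient p) ->
  plift (fun s => (gmove (g, pos) s (c1 (posn p)), gmove (g, pos) s (c2 (posn p)), gmove (g, pos) s (c3 (posn p))))
    (posn p) (mob N (hsec (side g pos p) (RtoC (ucr p)))) (ln (dist p), phi)
    (posn (nextp g p)) (mob N (hsec (side g pos p) (RtoC (ucr (nextp g p))))) (ln (dist (nextp g p)), phi + (if outer g p then 1 else 0) * (sgb pos * PI)).
Proof.
  intros HN Hr.
  assert (E0 : posn p = let '(x, y, z) := posr p in (RtoC x, RtoC y, RtoC z)) by (destruct p; reflexivity).
  destruct (posr p) as [[x y] z] eqn:Ep. rewrite E0. unfold Defs.c1, c2, c3. cbn [fst snd].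
  assert (M := affine_move (sgb pos) (al g x) (x - al g x) (al g y) (y - al g y) (al g z) (z - al g z)
    (if outer g p then 1 else 0) (orient p) phi (side g pos p) N
    (fun s => (gmove (g, pos) s (RtoC x), gmove (g, pos) s (RtoC y), gmove (g, pos) s (RtoC z))) (sgb_cases pos) HN).
  replace (al g x + (x - al g x)) with x in M by ring. replace (al g y + (y - al g y)) with y in M by ring.
  replace (al g z + (z - al g z)) with z in M by ring.
  assert (F : (y - x) / (z - x) = ucr p /\ Rabs (z - x) = dist p /\
    (al g y - (y - al g y) - (al g x - (x - al g x))) / (al g z - (z - al g z) - (al g x - (x - al g x))) = ucr (nextp g p) /\
    Rabs (al g z - (z - al g z) - (al g x - (x - al g x))) = dist (nextp g p) /\
    posn (nextp g p) = (RtoC (al g x - (x - al g x)), RtoC (al g y - (y - al g y)), RtoC (al g z - (z - al g z)))).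
  { clear M. destruct al_values as [[V1 [V2 V3]] [V4 [V5 V6]]].
    destruct p, g; inversion Ep; subst x y z; rewrite ?V1, ?V2, ?V3, ?V4, ?V5, ?V6; unfold ucr, dist, nextp, posn, permute;
    (split; [field|split; [unfold Rabs; destruct (Rcase_abs _); lra|split; [field|split; [unfold Rabs; destruct (Rcase_abs _); lra|
      apply f_equal2; [apply f_equal2|]; apply (f_equal RtoC); lra]]]]). }
  destruct F as [F1 [F2 [F3 [F4 F5]]]]. rewrite F1, F2, F3, F4, <- F5 in M. clear F1 F2 F3 F4 F5 E0.
  apply M; clear M; auto; try (destruct al_values as [[V1 [V2 V3]] [V4 [V5 V6]]];
    destruct p, g; inversion Ep; subst x y z; rewrite ?V1, ?V2, ?V3, ?V4, ?V5, ?V6; unfold orient, outer, negb; lra).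
  - destruct al_values as [[V1 [V2 V3]] [V4 [V5 V6]]].
    destruct p, g, pos; inversion Ep; subst x y z; rewrite ?V1, ?V2, ?V3, ?V4, ?V5, ?V6; unfold sgb, side; simpl; lra.
  - intros t. rewrite !gmove_affine. reflexivity.
Qed.

(** * Braid words *)

Definition arc (ls : list letter) (q : conf) (t : R) : conf := (ptraj ls (c1 q) t, ptraj ls (c2 q) t, ptraj ls (c3 q) t).

(* [run ls p X phi p' X' phi']: starting at the permutation [p] with lift [mob X Ci], the word [ls] leads to [p']
   with lift [mob X' Ci], while the argument of [z3 - z1] moves from [phi] to [phi']. *)
Inductive run : list letter -> perm3 -> mat -> R -> perm3 -> mat -> R -> Prop :=
| run_nil p X phi : rot phi = RtoC (orient p) -> G2 (mmul X (madj (corner true p))) -> run [] p X phi p X phi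
| run_cons g pos ls p X phi p' X' phi' : rot phi = RtoC (orient p) ->
    G2 (mmul X (madj (corner (side g pos p) p))) ->
    run ls (nextp g p) (mmul (mmul X (madj (corner (side g pos p) p))) (corner (side g pos p) (nextp g p)))
      (phi + (if outer g p then 1 else 0) * (sgb pos * PI)) p' X' phi' ->
    run ((g, pos) :: ls) p X phi p' X' phi'.

Lemma run_app l1 l2 p X phi p' X' phi' p'' X'' phi'' :
  run l1 p X phi p' X' phi' -> run l2 p' X' phi' p'' X'' phi'' -> run (l1 ++ l2) p X phi p'' X'' phi''.
Proof. intros H. induction H; intros H2; simpl; auto. constructor; auto. Qed.

Ltac mat_ring := apply f_equal2; [apply f_equal2; [apply f_equal2|]|]; ring.

Lemma mmul_assoc l m n : mmul (mmul l m) n = mmul l (mmul m n).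
Proof. destruct l as [[[? ?] ?] ?], m as [[[? ?] ?] ?], n as [[[? ?] ?] ?]. simpl. mat_ring. Qed.
Lemma mmul_one_r m : mmul m (1, 0, 0, 1) = m.
Proof. destruct m as [[[? ?] ?] ?]. simpl. mat_ring. Qed.

Lemma corner_det s p : det (corner s p) = 1.
Proof. destruct s, p; simpl; ring. Qed.
Lemma Im_Ci_pos : 0 < Im Ci.
Proof. simpl. lra. Qed.

Lemma corner_cancel X s p : mmul (mmul X (madj (corner s p))) (corner s p) = X.
Proof. rewrite mmul_assoc. rewrite <- (mmul_one_r X) at 2. f_equal. destruct s, p; simpl; mat_ring. Qed.

Lemma posn_ucoord p : ucoord (posn p) = RtoC (ucr p).
Proof.
  destruct p; unfold posn, permute, ucoord, ucr, Defs.c1, c2, c3; cbn [fst snd]; rewrite <- !RtoC_minus, <- RtoC_div by lra; f_equal; field.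
Qed.

Lemma posn_diff p : (c3 (posn p) - c1 (posn p))%C = RtoC (dist p * orient p).
Proof. destruct p; unfold posn, permute, dist, orient, Defs.c1, c3; cbn [fst snd]; rewrite <- RtoC_minus; f_equal; ring. Qed.

Lemma ucr_punctured p : punctured (RtoC (ucr p)).
Proof. split; intros E; apply RtoC_inj in E; destruct p; unfold ucr in E; lra. Qed.

Lemma dist_pos p : 0 < dist p.
Proof. destruct p; simpl; lra. Qed.

Lemma ptraj_cons l ls z t n : INR (length (l :: ls)) = n -> ptraj (l :: ls) z t =
  if Rle_dec (n * t) 1 then gmove l (n * t) z else ptraj ls (gmove l 1 z) ((n * t - 1) / (n - 1)).
Proof. intros <-. reflexivity. Qed.

Lemma run_plift ls p X phi p' X' phi' : run ls p X phi p' X' phi' ->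
  plift (arc ls (posn p)) (posn p) (mob X Ci) (ln (dist p), phi) (posn p') (mob X' Ci) (ln (dist p'), phi').
Proof.
  intros H. induction H as [p X phi Hr HX|g pos ls p X phi p' X' phi' Hr HX H IH].
  - assert (E : forall t, arc [] (posn p) t = posn p) by (intros; destruct p; reflexivity).
    exists (fun _ => mob X Ci), (fun _ => (ln (dist p), phi)). rewrite !E.
    split.
    { assert (CC : forall c, pcont (fun _ => c)) by (intros c z Hz; apply cont_at_const).
      split; [|split]; (eapply pcont_ext; [intros t _; rewrite E; reflexivity|apply CC]). }
    split; [intros z Hz; apply cont_at_const|]. split; [intros z Hz; apply cont_at_const|].
    split; [|auto]. intros t _. rewrite E. split.
    + rewrite posn_ucoord. rewrite <- (corner_cancel X true p). rewrite mob_mmul; [|apply G2_det; auto|apply corner_det|apply Im_Ci_pos].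
      apply Cov_act; auto. rewrite <- hsec_corner. apply Cov_hsec, ucr_punctured.
    + rewrite cexp_ln, Hr, posn_diff, RtoC_mult by apply dist_pos. reflexivity.
  - assert (L := plift_letter g pos p _ phi HX Hr). rewrite !hsec_corner in L.
    rewrite <- !mob_mmul in L by (first [apply corner_det|apply Im_Ci_pos|apply G2_det; exact HX]).
    rewrite corner_cancel in L.
    destruct ls as [|l ls].
    + inversion H; subst. eapply plift_ext; [|exact L]. intros t Ht. unfold arc. simpl ptraj.
      rewrite Rmult_1_l. destruct (Rle_dec t 1); [reflexivity|lra].
    + set (n := INR (length ((g, pos) :: l :: ls))).
      assert (Hn : 2 <= n). { unfold n. apply (le_INR 2). simpl. lia. }
      assert (Hi : 0 < / n < 1). { split; [apply Rinv_0_lt_compat; lra|]. rewrite <- Rinv_1. apply Rinv_lt_contravar; lra. }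
      assert (NX : (gmove (g, pos) 1 (c1 (posn p)), gmove (g, pos) 1 (c2 (posn p)), gmove (g, pos) 1 (c3 (posn p))) = posn (nextp g p)).
      { destruct L as [? [? [_ [_ [_ [_ [_ [E _]]]]]]]]. exact E. }
      apply (plift_glue (/ n) _ _ (arc (l :: ls) (posn (nextp g p))) _ _ _ _ _ _ _ _ _ Hi) with (3 := L) (4 := IH).
      * intros t Ht. unfold arc. rewrite !(fun z t => ptraj_cons (g, pos) (l :: ls) z t n eq_refl). destruct (Rle_dec (n * t) 1) as [_|C].
        -- replace (t / / n) with (n * t) by (field; lra). reflexivity.
        -- exfalso. apply C. apply Rmult_le_reg_l with (/ n); [lra|]. rewrite <- Rmult_assoc, Rinv_l; lra.
      * intros t Ht. rewrite <- NX. unfold arc at 1. rewrite !(fun z t => ptraj_cons (g, pos) (l :: ls) z t n eq_refl).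
        destruct (Rle_dec (n * t) 1) as [C|_].
        -- exfalso. assert (t <= / n); [|lra]. apply Rmult_le_reg_l with n; [lra|]. rewrite Rinv_r; lra.
        -- replace ((t - / n) / (1 - / n)) with ((n * t - 1) / (n - 1)) by (field; lra). reflexivity.
Qed.

Lemma tmat_add g m n : mmul (tmat (g, m)) (tmat (g, n)) = tmat (g, (m + n)%Z).
Proof. destruct g; unfold tmat; cbn [fst snd mmul]; rewrite ?mult_IZR, ?opp_IZR, ?plus_IZR; mat_ring. Qed.

(** The two half turns take the cross ratio through opposite half planes, once around a puncture;
    the corners compose to a generator. *)
Lemma run_square g pos N phi : G2 N -> rot phi = RtoC 1 ->
  run [(g, pos); (g, pos)] P123 N phi P123 (mmul N (tmat (g, if pos then 1%Z else (-1)%Z))) phi.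
Proof.
  intros HN Hr. set (s := side g pos P123).
  assert (E1 : mmul N (madj (corner s P123)) = N) by (rewrite <- (mmul_one_r N) at 2; f_equal; simpl; mat_ring).
  set (s' := side g pos (nextp g P123)).
  assert (E2 : mmul (mmul N (corner s (nextp g P123))) (madj (corner s' (nextp g P123))) = mmul N (tmat (g, if pos then 1%Z else (-1)%Z))).
  { rewrite mmul_assoc. f_equal. unfold s, s', side. destruct g, pos; unfold tmat; simpl; mat_ring. }
  assert (G : G2 (mmul N (tmat (g, if pos then 1%Z else (-1)%Z)))) by (apply G2_mul; auto; apply tmat_G2).
  assert (O1 : outer g P123 = false) by reflexivity. assert (O2 : outer g (nextp g P123) = false) by (destruct g; reflexivity).
  assert (X : nextp g (nextp g P123) = P123) by (destruct g; reflexivity).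
  constructor; [exact Hr|fold s; rewrite E1; exact HN|]. fold s. rewrite E1, O1. replace (phi + 0 * (sgb pos * PI)) with phi by ring.
  constructor; [rewrite Hr; destruct g; reflexivity|fold s'; rewrite E2; exact G|]. fold s'. rewrite E2, O2, X.
  replace (phi + 0 * (sgb pos * PI)) with phi by ring.
  replace (mmul (mmul N (tmat (g, if pos then 1%Z else (-1)%Z))) (corner s' P123)) with (mmul N (tmat (g, if pos then 1%Z else (-1)%Z))) by (symmetry; apply mmul_one_r).
  constructor; [exact Hr|]. replace (madj (corner true P123)) with ((1, 0, 0, 1) : mat) by (simpl; mat_ring). rewrite mmul_one_r. exact G.
Qed.

Lemma run_term g pos k N phi : G2 N -> rot phi = RtoC 1 ->
  run (repeat (g, pos) (2 * k)) P123 N phi P123 (mmul N (tmat (g, (if pos then Z.of_nat k else - Z.of_nat k)%Z))) phi.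
Proof.
  intros HN Hr. revert N HN. induction k as [|k IH]; intros N HN.
  - replace (tmat (g, (if pos then Z.of_nat 0 else - Z.of_nat 0)%Z)) with (1, 0, 0, 1) by (destruct g, pos; reflexivity). rewrite mmul_one_r.
    constructor; [exact Hr|]. replace (madj (corner true P123)) with ((1, 0, 0, 1) : mat) by (simpl; mat_ring). rewrite mmul_one_r. exact HN.
  - replace (2 * S k)%nat with (2 + 2 * k)%nat by lia. change (repeat (g, pos) (2 + 2 * k)) with ([(g, pos); (g, pos)] ++ repeat (g, pos) (2 * k)).
    eapply run_app; [apply run_square; auto|].
    assert (X := IH (mmul N (tmat (g, if pos then 1%Z else (-1)%Z))) ltac:(apply G2_mul; auto; apply tmat_G2)).
    rewrite mmul_assoc, tmat_add in X.
    replace ((if pos then 1 else -1) + (if pos then Z.of_nat k else - Z.of_nat k))%Z with (if pos then Z.of_nat (S k) else - Z.of_nat (S k))%Z in X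
      by (destruct pos; lia). exact X.
Qed.

Lemma run_word w N phi : G2 N -> rot phi = RtoC 1 ->
  run (concat (map expand_term w)) P123 N phi P123 (mmul N (wmat w)) phi.
Proof.
  intros HN Hr. revert N HN. induction w as [|[g n] w IH]; intros N HN.
  - exact (run_term true true 0 N phi HN Hr).
  - change (concat (map expand_term ((g, n) :: w))) with (expand_term (g, n) ++ concat (map expand_term w)).
    change (wmat ((g, n) :: w)) with (mmul (tmat (g, n)) (wmat w)). rewrite <- mmul_assoc.
    apply (run_app _ _ _ _ _ P123 (mmul N (tmat (g, n))) phi); [|apply IH, G2_mul; auto; apply tmat_G2].
    unfold expand_term. cbn [fst snd]. assert (X := run_term g (0 <? n)%Z (Z.abs_nat n) N phi HN Hr).
    replace (if (0 <? n)%Z then Z.of_nat (Z.abs_nat n) else (- Z.of_nat (Z.abs_nat n))%Z) with n in X by (destruct (Z.ltb_spec 0 n); lia).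
    exact X.
Qed.

(** In every step the cross ratio stays in the closed upper half plane, so the corners cancel and
    the matrix does not change. The outer strands are exchanged twice, which turns z3 - z1 once. *)
Lemma run_full_twist (pos : bool) N phi : G2 N -> rot phi = RtoC 1 ->
  run (if pos then Delta2 else Delta2inv) P123 N phi P123 N (phi + 2 * (sgb pos * PI)).
Proof.
  intros HN Hr.
  assert (R1 : rot (phi + 1 * (sgb pos * PI)) = RtoC (-1)).
  { rewrite rot_plus, Rmult_1_l, rot_sign_PI, Hr by apply sgb_cases. rewrite <- RtoC_mult. f_equal. ring. }
  assert (R2 : rot (phi + 1 * (sgb pos * PI) + 1 * (sgb pos * PI)) = RtoC 1).
  { rewrite rot_plus, R1, Rmult_1_l, rot_sign_PI by apply sgb_cases. rewrite <- RtoC_mult. f_equal. ring. }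
  assert (Z : forall x, x + 0 * (sgb pos * PI) = x) by (intros; ring).
  assert (E1 : mmul N (madj (corner true P123)) = N) by (rewrite <- (mmul_one_r N) at 2; f_equal; simpl; mat_ring).
  assert (E2 : forall X p, mmul (mmul X (corner true p)) (madj (corner true p)) = X).
  { intros X p. rewrite mmul_assoc. rewrite <- (mmul_one_r X) at 2. f_equal. destruct p; simpl; mat_ring. }
  replace (phi + 2 * (sgb pos * PI)) with (phi + 1 * (sgb pos * PI) + 1 * (sgb pos * PI)) by ring.
  rewrite <- (corner_cancel N true P123), E1.
  destruct pos; unfold Delta2, Delta2inv;
  (do 6 (constructor; [assumption|cbv [side nextp Bool.eqb]; rewrite ?E1, ?E2; exact HN|cbv [side nextp Bool.eqb outer negb]; rewrite ?E1, ?E2, ?Z]));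
  (constructor; [assumption|rewrite E2; exact HN]).
Qed.

Lemma run_full_twists k N phi : G2 N -> rot phi = RtoC 1 ->
  run (Delta2pow k) P123 N phi P123 N (phi + 2 * IZR k * PI).
Proof.
  intros HN. assert (X : forall (pos : bool) j phi, rot phi = RtoC 1 ->
    run (concat (repeat (if pos then Delta2 else Delta2inv) j)) P123 N phi P123 N (phi + 2 * INR j * (sgb pos * PI))).
  { intros pos. induction j as [|j IH]; intros psi Hr.
    - replace (psi + 2 * INR 0 * (sgb pos * PI)) with psi by (simpl; ring).
      assert (Y := run_term true true 0 N psi HN Hr). replace (tmat (true, Z.of_nat 0)) with ((1, 0, 0, 1) : mat) in Y by reflexivity.
      rewrite mmul_one_r in Y. exact Y.
    - simpl concat. eapply run_app; [apply run_full_twist; auto|].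
      replace (psi + 2 * INR (S j) * (sgb pos * PI)) with (psi + 2 * (sgb pos * PI) + 2 * INR j * (sgb pos * PI)) by (rewrite S_INR; ring).
      apply IH. replace (psi + 2 * (sgb pos * PI)) with (psi + sgb pos * PI + sgb pos * PI) by ring.
      rewrite !rot_plus, Hr, rot_sign_PI by apply sgb_cases. rewrite <- !RtoC_mult. f_equal. ring. }
  intros Hr. unfold Delta2pow. destruct (Z.leb_spec 0 k) as [L|L].
  - assert (Y := X true (Z.to_nat k) phi Hr). simpl sgb in Y. rewrite INR_IZR_INZ, Z2Nat.id, Rmult_1_l in Y by auto. exact Y.
  - assert (Y := X false (Z.abs_nat k) phi Hr). simpl sgb in Y. rewrite INR_IZR_INZ in Y.
    replace (Z.of_nat (Z.abs_nat k)) with (- k)%Z in Y by lia. rewrite opp_IZR in Y.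
    replace (2 * - IZR k * (-1 * PI)) with (2 * IZR k * PI) in Y by ring. exact Y.
Qed.

Definition twist (e : bool) : R := if e then 0 else PI / 2.
Definition base (e : bool) : conf :=
  if e then (RtoC (-1), RtoC 0, RtoC 1) else ((- Ci)%C, RtoC 0, Ci).
Definition braid_arc (e : bool) (ls : list letter) : R -> conf := if e then tr_arc ls else pb_arc ls.

Lemma tr_arc_plift w k : plift (tr_arc (braid_word w k)) (base true) Ci (ln 2, 0) (base true) (mob (wmat w) Ci) (ln 2, 2 * IZR k * PI).
Proof.
  assert (H1 := run_word w (1, 0, 0, 1) 0 G2_one rot_0).
  assert (H2 := run_full_twists k (mmul (1, 0, 0, 1) (wmat w)) 0 ltac:(apply G2_mul; [apply G2_one|apply wmat_G2]) rot_0).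
  assert (H := run_plift _ _ _ _ _ _ _ (run_app _ _ _ _ _ _ _ _ _ _ _ H1 H2)).
  rewrite Rplus_0_l, mob_one, mob_mmul, mob_one in H; [exact H|apply G2_det, G2_one|apply G2_det, wmat_G2|apply Im_Ci_pos].
Qed.

Definition spin (a : R) : conf := ((RtoC (-1) * rot a)%C, (RtoC 0 * rot a)%C, (RtoC 1 * rot a)%C).

Lemma spin_0 : spin 0 = base true.
Proof. unfold spin, base. rewrite rot_0, <- !RtoC_mult. apply f_equal2; [apply f_equal2|]; apply (f_equal RtoC); ring. Qed.

Lemma spin_quarter : spin (PI / 2) = base false.
Proof. unfold spin, base, rot. rewrite cos_PI2, sin_PI2. apply f_equal2; [apply f_equal2|]; apply C_ext; cre; ring. Qed.

Lemma plift_spin c om phi t0 : rot phi = RtoC 1 -> Cov (RtoC (1 / 2)) t0 ->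
  plift (fun t => spin (c + om * t)) (spin c) t0 (ln 2, phi + c) (spin (c + om)) t0 (ln 2, phi + (c + om)).
Proof.
  intros Hr HC.
  assert (CR : forall z, cont_at istrip (fun w => rot (c + om * Im w)) z).
  { intros z. apply (cont_at_ext_loc istrip (fun w => (rot c * rot (om * Im w))%C) _ _ 1 Rlt_0_1).
    - intros u _ _. symmetry. apply rot_plus.
    - symmetry. apply rot_plus.
    - apply cont_at_mult; [apply cont_at_const|apply cont_rot]. }
  assert (N : forall a, rot a <> RtoC 0).
  { intros a E. apply (affine_rot_neq_0 0 1 a); [lra|]. rewrite E. ring. }
  exists (fun _ => t0), (fun t => (ln 2, phi + (c + om * t))). split; [|split; [|split; [|split; [|split]]]].
  - split; [|split]; intros z Hz; (apply cont_at_mult; [apply cont_at_const|apply CR]).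
  - intros z Hz. apply cont_at_const.
  - intros z Hz. refine (cont_at_ext istrip (fun w => ((ln 2, (phi + c)%R) + Ci * (RtoC om * RtoC (Im w)))%C) _ z Hz _ _).
    + intros u _. apply C_ext; cre; simpl; ring.
    + apply cont_at_plus; [apply cont_at_const|]. apply cont_at_mult; [apply cont_at_const|].
      apply cont_at_mult; [apply cont_at_const|apply cont_at_RtoC_Im].
  - intros t _. split.
    + replace (ucoord (spin (c + om * t))) with (RtoC (1 / 2)); auto.
      unfold ucoord, spin, Defs.c1, c2, c3. cbn [fst snd]. specialize (N (c + om * t)). set (r := rot (c + om * t)) in *.
      assert (N2 : RtoC 2 <> RtoC 0) by (apply Cneq_Re; cre; lra). rewrite RtoC_div by lra.
      replace (RtoC 0 * r - RtoC (-1) * r)%C with (RtoC 1 * r)%C by (apply C_ext; cre; ring).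
      replace (RtoC 1 * r - RtoC (-1) * r)%C with (RtoC 2 * r)%C by (apply C_ext; cre; ring). field. auto.
    + rewrite cexp_ln, rot_plus, Hr by lra. unfold spin, Defs.c1, c3. cbn [fst snd]. apply C_ext; cre; ring.
  - rewrite Rmult_0_r, Rplus_0_r. auto.
  - rewrite Rmult_1_r. auto.
Qed.

Lemma Cov_half_Ci : Cov (RtoC (1 / 2)) Ci.
Proof.
  assert (O : Om (RtoC (1 / 2))) by (apply Om_interval; rewrite Re_RtoC; lra).
  assert (X := Cov_sheet cid (RtoC (1/2)) (Om_punctured _ O) O). unfold sheet, rho, cmap in X. rewrite mob_one, T1_half in X. exact X.
Qed.

(** Read off from the lift along the full twists: its final value is a logarithm of z3 - z1 = 2. *)
Lemma rot_period k : rot (2 * IZR k * PI) = RtoC 1.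
Proof.
  destruct (tr_arc_plift nil k) as [T [Z [_ [_ [_ [HC [_ [E1 [_ E2]]]]]]]]].
  destruct (HC 1 ltac:(lra)) as [_ E]. rewrite E1, E2, cexp_ln in E by lra.
  unfold base, Defs.c1, c3 in E. cbn [fst snd] in E.
  assert (F1 := f_equal Re E). assert (F2 := f_equal Im E). cre_in F1. cre_in F2. apply C_ext; cre; lra.
Qed.

Lemma braid_arc_plift e w k : plift (braid_arc e (braid_word w k)) (base e) Ci (ln 2, twist e)
  (base e) (mob (wmat w) Ci) (ln 2, 2 * IZR k * PI + twist e).
Proof.
  assert (H := tr_arc_plift w k). destruct e; unfold twist.
  { rewrite Rplus_0_r. exact H. }
  set (ls := braid_word w k) in *.
  assert (R1 := rot_period k).
  assert (S1 := plift_spin (PI / 2) (- (PI / 2)) 0 Ci rot_0 Cov_half_Ci).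
  assert (S2 := plift_spin 0 (PI / 2) (2 * IZR k * PI) (mob (wmat w) Ci) R1 (Cov_act _ _ _ Cov_half_Ci (wmat_G2 w))).
  replace (PI / 2 + - (PI / 2)) with 0 in S1 by ring. rewrite spin_0, spin_quarter, !Rplus_0_l in S1.
  rewrite spin_0, Rplus_0_l, spin_quarter, Rplus_0_r in S2.
  assert (B1 : tr_arc ls 1 = base true) by (destruct H as [? [? [_ [_ [_ [_ [_ [E _]]]]]]]]; exact E).
  assert (P1 : ptraj ls (RtoC (-1)) 1 = RtoC (-1) /\ ptraj ls (RtoC 0) 1 = RtoC 0 /\ ptraj ls (RtoC 1) 1 = RtoC 1).
  { unfold tr_arc, base in B1. injection B1 as -> -> ->. auto. }
  destruct P1 as [P1 [P2 P3]].
  (* The arc consists of thirds: two rotations, which leave the cross ratio unchanged, around the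
     totally real arc. It is glued at 1/3 and then at half of the rest. *)
  set (tail := fun s => if Rle_dec s (/ 2) then tr_arc ls (s / / 2) else spin (0 + PI / 2 * ((s - / 2) / (1 - / 2)))).
  assert (L2 : plift tail (base true) Ci (ln 2, 0) (base false) (mob (wmat w) Ci) (ln 2, 2 * IZR k * PI + PI / 2)).
  { apply (plift_glue (/ 2) tail _ _ _ _ _ _ _ _ _ _ _ ltac:(lra)) with (3 := H) (4 := S2); intros t Ht; unfold tail;
    destruct (Rle_dec t (/ 2)); auto; lra. }
  apply (plift_glue (/ 3) _ _ _ _ _ _ _ _ _ _ _ _ ltac:(lra)) with (3 := S1) (4 := L2); intros t Ht; unfold braid_arc, pb_arc, pb_traj.
  - destruct (Rle_dec (3 * t) 1); [|lra]. unfold spin.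
    replace (PI * (1 - 3 * t) / 2) with (PI / 2 + - (PI / 2) * (t / / 3)) by field. reflexivity.
  - destruct (Rle_dec (3 * t) 1); [lra|]. unfold tail.
    destruct (Rle_dec (3 * t) 2), (Rle_dec ((t - / 3) / (1 - / 3)) (/ 2)); try (exfalso; lra).
    + replace ((t - / 3) / (1 - / 3) / / 2) with (3 * t - 1) by field. reflexivity.
    + rewrite P1, P2, P3. unfold spin.
      replace (0 + PI / 2 * (((t - / 3) / (1 - / 3) - / 2) / (1 - / 2))) with (PI * (3 * t - 2) / 2) by field. reflexivity.
Qed.

(** * Configurations on the sides of a rectangle *)

Definition ends (e : bool) : conf -> Prop := if e then E_tr else E_pb.

(* In the second case the strand number two is the real one. *)
Definition ends2 (e : bool) (z : conf) : Prop :=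
  if e then E_tr z else Im (c2 z) = 0 /\ c1 z = Cconj (c3 z) /\ Im (c1 z) <> 0.

Lemma ends2_ends e z : ends2 e z -> ends e z.
Proof. destruct e; auto. destruct z as [[a b] c]. intros [H1 [H2 H3]]. right; left. auto. Qed.

Lemma ends2_base e : ends2 e (base e).
Proof. destruct e; simpl; unfold E_tr; simpl; repeat split; try apply C_ext; cre; simpl; lra. Qed.

Lemma ucoord_punctured z : distinct3 z -> punctured (ucoord z).
Proof.
  destruct z as [[a b] c]. intros [H1 [H2 H3]]. unfold ucoord, Defs.c1, c2, c3. cbn [fst snd].
  assert (N : (c - a)%C <> RtoC 0) by (intros E; apply H2; symmetry; apply Cminus_eq_0, E).
  split; intros E.
  - apply H1. symmetry. apply Cminus_eq_0. transitivity ((b - a) / (c - a) * (c - a))%C; [field; auto|rewrite E; ring].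
  - apply H3. apply Cminus_eq_0. transitivity (((b - a) / (c - a) - RtoC 1) * (c - a))%C; [field; auto|rewrite E; ring].
Qed.

Lemma distinct_13 z : distinct3 z -> (c3 z - c1 z)%C <> RtoC 0.
Proof. destruct z as [[a b] c]. intros [_ [H2 _]] E. apply H2. symmetry. apply Cminus_eq_0, E. Qed.

Lemma ends2_biota e z : distinct3 z -> ends2 e z -> biota e (ucoord z) = ucoord z.
Proof.
  intros Hd H. assert (N := distinct_13 z Hd). destruct z as [[a b] c]. unfold ucoord, Defs.c1, c2, c3 in *. cbn [fst snd] in *.
  destruct e; simpl in H.
  - destruct H as [H1 [H2 H3]]. unfold Defs.c1, c2, c3 in *. cbn [fst snd] in *. unfold biota. rewrite Cconj_div.
    f_equal; apply C_ext; cre; lra.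
  - unfold Defs.c1, c2, c3 in *. cbn [fst snd] in *. destruct H as [H1 [H2 H3]]. unfold biota. rewrite Cconj_div.
    assert (E1 : Cconj (b - a)%C = (b - c)%C) by (rewrite H2; apply C_ext; cre; lra).
    assert (E2 : Cconj (c - a)%C = (a - c)%C) by (rewrite H2; apply C_ext; cre; lra).
    rewrite E1, E2. field. split; [auto|]. intros E. apply N. transitivity (- (a - c))%C; [ring|rewrite E; ring].
Qed.

(** The strand on the real axis cannot change: the quotient y2^2 / (y1^2 + y2^2 + y3^2) of imaginary
    parts is continuous and takes only the values 0 and 1/2. *)
Lemma ends2_propagate e (D : C -> Prop) (F : C -> conf) z0 : convex D -> conf_cont_on D F ->
  (forall z, D z -> ends e (F z)) -> D z0 -> ends2 e (F z0) -> forall z, D z -> ends2 e (F z).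
Proof.
  intros HD [C1 [C2 C3]] HE H0 E0. destruct e; auto.
  set (r := fun z => let y1 := Im (c1 (F z)) in let y2 := Im (c2 (F z)) in let y3 := Im (c3 (F z)) in
    (RtoC y2 * RtoC y2 / (RtoC y1 * RtoC y1 + RtoC y2 * RtoC y2 + RtoC y3 * RtoC y3))%C).
  assert (K : forall z, D z -> (RtoC (Im (c1 (F z))) * RtoC (Im (c1 (F z))) + RtoC (Im (c2 (F z))) * RtoC (Im (c2 (F z))) + RtoC (Im (c3 (F z))) * RtoC (Im (c3 (F z))))%C <> RtoC 0
     /\ (r z = RtoC 0 /\ ends2 false (F z) \/ r z = RtoC (1/2) /\ ~ ends2 false (F z))).
  { intros z Hz. specialize (HE z Hz). unfold r. destruct (F z) as [[a b] c]. unfold ends2, Defs.c1, c2, c3. cbn [fst snd].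
    unfold ends in HE. simpl in HE.
    destruct HE as [[A1 [A2 A3]]|[[A1 [A2 A3]]|[A1 [A2 A3]]]]; rewrite A1.
    - assert (A4 : Im b = - Im c) by (rewrite A2; reflexivity). rewrite A4. rewrite RtoC_opp.
      assert (N : RtoC (Im c) <> RtoC 0) by (intros E; apply RtoC_inj in E; lra).
      assert (N2 : RtoC 2 <> RtoC 0) by (apply Cneq_Re; cre; lra).
      assert (Q : (RtoC 0 * RtoC 0 + - RtoC (Im c) * - RtoC (Im c) + RtoC (Im c) * RtoC (Im c))%C = (RtoC 2 * (RtoC (Im c) * RtoC (Im c)))%C) by (apply C_ext; cre; ring).
      rewrite Q. split; [apply Cmult_neq_0'; split; auto; apply Cmult_neq_0'; auto|]. right. split; [|lra].
      rewrite RtoC_div by lra. field. auto.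
    - assert (A4 : Im a = - Im c) by (rewrite A2; reflexivity).
      assert (N : RtoC (Im c) <> RtoC 0) by (intros E; apply RtoC_inj in E; lra).
      assert (N2 : RtoC 2 <> RtoC 0) by (apply Cneq_Re; cre; lra).
      rewrite A4, RtoC_opp.
      assert (Q : (- RtoC (Im c) * - RtoC (Im c) + RtoC 0 * RtoC 0 + RtoC (Im c) * RtoC (Im c))%C = (RtoC 2 * (RtoC (Im c) * RtoC (Im c)))%C) by (apply C_ext; cre; ring).
      rewrite Q. assert (N3 : (RtoC 2 * (RtoC (Im c) * RtoC (Im c)))%C <> RtoC 0) by (apply Cmult_neq_0'; split; auto; apply Cmult_neq_0'; auto).
      split; [exact N3|]. left. split; [field; auto|]. split; auto. split; auto. lra.
    - assert (A4 : Im a = - Im b) by (rewrite A2; reflexivity).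
      assert (N : RtoC (Im b) <> RtoC 0) by (intros E; apply RtoC_inj in E; lra).
      assert (N2 : RtoC 2 <> RtoC 0) by (apply Cneq_Re; cre; lra).
      rewrite A4, RtoC_opp.
      assert (Q : (- RtoC (Im b) * - RtoC (Im b) + RtoC (Im b) * RtoC (Im b) + RtoC 0 * RtoC 0)%C = (RtoC 2 * (RtoC (Im b) * RtoC (Im b)))%C) by (apply C_ext; cre; ring).
      rewrite Q. split; [apply Cmult_neq_0'; split; auto; apply Cmult_neq_0'; auto|]. right. split; [|lra].
      rewrite RtoC_div by lra. field. auto. }
  assert (H01 : RtoC 0 <> RtoC (1/2)) by (apply Cneq_Re; cre; lra).
  intros z Hz. assert (R : r z = RtoC 0).
  { apply (lift_unique (fun _ t => t = RtoC 0 \/ t = RtoC (1/2)) D (fun _ => RtoC 0) r (fun _ => RtoC 0) z0); auto.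
    - intros x0 y0 Hy. exists (1/4). split; [lra|]. intros x y y' _ Hy1 Hy2 B1 B2.
      assert (M : Cmod (RtoC 0 - RtoC (1/2)) = 1/2) by (rewrite <- RtoC_minus, Cmod_R, Rabs_left; lra).
      assert (M' : Cmod (RtoC (1/2) - RtoC 0) = 1/2) by (rewrite <- RtoC_minus, Cmod_R, Rabs_right; lra).
      destruct Hy as [-> | ->], Hy1 as [-> | ->], Hy2 as [-> | ->]; auto; lra.
    - intros w Hw. apply cont_at_const.
    - intros w Hw. destruct (K w Hw) as [N _]. unfold r. cbv zeta.
      assert (M1 := cont_at_Im D _ w (C1 w Hw)). assert (M2 := cont_at_Im D _ w (C2 w Hw)). assert (M3 := cont_at_Im D _ w (C3 w Hw)).
      exact (cont_at_div D _ _ w N (cont_at_mult D _ _ w M2 M2)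
        (cont_at_plus D _ _ w (cont_at_plus D _ _ w (cont_at_mult D _ _ w M1 M1) (cont_at_mult D _ _ w M2 M2)) (cont_at_mult D _ _ w M3 M3))).
    - intros w Hw. apply cont_at_const.
    - intros w Hw. destruct (K w Hw) as [_ [[A _]|[A _]]]; auto.
    - destruct (K z0 H0) as [_ [[A _]|[_ A]]]; auto. contradiction. }
  destruct (K z Hz) as [_ [[_ A]|[A _]]]; auto. congruence.
Qed.

Lemma ucoord_cont (D : C -> Prop) F : conf_cont_on D F -> (forall z, D z -> distinct3 (F z)) -> cont_on D (fun z => ucoord (F z)).
Proof.
  intros [C1 [C2 C3]] Hd z Hz.
  exact (cont_at_div D _ _ z (distinct_13 _ (Hd z Hz)) (cont_at_minus D _ _ z (C2 z Hz) (C1 z Hz)) (cont_at_minus D _ _ z (C3 z Hz) (C1 z Hz))).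
Qed.

Lemma side_geodesic e m (D : C -> Prop) F psi z0 : G2 m -> convex D -> conf_cont_on D F ->
  (forall z, D z -> distinct3 (F z)) -> (forall z, D z -> ends e (F z)) ->
  cont_on D psi -> (forall z, D z -> Cov (ucoord (F z)) (psi z)) ->
  D z0 -> ends2 e (F z0) -> geo e (mob m (psi z0)) ->
  forall z, D z -> ends2 e (F z) /\ geo e (mob m (psi z)).
Proof.
  intros Hm HD CF Hd HE Hpsi HC H0 E0 G0.
  assert (E2 := ends2_propagate e D F z0 HD CF HE H0 E0).
  intros z Hz. split; [auto|].
  apply (lift_on_geodesic e m D (fun z => ucoord (F z)) psi z0); auto.
  - apply ucoord_cont; auto.
  - intros w Hw. apply ends2_biota; auto.
Qed.

Definition pinv (p : perm3) : perm3 := match p with P231 => P312 | P312 => P231 | q => q end.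

Lemma permute_pinv p z : permute (pinv p) (permute p z) = z.
Proof. destruct z as [[a b] c], p; reflexivity. Qed.

Lemma distinct3_permute p z : distinct3 z -> distinct3 (permute p z).
Proof. destruct z as [[a b] c]. intros [H1 [H2 H3]]. destruct p; simpl; auto. Qed.

Lemma ends_permute e p z : ends e z -> ends e (permute p z).
Proof.
  destruct z as [[a b] c]. destruct e.
  - intros [H1 [H2 H3]]. destruct p; repeat split; assumption.
  - assert (S : forall x y : C, x = Cconj y -> Im x <> 0 -> y = Cconj x /\ Im y <> 0).
    { intros x y -> H. rewrite Cconj_conj. split; auto. cre_in H. lra. }
    intros [[H1 [H2 H3]]|[[H1 [H2 H3]]|[H1 [H2 H3]]]]; destruct (S _ _ H2 H3); destruct p; simpl; auto 10.
Qed.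

Lemma conf_cont_permute p D F : conf_cont_on D F -> conf_cont_on D (fun z => permute p (F z)).
Proof.
  intros [C1 [C2 C3]].
  assert (X : forall f g : C -> C, cont_on D f -> (forall z, f z = g z) -> cont_on D g).
  { intros f g Hf Efg z Hz. exact (cont_at_ext D f g z Hz (fun u _ => Efg u) (Hf z Hz)). }
  destruct p; (split; [|split]);
  first [refine (X _ _ C1 _); intros z; destruct (F z) as [[? ?] ?]; reflexivity
        |refine (X _ _ C2 _); intros z; destruct (F z) as [[? ?] ?]; reflexivity
        |refine (X _ _ C3 _); intros z; destruct (F z) as [[? ?] ?]; reflexivity].
Qed.

Lemma holo_cder D f z : D z -> holo_on D f -> exists l, cder f z l.
Proof.
  intros Hz H. destruct (H z Hz) as [l Hl]. exists l. intros eps He. destruct (Hl eps He) as [d [Hd K]].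
  exists d. split; auto. intros h _ Hh. destruct (Ceq_dec h (RtoC 0)) as [->|N].
  - replace (f (z + RtoC 0)%C) with (f z) by (f_equal; ring). replace (f z - f z - l * RtoC 0)%C with (RtoC 0) by ring.
    rewrite Cmod_0. lra.
  - specialize (K h N Hh). replace (f (z + h)%C - f z - l * h)%C with (((f (z + h)%C - f z) / h - l) * h)%C by (field; auto).
    rewrite Cmod_mult. apply Rmult_le_compat_r; [apply Cmod_ge_0|]. lra.
Qed.

Lemma cder_holo (D : C -> Prop) f : (forall z, D z -> exists l, cder f z l) -> holo_on D f.
Proof.
  intros H z Hz. destruct (H z Hz) as [l Hl]. exists l. intros eps He. destruct (Hl (eps / 2) ltac:(lra)) as [d [Hd K]].
  exists d. split; auto. intros h N Hh. specialize (K h I Hh). assert (P := Cmod_pos h N).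
  replace ((f (z + h)%C - f z) / h - l)%C with ((f (z + h)%C - f z - l * h) / h)%C by (field; auto).
  rewrite Cmod_div by auto. apply Rle_lt_trans with (eps / 2); [|lra].
  apply Rmult_le_reg_r with (Cmod h); auto.
  transitivity (Cmod (f (z + h)%C - f z - l * h)); [right; field; apply Rgt_not_eq; exact P|exact K].
Qed.

Lemma ucoord_cder D F z : D z -> distinct3 (F z) -> conf_holo_on D F -> exists l, cder (fun w => ucoord (F w)) z l.
Proof.
  intros Hz Hd [H1 [H2 H3]].
  destruct (holo_cder D _ z Hz H1) as [l1 D1]. destruct (holo_cder D _ z Hz H2) as [l2 D2]. destruct (holo_cder D _ z Hz H3) as [l3 D3].
  eexists. apply gder_div; [apply distinct_13; auto| |]; apply gder_minus; eauto.
Qed.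

Lemma conf_holo_permute p D F : conf_holo_on D F -> conf_holo_on D (fun z => permute p (F z)).
Proof.
  intros [C1 [C2 C3]].
  assert (X : forall f g : C -> C, holo_on D f -> (forall z, f z = g z) -> holo_on D g).
  { intros f g Hf Efg z Hz. destruct (Hf z Hz) as [l Hl]. exists l. intros eps He. destruct (Hl eps He) as [d [Hd K]].
    exists d. split; auto. intros h N Hh. rewrite <- !Efg. auto. }
  destruct p; (split; [|split]);
  first [refine (X _ _ C1 _); intros z; destruct (F z) as [[? ?] ?]; reflexivity
        |refine (X _ _ C2 _); intros z; destruct (F z) as [[? ?] ?]; reflexivity
        |refine (X _ _ C3 _); intros z; destruct (F z) as [[? ?] ?]; reflexivity].
Qed.

(** * The lower bound *)

Lemma real_segment_convex (a b c d : R) : convex (fun z => a < Re z < b /\ c <= Im z <= d).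
Proof.
  intros z w t [Hz1 Hz2] [Hw1 Hw2] Ht.
  assert (E1 : Re (z + RtoC t * (w - z))%C = (1 - t) * Re z + t * Re w) by (cre; ring).
  assert (E2 : Im (z + RtoC t * (w - z))%C = (1 - t) * Im z + t * Im w) by (cre; ring).
  cbv beta. rewrite E1, E2. clear E1 E2. destruct (Rle_dec t (1/2)).
  - repeat split; nra.
  - repeat split; nra.
Qed.

Lemma represents_width e w k x0 y0 bw ah F Psi Phi l :
  straightening Psi Phi (fun y => y < PI) e (wmat w) l -> 0 < bw -> 0 < ah ->
  represents (ends e) (braid_arc e (braid_word w k)) x0 y0 bw ah F -> Rabs l * bw <= PI * ah.
Proof.
  intros [S1 [_ [S3 _]]] Hb Ha [dF [cF [hF [eF rF]]]].
  assert (GM := wmat_G2 w). set (M := wmat w) in *. assert (DM := G2_det M GM).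
  destruct (braid_arc_plift e w k) as [T [Z [_ [CT [_ [HC [[P0 [T0 _]] [P1 [T1 _]]]]]]]]]. fold M in T1.
  set (g := braid_arc e (braid_word w k)) in *.
  set (x := x0 + bw / 2). destruct (rF x ltac:(unfold x; lra)) as [p [H [dH [cH [hH eH]]]]].
  (* After this relabelling of the strands the homotopy ends at [g] itself. *)
  set (F' := fun z => permute (pinv p) (F z)). set (H' := fun z => permute (pinv p) (H z)).
  assert (dF' : forall z, rect x0 (x0 + bw) y0 (y0 + ah) z -> distinct3 (F' z)) by (intros; apply distinct3_permute, dF; auto).
  assert (dH' : forall z, rect 0 1 0 1 z -> distinct3 (H' z)) by (intros; apply distinct3_permute, dH; auto).
  assert (cF' : conf_cont_on (rect x0 (x0 + bw) y0 (y0 + ah)) F') by (apply conf_cont_permute; exact cF).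
  assert (cH' : conf_cont_on (rect 0 1 0 1) H') by (apply conf_cont_permute; exact cH).
  assert (H0g : forall t, 0 <= t <= 1 -> H' (0, t) = F' (x, y0 + t * ah) /\ H' (1, t) = g t).
  { intros t Ht. destruct (hH t Ht) as [A B]. unfold H', F'. rewrite A, B, permute_pinv. auto. }
  (* The homotopy is lifted starting from s = 1, where the lift along the braid arc is known. At s =
     0 this gives a lift along a vertical segment of the rectangle. *)
  destruct (rect_lift punctured Cov (fun z => ucoord (H' z)) 0 1 0 1 Rlt_0_1 Rlt_0_1 Cov_separated Cov_sectioned
    (ucoord_cont _ _ cH' dH') (fun z Hz => ucoord_punctured _ (dH' z Hz)) (1, 0) Ci) as [TH [TH0 [cTH CTH]]].
  { split; simpl; lra. }
  { destruct (H0g 0 ltac:(lra)) as [_ ->]. rewrite <- T0. apply HC. lra. }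
  assert (R1 : TH (1, 1) = mob M Ci).
  { rewrite <- T1. apply (lift_unique Cov (rect 1 1 0 1) (fun z => ucoord (H' z)) TH (fun z => T (Im z)) (1, 0)).
    - apply Cov_separated.
    - apply rect_convex.
    - apply (cont_on_mono (rect 0 1 0 1)); [intros u [A B]; split; lra|apply ucoord_cont; auto].
    - apply (cont_on_mono (rect 0 1 0 1)); [intros u [A B]; split; lra|exact cTH].
    - apply (cont_on_mono istrip); [intros u [A B]; exact B|exact CT].
    - intros z [A B]. apply CTH. split; lra.
    - intros z [A B]. replace z with ((1, Im z) : C) at 1 by (apply C_ext; simpl; lra).
      destruct (H0g (Im z) B) as [_ ->]. apply HC; auto.
    - split; simpl; lra.
    - rewrite TH0. symmetry. exact T0.
    - split; simpl; lra. }
  (* The edges t = 0 and t = 1 of the homotopy stay in the end set, so the lift stays on the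
     geodesic and on its image under [M] respectively. *)
  assert (edge : forall t m z0, (t = 0 \/ t = 1) -> G2 m -> rect 0 1 t t z0 -> ends2 e (H' z0) -> geo e (mob m (TH z0)) ->
    ends2 e (H' (0, t)) /\ geo e (mob m (TH (0, t)))).
  { intros t m z0 Ht Hm Hz0 E0 G0.
    assert (I : forall u, rect 0 1 t t u -> rect 0 1 0 1 u) by (intros u [A B]; split; destruct Ht; lra).
    apply (side_geodesic e m (rect 0 1 t t) H' TH z0); auto.
    - apply rect_convex.
    - destruct cH' as [A1 [A2 A3]]. split; [|split]; eapply cont_on_mono; eauto.
    - intros z [A B]. apply ends_permute. replace z with ((Re z, t) : C) by (apply C_ext; simpl; lra).
      destruct (eH (Re z) A) as [B1 B2]. destruct Ht as [-> | ->]; auto.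
    - eapply cont_on_mono; eauto.
    - split; simpl; lra. }
  assert (gCi : geo e Ci) by (destruct e; simpl; [reflexivity|apply Cmod_eq_sqr; [lra|rewrite Cmod_sqr; simpl; ring]]).
  destruct (edge 0 (1, 0, 0, 1) (1, 0)) as [B0 B0']; auto.
  { apply G2_one. } { split; simpl; lra. } { destruct (H0g 0 ltac:(lra)) as [_ ->]. rewrite P0. apply ends2_base. }
  { rewrite mob_one, TH0. exact gCi. }
  destruct (edge 1 (madj M) (1, 1)) as [B1 B1']; auto.
  { apply G2_adj; auto. } { split; simpl; lra. } { destruct (H0g 1 ltac:(lra)) as [_ ->]. rewrite P1. apply ends2_base. }
  { rewrite R1, mob_adj_l by (auto; simpl; lra). exact gCi. }
  assert (V0 : H' (0, 0) = F' (x, y0)) by (destruct (H0g 0 ltac:(lra)) as [-> _]; f_equal; f_equal; ring).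
  assert (V1 : H' (0, 1) = F' (x, y0 + ah)) by (destruct (H0g 1 ltac:(lra)) as [-> _]; f_equal; f_equal; ring).
  (* The lift over the rectangle starts from that of the homotopy; by uniqueness both agree along
     the central vertical segment, in particular at its upper end. *)
  destruct (rect_lift punctured Cov (fun z => ucoord (F' z)) x0 (x0 + bw) y0 (y0 + ah) ltac:(lra) ltac:(lra) Cov_separated Cov_sectioned
    (ucoord_cont _ _ cF' dF') (fun z Hz => ucoord_punctured _ (dF' z Hz)) (x, y0) (TH (0, 0))) as [TF [TF0 [cTF CTF]]].
  { unfold x. split; simpl; lra. }
  { rewrite <- V0. apply CTH. split; simpl; lra. }
  assert (TF1 : TF (x, y0 + ah) = TH (0, 1)).
  { replace 1 with ((y0 + ah - y0) / ah) at 1 by (field; lra).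
    assert (J : forall u, rect x x y0 (y0 + ah) u -> rect x0 (x0 + bw) y0 (y0 + ah) u) by (unfold x; intros u [A B]; split; lra).
    assert (Q : forall u, rect x x y0 (y0 + ah) u -> 0 <= (Im u - y0) / ah <= 1).
    { intros u [A B]. assert (0 < / ah) by (apply Rinv_0_lt_compat; lra). split; [apply Rmult_le_pos; lra|].
      apply Rmult_le_reg_r with ah; [lra|]. unfold Rdiv. rewrite Rmult_assoc, Rinv_l; lra. }
    apply (lift_unique Cov (rect x x y0 (y0 + ah)) (fun z => ucoord (F' z)) TF (fun z => TH (0, (Im z - y0) / ah)) (x, y0)).
    - apply Cov_separated.
    - apply rect_convex.
    - apply (cont_on_mono (rect x0 (x0 + bw) y0 (y0 + ah))); [exact J|apply ucoord_cont; auto].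
    - apply (cont_on_mono (rect x0 (x0 + bw) y0 (y0 + ah))); [exact J|exact cTF].
    - intros z Hz. 
      assert (EQ : forall u, (Ci * ((RtoC (Im u) - RtoC y0) * RtoC (/ ah)))%C = (0, (Im u - y0) / ah)) by (intros; apply C_ext; cre; unfold Rdiv; ring).
      refine (cont_at_ext (rect x x y0 (y0 + ah)) (fun u => TH (Ci * ((RtoC (Im u) - RtoC y0) * RtoC (/ ah)))%C) _ z Hz (fun u _ => f_equal TH (EQ u)) _).
      refine (cont_at_comp _ (rect 0 1 0 1) (fun u => Ci * ((RtoC (Im u) - RtoC y0) * RtoC (/ ah)))%C TH z _ _ (cTH _ _)).
      + intros u Hu. rewrite EQ. specialize (Q u Hu). split; simpl; lra.
      + apply cont_at_mult; [apply cont_at_const|]. apply cont_at_mult; [|apply cont_at_const].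
        apply cont_at_minus; [apply cont_at_RtoC_Im|apply cont_at_const].
      + rewrite EQ. specialize (Q z Hz). split; simpl; lra.
    - intros z Hz. apply CTF; auto.
    - intros z Hz. assert (Qz := Q z Hz). replace (F' z) with (H' (0, (Im z - y0) / ah)).
      + apply CTH. split; simpl; lra.
      + destruct (H0g _ Qz) as [-> _]. f_equal. apply C_ext; simpl; [destruct Hz; lra|field; lra].
    - split; simpl; lra.
    - rewrite TF0. do 2 f_equal. simpl. field. lra.
    - split; simpl; lra. }
  assert (side : forall y m, (y = y0 \/ y = y0 + ah) -> G2 m -> ends2 e (F' (x, y)) -> geo e (mob m (TF (x, y))) ->
    forall x', x0 < x' < x0 + bw -> geo e (mob m (TF (x', y)))).
  { intros y m Hy Hm E0 G0 x' Hx'.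
    assert (J : forall u, (x0 < Re u < x0 + bw /\ y <= Im u <= y) -> rect x0 (x0 + bw) y0 (y0 + ah) u) by (intros u [A B]; split; destruct Hy; lra).
    apply (side_geodesic e m (fun u => x0 < Re u < x0 + bw /\ y <= Im u <= y) F' TF (x, y)); auto.
    - apply real_segment_convex.
    - destruct cF' as [A1 [A2 A3]]. split; [|split]; eapply cont_on_mono; eauto.
    - intros z [A B]. apply ends_permute. replace z with ((Re z, y) : C) by (apply C_ext; simpl; lra).
      destruct (eF (Re z) A) as [B2 B3]. destruct Hy as [-> | ->]; auto.
    - eapply cont_on_mono; eauto.
    - unfold x. simpl. lra.
    - simpl. lra. }
  apply (strip_width (fun z => Phi (TF z)) x0 y0 bw ah l Hb Ha).
  - intros z Hz. destruct (S1 _ (Cov_Im _ _ (CTF z Hz))) as [_ [_ [_ [c Hc]]]].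
    exact (cont_at_cder _ TF Phi z c (cTF z Hz) Hc).
  - intros z Hz. assert (Hz' : rect x0 (x0 + bw) y0 (y0 + ah) z) by (destruct Hz; split; lra).
    destruct (ucoord_cder (open_rect x0 y0 bw ah) F' z Hz (dF' z Hz')) as [l1 D1]; [apply conf_holo_permute; exact hF|].
    destruct (lift_holo punctured Cov _ TF x0 (x0 + bw) y0 (y0 + ah) z l1 Cov_separated Cov_sectioned (ucoord_cont _ _ cF' dF') cTF
      (fun z Hz => ucoord_punctured _ (dF' z Hz)) CTF Hz D1) as [l2 D2].
    destruct (S1 _ (Cov_Im _ _ (CTF z Hz'))) as [_ [_ [_ [c Hc]]]].
    eexists. apply (gder_comp _ TF Phi); eauto.
  - intros z Hz. destruct (S1 _ (Cov_Im _ _ (CTF z Hz))) as [A [B _]]. auto.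
  - intros x' Hx'.
    assert (I0 : 0 < Im (TF (x', y0))) by (eapply Cov_Im, CTF; split; simpl; lra).
    assert (I1 : 0 < Im (TF (x', y0 + ah))) by (eapply Cov_Im, CTF; split; simpl; lra).
    split.
    + apply (S3 _ I0). rewrite <- (mob_one (TF _)). apply side; auto; [apply G2_one|rewrite <- V0; exact B0|rewrite TF0; exact B0'].
    + apply (S3 _ I1). apply side; auto; [apply G2_adj; auto|rewrite <- V1; exact B1|rewrite TF1; exact B1'].
Qed.

(** * Construction of holomorphic rectangles *)

(** Compactness of a path in the domain of a straightening. The predicate [bd] will be y < PI or no
    condition; only its being open and closed downwards enters. *)
Lemma path_box f (bd : R -> Prop) : pcont f -> (forall y y', y <= y' -> bd y' -> bd y) ->
  (forall y, bd y -> exists d, 0 < d /\ bd (y + d)) -> (forall t, 0 <= t <= 1 -> 0 < Im (f t) /\ bd (Im (f t))) ->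
  exists X y1 y2, 0 < y1 /\ bd y2 /\ forall t, 0 <= t <= 1 -> Rabs (Re (f t)) <= X /\ y1 <= Im (f t) <= y2.
Proof.
  intros Hf Hm Ho Hb.
  assert (K : exists X y1 y2, 0 < y1 /\ bd y2 /\ forall z, rect 0 1 0 1 z -> Rabs (Re (f (Im z))) <= X /\ y1 <= Im (f (Im z)) <= y2).
  { assert (J : forall a b, bd a -> bd b -> bd (Rmax a b)) by (intros a b Ha Hb'; unfold Rmax; destruct (Rle_dec a b); auto).
    assert (glue : forall D D1 D2 : C -> Prop, (forall z, D z -> D1 z \/ D2 z) ->
      (exists X y1 y2, 0 < y1 /\ bd y2 /\ forall z, D1 z -> Rabs (Re (f (Im z))) <= X /\ y1 <= Im (f (Im z)) <= y2) ->
      (exists X y1 y2, 0 < y1 /\ bd y2 /\ forall z, D2 z -> Rabs (Re (f (Im z))) <= X /\ y1 <= Im (f (Im z)) <= y2) ->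
      exists X y1 y2, 0 < y1 /\ bd y2 /\ forall z, D z -> Rabs (Re (f (Im z))) <= X /\ y1 <= Im (f (Im z)) <= y2).
    { intros D D1 D2 HD [X [y1 [y2 [A [B K1]]]]] [X' [y1' [y2' [A' [B' K2]]]]].
      exists (Rmax X X'), (Rmin y1 y1'), (Rmax y2 y2'). split; [apply Rmin_pos; auto|]. split; [auto|].
      assert (M1 := Rmax_l X X'). assert (M2 := Rmax_r X X'). assert (M3 := Rmin_l y1 y1'). assert (M4 := Rmin_r y1 y1').
      assert (M5 := Rmax_l y2 y2'). assert (M6 := Rmax_r y2 y2').
      intros z Hz. destruct (HD z Hz) as [Hz'|Hz']; [specialize (K1 z Hz')|specialize (K2 z Hz')]; lra. }
    apply (rectangle_bisection (fun a b c d => exists X y1 y2, 0 < y1 /\ bd y2 /\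
      forall z, rect a b c d z -> Rabs (Re (f (Im z))) <= X /\ y1 <= Im (f (Im z)) <= y2) 0 1 0 1 Rlt_0_1 Rlt_0_1).
    - intros a m b c d _ _ _ _ _ _. apply glue. intros z [A B]. destruct (Rle_dec (Re z) m); [left|right]; split; lra.
    - intros a b c m d _ _ _ _ _ _. apply glue. intros z [A B]. destruct (Rle_dec (Im z) m); [left|right]; split; lra.
    - intros x y Hx Hy. destruct (Hb y Hy) as [P1 P2]. destruct (Ho _ P2) as [d0 [Hd0 P3]].
      set (eps := Rmin (Im (f y) / 2) d0). assert (He : 0 < eps) by (apply Rmin_pos; lra).
      assert (e1 : eps <= Im (f y) / 2) by apply Rmin_l. assert (e2 : eps <= d0) by apply Rmin_r.
      destruct (Hf (0, y) Hy eps He) as [dl [Hdl K]]. exists dl. split; [exact Hdl|].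
      intros a b c d Hab Hcd Ha Hb' Hc Hd Hs1 Hs2. exists (Rabs (Re (f y)) + eps), (Im (f y) / 2), (Im (f y) + d0).
      split; [lra|]. split; [exact P3|]. intros z [A B].
      assert (D : Cmod (f (Im z) - f y) < eps).
      { assert (IZ : istrip (0, Im z)) by (unfold istrip; simpl; lra). refine (K (0, Im z) IZ _).
        replace ((0, Im z) - (0, y))%C with (Ci * RtoC (Im z - y))%C by (apply C_ext; simpl; ring).
        rewrite Cmod_mult, Cmod_R. replace (Cmod Ci) with 1 by (symmetry; apply Cmod_eq_sqr; [lra|rewrite Cmod_sqr; simpl; ring]).
        rewrite Rmult_1_l. apply Rabs_def1; lra. }
      assert (D1 := re_le_Cmod (f (Im z) - f y)). assert (D2 := im_le_Cmod (f (Im z) - f y)). rewrite Re_minus in D1. rewrite Im_minus in D2.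
      assert (D3 := Rabs_triang (Re (f (Im z)) - Re (f y)) (Re (f y))). replace (Re (f (Im z)) - Re (f y) + Re (f y)) with (Re (f (Im z))) in D3 by ring.
      assert (D4 := Rle_abs (Im (f (Im z)) - Im (f y))). assert (D5 := Rle_abs (- (Im (f (Im z)) - Im (f y)))). rewrite Rabs_Ropp in D5. lra. }
  destruct K as [X [y1 [y2 [A [B K]]]]]. exists X, y1, y2. split; [auto|]. split; [auto|].
  intros t Ht. apply (K (0, t)). split; simpl; lra.
Qed.

(** Coordinates in which configuration space is a product: the midpoint of z1 and z3, their
    difference, and the cross ratio. Homotopies can be made in each factor separately. *)
Definition conf_of (m kap u : C) : conf := ((m - kap / RtoC 2)%C, (m + kap * (u - RtoC (1/2)))%C, (m + kap / RtoC 2)%C).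

Lemma RtoC_2_neq : RtoC 2 <> RtoC 0.
Proof. apply Cneq_Re; cre; lra. Qed.

Lemma conf_of_distinct m kap u : kap <> RtoC 0 -> punctured u -> distinct3 (conf_of m kap u).
Proof.
  intros Hk [H0 H1]. assert (N2 := RtoC_2_neq). assert (Hh : RtoC (1/2) = (/ RtoC 2)%C) by (rewrite RtoC_div by lra; field; auto).
  unfold conf_of, distinct3. rewrite Hh. split; [|split]; intros E.
  - assert (X : (kap * u)%C = RtoC 0).
    { transitivity ((m + kap * (u - / RtoC 2)) - (m - kap / RtoC 2))%C; [field; auto|rewrite <- E; ring]. }
    apply Cmult_integral in X. destruct X; auto.
  - apply Hk. transitivity ((m + kap / RtoC 2) - (m - kap / RtoC 2))%C; [field; auto|rewrite <- E; ring].
  - assert (X : (kap * (u - RtoC 1))%C = RtoC 0).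
    { transitivity ((m + kap * (u - / RtoC 2)) - (m + kap / RtoC 2))%C; [field; auto|rewrite <- E; ring]. }
    apply Cmult_integral in X. destruct X as [X|X]; auto. apply H1, Cminus_eq_0, X.
Qed.

Lemma conf_of_eq z : distinct3 z -> conf_of ((c1 z + c3 z) / RtoC 2)%C (c3 z - c1 z)%C (ucoord z) = z.
Proof.
  intros H. assert (N := distinct_13 z H). assert (N2 := RtoC_2_neq).
  assert (Hh : RtoC (1/2) = (/ RtoC 2)%C) by (rewrite RtoC_div by lra; field; auto).
  destruct z as [[a b] c]. unfold conf_of, ucoord, Defs.c1, c2, c3 in *. cbn [fst snd] in *. rewrite Hh.
  apply f_equal2; [apply f_equal2|]; field; auto.
Qed.

Lemma conf_of_cont D m kap u : cont_on D m -> cont_on D kap -> cont_on D u -> conf_cont_on D (fun z => conf_of (m z) (kap z) (u z)).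
Proof.
  intros Hm Hk Hu. assert (K : forall z, D z -> cont_at D (fun z => kap z / RtoC 2)%C z).
  { intros z Hz. exact (cont_at_div D _ _ z RtoC_2_neq (Hk z Hz) (cont_at_const D _ z)). }
  split; [|split]; intros z Hz.
  - exact (cont_at_minus D _ _ z (Hm z Hz) (K z Hz)).
  - exact (cont_at_plus D _ _ z (Hm z Hz) (cont_at_mult D _ _ z (Hk z Hz) (cont_at_minus D _ _ z (Hu z Hz) (cont_at_const D _ z)))).
  - exact (cont_at_plus D _ _ z (Hm z Hz) (K z Hz)).
Qed.

Lemma conf_of_ends e m x u : Im m = 0 -> rot (Im x) = rot (twist e) -> biota e u = u -> ends e (conf_of m (cexp x) u).
Proof.
  intros Hm Hr Hu. apply ends2_ends.
  assert (Ek : cexp x = (RtoC (exp (Re x)) * rot (Im x))%C) by (unfold cexp, rot; apply C_ext; cre; simpl; ring).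
  rewrite Hr in Ek. assert (Pe := exp_pos (Re x)). set (r := exp (Re x)) in *.
  assert (Eh : forall a : C, (a / RtoC 2)%C = (a * RtoC (1/2))%C) by (intros; rewrite (RtoC_div 1 2) by lra; field; apply RtoC_2_neq).
  unfold conf_of. rewrite !Eh. destruct e; unfold ends2, E_tr, Defs.c1, c2, c3; cbn [fst snd].
  - unfold twist in Ek. rewrite rot_0 in Ek. rewrite Ek. apply (f_equal Im) in Hu. unfold biota in Hu. cre_in Hu.
    repeat split; cre; [|replace (Im u) with 0 by lra|]; rewrite Hm; ring.
  - assert (Er : rot (twist false) = Ci) by (unfold rot, twist; rewrite cos_PI2, sin_PI2; reflexivity).
    rewrite Er in Ek. rewrite Ek. apply (f_equal Re) in Hu. unfold biota in Hu. cre_in Hu. split; [|split].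
    + cre. replace (Re u) with (1/2) by lra. rewrite Hm. ring.
    + apply C_ext; cre; rewrite ?Hm; ring.
    + cre. rewrite Hm. lra.
Qed.

Lemma ucoord_distinct z : (c3 z - c1 z)%C <> RtoC 0 -> (distinct3 z <-> punctured (ucoord z)).
Proof.
  intros N. split; [apply ucoord_punctured|]. destruct z as [[a b] c]. unfold ucoord, distinct3, Defs.c1, c2, c3 in *. cbn [fst snd] in *.
  intros [H0 H1]. split; [|split]; intros E; subst.
  - apply H0. field. exact N.
  - apply N. ring.
  - apply H1. field. exact N.
Qed.

Lemma ucoord_base e : ucoord (base e) = RtoC (1 / 2).
Proof.
  destruct e; [exact (posn_ucoord P123)|].
  assert (N : Ci <> RtoC 0) by (apply Cneq_Im; cre; lra). assert (N2 := RtoC_2_neq).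
  unfold ucoord, base, Defs.c1, c2, c3. cbn [fst snd]. rewrite RtoC_div by lra.
  replace (Ci - - Ci)%C with (RtoC 2 * Ci)%C by (apply C_ext; cre; ring). replace (RtoC 0 - - Ci)%C with (RtoC 1 * Ci)%C by (apply C_ext; cre; ring).
  field. auto.
Qed.

(** The cross ratio is the modular function of [Psi] after an affine map, and z3 - z1 is an
    exponential that performs the full twists. The homotopy to the braid arc is linear in the strip
    coordinate, in the logarithm of z3 - z1 and in the midpoint. *)
Lemma represents_exists e w k Psi Phi (bd : R -> Prop) l bw c :
  straightening Psi Phi bd e (wmat w) l -> (forall y y', y <= y' -> bd y' -> bd y) ->
  (forall y, bd y -> exists d, 0 < d /\ bd (y + d)) ->
  0 < bw -> (forall x, 0 <= x <= bw -> 0 < c - l * x /\ bd (c - l * x)) ->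
  exists F, represents (ends e) (braid_arc e (braid_word w k)) 0 0 bw 1 F.
Proof.
  intros [S1 [S2 [S3 S4]]] Hm Ho Hb HG.
  assert (GM := wmat_G2 w). set (M := wmat w) in *. assert (DM := G2_det M GM).
  destruct (braid_arc_plift e w k) as [T [Z [CC [CT [CZ [HC [[P0 [T0 Z0]] [P1 [T1 Z1]]]]]]]]]. fold M in T1.
  set (g := braid_arc e (braid_word w k)) in *.
  assert (IT : forall t, 0 <= t <= 1 -> 0 < Im (T t)) by (intros t Ht; eapply Cov_Im, HC, Ht).
  assert (CP : pcont (fun t => Phi (T t))).
  { intros z Hz. destruct (S1 _ (IT _ Hz)) as [_ [_ [_ [q Hq]]]]. exact (cont_at_cder istrip _ Phi z q (CT z Hz) Hq). }
  destruct (path_box (fun t => Phi (T t)) bd CP Hm Ho) as [X [v1 [v2 [V1 [V2 V3]]]]].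
  { intros t Ht. destruct (S1 _ (IT t Ht)) as [A [B _]]. auto. }
  destruct (HG 0 ltac:(lra)) as [g1 g2]. destruct (HG bw ltac:(lra)) as [g3 g4]. replace (c - l * 0) with c in * by ring.
  (* One box [Q] in the domain of [Psi] is to contain the path [Phi (T t)] of the braid arc and the
     image of the rectangle; being convex, it contains the segments between them. *)
  set (lo := Rmin v1 (Rmin c (c - l * bw))). set (hi := Rmax v2 (Rmax c (c - l * bw))).
  assert (Hlo : 0 < lo) by (apply Rmin_pos; [auto|apply Rmin_pos; auto]).
  assert (Hhi : bd hi) by (unfold hi, Rmax; repeat (destruct (Rle_dec _ _)); auto).
  assert (L1 : lo <= v1) by apply Rmin_l. assert (L2 : lo <= c /\ lo <= c - l * bw).
  { assert (A := Rmin_r v1 (Rmin c (c - l * bw))). fold lo in A. assert (B := Rmin_l c (c - l * bw)). assert (D := Rmin_r c (c - l * bw)). lra. }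
  assert (U1 : v2 <= hi) by apply Rmax_l. assert (U2 : c <= hi /\ c - l * bw <= hi).
  { assert (A := Rmax_r v2 (Rmax c (c - l * bw))). fold hi in A. assert (B := Rmax_l c (c - l * bw)). assert (D := Rmax_r c (c - l * bw)). lra. }
  destruct (Ho hi Hhi) as [d0 [Hd0 Hb0]]. assert (Al := Rle_abs l). assert (Al' := Rle_abs (- l)). rewrite Rabs_Ropp in Al'.
  assert (X0 : 0 <= X). { destruct (V3 0 ltac:(lra)) as [A _]. generalize (Rabs_pos (Re (Phi (T 0)))). lra. }
  set (x1 := - (X + Rabs l + 1)). set (x2 := X + Rabs l + 1). set (y1 := lo / 2). set (y2 := hi + d0).
  assert (Pl := Rabs_pos l).
  set (Q := rect x1 x2 y1 y2).
  assert (QP : forall q, Q q -> 0 < Im q /\ bd (Im q)).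
  { intros q [_ [A B]]. unfold y1 in A. split; [lra|]. apply (Hm _ y2); auto. }
  assert (QT : forall t, 0 <= t <= 1 -> Q (Phi (T t))).
  { intros t Ht. destruct (V3 t Ht) as [A B]. assert (A1 := Rle_abs (Re (Phi (T t)))). assert (A2 := Rle_abs (- Re (Phi (T t)))). rewrite Rabs_Ropp in A2.
    unfold Q, rect, x1, x2, y1, y2. lra. }
  (* A rotation by a right angle combined with scaling: the sides Im z = 0 and Im z = 1 go to the
     lines Re = 0 and Re = l. *)
  set (G := fun z => (Ci * RtoC c - Ci * RtoC l * z)%C).
  assert (EG : forall z, Re (G z) = l * Im z /\ Im (G z) = c - l * Re z) by (intros; unfold G; split; cre; ring).
  assert (QG : forall z, rect 0 (0 + bw) 0 (0 + 1) z -> rect_open x1 x2 y1 y2 (G z)).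
  { intros z [A B]. destruct (EG z) as [E1 E2]. unfold rect_open. rewrite E1, E2.
    assert (lo <= c - l * Re z <= hi).
    { destruct (Rle_dec 0 l); [assert (0 <= l * Re z <= l * bw) by (split; nra)|assert (l * bw <= l * Re z <= 0) by (split; nra)]; lra. }
    assert (- Rabs l <= l * Im z <= Rabs l) by (split; nra).
    unfold x1, x2, y1, y2. lra. }
  assert (QG' : forall z, rect 0 (0 + bw) 0 (0 + 1) z -> Q (G z)) by (intros z Hz; destruct (QG z Hz); split; lra).
  assert (cPsi : cont_on Q Psi).
  { intros q Hq. destruct (S2 q) as [_ [d Hd]]; try apply QP; auto. eapply cder_cont; eauto. }
  assert (HPsi : forall q, Q q -> 0 < Im (Psi q)) by (intros q Hq; apply S2; apply QP; auto).
  assert (Ip := Im_Ci_pos).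
  destruct (rect_lift (fun t => 0 < Im t) Cov' Psi x1 x2 y1 y2 ltac:(unfold x1, x2; lra) ltac:(unfold y1, y2; lra) Cov'_separated Cov'_sectioned cPsi HPsi
    (Phi Ci) (RtoC (1/2))) as [Lam [Lam0 [cL CL]]].
  { rewrite <- T0. apply QT. lra. }
  { unfold Cov'. destruct (S1 Ci Ip) as [_ [_ [-> _]]]. apply Cov_half_Ci. }
  fold Q in cL, CL.
  (* Both sides lift the path [T] for [Cov'] and start at 1/2. *)
  assert (LU : forall t, 0 <= t <= 1 -> Lam (Phi (T t)) = ucoord (g t)).
  { intros t Ht.
    assert (dg : forall z, istrip z -> (c3 (g (Im z)) - c1 (g (Im z)))%C <> RtoC 0).
    { intros z Hz. destruct (HC _ Hz) as [_ <-]. apply cexp_neq_0. }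
    assert (I : forall u, rect 0 0 0 1 u -> istrip u) by (intros u [A B]; exact B).
    apply (lift_unique Cov' (rect 0 0 0 1) (fun z => T (Im z)) (fun z => Lam (Phi (T (Im z)))) (fun z => ucoord (g (Im z))) (0, 0)) with (z := (0, t)).
    - apply Cov'_separated.
    - apply rect_convex.
    - apply (cont_on_mono istrip); auto.
    - apply (cont_on_mono istrip); auto. intros z Hz.
      exact (cont_at_comp istrip Q (fun u => Phi (T (Im u))) Lam z (fun u Hu => QT _ Hu) (CP z Hz) (cL _ (QT _ Hz))).
    - apply (cont_on_mono istrip); auto. intros z Hz. destruct CC as [C1 [C2 C3]].
      exact (cont_at_div istrip _ _ z (dg z Hz) (cont_at_minus istrip _ _ z (C2 z Hz) (C1 z Hz)) (cont_at_minus istrip _ _ z (C3 z Hz) (C1 z Hz))).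
    - intros z Hz. assert (Y := CL _ (QT _ (I z Hz))). destruct (S1 _ (IT _ (I z Hz))) as [_ [_ [E _]]]. rewrite E in Y. exact Y.
    - intros z Hz. apply HC. apply (I z Hz).
    - split; simpl; lra.
    - simpl. rewrite T0, Lam0, P0. symmetry. apply ucoord_base.
    - split; simpl; lra. }
  assert (b_half : biota e (RtoC (1/2)) = RtoC (1/2)) by (destruct e; unfold biota; apply C_ext; cre; lra).
  assert (line : forall q0 m y, (y = 0 \/ y = l) -> G2 m -> Q q0 -> Re q0 = y -> Lam q0 = RtoC (1/2) ->
    (forall q, Q q -> Re q = y -> geo e (mob m (Psi q))) -> forall q, Q q -> Re q = y -> biota e (Lam q) = Lam q).
  { intros q0 m y Hy Gm Q0 R0 E0 Gq q Hq Rq.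
    assert (I : forall u, rect y y y1 y2 u -> Q u /\ Re u = y).
    { intros u [A B]. split; [|lra]. split; [|exact B]. unfold x1, x2. destruct Hy as [-> | ->]; lra. }
    apply (base_on_geodesic e m (rect y y y1 y2) Lam Psi q0); auto.
    - apply rect_convex.
    - apply (cont_on_mono Q); auto. intros u Hu; apply I; auto.
    - apply (cont_on_mono Q); auto. intros u Hu; apply I; auto.
    - intros z Hz. apply CL, I, Hz.
    - intros z Hz. apply Gq; apply I, Hz.
    - destruct Q0 as [_ B]. split; [lra|exact B].
    - rewrite E0. exact b_half.
    - destruct Hq as [_ B]. split; [lra|exact B]. }
  assert (gCi : geo e Ci) by (destruct e; simpl; [reflexivity|apply Cmod_eq_sqr; [lra|rewrite Cmod_sqr; simpl; ring]]).
  assert (line0 : forall q, Q q -> Re q = 0 -> biota e (Lam q) = Lam q).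
  { apply (line (Phi Ci) (1, 0, 0, 1)); auto; [apply G2_one|rewrite <- T0; apply QT; lra|apply S3; auto|].
    intros q Hq Rq. rewrite mob_one. apply S4; auto; apply QP; auto. }
  assert (line1 : forall q, Q q -> Re q = l -> biota e (Lam q) = Lam q).
  { apply (line (Phi (mob M Ci)) (madj M)); auto.
    - apply G2_adj; auto.
    - rewrite <- T1. apply QT. lra.
    - apply S3; [apply mob_Im_pos; auto|rewrite mob_adj_l; auto].
    - rewrite <- T1, LU, P1 by lra. apply ucoord_base.
    - intros q Hq Rq. apply S4; auto; apply QP; auto. }
  (* A holomorphic logarithm of z3 - z1 whose imaginary part grows by 2 pi k from the lower to the
     upper side, as along the braid arc. *)
  set (ze := fun z => (RtoC (2 * IZR k * PI) * z + (ln 2, twist e))%C).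
  assert (PU : forall q, Q q -> punctured (Lam q)) by (intros q Hq; apply (CL q Hq)).
  set (F := fun z => conf_of (RtoC 0) (cexp (ze z)) (Lam (G z))).
  assert (cG : forall D z, cont_at D G z).
  { intros D z. apply cont_at_minus; [apply cont_at_const|]. apply cont_at_mult; [apply cont_at_const|apply cont_at_id]. }
  assert (cze : forall D z, cont_at D ze z).
  { intros D z. apply (cont_at_plus D (fun z => RtoC (2 * IZR k * PI) * z)%C (fun _ => (ln 2, twist e))); [|apply cont_at_const].
    apply cont_at_mult; [apply cont_at_const|apply cont_at_id]. }
  assert (Ize : forall z, Im (ze z) = 2 * IZR k * PI * Im z + twist e) by (intros; unfold ze; cre; simpl; ring).
  assert (R1 : rot (2 * IZR k * PI + twist e) = rot (twist e)).
  { rewrite rot_plus, rot_period. ring. }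
  exists F. split; [|split; [|split; [|split]]].
  - intros z Hz. apply conf_of_distinct; [apply cexp_neq_0|apply PU, QG', Hz].
  - apply conf_of_cont; intros z Hz.
    + apply cont_at_const.
    + exact (cont_at_cder _ ze cexp z _ (cze _ z) (cder_cexp _)).
    + exact (cont_at_comp _ Q G Lam z (fun u Hu => QG' u Hu) (cG _ z) (cL _ (QG' z Hz))).
  - assert (DL : forall z, open_rect 0 0 bw 1 z -> exists d, cder (fun z => Lam (G z)) z d).
    { intros z Hz. assert (Hz' : rect 0 (0 + bw) 0 (0 + 1) z) by (destruct Hz; split; lra).
      assert (HQ := QG z Hz'). destruct (S2 (G z)) as [_ [d Hd]]; try apply QP, QG'; auto.
      destruct (lift_holo (fun t => 0 < Im t) Cov' Psi Lam x1 x2 y1 y2 (G z) d Cov'_separated Cov'_sectioned cPsi cL HPsi CL HQ Hd) as [d2 Hd2].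
      eexists. apply (gder_comp _ G Lam); [|exact Hd2]. apply gder_minus; [apply gder_const|]. apply gder_scal, gder_id. }
    assert (DK : forall z, exists d, cder (fun z => cexp (ze z)) z d).
    { intros z. eexists. apply (gder_comp _ ze cexp); [|apply cder_cexp].
      apply (gder_plus _ (fun z => RtoC (2 * IZR k * PI) * z)%C (fun _ => (ln 2, twist e))); [apply gder_scal, gder_id|apply gder_const]. }
    assert (DH : forall z, exists d, cder (fun z => (cexp (ze z) / RtoC 2)%C) z d).
    { intros z. destruct (DK z) as [d Hd]. eexists. apply gder_div; [apply RtoC_2_neq|exact Hd|apply gder_const]. }
    split; [|split]; apply cder_holo; intros z Hz.
    + destruct (DH z) as [d Hd]. eexists. apply (gder_minus _ (fun _ => RtoC 0)); [apply gder_const|exact Hd].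
    + destruct (DK z) as [d1 Hd1]. destruct (DL z Hz) as [d2 Hd2]. eexists.
      apply (gder_plus _ (fun _ => RtoC 0) (fun z => (cexp (ze z) * (Lam (G z) - RtoC (1/2)))%C)); [apply gder_const|].
      apply (gder_mult _ (fun z => cexp (ze z)) (fun z => (Lam (G z) - RtoC (1/2))%C)); [exact Hd1|].
      apply (gder_minus _ (fun z => Lam (G z))); [exact Hd2|apply gder_const].
    + destruct (DH z) as [d Hd]. eexists. apply (gder_plus _ (fun _ => RtoC 0)); [apply gder_const|exact Hd].
  - intros x Hx. replace (0 + 1) with 1 by ring. split.
    + assert (Hz : rect 0 (0 + bw) 0 (0 + 1) (x, 0)) by (split; simpl; lra).
      apply conf_of_ends; [reflexivity| |apply line0; [apply QG', Hz|destruct (EG (x, 0)) as [-> _]; simpl; ring]].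
      rewrite Ize. f_equal. simpl. ring.
    + assert (Hz : rect 0 (0 + bw) 0 (0 + 1) (x, 1)) by (split; simpl; lra).
      apply conf_of_ends; [reflexivity| |apply line1; [apply QG', Hz|destruct (EG (x, 1)) as [-> _]; simpl; ring]].
      rewrite Ize, <- R1. f_equal. simpl. ring.
  - intros x Hx.
    set (mid := fun t => ((c1 (g t) + c3 (g t)) / RtoC 2)%C).
    set (qh := fun z : C => (G (x, Im z) + RtoC (Re z) * (Phi (T (Im z)) - G (x, Im z)))%C).
    set (zh := fun z : C => (ze (x, Im z) + RtoC (Re z) * (Z (Im z) - ze (x, Im z)))%C).
    set (H := fun z : C => conf_of (RtoC (Re z) * mid (Im z))%C (cexp (zh z)) (Lam (qh z))).
    assert (Rx : forall t, 0 <= t <= 1 -> rect 0 (0 + bw) 0 (0 + 1) (x, t)) by (intros; split; simpl; lra).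
    assert (Qqh : forall z, unit_square z -> Q (qh z)).
    { intros z [A B]. exact (rect_convex x1 x2 y1 y2 _ _ _ (QG' _ (Rx _ B)) (QT _ B) A). }
    assert (cx : forall D z, cont_at D (fun z => (x, Im z)) z).
    { intros D z. apply (cont_at_ext_loc D (fun z => (RtoC x + Ci * RtoC (Im z))%C) _ _ 1 Rlt_0_1).
      - intros u _ _. apply C_ext; cre; simpl; ring.
      - apply C_ext; cre; simpl; ring.
      - apply cont_at_plus; [apply cont_at_const|]. apply cont_at_mult; [apply cont_at_const|apply cont_at_RtoC_Im]. }
    assert (cRe : forall D z, cont_at D (fun z => RtoC (Re z)) z) by (intros; apply cont_at_Re, cont_at_id).
    assert (Us : forall z, unit_square z -> istrip z) by (intros z [A B]; exact B).
    assert (tri : forall u v : C -> C, cont_on unit_square u -> cont_on unit_square v ->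
      cont_on unit_square (fun z => u z + RtoC (Re z) * (v z - u z))%C).
    { intros u v Hu Hv z Hz. exact (cont_at_plus _ _ _ z (Hu z Hz) (cont_at_mult _ _ _ z (cRe _ z) (cont_at_minus _ _ _ z (Hv z Hz) (Hu z Hz)))). }
    exists P123, H. split; [|split; [|split]].
    + intros z Hz. apply conf_of_distinct; [apply cexp_neq_0|apply PU, Qqh, Hz].
    + apply conf_of_cont.
      * destruct CC as [C1 [C2 C3]]. intros z Hz.
        exact (cont_at_mono istrip unit_square _ _ Us (cont_at_mult istrip _ _ z (cRe _ z)
          (cont_at_div istrip _ _ z RtoC_2_neq (cont_at_plus istrip _ _ z (C1 z (Us z Hz)) (C3 z (Us z Hz))) (cont_at_const _ _ z)))).
      * assert (Y : cont_on unit_square zh).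
        { apply tri; [intros z Hz; exact (cont_at_comp unit_square (fun _ => True) (fun z => (x, Im z)) ze z (fun _ _ => I) (cx _ z) (cze _ _))|].
          apply (cont_on_mono istrip); auto. }
        intros z Hz. exact (cont_at_cder _ zh cexp z _ (Y z Hz) (cder_cexp _)).
      * assert (Y : cont_on unit_square qh).
        { apply tri; [intros z Hz; exact (cont_at_comp unit_square (fun _ => True) (fun z => (x, Im z)) G z (fun _ _ => I) (cx _ z) (cG _ _))|].
          apply (cont_on_mono istrip); auto. }
        intros z Hz. exact (cont_at_comp unit_square Q qh Lam z Qqh (Y z Hz) (cL _ (Qqh z Hz))).
    + intros t Ht. split.
      * unfold H, F, zh, qh. rewrite Re_pair, Im_pair. replace (0 + t * 1) with t by ring.
        replace (ze (x, t) + RtoC 0 * (Z t - ze (x, t)))%C with (ze (x, t)) by ring.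
        replace (G (x, t) + RtoC 0 * (Phi (T t) - G (x, t)))%C with (G (x, t)) by ring.
        replace (RtoC 0 * mid t)%C with (RtoC 0) by ring. reflexivity.
      * unfold H, zh, qh. rewrite Re_pair, Im_pair.
        replace (ze (x, t) + RtoC 1 * (Z t - ze (x, t)))%C with (Z t) by ring.
        replace (G (x, t) + RtoC 1 * (Phi (T t) - G (x, t)))%C with (Phi (T t)) by ring.
        replace (RtoC 1 * mid t)%C with (mid t) by ring.
        destruct (HC t Ht) as [HC1 HC2]. rewrite LU, HC2 by exact Ht. unfold mid.
        rewrite conf_of_eq; [destruct (g t) as [[? ?] ?]; reflexivity|].
        assert (X3 : (c3 (g t) - c1 (g t))%C <> RtoC 0) by (rewrite <- HC2; apply cexp_neq_0). exact (proj2 (ucoord_distinct (g t) X3) (proj1 HC1)).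
    + assert (Bm : (c1 (base e) + c3 (base e))%C = RtoC 0) by (destruct e; unfold base, Defs.c1, c3; cbn [fst snd]; apply C_ext; cre; ring).
      (* At t = 0 and t = 1 both ends of the linear homotopy lie on the same vertical line and have
         the same argument of z3 - z1, so the whole segment satisfies the end condition. *)
      assert (Ed : forall s t, 0 <= s <= 1 -> (t = 0 \/ t = 1) -> Re (Phi (T t)) = l * t -> g t = base e -> Im (Z t) = 2 * IZR k * PI * t + twist e ->
        (forall q, Q q -> Re q = l * t -> biota e (Lam q) = Lam q) -> ends e (H (s, t))).
      { intros s t Hs Ht EP Eg Ez HL. assert (Ht' : 0 <= t <= 1) by (destruct Ht; lra).
        assert (Hq : Q (qh (s, t))) by (apply Qqh; split; simpl; lra).
        apply conf_of_ends.
        - rewrite Re_pair, Im_pair. unfold mid. rewrite Eg, Bm. unfold Cdiv. cre. ring.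
        - unfold zh. rewrite Re_pair, Im_pair.
          replace (Im (ze (x, t) + RtoC s * (Z t - ze (x, t)))%C) with (2 * IZR k * PI * t + twist e).
          + destruct Ht as [-> | ->]; [f_equal; ring|rewrite Rmult_1_r; exact R1].
          + cre. rewrite Ize, Im_pair, Ez. ring.
        - apply HL; auto. unfold qh. rewrite Re_pair, Im_pair. cre. destruct (EG (x, t)) as [-> _]. rewrite EP, Im_pair. ring. }
      intros s Hs. split.
      * apply Ed; auto; try lra.
        -- rewrite T0, Rmult_0_r. apply S3; auto.
        -- rewrite Z0. simpl. ring.
        -- intros q Hq Rq. apply line0; auto. lra.
      * apply Ed; auto; try lra.
        -- rewrite T1, Rmult_1_r. apply S3; [apply mob_Im_pos; auto|rewrite mob_adj_l; auto].
        -- rewrite Z1. simpl. ring.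
        -- intros q Hq Rq. apply line1; auto. lra.
Qed.

(** * Extremal length *)

Lemma lambda_set_nonexceptional e w k : reduced w -> exceptional e w = false ->
  0 < Lw w /\ (exists x, lambda_set (ends e) (braid_arc e (braid_word w k)) x /\ x <= 4 * Lw w) /\
  forall x, lambda_set (ends e) (braid_arc e (braid_word w k)) x -> Lw w / (2 * PI) <= x.
Proof.
  intros Hr He. destruct (word_bounds e w Hr He) as [B1 [B2 [B3 B4]]]. assert (Pp := PI_RGT_0). assert (P3 := PI2_3_2).
  destruct (proj1 (straightening_exists e (wmat w) (G2_det _ (wmat_G2 w))) B1) as [Psi [Phi [l [S [L1 L2]]]]].
  assert (Ll : 0 < Rabs l).
  { apply Rlt_le_trans with (ln (Rabs (tval e (wmat w)))); auto. rewrite <- ln_1 at 1. apply ln_increasing; lra. }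
  split; [exact B2|]. split.
  - exists (Rabs l). split; [|lra].
    assert (Hi : 0 < / Rabs l) by (apply Rinv_0_lt_compat; auto).
    (* Width 1/|l| and height 1 give extremal length |l|. With c = 2 the imaginary parts 2 - l x lie
       in [1, 3], inside the strip because PI > 3. *)
    destruct (represents_exists e w k Psi Phi (fun y => y < PI) l (/ Rabs l) 2 S) as [F HF]; auto.
    + intros; lra.
    + intros y Hy. exists ((PI - y) / 2). lra.
    + intros x Hx. assert (X : Rabs (l * x) <= 1).
      { rewrite Rabs_mult, (Rabs_right x) by lra. apply Rle_trans with (Rabs l * / Rabs l); [apply Rmult_le_compat_l; lra|]. rewrite Rinv_r; lra. }
      apply Rabs_le_between in X. lra.
    + exists 0, 0, (/ Rabs l), 1, F. split; [auto|]. split; [lra|]. split; [exact HF|]. field. lra.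
  - intros x [x0 [y0 [bw [ah [F [Hb [Ha [HF ->]]]]]]]].
    assert (X := represents_width e w k x0 y0 bw ah F Psi Phi l S Hb Ha HF).
    apply Rmult_le_reg_r with (2 * PI * bw); [nra|].
    replace (Lw w / (2 * PI) * (2 * PI * bw)) with (2 * (Lw w / 2) * bw) by (field; lra).
    replace (ah / bw * (2 * PI * bw)) with (2 * (PI * ah)) by (field; lra).
    assert (Lw w / 2 * bw <= Rabs l * bw) by (apply Rmult_le_compat_r; lra). lra.
Qed.

Lemma lambda_set_exceptional e w k b : reduced w -> exceptional e w = true -> 0 < b ->
  lambda_set (ends e) (braid_arc e (braid_word w k)) (/ b).
Proof.
  intros Hr He Hb. destruct (proj2 (straightening_exists e (wmat w) (G2_det _ (wmat_G2 w))) (exceptional_tval e w Hr He)) as [Psi [Phi [l S]]].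
  (* The image lies in a half plane instead of a strip, so any width is possible once the rectangle
     is placed high enough. *)
  destruct (represents_exists e w k Psi Phi (fun _ => True) l b (Rabs l * b + 1) S) as [F HF]; auto.
  - intros y _. exists 1. split; [lra|auto].
  - intros x Hx. split; auto. assert (X := Rle_abs (l * x)). rewrite Rabs_mult, (Rabs_right x) in X by lra.
    assert (Rabs l * x <= Rabs l * b) by (apply Rmult_le_compat_l; [apply Rabs_pos|lra]). lra.
  - exists 0, 0, b, 1, F. split; [auto|]. split; [lra|]. split; [exact HF|]. field. lra.
Qed.

Lemma lambda_set_pos E g x : lambda_set E g x -> 0 < x /\ module_set E g (/ x).
Proof.
  intros [x0 [y0 [bw [ah [F [Hb [Ha [HF ->]]]]]]]]. split; [apply Rdiv_lt_0_compat; auto|].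
  exists x0, y0, bw, ah, F. repeat (split; auto). field. lra.
Qed.

Lemma module_set_inv E g x : module_set E g x -> 0 < x /\ lambda_set E g (/ x).
Proof.
  intros [x0 [y0 [bw [ah [F [Hb [Ha [HF ->]]]]]]]]. split; [apply Rdiv_lt_0_compat; auto|].
  exists x0, y0, bw, ah, F. repeat (split; auto). field. lra.
Qed.

(** The positive lower bound [c] makes the infimum a nonzero real number, so [Rbar_inv] is an
    ordinary reciprocal and inversion exchanges infimum and supremum. *)
Lemma Lambda_Module_finite E g c x : 0 < c -> lambda_set E g x -> (forall y, lambda_set E g y -> c <= y) ->
  Rbar_le (Finite c) (Lambda E g) /\ Lambda E g = Rbar_inv (Module E g) /\ Rbar_le (Lambda E g) (Finite x).
Proof.
  intros Hc Hx Hl. destruct (Glb_Rbar_correct (lambda_set E g)) as [G1 G2]. fold (Lambda E g) in *.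
  assert (A : Rbar_le (Finite c) (Lambda E g)) by (apply G2; intros y Hy; apply Hl; auto).
  assert (B : Rbar_le (Lambda E g) (Finite x)) by (apply G1; auto).
  split; [exact A|]. split; [|exact B].
  destruct (Lambda E g) as [L| |]; try contradiction. simpl in A, B.
  assert (HM : Module E g = Finite (/ L)).
  { apply is_lub_Rbar_unique. split.
    - intros m Hm. destruct (module_set_inv E g m Hm) as [Pm Im]. specialize (G1 _ Im). simpl in *.
      rewrite <- (Rinv_inv m). apply Rinv_le_contravar; lra.
    - intros b Hb. destruct b as [b| |]; simpl; auto.
      + assert (X := Hb _ (proj2 (lambda_set_pos E g x Hx))). simpl in X.
        assert (Px : 0 < / x) by (apply Rinv_0_lt_compat; lra).
        assert (Y : / b <= L).
        { apply (G2 (Finite (/ b))). intros y Hy. destruct (lambda_set_pos E g y Hy) as [Py My]. specialize (Hb _ My). simpl in *.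
          rewrite <- (Rinv_inv y). apply Rinv_le_contravar; auto. apply Rinv_0_lt_compat; auto. }
        rewrite <- (Rinv_inv b). apply Rinv_le_contravar; auto. apply Rinv_0_lt_compat. lra.
      + exact (Hb _ (proj2 (lambda_set_pos E g x Hx))). }
  rewrite HM. simpl. rewrite Rinv_inv. reflexivity.
Qed.

Lemma Lambda_Module_degenerate E g : (forall b, 0 < b -> lambda_set E g (/ b)) ->
  Lambda E g = Finite 0 /\ Module E g = p_infty.
Proof.
  intros H. split.
  - apply is_glb_Rbar_unique. split.
    + intros y Hy. simpl. destruct (lambda_set_pos E g y Hy). lra.
    + intros b Hb. destruct b as [b| |]; simpl; auto.
      * apply Rnot_lt_le. intros N. assert (X := Hb _ (H (2 / b) ltac:(apply Rdiv_lt_0_compat; lra))). simpl in X.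
        replace (/ (2 / b)) with (b / 2) in X by (field; lra). lra.
      * exact (Hb _ (H 1 Rlt_0_1)).
  - apply is_lub_Rbar_unique. split.
    + intros y Hy. exact I.
    + intros b Hb. destruct b as [b| |]; simpl; auto.
      * assert (P : 0 < Rabs b + 1) by (generalize (Rabs_pos b); lra).
        assert (X := Hb _ (proj2 (lambda_set_pos E g _ (H _ P)))). simpl in X. rewrite Rinv_inv in X. generalize (Rle_abs b). lra.
      * exact (Hb _ (proj2 (lambda_set_pos E g _ (H 1 Rlt_0_1)))).
Qed.

Lemma extremal_length_bounds e w k : reduced w ->
  if exceptional e w
  then Lambda (ends e) (braid_arc e (braid_word w k)) = Finite 0 /\ Module (ends e) (braid_arc e (braid_word w k)) = p_infty
  else Rbar_le (Finite (Lw w / (2 * PI))) (Lambda (ends e) (braid_arc e (braid_word w k))) /\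
       Lambda (ends e) (braid_arc e (braid_word w k)) = Rbar_inv (Module (ends e) (braid_arc e (braid_word w k))) /\
       Rbar_le (Lambda (ends e) (braid_arc e (braid_word w k))) (Finite (300 * Lw w)).
Proof.
  intros Hr. destruct (exceptional e w) eqn:He.
  - apply Lambda_Module_degenerate. intros b Hb. apply lambda_set_exceptional; auto.
  - destruct (lambda_set_nonexceptional e w k Hr He) as [Hp [[x [Hx Hx4]] Hl]]. assert (Pp := PI_RGT_0).
    destruct (Lambda_Module_finite _ _ (Lw w / (2 * PI)) x ltac:(apply Rdiv_lt_0_compat; lra) Hx Hl) as [A [B D]].
    split; [exact A|]. split; [exact B|]. apply Rbar_le_trans with (1 := D). simpl. lra.
Qed.

(* Every pure 3-braid whose image in PB_3/<Delta_3^2> is the reduced word w is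
   b = w(a_j := sigma_j^2) * Delta_3^(2k) for some integer k. *)
Theorem theorem1 (w : fword) (k : Z) :
  reduced w ->
  (if Nat.leb (length w) 1
   then Lambda_tr (braid_word w k) = Finite 0 /\ M_tr (braid_word w k) = p_infty
   else Rbar_le (Finite (Lw w / (2 * PI))) (Lambda_tr (braid_word w k)) /\
        Lambda_tr (braid_word w k) = Rbar_inv (M_tr (braid_word w k)) /\
        Rbar_le (Lambda_tr (braid_word w k)) (Finite (300 * Lw w))) /\
  (if ((forallb (fun t => Z.eqb (snd t) 1) w) || (forallb (fun t => Z.eqb (snd t) (-1)) w))%bool
   then Lambda_pb (braid_word w k) = Finite 0 /\ M_pb (braid_word w k) = p_infty
   else Rbar_le (Finite (Lw w / (2 * PI))) (Lambda_pb (braid_word w k)) /\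
        Lambda_pb (braid_word w k) = Rbar_inv (M_pb (braid_word w k)) /\
        Rbar_le (Lambda_pb (braid_word w k)) (Finite (300 * Lw w))).
Proof.
  intros Hr. split; [exact (extremal_length_bounds true w k Hr)|exact (extremal_length_bounds false w k Hr)].
Qed.
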